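(* Let $\Gamma$ be an arbitrary (not necessarily finite) abelian group and let $L=\sum_{\gamma\in\Gamma}L_\gamma\subseteq\mathcal{K}(\mathcal{X})$ be a $\Gamma$-subgraded Lie algebra of compact operators which is locally finitely subgraded. If every component $L_\gamma$ consists of Engel elements of $L$, then $L$ is $E$-solvable. If every component $L_\gamma$ consists of Volterra operators, then $L$ consists of Volterra operators.
   Context: $L$ is $\Gamma$-subgraded if $L=\sum_\gamma L_\gamma$ for subspaces (not necessarily direct) with $[L_\gamma,L_\delta]\subseteq L_{\gamma+\delta}$; elements of $\bigcup_\gamma L_\gamma$ are homogeneous. For an abelian group $\Lambda$, a $\Lambda$-subgraded Lie subalgebra $M=\sum_{\lambda\in\Lambda}M_\lambda\subseteq L$ is a subgraded subalgebra of $L$ if for each $\delta\in\Lambda$ there is $\gamma\in\Gamma$ with $M_\delta\subseteq L_\gamma$. $L$ is locally finitely subgraded if every finite set of homogeneous elements of $L$ is contained in a subgraded subalgebra $M$ which is $\Lambda$-subgraded for some finite abelian group $\Lambda$. An operator Lie algebra is normed by the operator norm; $\operatorname{ad}a:x\mapsto[a,x]$; $a$ is an Engel element of $L$ if $\lim_n\|(\operatorname{ad}a)^n\|^{1/n}=0$. A normed Lie algebra $L$ is $E$-solvable if for every closed ideal $I\neq L$ the quotient $L/I$ contains a nonzero closed ideal all of whose elements are Engel elements of it. Volterra means compact and quasinilpotent. *)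

(* Defs.v *)
From Stdlib Require Import Reals Lra List Classical ClassicalEpsilon FunctionalExtensionality.
Open Scope R_scope.
Set Implicit Arguments.

Record Cpx := mkC { cre : R; cim : R }.
Definition Cadd (a b : Cpx) : Cpx := mkC (cre a + cre b) (cim a + cim b).
Definition Cmul (a b : Cpx) : Cpx :=
  mkC (cre a * cre b - cim a * cim b) (cre a * cim b + cim a * cre b).
Definition Cone : Cpx := mkC 1 0.
Definition Cabs (a : Cpx) : R := sqrt (cre a * cre a + cim a * cim a).

Record CBanach := {
  car :> Type;
  vadd : car -> car -> car;
  vopp : car -> car;
  vzero : car;
  vscal : Cpx -> car -> car;
  vnorm : car -> R;
  vadd_assoc : forall x y z, vadd x (vadd y z) = vadd (vadd x y) z;
  vadd_comm : forall x y, vadd x y = vadd y x;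
  vadd_0 : forall x, vadd vzero x = x;
  vadd_opp : forall x, vadd (vopp x) x = vzero;
  vscal_1 : forall x, vscal Cone x = x;
  vscal_mul : forall a b x, vscal (Cmul a b) x = vscal a (vscal b x);
  vscal_addv : forall a x y, vscal a (vadd x y) = vadd (vscal a x) (vscal a y);
  vscal_adds : forall a b x, vscal (Cadd a b) x = vadd (vscal a x) (vscal b x);
  vnorm_eq0 : forall x, vnorm x = 0 <-> x = vzero;
  vnorm_triangle : forall x y, vnorm (vadd x y) <= vnorm x + vnorm y;
  vnorm_scal : forall a x, vnorm (vscal a x) = Cabs a * vnorm x;
  vcomplete : forall u : nat -> car,
    (forall eps, eps > 0 -> exists N, forall m n, (m >= N)%nat -> (n >= N)%nat ->
        vnorm (vadd (u m) (vopp (u n))) < eps) ->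
    exists l, forall eps, eps > 0 -> exists N, forall n, (n >= N)%nat ->
        vnorm (vadd (u n) (vopp l)) < eps
}.

Definition sup_of (E : R -> Prop) : R := epsilon (inhabits 0) (fun m => is_lub E m).
Definition inf_of (E : R -> Prop) : R := - sup_of (fun y => E (- y)).

Section Ops.
Variable X : CBanach.

Definition op := X -> X.
Definition linear (T : op) : Prop :=
  (forall x y, T (vadd X x y) = vadd X (T x) (T y)) /\
  (forall a x, T (vscal X a x) = vscal X a (T x)).

Definition opzero : op := fun _ => vzero X.
Definition opadd (A B : op) : op := fun x => vadd X (A x) (B x).
Definition opsub (A B : op) : op := fun x => vadd X (A x) (vopp X (B x)).
Definition opscal (c : Cpx) (A : op) : op := fun x => vscal X c (A x).
Definition opcomp (A B : op) : op := fun x => A (B x).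
Definition bracket (A B : op) : op := opsub (opcomp A B) (opcomp B A).

Definition opnorm (A : op) : R :=
  sup_of (fun r => exists x, vnorm X x <= 1 /\ r = vnorm X (A x)).

Definition compact_op (T : op) : Prop :=
  linear T /\
  forall u : nat -> X, (exists M, forall n, vnorm X (u n) <= M) ->
    exists (phi : nat -> nat) (y : X),
      (forall n, (phi n < phi (S n))%nat) /\
      forall eps, eps > 0 -> exists N, forall n, (n >= N)%nat ->
        vnorm X (vadd X (T (u (phi n))) (vopp X y)) < eps.

(* lim_n ||T^n||^{1/n} = 0 for a map T on a (semi)normed space with norm nrm,
   restricted to the domain dom:  for every eps > 0, eventually ||T^n|| <= eps^n *)
Definition spec_rad_zero (V : Type) (nrm : V -> R) (dom : V -> Prop) (T : V -> V) : Prop :=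
  forall eps, eps > 0 -> exists N, forall n, (n >= N)%nat ->
    forall v, dom v -> nrm (Nat.iter n T v) <= eps ^ n * nrm v.

Definition quasinilpotent (T : op) : Prop :=
  spec_rad_zero (vnorm X) (fun _ => True) T.
Definition volterra (T : op) : Prop := compact_op T /\ quasinilpotent T.

Definition is_subspace (S : op -> Prop) : Prop :=
  S opzero /\ (forall A B, S A -> S B -> S (opadd A B)) /\
  (forall c A, S A -> S (opscal c A)).

Definition ad (a : op) : op -> op := fun B => bracket a B.

Definition engel (L : op -> Prop) (a : op) : Prop :=
  L a /\ spec_rad_zero opnorm L (ad a).

Definition is_ideal (L I : op -> Prop) : Prop :=
  (forall A, I A -> L A) /\ is_subspace I /\
  (forall A B, L A -> I B -> I (bracket A B)).

Definition closed_in (L I : op -> Prop) : Prop :=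
  forall (u : nat -> op) (A : op), (forall n, I (u n)) -> L A ->
    (forall eps, eps > 0 -> exists N, forall n, (n >= N)%nat ->
        opnorm (opsub (u n) A) < eps) -> I A.

Definition qnorm (I : op -> Prop) (A : op) : R :=
  inf_of (fun r => exists B, I B /\ r = opnorm (opsub A B)).

(* E-solvability.  Closed ideals of L/I are identified with closed ideals J of
   L containing I; J/I is nonzero iff J strictly contains I.  a + I is an Engel
   element of L/I iff ad a (which preserves I) has spectral radius 0 for the
   quotient norm. *)
Definition E_solvable (L : op -> Prop) : Prop :=
  forall I, is_ideal L I -> closed_in L I -> (exists A, L A /\ ~ I A) ->
    exists J, is_ideal L J /\ closed_in L J /\ (forall A, I A -> J A) /\
      (exists A, J A /\ ~ I A) /\
      (forall a, J a -> spec_rad_zero (qnorm I) L (ad a)).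

End Ops.

Arguments linear {X} _.
Arguments opzero {X}.
Arguments opadd {X} _ _.
Arguments opsub {X} _ _.
Arguments opscal {X} _ _.
Arguments opcomp {X} _ _.
Arguments bracket {X} _ _.
Arguments opnorm {X} _.
Arguments compact_op {X} _.
Arguments quasinilpotent {X} _.
Arguments volterra {X} _.
Arguments is_subspace {X} _.
Arguments ad {X} _ _.
Arguments engel {X} _ _.
Arguments is_ideal {X} _ _.
Arguments closed_in {X} _ _.
Arguments qnorm {X} _ _.
Arguments E_solvable {X} _.

Record AbGroup := {
  gcar :> Type;
  gadd : gcar -> gcar -> gcar;
  gzero : gcar;
  gopp : gcar -> gcar;
  gadd_assoc : forall x y z, gadd x (gadd y z) = gadd (gadd x y) z;
  gadd_comm : forall x y, gadd x y = gadd y x;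
  gadd_0 : forall x, gadd gzero x = x;
  gadd_opp : forall x, gadd (gopp x) x = gzero
}.

Arguments gadd {_} _ _.
Arguments gzero {_}.
Arguments gopp {_} _.

Definition finite_group (G : AbGroup) : Prop :=
  exists enum : list G, forall g, In g enum.

Section Grading.
Variable X : CBanach.

Definition sum_of {G : AbGroup} (S : G -> op X -> Prop) (A : op X) : Prop :=
  exists l : list (G * op X),
    Forall (fun p => S (fst p) (snd p)) l /\
    A = fold_right (fun p acc => opadd (snd p) acc) (@opzero X) l.

Definition subgraded {G : AbGroup} (L : op X -> Prop) (Lg : G -> op X -> Prop) : Prop :=
  (forall g, is_subspace (Lg g)) /\
  (forall A, L A <-> sum_of Lg A) /\
  (forall g h A B, Lg g A -> Lg h B -> Lg (gadd g h) (bracket A B)).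

Definition homogeneous {G : AbGroup} (Lg : G -> op X -> Prop) (A : op X) : Prop :=
  exists g, Lg g A.

Definition subgraded_subalgebra {G : AbGroup} (Lg : G -> op X -> Prop)
    {Lam : AbGroup} (M : Lam -> op X -> Prop) : Prop :=
  subgraded (sum_of M) M /\
  (forall d, exists g, forall A, M d A -> Lg g A).

Definition locally_finitely_subgraded {G : AbGroup} (Lg : G -> op X -> Prop) : Prop :=
  forall l : list (op X), Forall (homogeneous Lg) l ->
    exists (Lam : AbGroup) (M : Lam -> op X -> Prop),
      finite_group Lam /\ subgraded_subalgebra Lg M /\
      Forall (sum_of M) l.

End Grading.

Arguments sum_of {X G} _ _.
Arguments subgraded {X G} _ _.
Arguments homogeneous {X G} _ _.
Arguments subgraded_subalgebra {X G} _ {Lam} _.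
Arguments locally_finitely_subgraded {X G} _.

(* Main.v *)
(** For Volterra components and a finite grading group, suppose that a sum [a] of homogeneous elements has a nonzero
    eigenvalue [z].  Minimality of [X1 /\ ker (a - z)^k] among the closed invariant subspaces [X1] gives a subquotient
    [U] of [X] on which the components act irreducibly and [a] keeps the eigenvalue.  As the components need not be
    independent, the convolution action on [U^G] is used; let [Y] be the closed Lie algebra that they generate there.
    If [Y] has no nonzero operator of finite rank, a theorem of Wojtynski makes [ad a] quasinilpotent on [Y], so
    [ker (a - z)^k] is invariant, [U] is finite-dimensional, and Jacobson's theorem contradicts the eigenvalue.
    Otherwise [U] carries a finite rank limit [f] of homogeneous elements.  By irreducibility the range [E] of [f] is
    spanned by the [f y e0] with [y] a product of homogeneous elements, and after a small perturbation [y] may be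
    replaced by products of exponentials.  The sum [W] of finitely many translates [w E] is then spanned by the images
    of [W] under the conjugates [w f w^-1].  These conjugates lie in [Y], their components are finite rank limits of
    Volterra operators, hence nilpotent, and by Jacobson's theorem [W = 0].

    For Engel components, the Riesz projections of a homogeneous element at nonzero eigenvalues commute with [L], and
    on the intersection of all their kernels [L] is Volterra by the first part.  So for [a] in [L] some finite rank
    projection [q] commuting with [L] leaves [a] small off its range, while Jacobson's theorem applied to the [ad b],
    [b] homogeneous, on the corner of [q] makes [ad a] nilpotent there.  Hence all elements of [L] are Engel. *)

From Stdlib Require Import Reals Lra Lia List Classical ClassicalEpsilon FunctionalExtensionality PropExtensionality ProofIrrelevance.
Require Import Defs.
Open Scope R_scope.
Set Implicit Arguments. Unset Strict Implicit.

(** * Complex scalars and vectors *)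

(** The components of a sum are not determined by the sum, so a limit of sums has no components of
    its own. On [U^G] a convolution operator has well-defined coefficients, and these pass to
    brackets and to limits; this is the only reason for leaving [U]. Only Lie operations keep the
    coefficients in the closed components. A product [y f] with a word [y] is therefore useless,
    while conjugation by [exp m] is [exp (ad m)] and stays inside a closed space stable under
    [ad m]. Hence words are traded for products of exponentials. Contour integrals are replaced by
    means of resolvents over the [2^j]-th roots of unity. Their geometric convergence gives the
    spectral radius of compact operators, the theorem of Wojtynski and the nilpotency of finite rank
    limits alike. Once every element of [L] is Engel, the ideal demanded by E-solvability is the
    whole quotient, for every closed ideal. *)

Definition C0 : Cpx := mkC 0 0.
Definition Copp (a : Cpx) : Cpx := mkC (- cre a) (- cim a).
Definition Csub (a b : Cpx) : Cpx := Cadd a (Copp b).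
Definition Csq (a : Cpx) : R := cre a * cre a + cim a * cim a.
Definition Cinv (a : Cpx) : Cpx := mkC (cre a / Csq a) (- cim a / Csq a).
Definition Cdiv (a b : Cpx) : Cpx := Cmul a (Cinv b).
Definition RtoC (r : R) : Cpx := mkC r 0.

Lemma Cpx_eq (a b : Cpx) : cre a = cre b -> cim a = cim b -> a = b.
Proof. destruct a, b; simpl; intros; subst; reflexivity. Qed.

Lemma Csq_pos (a : Cpx) : a <> C0 -> 0 < Csq a.
Proof.
  destruct a as [x y]; unfold Csq; simpl; intro H.
  destruct (Req_dec x 0) as [->|Hx].
  - destruct (Req_dec y 0) as [->|Hy]; [now contradiction H|nra].
  - nra.
Qed.

Lemma Cpx_field : field_theory C0 Cone Cadd Cmul Csub Copp Cdiv Cinv (@eq Cpx).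
Proof.
  constructor.
  - constructor; intros; apply Cpx_eq; simpl; ring.
  - intro H; injection H; lra.
  - intros; reflexivity.
  - intros p Hp. pose proof (Csq_pos Hp) as H0.
    apply Cpx_eq; simpl; unfold Csq in *; field; lra.
Qed.
Add Field CpxF : Cpx_field.

Lemma Cabs_sq (a : Cpx) : Cabs a * Cabs a = Csq a.
Proof. unfold Cabs, Csq. apply sqrt_sqrt. nra. Qed.
Lemma Cabs_ge0 (a : Cpx) : 0 <= Cabs a.
Proof. apply sqrt_pos. Qed.
Lemma Cabs_eq0 (a : Cpx) : Cabs a = 0 -> a = C0.
Proof.
  intro H. apply NNPP; intro Hn. pose proof (Csq_pos Hn). pose proof (Cabs_sq a).
  rewrite H in *; lra.
Qed.
Lemma Cabs_pos (a : Cpx) : a <> C0 -> 0 < Cabs a.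
Proof.
  intro H. destruct (Cabs_ge0 a) as [?|E]; [assumption|].
  contradiction H; now apply Cabs_eq0.
Qed.
Lemma Cabs_C0 : Cabs C0 = 0.
Proof. unfold Cabs, C0; simpl. replace (0*0+0*0) with 0 by ring. apply sqrt_0. Qed.
Lemma Cabs_mul (a b : Cpx) : Cabs (Cmul a b) = Cabs a * Cabs b.
Proof.
  unfold Cabs; rewrite <- sqrt_mult by nra; f_equal; destruct a, b; simpl; ring.
Qed.
Lemma Cabs_RtoC (r : R) : Cabs (RtoC r) = Rabs r.
Proof.
  unfold Cabs, RtoC; simpl. replace (r*r+0*0) with (Rsqr r) by (unfold Rsqr; ring).
  apply sqrt_Rsqr_abs.
Qed.
Lemma Cabs_RtoC_pos (r : R) : 0 <= r -> Cabs (RtoC r) = r.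
Proof. intro; rewrite Cabs_RtoC; now apply Rabs_pos_eq. Qed.
Lemma Cabs_1 : Cabs Cone = 1.
Proof. change Cone with (RtoC 1). apply Cabs_RtoC_pos; lra. Qed.
Lemma Cabs_opp (a : Cpx) : Cabs (Copp a) = Cabs a.
Proof. unfold Cabs; f_equal; destruct a; simpl; ring. Qed.
Lemma le_of_sq (x y : R) : 0 <= y -> x * x <= y * y -> x <= y.
Proof. intros; nra. Qed.
Lemma Cabs_tri (a b : Cpx) : Cabs (Cadd a b) <= Cabs a + Cabs b.
Proof.
  pose proof (Cabs_ge0 a); pose proof (Cabs_ge0 b).
  pose proof (Cabs_sq a); pose proof (Cabs_sq b).
  apply le_of_sq; [lra|]. rewrite Cabs_sq.
  assert (cre a * cre b + cim a * cim b <= Cabs a * Cabs b).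
  { apply le_of_sq; [nra|].
    replace (Cabs a * Cabs b * (Cabs a * Cabs b)) with ((Cabs a * Cabs a) * (Cabs b * Cabs b)) by ring.
    rewrite !Cabs_sq; unfold Csq.
    (* Lagrange's identity: the two sides of the Cauchy-Schwarz inequality differ by this square. *)
    pose proof (Rle_0_sqr (cre a * cim b - cim a * cre b)); unfold Rsqr in *; nra. }
  unfold Csq in *; simpl; nra.
Qed.
Lemma Cabs_inv (a : Cpx) : a <> C0 -> Cabs (Cinv a) = / Cabs a.
Proof.
  intro H. pose proof (Cabs_pos H).
  apply Rmult_eq_reg_l with (Cabs a); [|lra].
  rewrite <- Cabs_mul, Rinv_r by lra.
  replace (Cmul a (Cinv a)) with Cone by (field; assumption). apply Cabs_1.
Qed.
Lemma Cabs_re (a : Cpx) : Rabs (cre a) <= Cabs a.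
Proof.
  apply le_of_sq; [apply Cabs_ge0|]. rewrite Cabs_sq; unfold Csq.
  pose proof (Rsqr_abs (cre a)); unfold Rsqr in *; nra.
Qed.
Lemma Cabs_im (a : Cpx) : Rabs (cim a) <= Cabs a.
Proof.
  apply le_of_sq; [apply Cabs_ge0|]. rewrite Cabs_sq; unfold Csq.
  pose proof (Rsqr_abs (cim a)); unfold Rsqr in *; nra.
Qed.
Lemma Cabs_le_reim (a : Cpx) : Cabs a <= Rabs (cre a) + Rabs (cim a).
Proof.
  pose proof (Rabs_pos (cre a)); pose proof (Rabs_pos (cim a)).
  apply le_of_sq; [lra|]. rewrite Cabs_sq; unfold Csq.
  pose proof (Rsqr_abs (cre a)); pose proof (Rsqr_abs (cim a)); unfold Rsqr in *; nra.
Qed.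
Lemma Cmul_neq0 (a b : Cpx) : a <> C0 -> b <> C0 -> Cmul a b <> C0.
Proof.
  intros Ha Hb H. pose proof (Cabs_pos Ha); pose proof (Cabs_pos Hb).
  assert (Cabs (Cmul a b) = 0) by (rewrite H; apply Cabs_C0).
  rewrite Cabs_mul in *; nra.
Qed.
Lemma Copp_neq0 (a : Cpx) : a <> C0 -> Copp a <> C0.
Proof. intros H E; apply H. replace a with (Copp (Copp a)) by ring. rewrite E; ring. Qed.
Lemma Cone_neq0 : Cone <> C0.
Proof. intro H; injection H; lra. Qed.
Lemma Csub_neq0 (a b : Cpx) : a <> b -> Csub a b <> C0.
Proof. intros H E; apply H. replace a with (Cadd (Csub a b) b) by ring. rewrite E; ring. Qed.
Lemma RtoC_neq0 (r : R) : r <> 0 -> RtoC r <> C0.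
Proof. intros H E; injection E; exact H. Qed.
Lemma Cabs_neq0 (a : Cpx) : 0 < Cabs a -> a <> C0.
Proof. intros H E; rewrite E, Cabs_C0 in H; lra. Qed.

Fixpoint Cpow (a : Cpx) (n : nat) : Cpx :=
  match n with O => Cone | S n => Cmul a (Cpow a n) end.
Lemma Cabs_pow (a : Cpx) n : Cabs (Cpow a n) = Cabs a ^ n.
Proof. induction n; simpl; [apply Cabs_1|now rewrite Cabs_mul, IHn]. Qed.
Lemma Cpow_neq0 (a : Cpx) n : a <> C0 -> Cpow a n <> C0.
Proof. intro H; induction n; simpl; [apply Cone_neq0|now apply Cmul_neq0]. Qed.
Lemma Cpow_add (a : Cpx) n m : Cpow a (n + m) = Cmul (Cpow a n) (Cpow a m).
Proof. induction n; simpl; [ring|rewrite IHn; ring]. Qed.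
Lemma Cpow_mul_l (a b : Cpx) n : Cpow (Cmul a b) n = Cmul (Cpow a n) (Cpow b n).
Proof. induction n; simpl; [ring|rewrite IHn; ring]. Qed.

Notation "x +v y" := (vadd _ x y) (at level 50, left associativity).
Notation "-v x" := (vopp _ x) (at level 35, right associativity).
Notation "x -v y" := (vadd _ x (vopp _ y)) (at level 50, left associativity).
Notation "c *v x" := (vscal _ c x) (at level 40).
Notation nm := (vnorm _).

Section VecBasics.
Variable X : CBanach.
Implicit Types x y z : X.

Lemma vadd_0r x : x +v vzero X = x.
Proof. rewrite vadd_comm; apply vadd_0. Qed.
Lemma vadd_oppr x : x -v x = vzero X.
Proof. rewrite vadd_comm; apply vadd_opp. Qed.
Lemma vadd_cancel x y z : x +v y = x +v z -> y = z.
Proof.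
  intro H. rewrite <- (vadd_0 X y), <- (vadd_0 X z), <- (vadd_opp X x).
  now rewrite <- !vadd_assoc, H.
Qed.
Lemma vscal_C0 x : C0 *v x = vzero X.
Proof.
  apply vadd_cancel with (C0 *v x). rewrite <- vscal_adds, vadd_0r.
  f_equal; ring.
Qed.
Lemma vscal_v0 c : c *v vzero X = vzero X.
Proof.
  apply vadd_cancel with (c *v vzero X). now rewrite <- vscal_addv, !vadd_0r.
Qed.
Lemma vopp_scal x : -v x = Copp Cone *v x.
Proof.
  apply vadd_cancel with x. rewrite vadd_oppr.
  transitivity (Cone *v x +v Copp Cone *v x); [|now rewrite vscal_1].
  rewrite <- vscal_adds. replace (Cadd Cone (Copp Cone)) with C0 by ring. symmetry; apply vscal_C0.
Qed.

(* Syntax of linear expressions; [vec] compares the coefficients of each atom by [ring] or [field]. *)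
Inductive vx := xZ | xA (n : nat) | xP (a b : vx) | xN (a : vx) | xS (c : Cpx) (a : vx).
Fixpoint ev (env : list X) (e : vx) : X :=
  match e with
  | xZ => vzero X | xA n => nth n env (vzero X)
  | xP a b => ev env a +v ev env b | xN a => -v ev env a | xS c a => c *v ev env a
  end.
Fixpoint cf (e : vx) (n : nat) : Cpx :=
  match e with
  | xZ => C0 | xA m => if Nat.eqb m n then Cone else C0
  | xP a b => Cadd (cf a n) (cf b n) | xN a => Copp (cf a n) | xS c a => Cmul c (cf a n)
  end.
Fixpoint lc (f : nat -> Cpx) (env : list X) : X :=
  match env with nil => vzero X | v :: l => f O *v v +v lc (fun n => f (S n)) l end.
(** Only finitely many coefficients are compared, so that the premise of [vec_eq] computes to a
    conjunction of scalar identities. *)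
Fixpoint ceq (f g : nat -> Cpx) (k : nat) : Prop :=
  match k with O => True | S k => f O = g O /\ ceq (fun n => f (S n)) (fun n => g (S n)) k end.

Lemma vadd4 x y z (w : X) : (x +v y) +v (z +v w) = (x +v z) +v (y +v w).
Proof.
  rewrite <- !vadd_assoc. f_equal. rewrite !vadd_assoc. f_equal. apply vadd_comm.
Qed.
Lemma lc_add env : forall f g, lc (fun n => Cadd (f n) (g n)) env = lc f env +v lc g env.
Proof.
  induction env as [|v l IH]; intros f g; simpl; [now rewrite vadd_0|].
  rewrite IH, vscal_adds. apply vadd4.
Qed.
Lemma lc_scal c env : forall f, lc (fun n => Cmul c (f n)) env = c *v lc f env.
Proof.
  induction env as [|v l IH]; intros f; simpl; [now rewrite vscal_v0|].
  now rewrite IH, vscal_addv, vscal_mul.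
Qed.
Lemma lc_ext env : forall f g, (forall n, f n = g n) -> lc f env = lc g env.
Proof.
  induction env as [|v l IH]; intros f g H; simpl; [reflexivity|].
  rewrite H; f_equal; apply IH; intro; apply H.
Qed.
Lemma lc_zero env : lc (fun _ => C0) env = vzero X.
Proof. induction env as [|v l IH]; simpl; [reflexivity|]. now rewrite IH, vscal_C0, vadd_0. Qed.
Lemma lc_atom env : forall m, lc (fun n => if Nat.eqb m n then Cone else C0) env = nth m env (vzero X).
Proof.
  induction env as [|v l IH]; intros [|m]; simpl; try reflexivity.
  - now rewrite lc_zero, vscal_1, vadd_0r.
  - now rewrite vscal_C0, vadd_0, IH.
Qed.
Lemma ev_lc env e : ev env e = lc (cf e) env.
Proof.
  induction e; simpl.
  - now rewrite lc_zero.
  - now rewrite lc_atom.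
  - now rewrite lc_add, IHe1, IHe2.
  - rewrite IHe, vopp_scal, <- lc_scal. apply lc_ext; intro; ring.
  - now rewrite lc_scal, IHe.
Qed.
Lemma lc_ceq env : forall f g, ceq f g (length env) -> lc f env = lc g env.
Proof.
  induction env as [|v l IH]; intros f g H; simpl in *; [reflexivity|].
  destruct H as [H1 H2]. now rewrite H1, (IH _ _ H2).
Qed.
Lemma vec_eq env a b : ceq (cf a) (cf b) (length env) -> ev env a = ev env b.
Proof. intro; rewrite !ev_lc; now apply lc_ceq. Qed.
End VecBasics.

Ltac v_in x l := match l with nil => constr:(false) | x :: _ => constr:(true) | _ :: ?t => v_in x t end.
Ltac v_add x l := let b := v_in x l in match b with true => l | false => constr:(cons x l) end.
Ltac v_atoms t l :=
  match t with
  | vadd _ ?a ?b => let l := v_atoms a l in v_atoms b l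
  | vopp _ ?a => v_atoms a l
  | vscal _ _ ?a => v_atoms a l
  | vzero _ => l
  | _ => v_add t l
  end.
Ltac v_idx x l := match l with x :: _ => constr:(O) | _ :: ?t => let n := v_idx x t in constr:(S n) end.
Ltac v_reify t l :=
  match t with
  | vadd _ ?a ?b => let a := v_reify a l in let b := v_reify b l in constr:(xP a b)
  | vopp _ ?a => let a := v_reify a l in constr:(xN a)
  | vscal _ ?c ?a => let a := v_reify a l in constr:(xS c a)
  | vzero _ => constr:(xZ)
  | _ => let n := v_idx t l in constr:(xA n)
  end.
Ltac vec_pre :=
  match goal with |- @eq ?T ?a ?b =>
    let X := match constr:((a, b)) with
      | context [vadd ?X _ _] => X | context [vopp ?X _] => X
      | context [vscal ?X _ _] => X | context [vzero ?X] => X end in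
    let l := v_atoms a (@nil (car X)) in let l := v_atoms b l in
    let ra := v_reify a l in let rb := v_reify b l in
    change (@ev X l ra = @ev X l rb); apply vec_eq;
    cbn [ceq cf length Nat.eqb]; repeat split
  end.
Ltac vec := vec_pre; first [ring | field].

Section Norms.
Variable X : CBanach.
Implicit Types x y z : X.
Lemma nm_0 : nm (vzero X) = 0.
Proof. now apply vnorm_eq0. Qed.
Lemma nm_opp x : nm (-v x) = nm x.
Proof. rewrite vopp_scal, vnorm_scal, Cabs_opp, Cabs_1; ring. Qed.
Lemma nm_ge0 x : 0 <= nm x.
Proof.
  pose proof (vnorm_triangle X x (-v x)) as H. rewrite vadd_oppr, nm_0, nm_opp in H; lra.
Qed.
Lemma nm_pos x : x <> vzero X -> 0 < nm x.
Proof.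
  intro H; destruct (nm_ge0 x) as [?|E]; [assumption|].
  contradiction H; now apply vnorm_eq0.
Qed.
Lemma nm_eq0 x : nm x = 0 -> x = vzero X.
Proof. apply vnorm_eq0. Qed.
Lemma nm_le0 x : nm x <= 0 -> x = vzero X.
Proof. intro; apply nm_eq0; pose proof (nm_ge0 x); lra. Qed.
Lemma nm_add x y : nm (x +v y) <= nm x + nm y.
Proof. apply vnorm_triangle. Qed.
Lemma nm_sub x y : nm (x -v y) <= nm x + nm y.
Proof. rewrite <- (nm_opp y); apply vnorm_triangle. Qed.
Lemma nm_swap x y : nm (x -v y) = nm (y -v x).
Proof. rewrite <- nm_opp; f_equal; vec. Qed.
Lemma nm_tri x y z : nm (x -v z) <= nm (x -v y) + nm (y -v z).
Proof. replace (x -v z) with ((x -v y) +v (y -v z)) by vec. apply nm_add. Qed.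
Lemma nm_rev x y : nm x - nm y <= nm (x -v y).
Proof.
  pose proof (nm_add (x -v y) y). replace (x -v y +v y) with x in H by vec; lra.
Qed.
Lemma sub_eq0 x y : x -v y = vzero X -> x = y.
Proof. intro H. replace x with ((x -v y) +v y) by vec. rewrite H; vec. Qed.
Lemma vscal_eq0 c x : c *v x = vzero X -> c <> C0 -> x = vzero X.
Proof.
  intros H Hc. replace x with (Cinv c *v (c *v x)) by (vec_pre; field; assumption).
  rewrite H; vec.
Qed.
Lemma nm_Rscal r x : 0 <= r -> nm (RtoC r *v x) = r * nm x.
Proof. intro; now rewrite vnorm_scal, Cabs_RtoC_pos. Qed.
End Norms.

(** * Limits and bounded operators *)

Definition incr (phi : nat -> nat) : Prop := forall n, (phi n < phi (S n))%nat.
Lemma incr_ge phi : incr phi -> forall n, (n <= phi n)%nat.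
Proof. intros H n; induction n; [lia|]. specialize (H n); lia. Qed.
Lemma incr_lt phi : incr phi -> forall m n, (m < n)%nat -> (phi m < phi n)%nat.
Proof. intros H m n Hmn; induction Hmn; [apply H|]. specialize (H m0); lia. Qed.
Lemma incr_comp phi psi : incr phi -> incr psi -> incr (fun n => phi (psi n)).
Proof. intros H1 H2 n; apply incr_lt; auto. Qed.
Lemma incr_id : incr (fun n => n).
Proof. intro; lia. Qed.

Lemma subseq_choice (P : nat -> nat -> Prop) :
  (forall k N, exists n, (N <= n)%nat /\ P k n) -> exists phi, incr phi /\ forall k, P k (phi k).
Proof.
  intro H.
  assert (H' : forall k N, {n | (N <= n)%nat /\ P k n})
    by (intros; apply constructive_indefinite_description; apply H).
  pose (phi := fix phi k := match k with O => proj1_sig (H' O O)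
                                    | S k' => proj1_sig (H' (S k') (S (phi k'))) end).
  exists phi; split.
  - intro n; simpl. destruct (H' (S n) (S (phi n))) as [m [Hm ?]]; simpl; lia.
  - intros [|k]; simpl; [destruct (H' O O) as [m [? ?]]|destruct (H' (S k) (S (phi k))) as [m [? ?]]]; assumption.
Qed.

Lemma pow_small (eta C eps : R) : 0 <= eta < 1 -> 0 < eps ->
  exists N, forall n, (N <= n)%nat -> C * eta ^ n < eps.
Proof.
  intros He Hp.
  destruct (pow_lt_1_zero eta) with (y := eps / (Rabs C + 1)) as [N HN].
  - rewrite Rabs_pos_eq; lra.
  - apply Rdiv_lt_0_compat; [lra|]. pose proof (Rabs_pos C); lra.
  - exists N; intros n Hn. specialize (HN n Hn).
    pose proof (Rabs_pos C); pose proof (Rle_abs C); pose proof (pow_le eta n (proj1 He)).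
    rewrite Rabs_pos_eq in HN by assumption.
    assert (eta ^ n * (Rabs C + 1) < eps).
    { apply Rmult_lt_reg_r with (/ (Rabs C + 1)); [apply Rinv_0_lt_compat; lra|].
      rewrite Rmult_assoc, Rinv_r, Rmult_1_r by lra. exact HN. }
    nra.
Qed.

Lemma le_pow_zero (a C eta : R) : 0 <= eta < 1 -> (forall n, a <= C * eta ^ n) -> a <= 0.
Proof.
  intros He H. apply Rnot_lt_le; intro Ha.
  destruct (pow_small C He Ha) as [N HN]. specialize (HN N (le_n _)). specialize (H N). lra.
Qed.

Lemma inv_small eps : 0 < eps -> exists N, forall n, (N <= n)%nat -> / (INR n + 1) < eps.
Proof.
  intro H. destruct (INR_archimed 1 (/ eps)) as [N HN]; [lra|].
  exists N; intros n Hn. apply le_INR in Hn.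
  assert (0 < / eps) by now apply Rinv_0_lt_compat.
  rewrite <- (Rinv_inv eps). apply Rinv_lt_contravar; nra.
Qed.

Lemma real_subseq (u : nat -> R) M : (forall n, Rabs (u n) <= M) ->
  exists phi l, incr phi /\ forall eps, 0 < eps -> exists N, forall n, (N <= n)%nat -> Rabs (u (phi n) - l) < eps.
Proof.
  intro H.
  destruct (Bolzano_Weierstrass u (fun c => - M <= c <= M)) as [l Hl].
  - apply compact_P3.
  - intro n; specialize (H n). pose proof (Rle_abs (u n)); pose proof (Rle_abs (- u n)); rewrite Rabs_Ropp in *; lra.
  - assert (Hk : forall k N, exists n, (N <= n)%nat /\ Rabs (u n - l) < / (INR k + 1)).
    { intros k N. assert (Hk : 0 < / (INR k + 1)) by (apply Rinv_0_lt_compat; pose proof (pos_INR k); lra).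
      destruct (Hl (disc l (mkposreal _ Hk)) N) as [p [Hp1 Hp2]].
      - exists (mkposreal _ Hk); intros x Hx; exact Hx.
      - exists p; split; [exact Hp1|exact Hp2]. }
    destruct (subseq_choice Hk) as [phi [Hphi HP]].
    exists phi, l; split; [exact Hphi|].
    intros eps Heps. destruct (inv_small Heps) as [N HN]. exists N; intros n Hn.
    eapply Rlt_trans; [apply HP|now apply HN].
Qed.

Lemma Cpx_subseq (u : nat -> Cpx) M : (forall n, Cabs (u n) <= M) ->
  exists phi l, incr phi /\
    forall eps, 0 < eps -> exists N, forall n, (N <= n)%nat -> Cabs (Csub (u (phi n)) l) < eps.
Proof.
  intro H.
  destruct (@real_subseq (fun n => cre (u n)) M) as [p1 [l1 [Hp1 H1]]].
  { intro n; eapply Rle_trans; [apply Cabs_re|apply H]. }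
  destruct (@real_subseq (fun n => cim (u (p1 n))) M) as [p2 [l2 [Hp2 H2]]].
  { intro n; eapply Rle_trans; [apply Cabs_im|apply H]. }
  exists (fun n => p1 (p2 n)), (mkC l1 l2); split; [now apply incr_comp|].
  intros eps Heps. destruct (H1 (eps/2)) as [N1 HN1]; [lra|]. destruct (H2 (eps/2)) as [N2 HN2]; [lra|].
  exists (max N1 N2); intros n Hn. eapply Rle_lt_trans; [apply Cabs_le_reim|]. simpl.
  assert (A := incr_ge Hp2 n).
  specialize (HN1 (p2 n) ltac:(lia)). specialize (HN2 n ltac:(lia)).
  unfold Rminus in *; lra.
Qed.

Section Lim.
Variable X : CBanach.
Implicit Types (x y z l : X) (u : nat -> X).

Definition lim u l : Prop := forall eps, 0 < eps -> exists N, forall n, (N <= n)%nat -> nm (u n -v l) < eps.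

Lemma lim_unique u l l' : lim u l -> lim u l' -> l = l'.
Proof.
  intros H H'. apply sub_eq0, nm_le0. apply Rnot_lt_le; intro Hp.
  destruct (H (nm (l -v l') / 2)) as [N HN]; [lra|].
  destruct (H' (nm (l -v l') / 2)) as [N' HN']; [lra|].
  specialize (HN (max N N') ltac:(lia)). specialize (HN' (max N N') ltac:(lia)).
  pose proof (nm_tri l (u (max N N')) l') as Ht. rewrite (nm_swap l (u (max N N'))) in Ht. lra.
Qed.
Lemma lim_sub u l phi : lim u l -> incr phi -> lim (fun n => u (phi n)) l.
Proof.
  intros H Hp eps He; destruct (H eps He) as [N HN]; exists N; intros n Hn.
  apply HN. pose proof (incr_ge Hp n); lia.
Qed.
Lemma lim_const l : lim (fun _ => l) l.
Proof. intros eps He; exists O; intros; now rewrite vadd_oppr, nm_0. Qed.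
Lemma lim_ext u u' l : (forall n, u n = u' n) -> lim u l -> lim u' l.
Proof. intros H Hl eps He; destruct (Hl eps He) as [N HN]; exists N; intros; rewrite <- H; auto. Qed.
Lemma lim_add u v l m : lim u l -> lim v m -> lim (fun n => u n +v v n) (l +v m).
Proof.
  intros H1 H2 eps He. destruct (H1 (eps/2)) as [N1 HN1]; [lra|]. destruct (H2 (eps/2)) as [N2 HN2]; [lra|].
  exists (max N1 N2); intros n Hn. specialize (HN1 n ltac:(lia)). specialize (HN2 n ltac:(lia)).
  replace (u n +v v n -v (l +v m)) with ((u n -v l) +v (v n -v m)) by vec.
  pose proof (nm_add (u n -v l) (v n -v m)); lra.
Qed.
Lemma lim_opp u l : lim u l -> lim (fun n => -v u n) (-v l).
Proof.
  intros H eps He. destruct (H eps He) as [N HN]; exists N; intros n Hn.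
  replace (-v u n -v (-v l)) with (-v (u n -v l)) by vec. rewrite nm_opp; auto.
Qed.
Lemma lim_minus u v l m : lim u l -> lim v m -> lim (fun n => u n -v v n) (l -v m).
Proof. intros; apply lim_add; [assumption|now apply lim_opp]. Qed.
Lemma lim_scal c u l : lim u l -> lim (fun n => c *v u n) (c *v l).
Proof.
  intros H eps He. pose proof (Cabs_ge0 c).
  destruct (H (eps / (Cabs c + 1))) as [N HN]; [apply Rdiv_lt_0_compat; lra|].
  exists N; intros n Hn. specialize (HN n Hn).
  replace (c *v u n -v c *v l) with (c *v (u n -v l)) by vec. rewrite vnorm_scal.
  pose proof (nm_ge0 (u n -v l)).
  assert (eps / (Cabs c + 1) * (Cabs c + 1) = eps) by (field; lra). nra.
Qed.
Lemma lim_cscal (c : nat -> Cpx) c0 x :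
  (forall eps, 0 < eps -> exists N, forall n, (N <= n)%nat -> Cabs (Csub (c n) c0) < eps) ->
  lim (fun n => c n *v x) (c0 *v x).
Proof.
  intros H eps He. pose proof (nm_ge0 x).
  destruct (H (eps / (nm x + 1))) as [N HN]; [apply Rdiv_lt_0_compat; lra|].
  exists N; intros n Hn. specialize (HN n Hn).
  replace (c n *v x -v c0 *v x) with (Csub (c n) c0 *v x) by vec.
  rewrite vnorm_scal. pose proof (Cabs_ge0 (Csub (c n) c0)).
  assert (eps / (nm x + 1) * (nm x + 1) = eps) by (field; lra). nra.
Qed.
Lemma lim_norm_le u l C : lim u l -> (exists N, forall n, (N <= n)%nat -> nm (u n) <= C) -> nm l <= C.
Proof.
  intros H [N HN]. apply Rnot_lt_le; intro Hp.
  destruct (H (nm l - C)) as [N' HN']; [lra|].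
  specialize (HN (max N N') ltac:(lia)). specialize (HN' (max N N') ltac:(lia)).
  rewrite nm_swap in HN'. pose proof (nm_rev l (u (max N N'))); lra.
Qed.
Lemma lim_norm_ge u l C : lim u l -> (exists N, forall n, (N <= n)%nat -> C <= nm (u n)) -> C <= nm l.
Proof.
  intros H [N HN]. apply Rnot_lt_le; intro Hp.
  destruct (H (C - nm l)) as [N' HN']; [lra|].
  specialize (HN (max N N') ltac:(lia)). specialize (HN' (max N N') ltac:(lia)).
  pose proof (nm_rev (u (max N N')) l); lra.
Qed.
Lemma lim_bounded u l : lim u l -> exists M, forall n, nm (u n) <= M.
Proof.
  intros H. destruct (H 1) as [N HN]; [lra|].
  assert (Hf : forall k, exists M, forall n, (n < k)%nat -> nm (u n) <= M).
  { induction k as [|k [M HM]]; [exists 0; intros; lia|].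
    exists (Rmax M (nm (u k))); intros n Hn. destruct (Nat.eq_dec n k) as [->|Hne]; [apply Rmax_r|].
    eapply Rle_trans; [apply HM; lia|apply Rmax_l]. }
  destruct (Hf N) as [M HM]. exists (Rmax M (nm l + 1)); intro n.
  destruct (Nat.lt_ge_cases n N) as [Hn|Hn].
  - eapply Rle_trans; [apply HM; assumption|apply Rmax_l].
  - eapply Rle_trans; [|apply Rmax_r]. specialize (HN n Hn).
    pose proof (nm_rev (u n) l); lra.
Qed.
Lemma lim_small u l (r : nat -> R) :
  (forall n, nm (u n -v l) <= r n) -> (forall eps, 0 < eps -> exists N, forall n, (N <= n)%nat -> r n < eps) ->
  lim u l.
Proof. intros H Hr eps He; destruct (Hr eps He) as [N HN]; exists N; intros; eapply Rle_lt_trans; eauto. Qed.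

Lemma complete_geom u C eta : 0 <= eta < 1 -> (forall n, nm (u (S n) -v u n) <= C * eta ^ n) ->
  exists l, lim u l.
Proof.
  intros He H.
  assert (HC : 0 <= C). { specialize (H O); simpl in H. pose proof (nm_ge0 (u 1%nat -v u O)); lra. }
  assert (Hk : forall k n, nm (u (k + n)%nat -v u n) <= C / (1 - eta) * eta ^ n).
  { intros k n.
    assert (nm (u (k + n)%nat -v u n) <= C * eta ^ n * ((1 - eta ^ k) / (1 - eta))).
    { induction k; simpl Nat.add.
      - rewrite vadd_oppr, nm_0. simpl. right; field; lra.
      - pose proof (nm_tri (u (S (k + n))) (u (k + n)%nat) (u n)). specialize (H (k + n)%nat).
        rewrite pow_add in H.
        assert (C * eta ^ n * ((1 - eta ^ S k) / (1 - eta)) = C * eta ^ n * ((1 - eta ^ k) / (1 - eta)) + C * (eta ^ k * eta ^ n)).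
        { simpl; field; lra. }
        lra. }
    eapply Rle_trans; [eassumption|].
    pose proof (pow_le eta k (proj1 He)). pose proof (pow_le eta n (proj1 He)).
    replace (C / (1 - eta) * eta ^ n) with (C * eta ^ n * (1 / (1 - eta))) by (field; lra).
    apply Rmult_le_compat_l; [now apply Rmult_le_pos|]. unfold Rdiv.
    apply Rmult_le_compat_r; [left; apply Rinv_0_lt_compat|]; lra. }
  destruct (vcomplete X u) as [l Hl].
  - intros eps Heps. destruct (pow_small (C / (1 - eta)) He (eps := eps / 2)) as [N HN]; [lra|].
    exists N; intros m n Hm Hn.
    pose proof (Hk (m - N)%nat N) as A1. pose proof (Hk (n - N)%nat N) as A2.
    replace (m - N + N)%nat with m in A1 by lia. replace (n - N + N)%nat with n in A2 by lia.
    pose proof (nm_tri (u m) (u N) (u n)). rewrite (nm_swap (u N)) in H0.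
    specialize (HN N (le_n _)). lra.
  - exists l; intros eps Heps. destruct (Hl eps Heps) as [N HN]; exists N; intros; apply HN; lia.
Qed.

Definition subsp (Z : X -> Prop) : Prop :=
  Z (vzero X) /\ (forall x y, Z x -> Z y -> Z (x +v y)) /\ (forall c x, Z x -> Z (c *v x)).
Definition closed (Z : X -> Prop) : Prop := forall u l, (forall n, Z (u n)) -> lim u l -> Z l.

Lemma subsp_opp Z x : subsp Z -> Z x -> Z (-v x).
Proof. intros [_ [_ H]] Hx. rewrite vopp_scal; auto. Qed.
Lemma subsp_sub Z x y : subsp Z -> Z x -> Z y -> Z (x -v y).
Proof. intros H Hx Hy. pose proof (subsp_opp H Hy). destruct H as [_ [H _]]; auto. Qed.
Lemma subsp_add Z x y : subsp Z -> Z x -> Z y -> Z (x +v y).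
Proof. intros [_ [H _]]; auto. Qed.
Lemma subsp_scal Z c x : subsp Z -> Z x -> Z (c *v x).
Proof. intros [_ [_ H]]; auto. Qed.
Lemma subsp_0 Z : subsp Z -> Z (vzero X).
Proof. intros [H _]; auto. Qed.
Lemma subsp_and Z W : subsp Z -> subsp W -> subsp (fun x => Z x /\ W x).
Proof. intros [? [? ?]] [? [? ?]]; repeat split; intuition. Qed.

Definition closure (Z : X -> Prop) (x : X) : Prop := forall eps, 0 < eps -> exists z, Z z /\ nm (x -v z) < eps.
Lemma closure_in (Z : X -> Prop) x : Z x -> closure Z x.
Proof. intros H eps He; exists x; split; [assumption|now rewrite vadd_oppr, nm_0]. Qed.
Lemma closure_closed Z : closed (closure Z).
Proof.
  intros u l Hu Hl eps He. destruct (Hl (eps/2)) as [N HN]; [lra|].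
  destruct (Hu N (eps/2)) as [z [Hz Hn]]; [lra|]. exists z; split; [assumption|].
  specialize (HN N (le_n _)). rewrite nm_swap in HN. pose proof (nm_tri l (u N) z); lra.
Qed.
Lemma closure_lim Z x : closure Z x -> exists u, (forall n, Z (u n)) /\ lim u x.
Proof.
  intro H.
  assert (H' : forall n, exists z, Z z /\ nm (x -v z) < / (INR n + 1)).
  { intro n; apply H, Rinv_0_lt_compat. pose proof (pos_INR n); lra. }
  apply choice in H'. destruct H' as [u Hu]. exists u; split; [apply Hu|].
  apply lim_small with (r := fun n => / (INR n + 1)).
  - intro n; rewrite nm_swap; left; apply Hu.
  - apply inv_small.
Qed.
Lemma closed_closure Z x : closed Z -> closure Z x -> Z x.
Proof. intros H Hx. destruct (closure_lim Hx) as [u [Hu Hl]]. eapply H; eauto. Qed.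
Lemma closure_subsp Z : subsp Z -> subsp (closure Z).
Proof.
  intros [H0 [Ha Hs]]; split; [now apply closure_in|split].
  - intros x y Hx Hy eps He. destruct (Hx (eps/2)) as [z [? ?]]; [lra|]. destruct (Hy (eps/2)) as [w [? ?]]; [lra|].
    exists (z +v w); split; [auto|]. replace (x +v y -v (z +v w)) with ((x -v z) +v (y -v w)) by vec.
    pose proof (nm_add (x -v z) (y -v w)); lra.
  - intros c x Hx eps He. pose proof (Cabs_ge0 c).
    destruct (Hx (eps / (Cabs c + 1))) as [z [Hz Hn]]; [apply Rdiv_lt_0_compat; lra|].
    exists (c *v z); split; [auto|]. replace (c *v x -v c *v z) with (c *v (x -v z)) by vec.
    rewrite vnorm_scal. pose proof (nm_ge0 (x -v z)).
    assert (eps / (Cabs c + 1) * (Cabs c + 1) = eps) by (field; lra). nra.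
Qed.
Lemma closure_min (Z W : X -> Prop) x : (forall x, Z x -> W x) -> closed W -> closure Z x -> W x.
Proof.
  intros H HW Hx. destruct (closure_lim Hx) as [u [Hu Hl]]. apply (HW u x); auto.
Qed.

(** A closed subspace of a Banach space need not contain a nearest point; a point within a factor 2
    of the distance replaces it throughout. The distance enters as minus the supremum [d] of the
    negated norms. *)
Lemma near_min Z x : subsp Z -> closed Z -> exists z, Z z /\ forall z', Z z' -> nm (x -v z) <= 2 * nm (x -v z').
Proof.
  intros HZ Hc. destruct (classic (Z x)) as [Hx|Hx].
  - exists x; split; [assumption|]; intros z' _. rewrite vadd_oppr, nm_0. pose proof (nm_ge0 (x -v z')); lra.
  - destruct (completeness (fun r => exists z, Z z /\ r = - nm (x -v z))) as [d [Hub Hl]].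
    + exists 0. intros r [z [_ ->]]. pose proof (nm_ge0 (x -v z)); lra.
    + exists (- nm (x -v vzero X)), (vzero X); split; [apply (subsp_0 HZ)|reflexivity].
    + assert (Hd : d < 0).
      { apply Rnot_le_lt; intro Hd. apply Hx. apply (closed_closure Hc). intros eps He.
        apply NNPP; intro Hn.
        assert (d <= - eps). { apply Hl. intros r [z [Hz ->]]. apply Rnot_lt_le; intro. apply Hn. exists z; split; [assumption|lra]. }
        lra. }
      destruct (classic (exists z, Z z /\ nm (x -v z) <= 2 * - d)) as [[z [Hz Hn]]|Hn].
      * exists z; split; [assumption|]. intros z' Hz'.
        assert (- nm (x -v z') <= d) by (apply Hub; eauto). lra.
      (* If every point were farther than [-2 d], then [2 d] would be an upper bound below the
         supremum, [d] being negative. *)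
      * exfalso. assert (d <= 2 * d); [|lra]. apply Hl. intros r [z [Hz ->]].
        apply Rnot_lt_le; intro. apply Hn; exists z; split; [assumption|lra].
Qed.
End Lim.

Section Ops2.
Variable X : CBanach.
Implicit Types (A B T : op X) (x y : X).

Lemma lin_add T x y : linear T -> T (x +v y) = T x +v T y.
Proof. intros [H _]; apply H. Qed.
Lemma lin_scal T c x : linear T -> T (c *v x) = c *v T x.
Proof. intros [_ H]; apply H. Qed.
Lemma lin_0 T : linear T -> T (vzero X) = vzero X.
Proof. intro H. rewrite <- (vscal_C0 (vzero X)), lin_scal by assumption. now rewrite !vscal_C0. Qed.
Lemma lin_opp T x : linear T -> T (-v x) = -v T x.
Proof. intro H. now rewrite !vopp_scal, lin_scal. Qed.
Lemma lin_sub T x y : linear T -> T (x -v y) = T x -v T y.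
Proof. intro H. now rewrite lin_add, lin_opp. Qed.

Definition lb T : Prop := linear T /\ exists C, forall x, nm (T x) <= C * nm x.
Lemma lb_bound T : lb T -> exists C, 0 < C /\ forall x, nm (T x) <= C * nm x.
Proof.
  intros [_ [C H]]. exists (Rmax C 1); split; [pose proof (Rmax_r C 1); lra|].
  intro x. eapply Rle_trans; [apply H|]. apply Rmult_le_compat_r; [apply nm_ge0|apply Rmax_l].
Qed.
Lemma lb_lin T : lb T -> linear T. Proof. now intros [? _]. Qed.
Lemma lb_lim T u l : lb T -> lim u l -> lim (fun n => T (u n)) (T l).
Proof.
  intros HT Hl eps He. destruct (lb_bound HT) as [C [HC H]].
  destruct (Hl (eps / C)) as [N HN]; [now apply Rdiv_lt_0_compat|].
  exists N; intros n Hn. rewrite <- lin_sub by apply HT. eapply Rle_lt_trans; [apply H|].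
  specialize (HN n Hn). assert (eps / C * C = eps) by (field; lra). nra.
Qed.
Definition opid : op X := fun x => x.
Lemma lin_opid : linear opid. Proof. split; reflexivity. Qed.
Lemma lin_opzero : linear (@opzero X). Proof. split; intros; unfold opzero; vec. Qed.
Lemma lin_opadd A B : linear A -> linear B -> linear (opadd A B).
Proof. intros HA HB; split; intros; unfold opadd; rewrite ?(lin_add _ _ HA), ?(lin_add _ _ HB), ?(lin_scal _ _ HA), ?(lin_scal _ _ HB); vec. Qed.
Lemma lin_opsub A B : linear A -> linear B -> linear (opsub A B).
Proof. intros HA HB; split; intros; unfold opsub; rewrite ?(lin_add _ _ HA), ?(lin_add _ _ HB), ?(lin_scal _ _ HA), ?(lin_scal _ _ HB); vec. Qed.
Lemma lin_opscal c A : linear A -> linear (opscal c A).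
Proof. intros HA; split; intros; unfold opscal; rewrite ?(lin_add _ _ HA), ?(lin_scal _ _ HA); vec. Qed.
Lemma lin_opcomp A B : linear A -> linear B -> linear (opcomp A B).
Proof. intros HA HB; split; intros; unfold opcomp; now rewrite ?(lin_add _ _ HB), ?(lin_add _ _ HA), ?(lin_scal _ _ HB), ?(lin_scal _ _ HA). Qed.
Lemma lin_bracket A B : linear A -> linear B -> linear (bracket A B).
Proof. intros; apply lin_opsub; apply lin_opcomp; assumption. Qed.
Lemma lin_iter T n : linear T -> linear (Nat.iter n T).
Proof. intro H; induction n; [apply lin_opid|]. change (linear (opcomp T (Nat.iter n T))). now apply lin_opcomp. Qed.

Lemma lb_opid : lb opid.
Proof. split; [apply lin_opid|exists 1; intro; unfold opid; lra]. Qed.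
Lemma lb_opzero : lb (@opzero X).
Proof. split; [apply lin_opzero|exists 0; intro; unfold opzero; rewrite nm_0; lra]. Qed.
Lemma lb_opadd A B : lb A -> lb B -> lb (opadd A B).
Proof.
  intros [HA [a Ha]] [HB [b Hb]]; split; [now apply lin_opadd|].
  exists (a + b); intro x. pose proof (nm_add (A x) (B x)). specialize (Ha x); specialize (Hb x). unfold opadd; lra.
Qed.
Lemma lb_opsub A B : lb A -> lb B -> lb (opsub A B).
Proof.
  intros [HA [a Ha]] [HB [b Hb]]; split; [now apply lin_opsub|].
  exists (a + b); intro x. pose proof (nm_sub (A x) (B x)). specialize (Ha x); specialize (Hb x). unfold opsub; lra.
Qed.
Lemma lb_opscal c A : lb A -> lb (opscal c A).
Proof.
  intros [HA [a Ha]]; split; [now apply lin_opscal|].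
  exists (Cabs c * a); intro x. unfold opscal; rewrite vnorm_scal, Rmult_assoc.
  apply Rmult_le_compat_l; [apply Cabs_ge0|apply Ha].
Qed.
Lemma lb_opcomp A B : lb A -> lb B -> lb (opcomp A B).
Proof.
  intros HA HB. destruct (lb_bound HA) as [a [Ha HA']]. destruct (lb_bound HB) as [b [Hb HB']].
  split; [apply lin_opcomp; [apply HA|apply HB]|].
  exists (a * b); intro x. unfold opcomp. eapply Rle_trans; [apply HA'|]. rewrite Rmult_assoc.
  apply Rmult_le_compat_l; [lra|apply HB'].
Qed.
Lemma lb_bracket A B : lb A -> lb B -> lb (bracket A B).
Proof. intros; apply lb_opsub; apply lb_opcomp; assumption. Qed.
Lemma lb_iter T n : lb T -> lb (Nat.iter n T).
Proof. intro H; induction n; [apply lb_opid|]. change (lb (opcomp T (Nat.iter n T))). now apply lb_opcomp. Qed.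

Lemma sup_of_lub (E : R -> Prop) : bound E -> (exists r, E r) -> is_lub E (sup_of E).
Proof.
  intros Hb He. unfold sup_of. apply epsilon_spec. destruct (completeness E Hb He) as [m Hm]; eauto.
Qed.
Lemma opnorm_lub T : lb T -> is_lub (fun r => exists x, vnorm X x <= 1 /\ r = vnorm X (T x)) (opnorm T).
Proof.
  intro H. destruct (lb_bound H) as [C [HC Hb]]. apply sup_of_lub.
  - exists C. intros r [x [Hx ->]]. specialize (Hb x). pose proof (nm_ge0 x). nra.
  - exists (nm (T (vzero X))), (vzero X). rewrite nm_0; split; [lra|reflexivity].
Qed.
Lemma opnorm_ge0 T : lb T -> 0 <= opnorm T.
Proof.
  intro H. destruct (opnorm_lub H) as [Hu _]. apply Rle_trans with (nm (T (vzero X))); [apply nm_ge0|].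
  apply Hu. exists (vzero X); rewrite nm_0; split; [lra|reflexivity].
Qed.
Lemma opnorm_spec T x : lb T -> nm (T x) <= opnorm T * nm x.
Proof.
  intro H. destruct (classic (x = vzero X)) as [->|Hx].
  - rewrite lin_0, nm_0 by apply H; lra.
  - pose proof (nm_pos Hx) as Hp.
    assert (nm (T (RtoC (/ nm x) *v x)) <= opnorm T).
    { apply (proj1 (opnorm_lub H)). eexists; split; [|reflexivity].
      rewrite nm_Rscal by (left; now apply Rinv_0_lt_compat). rewrite Rinv_l; lra. }
    rewrite lin_scal, nm_Rscal in H0 by (try apply H; left; now apply Rinv_0_lt_compat).
    apply Rmult_le_reg_l with (/ nm x); [now apply Rinv_0_lt_compat|].
    replace (/ nm x * (opnorm T * nm x)) with (opnorm T) by (field; lra). exact H0.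
Qed.
Lemma opnorm_le T C : lb T -> 0 <= C -> (forall x, nm (T x) <= C * nm x) -> opnorm T <= C.
Proof.
  intros H HC Hb. apply (proj2 (opnorm_lub H)). intros r [x [Hx ->]].
  specialize (Hb x). pose proof (nm_ge0 x); nra.
Qed.
End Ops2.
Arguments opid {X}.

Ltac lpush H := repeat (first [rewrite (lin_sub _ _ H) | rewrite (lin_add _ _ H) | rewrite (lin_scal _ _ H) | rewrite (lin_opp _ H) | rewrite (lin_0 H)]).

(** * Finite-dimensional subspaces *)

Section Span.
Variable X : CBanach.
Implicit Types (x y z v : X) (l : list X) (Z W : X -> Prop).

Fixpoint span l x : Prop :=
  match l with nil => x = vzero X | v :: l' => exists c y, span l' y /\ x = c *v v +v y end.

Lemma span_subsp l : subsp (span l).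
Proof.
  induction l as [|v l [H0 [Ha Hs]]].
  - split; [reflexivity|split; simpl; intros; subst; vec].
  - split; [|split]; simpl.
    + exists C0, (vzero X); split; [assumption|vec].
    + intros x y [c [x' [Hx ->]]] [d [y' [Hy ->]]]. exists (Cadd c d), (x' +v y'); split; [auto|vec].
    + intros c x [d [x' [Hx ->]]]. exists (Cmul c d), (c *v x'); split; [auto|vec].
Qed.
Lemma span_in l v : In v l -> span l v.
Proof.
  induction l as [|w l IH]; simpl; [tauto|]. intros [->|H].
  - exists Cone, (vzero X); split; [apply (subsp_0 (span_subsp l))|vec].
  - exists C0, v; split; [auto|vec].
Qed.
Lemma span_least l Z x : subsp Z -> (forall v, In v l -> Z v) -> span l x -> Z x.
Proof.
  intros HZ. revert x; induction l as [|w l IH]; simpl; intros x H Hx.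
  - subst; now apply subsp_0.
  - destruct Hx as [c [y [Hy ->]]]. apply subsp_add; [assumption| |auto].
    apply subsp_scal; auto.
Qed.
Lemma span_incl l l' x : incl l l' -> span l x -> span l' x.
Proof. intros H. apply span_least; [apply span_subsp|]. intros; apply span_in; auto. Qed.

Fixpoint lcomb (cs : list Cpx) l : X :=
  match cs, l with c :: cs, v :: l => c *v v +v lcomb cs l | _, _ => vzero X end.

(** Compactness of bounded sequences and boundedness of coefficients are proved in one induction:
    compactness makes the span of the tail closed, a closed tail lies at positive distance from a
    new vector, and this distance bounds the coefficient of that vector. The list may be linearly
    dependent, so only some choice of coefficients is bounded. *)
Lemma span_analytic l :
  (forall u : nat -> X, (forall n, span l (u n)) -> (exists M, forall n, nm (u n) <= M) ->
     exists phi y, incr phi /\ span l y /\ lim (fun n => u (phi n)) y) /\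
  (exists C, 0 < C /\ forall x, span l x ->
     exists cs, length cs = length l /\ x = lcomb cs l /\ forall c, In c cs -> Cabs c <= C * nm x).
Proof.
  induction l as [|v l [IH1 [C [HC IH2]]]].
  - split.
    + intros u Hu _. exists (fun n => n), (vzero X); split; [apply incr_id|split; [reflexivity|]].
      apply lim_ext with (fun _ => vzero X); [intro n; symmetry; apply Hu|apply lim_const].
    + exists 1; split; [lra|]. intros x ->. exists nil; repeat split; intros c [].
  - assert (Hcl : closed (span l)).
    { intros u y Hu Hy. destruct (IH1 u Hu (lim_bounded Hy)) as [phi [y' [Hp [Hs Hl]]]].
      now rewrite (lim_unique (lim_sub Hy Hp) Hl). }
    assert (Hb : exists D, 0 < D /\ forall x, span (v :: l) x ->
       exists c y, span l y /\ x = c *v v +v y /\ Cabs c <= D * nm x).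
    { destruct (near_min v (span_subsp l) Hcl) as [z [Hz Hmin]].
      destruct (classic (v -v z = vzero X)) as [E|E].
      (* A head vector depending on the tail gets the coefficient 0 and is absorbed into the
         tail. *)
      - exists 1; split; [lra|]. intros x [c [y [Hy ->]]]. exists C0, (c *v v +v y). split; [|split].
        + apply sub_eq0 in E. subst z. apply subsp_add; [apply span_subsp| |assumption]. apply subsp_scal; [apply span_subsp|assumption].
        + vec.
        + rewrite Cabs_C0. pose proof (nm_ge0 (c *v v +v y)); lra.
      - pose proof (nm_pos E) as Hd. exists (2 / nm (v -v z)); split; [apply Rdiv_lt_0_compat; lra|].
        intros x [c [y [Hy ->]]]. exists c, y; split; [assumption|split; [reflexivity|]].
        destruct (classic (c = C0)) as [->|Hc].
        + rewrite Cabs_C0. apply Rmult_le_pos; [left; apply Rdiv_lt_0_compat; lra|apply nm_ge0].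
        + specialize (Hmin (Copp (Cinv c) *v y) (subsp_scal (Copp (Cinv c)) (span_subsp l) Hy)).
          replace (c *v v +v y) with (c *v (v -v Copp (Cinv c) *v y)) by (vec_pre; field; assumption).
          rewrite vnorm_scal. pose proof (Cabs_ge0 c).
          apply Rmult_le_reg_l with (nm (v -v z)); [assumption|].
          replace (nm (v -v z) * (2 / nm (v -v z) * (Cabs c * nm (v -v Copp (Cinv c) *v y))))
            with (2 * (Cabs c * nm (v -v Copp (Cinv c) *v y))) by (field; lra). nra. }
    destruct Hb as [D [HD Hb]]. split.
    + intros u Hu [M HM].
      assert (H : forall n, exists p : Cpx * X, span l (snd p) /\ u n = fst p *v v +v snd p /\ Cabs (fst p) <= D * nm (u n)).
      { intro n. destruct (Hb (u n) (Hu n)) as [c [y Hy]]. now exists (c, y). }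
      apply choice in H. destruct H as [p Hp].
      destruct (@Cpx_subseq (fun n => fst (p n)) (D * M)) as [p1 [c [Hp1 Hc]]].
      { intro n. eapply Rle_trans; [apply Hp|]. apply Rmult_le_compat_l; [lra|apply HM]. }
      destruct (IH1 (fun n => snd (p (p1 n)))) as [p2 [y [Hp2 [Hy Hl]]]].
      { intro n; apply Hp. }
      { exists (M + D * M * nm v); intro n. destruct (Hp (p1 n)) as [_ [E Hn]].
        replace (snd (p (p1 n))) with (u (p1 n) -v fst (p (p1 n)) *v v) by (rewrite E; vec).
        eapply Rle_trans; [apply nm_sub|]. rewrite vnorm_scal. pose proof (HM (p1 n)). pose proof (nm_ge0 v).
        apply Rplus_le_compat; [assumption|]. apply Rmult_le_compat_r; [assumption|].
        eapply Rle_trans; [apply Hn|]. apply Rmult_le_compat_l; lra. }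
      exists (fun n => p1 (p2 n)), (c *v v +v y); split; [now apply incr_comp|split].
      * exists c, y; split; [assumption|reflexivity].
      * apply lim_ext with (fun n => fst (p (p1 (p2 n))) *v v +v snd (p (p1 (p2 n)))).
        { intro n; symmetry; apply Hp. }
        apply lim_add; [|assumption]. apply lim_cscal. intros eps He. destruct (Hc eps He) as [N HN].
        exists N; intros n Hn. apply HN. pose proof (incr_ge Hp2 n); lia.
    + exists (Rmax D (C * (1 + D * nm v))). pose proof (nm_ge0 v). split.
      { eapply Rlt_le_trans; [apply HD|apply Rmax_l]. }
      intros x Hx. destruct (Hb x Hx) as [c [y [Hy [E Hc]]]]. destruct (IH2 y Hy) as [cs [Hl [Ecs Hcs]]].
      exists (c :: cs); simpl; split; [now rewrite Hl|split; [now rewrite <- Ecs|]].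
      pose proof (nm_ge0 x). intros d [<-|Hd].
      * eapply Rle_trans; [apply Hc|]. apply Rmult_le_compat_r; [assumption|apply Rmax_l].
      * eapply Rle_trans; [apply Hcs; assumption|]. apply Rle_trans with (C * (1 + D * nm v) * nm x).
        2:{ apply Rmult_le_compat_r; [assumption|apply Rmax_r]. }
        rewrite Rmult_assoc. apply Rmult_le_compat_l; [lra|].
        replace y with (x -v c *v v) by (rewrite E; vec). eapply Rle_trans; [apply nm_sub|].
        rewrite vnorm_scal. nra.
Qed.
Lemma span_closed l : closed (span l).
Proof.
  intros u y Hu Hy. destruct (proj1 (span_analytic l) u Hu (lim_bounded Hy)) as [phi [y' [Hp [Hs Hl]]]].
  now rewrite (lim_unique (lim_sub Hy Hp) Hl).
Qed.
Lemma lcomb_span l : forall cs, span l (lcomb cs l).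
Proof.
  induction l as [|v l IH]; intros [|c cs]; simpl; try reflexivity.
  - exists C0, (vzero X); split; [apply (subsp_0 (span_subsp l))|vec].
  - exists c, (lcomb cs l); split; [apply IH|reflexivity].
Qed.

Lemma span_perturb l : exists eta, 0 < eta /\ forall l', Forall2 (fun b b' => nm (b -v b') < eta) l l' ->
  forall x, span l x -> exists x', span l' x' /\ nm (x -v x') <= nm x / 2.
Proof.
  destruct (proj2 (span_analytic l)) as [C [HC H]].
  (* The coefficients are at most [C] times the norm of [x], so moving each of the vectors by this
     much costs at most half of that norm. The added 1 keeps the quotient meaningful for the empty
     list. *)
  exists (/ (2 * C * (INR (length l) + 1))).
  assert (Hk : 0 < 2 * C * (INR (length l) + 1)) by (pose proof (pos_INR (length l)); nra).
  split; [now apply Rinv_0_lt_compat|]. intros l' Hl' x Hx.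
  destruct (H x Hx) as [cs [Hlen [E Hcs]]]. exists (lcomb cs l'); split; [apply lcomb_span|].
  assert (Hg : forall m ms m' eta, Forall2 (fun b b' => nm (b -v b') < eta) m m' ->
     (forall c, In c ms -> Cabs c <= C * nm x) -> nm (lcomb ms m -v lcomb ms m') <= INR (length m) * (C * nm x * eta)).
  { clear - HC. intros m ms m' eta Hm. revert ms. induction Hm as [|b b' m m' Hb Hm IH]; intros ms Hms; simpl length.
    - destruct ms; simpl; rewrite vadd_oppr, nm_0; lra.
    - assert (0 <= C * nm x * eta).
      { pose proof (nm_ge0 x); pose proof (nm_ge0 (b -v b')). apply Rmult_le_pos; [apply Rmult_le_pos|]; lra. }
      destruct ms as [|c ms]; simpl lcomb.
      + rewrite vadd_oppr, nm_0. pose proof (pos_INR (S (length m))). nra.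
      + rewrite S_INR.
        replace (c *v b +v lcomb ms m -v (c *v b' +v lcomb ms m'))
          with (c *v (b -v b') +v (lcomb ms m -v lcomb ms m')) by vec.
        eapply Rle_trans; [apply nm_add|]. rewrite vnorm_scal.
        assert (nm (lcomb ms m -v lcomb ms m') <= INR (length m) * (C * nm x * eta)) by (apply IH; intros; apply Hms; now right).
        assert (Cabs c * nm (b -v b') <= C * nm x * eta).
        { apply Rmult_le_compat; [apply Cabs_ge0|apply nm_ge0|apply Hms; now left|lra]. }
        lra. }
  rewrite E at 1. eapply Rle_trans; [apply Hg; eassumption|].
  pose proof (nm_ge0 x). pose proof (pos_INR (length l)).
  replace (INR (length l) * (C * nm x * / (2 * C * (INR (length l) + 1))))
    with (nm x * / 2 * (INR (length l) / (INR (length l) + 1))) by (field; lra).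
  assert (INR (length l) / (INR (length l) + 1) <= 1).
  { apply Rmult_le_reg_r with (INR (length l) + 1); [lra|]. unfold Rdiv; rewrite Rmult_assoc, Rinv_l; lra. }
  nra.
Qed.

(** Approximating the error again halves it each time; after two rounds the error is a quarter of
    that of the almost nearest point, which the factor 2 in [near_min] forbids. *)
Lemma half_dist_dense Z W : subsp W -> closed W -> (forall x, W x -> Z x) -> subsp Z ->
  (forall x, Z x -> exists x', W x' /\ nm (x -v x') <= nm x / 2) -> forall x, Z x -> W x.
Proof.
  intros HW Hc HWZ HZ H x Hx. apply NNPP; intro Hn.
  destruct (near_min x HW Hc) as [z [Hz Hmin]].
  assert (Hp : 0 < nm (x -v z)).
  { apply nm_pos; intro E. apply sub_eq0 in E; now subst. }
  assert (Hgo : forall n, exists w, W w /\ nm (x -v w) <= nm (x -v z) * (/2) ^ n).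
  { induction n as [|n [w [Hw Hnw]]].
    - exists z; split; [assumption|simpl; lra].
    - destruct (H (x -v w)) as [w' [Hw' Hn']]; [apply subsp_sub; auto|].
      exists (w +v w'); split; [now apply subsp_add|].
      replace (x -v (w +v w')) with (x -v w -v w') by vec. simpl; lra. }
  destruct (Hgo 2%nat) as [w [Hw Hnw]]. specialize (Hmin w Hw). simpl in Hnw; lra.
Qed.

Lemma span_compactness l (u : nat -> X) : (forall n, span l (u n)) -> (exists M, forall n, nm (u n) <= M) ->
     exists phi y, incr phi /\ span l y /\ lim (fun n => u (phi n)) y.
Proof. apply (proj1 (span_analytic l)). Qed.

(** Replaces a dimension count. If the chain first leaves the span of the tail at [j], through a
    vector [w], then every later member is spanned by [w] and its part in that span, so the
    induction hypothesis applies to the intersections with one index removed. *)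
Lemma chain_stops l : forall Z : nat -> X -> Prop, (forall i, subsp (Z i)) ->
  (forall i x, Z i x -> Z (S i) x) -> (forall i x, Z i x -> span l x) ->
  exists i, (i <= length l)%nat /\ forall x, Z (S i) x -> Z i x.
Proof.
  induction l as [|v l IH]; intros Z HZ Hinc Hsp.
  - exists O; split; [lia|]. intros x Hx. apply Hsp in Hx; simpl in Hx; subst. apply subsp_0, HZ.
  - destruct (classic (forall i x, Z i x -> span l x)) as [Hall|Hnot].
    { destruct (IH Z HZ Hinc Hall) as [i [Hi H]]. exists i; split; [simpl; lia|assumption]. }
    assert (Hex : exists i, exists x, Z i x /\ ~ span l x).
    { apply NNPP; intro Hn; apply Hnot; intros i x Hx. apply NNPP; intro. apply Hn; eauto. }
    assert (Hj : exists j, (exists x, Z j x /\ ~ span l x) /\ forall i, (i < j)%nat -> forall x, Z i x -> span l x).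
    { destruct Hex as [i0 Hi0]. revert Hi0.
      induction i0 as [i0 IHi] using (well_founded_ind Nat.lt_wf_0); intro Hi0.
      destruct (classic (exists i, (i < i0)%nat /\ exists x, Z i x /\ ~ span l x)) as [[i [Hi Hx]]|Hn].
      - now apply (IHi i).
      - exists i0; split; [assumption|]. intros i Hi x Hx. apply NNPP; intro. apply Hn; eauto. }
    destruct Hj as [j [[w [Hw Hwn]] Hmin]].
    assert (Hmono : forall a b, (a <= b)%nat -> forall x, Z a x -> Z b x).
    { intros a b Hab; induction Hab; auto. }
    assert (Hdec : forall i x, (j <= i)%nat -> Z i x -> exists c, Z i (x -v c *v w) /\ span l (x -v c *v w)).
    { intros i x Hji Hx. destruct (Hsp j w Hw) as [c [w' [Hw' Ew]]].
      destruct (Hsp i x Hx) as [d [x' [Hx' Ex]]].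
      assert (Hc : c <> C0). { intro; subst c. apply Hwn. rewrite Ew. replace (C0 *v v +v w') with w' by vec. assumption. }
      exists (Cdiv d c); split.
      - apply subsp_sub; auto. apply subsp_scal; auto. now apply (Hmono j i).
      - rewrite Ex, Ew. replace (d *v v +v x' -v Cdiv d c *v (c *v v +v w')) with (x' -v Cdiv d c *v w') by (vec_pre; field; assumption).
        apply subsp_sub; [apply span_subsp|assumption|]. apply subsp_scal; [apply span_subsp|assumption]. }
    (* The index [j] is skipped: at that place the chain may grow by [w] without growing inside the
       span of the tail. *)
    pose (Z' := fun i => let k := if Nat.ltb i j then i else S i in fun x => Z k x /\ span l x).
    destruct (IH Z') as [i [Hi Hst]].
    + intro i; unfold Z'; apply subsp_and; [apply HZ|apply span_subsp].
    + intros i x; unfold Z'. intros [H1 H2]; split; [|assumption].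
      destruct (Nat.ltb_spec i j), (Nat.ltb_spec (S i) j); try lia; auto.
    + intros i x [_ H]; exact H.
    + unfold Z' in Hst. destruct (Nat.ltb_spec i j) as [H1|H1], (Nat.ltb_spec (S i) j) as [H2|H2]; try lia.
      * exists i; split; [simpl; lia|]. intros x Hx. apply Hst. split; [assumption|]. now apply (Hmin (S i)).
      * assert (j = S i) by lia. exists (S i); split; [simpl; lia|]. intros x Hx.
        destruct (Hdec (S (S i)) x ltac:(lia) Hx) as [c [Hc1 Hc2]].
        replace x with ((x -v c *v w) +v c *v w) by vec. apply subsp_add; auto.
        -- apply Hinc. now apply Hst.
        -- apply subsp_scal; auto. now subst j.
      * exists (S i); split; [simpl; lia|]. intros x Hx.
        destruct (Hdec (S (S i)) x ltac:(lia) Hx) as [c [Hc1 Hc2]].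
        replace x with ((x -v c *v w) +v c *v w) by vec. apply subsp_add; auto.
        -- now apply Hst.
        -- apply subsp_scal; auto. apply (Hmono j); [lia|assumption].
Qed.

(** A descending chain read backwards from an index beyond the length of [l] is an ascending one. *)
Lemma chain_stops_down l : forall Z : nat -> X -> Prop, (forall i, subsp (Z i)) ->
  (forall i x, Z (S i) x -> Z i x) -> (forall x, Z O x -> span l x) ->
  exists i, forall x, Z i x -> Z (S i) x.
Proof.
  intros Z HZ Hdec H0. set (n := S (length l)).
  assert (Hs : forall i x, Z i x -> span l x).
  { intros i; induction i; auto. }
  destruct (@chain_stops l (fun i => Z (n - i)%nat)) as [i [Hi H]].
  - intro; apply HZ.
  - intros i x Hx. destruct (Nat.le_gt_cases (S i) n) as [Hle|Hgt].
    + apply Hdec. now replace (S (n - S i)) with (n - i)%nat by lia.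
    + replace (n - S i)%nat with (n - i)%nat by lia. assumption.
  - intros i; apply Hs.
  - exists (n - S i)%nat. intros x Hx. apply H in Hx. replace (S (n - S i)) with (n - i)%nat by (unfold n; lia). assumption.
Qed.

Definition strict_sub Z W : Prop := (forall x, Z x -> W x) /\ exists x, W x /\ ~ Z x.

(** Without a maximal member, choosing strictly larger members of [F] forever would give a chain
    contradicting [chain_stops]. *)
Lemma subsp_max_exists l (F : (X -> Prop) -> Prop) : (exists Z, F Z) ->
  (forall Z, F Z -> subsp Z /\ forall x, Z x -> span l x) ->
  exists Z, F Z /\ forall W, F W -> (forall x, Z x -> W x) -> forall x, W x -> Z x.
Proof.
  intros [Z0 HZ0] HF. apply NNPP; intro Hn.
  assert (H : forall Z : {Z | F Z}, exists W : {Z | F Z}, strict_sub (proj1_sig Z) (proj1_sig W)).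
  { intros [Z HZ]. apply NNPP; intro Hm. apply Hn. exists Z; split; [assumption|].
    intros W HW HZW x Hx. apply NNPP; intro. apply Hm. exists (exist _ W HW); simpl. split; [assumption|eauto]. }
  apply choice in H. destruct H as [f Hf].
  pose (s := fun n => Nat.iter n f (exist _ Z0 HZ0)).
  destruct (@chain_stops l (fun n => proj1_sig (s n))) as [i [_ Hi]].
  - intro i; apply (HF _ (proj2_sig (s i))).
  - intros i. apply (Hf (s i)).
  - intro i; apply (HF _ (proj2_sig (s i))).
  - destruct (Hf (s i)) as [_ [x [Hx Hx']]]. apply Hx', Hi, Hx.
Qed.
Lemma subsp_min_exists l (F : (X -> Prop) -> Prop) : (exists Z, F Z) ->
  (forall Z, F Z -> subsp Z /\ forall x, Z x -> span l x) ->
  exists Z, F Z /\ forall W, F W -> (forall x, W x -> Z x) -> forall x, Z x -> W x.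
Proof.
  intros [Z0 HZ0] HF. apply NNPP; intro Hn.
  assert (H : forall Z : {Z | F Z}, exists W : {Z | F Z}, strict_sub (proj1_sig W) (proj1_sig Z)).
  { intros [Z HZ]. apply NNPP; intro Hm. apply Hn. exists Z; split; [assumption|].
    intros W HW HZW x Hx. apply NNPP; intro. apply Hm. exists (exist _ W HW); simpl. split; [assumption|eauto]. }
  apply choice in H. destruct H as [f Hf].
  pose (s := fun n => Nat.iter n f (exist _ Z0 HZ0)).
  destruct (@chain_stops_down l (fun n => proj1_sig (s n))) as [i Hi].
  - intro i; apply (HF _ (proj2_sig (s i))).
  - intros i. apply (Hf (s i)).
  - apply (HF _ (proj2_sig (s O))).
  - destruct (Hf (s i)) as [_ [x [Hx Hx']]]. apply Hx', Hi, Hx.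
Qed.

(** A maximal span of finitely many vectors of [Z] is all of [Z], since any further vector could be
    adjoined. *)
Lemma subsp_span l Z : subsp Z -> (forall x, Z x -> span l x) -> exists l', forall x, Z x <-> span l' x.
Proof.
  intros HZ Hl.
  destruct (@subsp_max_exists l (fun W => exists l', (forall v, In v l' -> Z v) /\ W = span l')) as [W [[l' [Hl' ->]] Hmax]].
  - exists (span nil), nil; split; [intros v []|reflexivity].
  - intros W [l' [Hl' ->]]; split; [apply span_subsp|]. intros x Hx; apply Hl. eapply span_least; eauto.
  - exists l'; intro x; split; [|now apply span_least]. intro Hx.
    apply (Hmax (span (x :: l'))).
    + exists (x :: l'); split; [|reflexivity]. intros v [<-|Hv]; auto.
    + intros y Hy. apply span_incl with l'; [intros a Ha; now right|assumption].
    + apply span_in; now left.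
Qed.
Lemma subsp_span_closed l Z : subsp Z -> (forall x, Z x -> span l x) -> closed Z.
Proof.
  intros HZ Hl. destruct (subsp_span HZ Hl) as [l' H]. intros u y Hu Hy. apply H.
  eapply span_closed; [|eassumption]. intro; now apply H.
Qed.

(** Algebraic span of an arbitrary set, in contrast to [span] of a list; it need be neither closed
    nor finite-dimensional. *)
Inductive lspan (P : X -> Prop) : X -> Prop :=
| lspan0 : lspan P (vzero X)
| lspanS c x y : P x -> lspan P y -> lspan P (c *v x +v y).
Lemma lspan_in (P : X -> Prop) x : P x -> lspan P x.
Proof. intro. replace x with (Cone *v x +v vzero X) by vec. now constructor; [|constructor]. Qed.
Lemma lspan_add (P : X -> Prop) x y : lspan P x -> lspan P y -> lspan P (x +v y).
Proof.
  intros Hx Hy; induction Hx as [|c x x' Hx Hx' IH].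
  - now rewrite vadd_0.
  - rewrite <- vadd_assoc. now constructor.
Qed.
Lemma lspan_subsp (P : X -> Prop) : subsp (lspan P).
Proof.
  split; [constructor|split; [intros; now apply lspan_add|]].
  intros c x Hx; induction Hx as [|d x x' Hx Hx' IH].
  - rewrite vscal_v0; constructor.
  - rewrite vscal_addv, <- vscal_mul. now constructor.
Qed.
Lemma lspan_least (P Z : X -> Prop) x : subsp Z -> (forall x, P x -> Z x) -> lspan P x -> Z x.
Proof.
  intros HZ H Hx; induction Hx; [now apply subsp_0|].
  apply subsp_add; auto. apply subsp_scal; auto.
Qed.
Lemma lspan_mono (P Q : X -> Prop) x : (forall x, P x -> Q x) -> lspan P x -> lspan Q x.
Proof. intros H. apply lspan_least; [apply lspan_subsp|]. intros; apply lspan_in; auto. Qed.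
End Span.

Definition finrank {X : CBanach} (T : op X) : Prop := lb T /\ exists l, forall x, span l (T x).

(** * Riesz theory of compact operators *)

Section Compact.
Variable X : CBanach.
Implicit Types (x y : X) (K T A B : op X) (u : nat -> X).

Lemma compact_intro T : linear T ->
  (forall u, (exists M, forall n, nm (u n) <= M) -> exists phi y, incr phi /\ lim (fun n => T (u (phi n))) y) ->
  compact_op T.
Proof. intros H1 H2; split; [assumption|]. intros u Hu. destruct (H2 u Hu) as [phi [y [Hp Hl]]]. exists phi, y; split; assumption. Qed.
Lemma compact_subseq T u : compact_op T -> (exists M, forall n, nm (u n) <= M) ->
  exists phi y, incr phi /\ lim (fun n => T (u (phi n))) y.
Proof. intros [_ H] Hu. destruct (H u Hu) as [phi [y [Hp Hl]]]. exists phi, y; split; assumption. Qed.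
Lemma compact_lin T : compact_op T -> linear T. Proof. now intros [? _]. Qed.
(** Otherwise there are vectors of norm at most 1 whose images have norms at least [n], and no
    subsequence of the images is bounded. *)
Lemma compact_lb T : compact_op T -> lb T.
Proof.
  intro H; split; [apply H|]. apply NNPP; intro Hn.
  assert (H1 : forall n : nat, exists x, nm x <= 1 /\ INR n <= nm (T x)).
  { intro n. apply NNPP; intro Hm. apply Hn. exists (INR n). intro x.
    destruct (classic (x = vzero X)) as [->|Hx]; [rewrite lin_0, nm_0 by apply H; lra|].
    pose proof (nm_pos Hx). apply Rnot_lt_le; intro Hlt. apply Hm.
    assert (0 <= / nm x) by (left; now apply Rinv_0_lt_compat).
    exists (RtoC (/ nm x) *v x). rewrite lin_scal, !nm_Rscal by (try apply H; assumption).
    split; [rewrite Rinv_l; lra|]. apply Rmult_le_reg_l with (nm x); [assumption|].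
    replace (nm x * (/ nm x * nm (T x))) with (nm (T x)) by (field; lra). lra. }
  apply choice in H1. destruct H1 as [u Hu].
  destruct (compact_subseq (u := u) H) as [phi [y [Hp Hl]]]; [exists 1; apply Hu|].
  destruct (lim_bounded Hl) as [M HM]. destruct (INR_archimed 1 (M + 1)) as [N HN]; [lra|].
  specialize (HM N). destruct (Hu (phi N)) as [_ H2]. pose proof (le_INR _ _ (incr_ge Hp N)). lra.
Qed.
Lemma bounded_lb A u : lb A -> (exists M, forall n, nm (u n) <= M) -> exists M, forall n, nm (A (u n)) <= M.
Proof.
  intros HA [M HM]. destruct (lb_bound HA) as [C [HC H]]. exists (C * M); intro n.
  eapply Rle_trans; [apply H|]. apply Rmult_le_compat_l; [lra|apply HM].
Qed.
Lemma compact_comp_l A K : lb A -> compact_op K -> compact_op (opcomp A K).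
Proof.
  intros HA HK. apply compact_intro; [apply lin_opcomp; [apply HA|apply HK]|]. intros u Hu.
  destruct (compact_subseq HK Hu) as [phi [y [Hp Hl]]]. exists phi, (A y); split; [assumption|].
  now apply (lb_lim HA) in Hl.
Qed.
Lemma compact_comp_r A K : lb A -> compact_op K -> compact_op (opcomp K A).
Proof.
  intros HA HK. apply compact_intro; [apply lin_opcomp; [apply HK|apply HA]|]. intros u Hu.
  apply (compact_subseq HK (bounded_lb HA Hu)).
Qed.
Lemma compact_add K1 K2 : compact_op K1 -> compact_op K2 -> compact_op (opadd K1 K2).
Proof.
  intros H1 H2. apply compact_intro; [apply lin_opadd; [apply H1|apply H2]|]. intros u Hu.
  destruct (compact_subseq H1 Hu) as [p1 [y1 [Hp1 Hl1]]].
  destruct (@compact_subseq K2 (fun n => u (p1 n)) H2) as [p2 [y2 [Hp2 Hl2]]].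
  { destruct Hu as [M HM]; exists M; intro; apply HM. }
  exists (fun n => p1 (p2 n)), (y1 +v y2); split; [now apply incr_comp|].
  unfold opadd. apply lim_add; [apply (lim_sub Hl1 Hp2)|assumption].
Qed.
Lemma compact_scal c K : compact_op K -> compact_op (opscal c K).
Proof.
  intros H. apply compact_intro; [apply lin_opscal, H|]. intros u Hu.
  destruct (compact_subseq H Hu) as [p [y [Hp Hl]]]. exists p, (c *v y); split; [assumption|]. now apply lim_scal.
Qed.
Lemma compact_zero : compact_op (@opzero X).
Proof.
  apply compact_intro; [apply lin_opzero|]. intros u _. exists (fun n => n), (vzero X).
  split; [apply incr_id|exact (lim_const (vzero X))].
Qed.
Lemma compact_sub K1 K2 : compact_op K1 -> compact_op K2 -> compact_op (opsub K1 K2).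
Proof.
  intros H1 H2. replace (opsub K1 K2) with (opadd K1 (opscal (Copp Cone) K2)).
  - apply compact_add; [assumption|now apply compact_scal].
  - apply functional_extensionality; intro x; unfold opsub, opadd, opscal; vec.
Qed.
Lemma compact_finrank T : finrank T -> compact_op T.
Proof.
  intros [HT [l Hl]]. apply compact_intro; [apply HT|]. intros u Hu.
  destruct (@span_compactness X l (fun n => T (u n))) as [phi [y [Hp [_ Hy]]]].
  - intro; apply Hl.
  - now apply bounded_lb.
  - exists phi, y; split; assumption.
Qed.

Lemma no_separated K u delta : compact_op K -> (exists M, forall n, nm (u n) <= M) -> 0 < delta ->
  (forall m n, (m < n)%nat -> delta <= nm (K (u n) -v K (u m))) -> False.
Proof.
  intros HK Hu Hd H. destruct (compact_subseq HK Hu) as [phi [y [Hp Hl]]].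
  destruct (Hl (delta / 2)) as [N HN]; [lra|].
  pose proof (HN N (le_n _)). pose proof (HN (S N) (le_S _ _ (le_n _))).
  specialize (H _ _ (Hp N)). pose proof (nm_tri (K (u (phi (S N)))) y (K (u (phi N)))).
  rewrite (nm_swap y (K (u (phi N)))) in *. lra.
Qed.

(** Riesz's lemma with the constant 1/2, obtained by normalising the difference of [x] and an almost
    nearest point. *)
Lemma riesz_unit (Z W : X -> Prop) : subsp Z -> closed Z -> subsp W -> strict_sub Z W ->
  exists x, W x /\ nm x = 1 /\ forall z, Z z -> /2 <= nm (x -v z).
Proof.
  intros HZ Hc HW [Hs [x [Hx Hnx]]]. destruct (near_min x HZ Hc) as [z [Hz Hmin]].
  assert (Hp : 0 < nm (x -v z)). { apply nm_pos; intro E; apply sub_eq0 in E; now subst. }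
  assert (Hi : 0 < / nm (x -v z)) by now apply Rinv_0_lt_compat.
  exists (RtoC (/ nm (x -v z)) *v (x -v z)); split; [|split].
  - apply subsp_scal; [assumption|]. apply subsp_sub; auto.
  - rewrite nm_Rscal by lra. rewrite Rinv_l; lra.
  - intros z' Hz'.
    assert (Hr : RtoC (nm (x -v z)) <> C0) by (apply RtoC_neq0; lra).
    replace (RtoC (/ nm (x -v z)) *v (x -v z) -v z') with (RtoC (/ nm (x -v z)) *v (x -v (z +v RtoC (nm (x -v z)) *v z'))).
    2:{ replace (RtoC (/ nm (x -v z))) with (Cinv (RtoC (nm (x -v z)))); [vec_pre; field; assumption|].
        apply Cpx_eq; simpl; unfold Csq; simpl; field; lra. }
    rewrite nm_Rscal by lra.
    specialize (Hmin (z +v RtoC (nm (x -v z)) *v z') ltac:(apply subsp_add; auto; now apply subsp_scal)).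
    apply Rmult_le_reg_l with (nm (x -v z)); [assumption|].
    rewrite <- Rmult_assoc, Rinv_r by lra. lra.
Qed.

(** Riesz's argument: with unit vectors [u n] in [Z (S n)] away from [Z n], the difference of
    [K (u n)] and [K (u m)] is [zeta n] times [u n] minus an element of [Z n], so the images are
    separated. The scalar may vary with [n], which serves chains built from different
    eigenvalues. *)
Lemma chain_up K (Z : nat -> X -> Prop) (zeta : nat -> Cpx) delta : compact_op K -> 0 < delta ->
  (forall n, subsp (Z n)) -> (forall n, closed (Z n)) -> (forall n, strict_sub (Z n) (Z (S n))) ->
  (forall n x, Z n x -> Z n (K x)) -> (forall n, delta <= Cabs (zeta n)) ->
  (forall n x, Z (S n) x -> Z n (K x -v zeta n *v x)) -> False.
Proof.
  intros HK Hd HZ Hc Hs HKZ Hz HD.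
  assert (H : forall n, exists x, Z (S n) x /\ nm x = 1 /\ forall z, Z n z -> /2 <= nm (x -v z)).
  { intro n; apply riesz_unit; auto. }
  apply choice in H. destruct H as [u Hu].
  assert (Hmono : forall a b, (a <= b)%nat -> forall x, Z a x -> Z b x).
  { intros a b Hab; induction Hab; auto. intros x Hx. apply Hs; auto. }
  apply (@no_separated K u (delta * /2) HK).
  - exists 1; intro n. destruct (Hu n) as [_ [-> _]]; lra.
  - lra.
  - intros m n Hmn. destruct (Hu n) as [H1 [_ H3]]. destruct (Hu m) as [H4 _].
    pose proof (Hz n) as Hzn.
    assert (Hz0 : zeta n <> C0) by (apply Cabs_neq0; lra).
    replace (K (u n) -v K (u m)) with (zeta n *v (u n -v (Cinv (zeta n) *v (K (u m) -v (K (u n) -v zeta n *v u n)))))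
      by (vec_pre; field; assumption).
    rewrite vnorm_scal. apply Rmult_le_compat; try lra. apply H3.
    apply subsp_scal; auto. apply subsp_sub; auto. apply HKZ. now apply (Hmono (S m) n).
Qed.
Lemma chain_down K (Z : nat -> X -> Prop) (zeta : nat -> Cpx) delta : compact_op K -> 0 < delta ->
  (forall n, subsp (Z n)) -> (forall n, closed (Z n)) -> (forall n, strict_sub (Z (S n)) (Z n)) ->
  (forall n x, Z n x -> Z n (K x)) -> (forall n, delta <= Cabs (zeta n)) ->
  (forall n x, Z n x -> Z (S n) (K x -v zeta n *v x)) -> False.
Proof.
  intros HK Hd HZ Hc Hs HKZ Hz HD.
  assert (H : forall n, exists x, Z n x /\ nm x = 1 /\ forall z, Z (S n) z -> /2 <= nm (x -v z)).
  { intro n; apply riesz_unit; auto. }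
  apply choice in H. destruct H as [u Hu].
  assert (Hmono : forall a b, (a <= b)%nat -> forall x, Z b x -> Z a x).
  { intros a b Hab; induction Hab; auto. intros x Hx. apply IHHab, Hs, Hx. }
  apply (@no_separated K u (delta * /2) HK).
  - exists 1; intro n. destruct (Hu n) as [_ [-> _]]; lra.
  - lra.
  - intros m n Hmn. destruct (Hu m) as [H1 [_ H3]]. destruct (Hu n) as [H4 _].
    pose proof (Hz m) as Hzn.
    assert (Hz0 : zeta m <> C0) by (apply Cabs_neq0; lra).
    rewrite nm_swap.
    replace (K (u m) -v K (u n)) with (zeta m *v (u m -v (Cinv (zeta m) *v (K (u n) -v (K (u m) -v zeta m *v u m)))))
      by (vec_pre; field; assumption).
    rewrite vnorm_scal. apply Rmult_le_compat; try lra. apply H3.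
    apply subsp_scal; auto. apply subsp_sub; auto. apply HKZ. now apply (Hmono (S m) n).
Qed.

Definition Dop K (a : Cpx) : op X := fun x => K x -v a *v x.
Lemma lin_Dop K a : linear K -> linear (Dop K a).
Proof. intro H; split; intros; unfold Dop; rewrite ?(lin_add _ _ H), ?(lin_scal _ _ H); vec. Qed.
Lemma lb_Dop K a : lb K -> lb (Dop K a).
Proof.
  intro H. replace (Dop K a) with (opsub K (opscal a opid)) by reflexivity.
  apply lb_opsub; [assumption|]. apply lb_opscal, lb_opid.
Qed.
Lemma iter_comm T A n x : (forall x, A (T x) = T (A x)) -> A (Nat.iter n T x) = Nat.iter n T (A x).
Proof. intro H; induction n; simpl; [reflexivity|]. now rewrite H, IHn. Qed.
Lemma Dop_comm K A a : linear A -> (forall x, A (K x) = K (A x)) -> forall x, A (Dop K a x) = Dop K a (A x).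
Proof. intros HA H x. unfold Dop. now rewrite lin_sub, lin_scal, H. Qed.
Lemma K_Dop K a x : linear K -> K (Dop K a x) = Dop K a (K x).
Proof. intros H; apply Dop_comm; auto. Qed.

(** Powers of [K - a] are again a compact operator minus a nonzero scalar, so closedness of the
    range and lower bounds carry over to them. *)
Lemma Dop_pow_form K a n : compact_op K -> a <> C0 ->
  exists K' g, compact_op K' /\ g <> C0 /\ forall x, Nat.iter n (Dop K a) x = Dop K' g x.
Proof.
  intros HK Ha. induction n as [|n [K' [g [HK' [Hg IH]]]]].
  - exists (@opzero X), (Copp Cone). split; [apply compact_zero|split; [apply Copp_neq0, Cone_neq0|]].
    intro x; unfold Dop, opzero; simpl; vec.
  - exists (opsub (opcomp K K') (opadd (opscal g K) (opscal a K'))), (Copp (Cmul a g)).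
    split; [|split].
    + apply compact_sub; [apply compact_comp_l; [now apply compact_lb|assumption]|].
      apply compact_add; now apply compact_scal.
    + now apply Copp_neq0, Cmul_neq0.
    + intro x; simpl. rewrite IH. unfold Dop, opsub, opcomp, opadd, opscal.
      rewrite lin_sub, lin_scal by apply HK. vec.
Qed.

Lemma ker_subsp T : linear T -> subsp (fun x => T x = vzero X).
Proof.
  intro H; split; [now apply lin_0|split].
  - intros x y Hx Hy. rewrite lin_add, Hx, Hy by assumption; vec.
  - intros c x Hx. rewrite lin_scal, Hx by assumption; vec.
Qed.
Lemma ker_closed T : lb T -> closed (fun x => T x = vzero X).
Proof.
  intros H u l Hu Hl. apply (lb_lim H) in Hl. eapply lim_unique; [eassumption|].
  apply lim_ext with (fun _ => vzero X); [intro; now rewrite Hu|apply lim_const].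
Qed.
Lemma range_subsp T : linear T -> subsp (fun y => exists x, y = T x).
Proof.
  intro H; split; [exists (vzero X); now rewrite lin_0|split].
  - intros x y [x' ->] [y' ->]. exists (x' +v y'); now rewrite lin_add.
  - intros c x [x' ->]. exists (c *v x'); now rewrite lin_scal.
Qed.

(** [a u n] is the difference of [K (u n)], which converges along a subsequence by compactness, and
    of [Dop K a (u n)], which converges by hypothesis. *)
Lemma approx_eigen_conv K a u : compact_op K -> a <> C0 -> (exists M, forall n, nm (u n) <= M) ->
  forall y, lim (fun n => Dop K a (u n)) y -> exists phi x, incr phi /\ lim (fun n => u (phi n)) x /\ Dop K a x = y.
Proof.
  intros HK Ha Hu y Hy. destruct (compact_subseq HK Hu) as [phi [w [Hp Hw]]].
  assert (Hx : lim (fun n => u (phi n)) (Cinv a *v (w -v y))).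
  { apply lim_ext with (fun n => Cinv a *v (K (u (phi n)) -v Dop K a (u (phi n)))).
    - intro n; unfold Dop. vec_pre; field; assumption.
    - apply lim_scal, lim_minus; [assumption|]. apply (lim_sub Hy Hp). }
  exists phi, (Cinv a *v (w -v y)); split; [assumption|split; [assumption|]].
  apply (lb_lim (lb_Dop a (compact_lb HK))) in Hx. eapply lim_unique; [eassumption|]. apply (lim_sub Hy Hp).
Qed.

(** Preimages are taken almost minimal modulo the kernel. Were they unbounded, a subsequence of
    their normalisations would converge to a kernel vector, and subtracting a multiple of that
    vector would shorten some preimage too much. *)
Lemma range_Dop_closed K a : compact_op K -> a <> C0 -> closed (fun y => exists x, y = Dop K a x).
Proof.
  intros HK Ha v y Hv Hy. pose proof (lb_Dop a (compact_lb HK)) as HD.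
  pose proof (ker_subsp (lb_lin HD)) as Hks. pose proof (ker_closed HD) as Hkc.
  assert (H : forall n, exists x, v n = Dop K a x /\ forall z, Dop K a z = vzero X -> nm x <= 2 * nm (x -v z)).
  { intro n. destruct (Hv n) as [x Hx]. destruct (near_min x Hks Hkc) as [z [Hz Hm]].
    exists (x -v z); split; [now rewrite lin_sub, Hz, Hx by apply HD; vec|].
    intros z' Hz'. replace (x -v z -v z') with (x -v (z +v z')) by vec. apply Hm.
    rewrite lin_add, Hz, Hz' by apply HD; vec. }
  apply choice in H. destruct H as [u Hu].
  destruct (classic (exists M, forall n, nm (u n) <= M)) as [Hb|Hb].
  - destruct (@approx_eigen_conv K a u HK Ha Hb y) as [phi [x [_ [_ E]]]]; [|now exists x].
    apply lim_ext with v; [apply Hu|assumption].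
  - exfalso.
    assert (H : forall k N, exists n, (N <= n)%nat /\ INR k + 1 <= nm (u n)).
    { intros k N. apply NNPP; intro Hn. apply Hb.
      assert (Hf : exists M, forall n, (n < N)%nat -> nm (u n) <= M).
      { clear. induction N as [|N [M HM]]; [exists 0; intros; lia|].
        exists (Rmax M (nm (u N))); intros n Hn. destruct (Nat.eq_dec n N) as [->|]; [apply Rmax_r|].
        eapply Rle_trans; [apply HM; lia|apply Rmax_l]. }
      destruct Hf as [M HM]. exists (Rmax M (INR k + 1)); intro n. destruct (Nat.lt_ge_cases n N).
      - eapply Rle_trans; [apply HM; assumption|apply Rmax_l].
      - eapply Rle_trans; [|apply Rmax_r]. apply Rnot_lt_le; intro. apply Hn; exists n; split; [assumption|lra]. }
    destruct (subseq_choice H) as [phi [Hp Hphi]].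
    destruct (lim_bounded Hy) as [M HM].
    pose (w := fun n => RtoC (/ nm (u (phi n))) *v u (phi n)).
    assert (Hpos : forall n, 0 < nm (u (phi n))) by (intro n; specialize (Hphi n); pose proof (pos_INR n); lra).
    assert (Hw1 : forall n, nm (w n) = 1).
    { intro n; unfold w. specialize (Hpos n). rewrite nm_Rscal by (left; now apply Rinv_0_lt_compat). field; lra. }
    destruct (@approx_eigen_conv K a w HK Ha) with (y := vzero X) as [psi [x [Hps [Hx E]]]].
    + exists 1; intro n; rewrite Hw1; lra.
    + apply lim_small with (fun n => M * / (INR n + 1)).
      * intro n. unfold w. replace (Dop K a (RtoC (/ nm (u (phi n))) *v u (phi n)) -v vzero X) with (RtoC (/ nm (u (phi n))) *v v (phi n)).
        2:{ rewrite lin_scal by apply HD. destruct (Hu (phi n)) as [<- _]. vec. }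
        specialize (Hpos n). specialize (Hphi n). pose proof (pos_INR n).
        rewrite nm_Rscal by (left; now apply Rinv_0_lt_compat).
        rewrite Rmult_comm. apply Rmult_le_compat; [apply nm_ge0|left; now apply Rinv_0_lt_compat|apply HM|].
        apply Rinv_le_contravar; lra.
      * intros eps He. assert (HM0 : 0 <= M) by (eapply Rle_trans; [apply nm_ge0|apply (HM O)]).
        destruct (@inv_small (eps / (M + 1))) as [N HN]; [apply Rdiv_lt_0_compat; lra|].
        exists N; intros n Hn. specialize (HN n Hn).
        assert (eps / (M + 1) * (M + 1) = eps) by (field; lra).
        assert (0 < / (INR n + 1)) by (apply Rinv_0_lt_compat; pose proof (pos_INR n); lra). nra.
    + destruct (Hx (/ 4)) as [N HN]; [lra|]. specialize (HN N (le_n _)).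
      unfold w in HN. specialize (Hpos (psi N)). destruct (Hu (phi (psi N))) as [_ Hmin].
      specialize (Hmin (RtoC (nm (u (phi (psi N)))) *v x)). rewrite lin_scal, E, vscal_v0 in Hmin by apply HD.
      specialize (Hmin eq_refl).
      replace (u (phi (psi N)) -v RtoC (nm (u (phi (psi N)))) *v x)
        with (RtoC (nm (u (phi (psi N)))) *v (RtoC (/ nm (u (phi (psi N)))) *v u (phi (psi N)) -v x)) in Hmin.
      2:{ assert (RtoC (nm (u (phi (psi N)))) <> C0) by (apply RtoC_neq0; lra).
          replace (RtoC (/ nm (u (phi (psi N))))) with (Cinv (RtoC (nm (u (phi (psi N)))))); [vec_pre; field; assumption|].
          apply Cpx_eq; simpl; unfold Csq; simpl; field; lra. }
      rewrite nm_Rscal in Hmin by lra. nra.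
Qed.

Definition Cclosed (Om : Cpx -> Prop) : Prop := forall (z : nat -> Cpx) l, (forall n, Om (z n)) ->
  (forall eps, 0 < eps -> exists N, forall n, (N <= n)%nat -> Cabs (Csub (z n) l) < eps) -> Om l.

(* The bound is uniform in the spectral parameter; [Om = {a}] gives the usual statement. *)
Lemma lower_bound_unif K (Z : X -> Prop) (Om : Cpx -> Prop) M : compact_op K -> subsp Z -> closed Z ->
  Cclosed Om -> (forall z, Om z -> Cabs z <= M) -> ~ Om C0 ->
  (forall z x, Om z -> Z x -> K x = z *v x -> x = vzero X) ->
  exists c, 0 < c /\ forall z x, Om z -> Z x -> c * nm x <= nm (Dop K z x).
Proof.
  intros HK HZ Hc HOc HM H0 Hinj. apply NNPP; intro Hn.
  assert (H : forall n, exists p : Cpx * X, Om (fst p) /\ Z (snd p) /\ nm (snd p) = 1 /\ nm (Dop K (fst p) (snd p)) < / (INR n + 1)).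
  { intro n. apply NNPP; intro Hm. apply Hn. exists (/ (INR n + 1)).
    assert (Hpos : 0 < / (INR n + 1)) by (apply Rinv_0_lt_compat; pose proof (pos_INR n); lra).
    split; [assumption|]. intros z x Hz Hx. apply Rnot_lt_le; intro Hlt.
    assert (Hx0 : 0 < nm x). { pose proof (nm_ge0 x); pose proof (nm_ge0 (Dop K z x)). nra. }
    apply Hm. exists (z, RtoC (/ nm x) *v x); simpl.
    assert (0 < / nm x) by now apply Rinv_0_lt_compat.
    split; [assumption|split; [now apply subsp_scal|split]].
    - rewrite nm_Rscal by lra. field; lra.
    - rewrite lin_scal, nm_Rscal by (try apply lin_Dop, HK; lra).
      apply Rmult_lt_reg_l with (nm x); [assumption|]. rewrite <- Rmult_assoc, Rinv_r, Rmult_1_l by lra. lra. }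
  apply choice in H. destruct H as [p Hp].
  destruct (@Cpx_subseq (fun n => fst (p n)) M) as [phi [z [Hphi Hz]]].
  { intro n; apply HM, Hp. }
  assert (HOz : Om z) by (apply (HOc (fun n => fst (p (phi n)))); [intro; apply Hp|assumption]).
  assert (Hz0 : z <> C0) by (intro; now subst z).
  destruct (@approx_eigen_conv K z (fun n => snd (p (phi n))) HK Hz0) with (y := vzero X) as [psi [x [Hps [Hx E]]]].
  - exists 1; intro n. destruct (Hp (phi n)) as [_ [_ [-> _]]]; lra.
  - intros eps He. destruct (@inv_small (eps / 2)) as [N1 HN1]; [lra|].
    destruct (Hz (eps / 2)) as [N2 HN2]; [lra|]. exists (max N1 N2); intros n Hnn.
    specialize (HN2 n ltac:(lia)). pose proof (incr_ge Hphi n). specialize (HN1 (phi n) ltac:(lia)).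
    destruct (Hp (phi n)) as [_ [_ [H1 H2]]].
    replace (Dop K z (snd (p (phi n))) -v vzero X)
      with (Dop K (fst (p (phi n))) (snd (p (phi n))) +v Csub (fst (p (phi n))) z *v snd (p (phi n))) by (unfold Dop; vec).
    eapply Rle_lt_trans; [apply nm_add|]. rewrite vnorm_scal, H1. lra.
  - assert (Hx0 : x = vzero X).
    { apply (Hinj z); [assumption|apply (Hc _ _ (fun n => proj1 (proj2 (Hp (phi (psi n))))) Hx)|]. now apply sub_eq0. }
    subst x. assert (1 <= nm (vzero X)); [|rewrite nm_0 in *; lra].
    apply (lim_norm_ge Hx). exists O; intros n _. destruct (Hp (phi (psi n))) as [_ [_ [-> _]]]; lra.
Qed.

Lemma Cclosed_single a : Cclosed (fun z => z = a).
Proof.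
  intros z l Hz Hl. apply NNPP; intro Hn.
  pose proof (Cabs_pos (Csub_neq0 Hn)) as Hp. destruct (Hl (Cabs (Csub l a))) as [N HN]; [assumption|].
  specialize (HN N (le_n _)). rewrite Hz in HN.
  replace (Csub a l) with (Copp (Csub l a)) in HN by ring. rewrite Cabs_opp in HN. lra.
Qed.
Lemma lower_bound K (Z : X -> Prop) a : compact_op K -> subsp Z -> closed Z -> a <> C0 ->
  (forall x, Z x -> Dop K a x = vzero X -> x = vzero X) ->
  exists c, 0 < c /\ forall x, Z x -> c * nm x <= nm (Dop K a x).
Proof.
  intros HK HZ Hc Ha Hinj.
  destruct (@lower_bound_unif K Z (fun z => z = a) (Cabs a) HK HZ Hc) as [c [Hc0 H]].
  - apply Cclosed_single.
  - intros z ->; lra.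
  - congruence.
  - intros z x -> Hx E. apply Hinj; [assumption|]. unfold Dop; rewrite E; vec.
  - exists c; split; [assumption|]. intros x Hx; now apply H.
Qed.

Lemma inverse_exists T c : linear T -> 0 < c -> (forall x, c * nm x <= nm (T x)) -> (forall y, exists x, T x = y) ->
  exists R, lb R /\ (forall x, R (T x) = x) /\ (forall y, T (R y) = y) /\ (forall y, nm (R y) <= / c * nm y).
Proof.
  intros HT Hc Hb Hs. apply choice in Hs. destruct Hs as [R HR].
  assert (Hinj : forall x y, T x = T y -> x = y).
  { intros x y E. apply sub_eq0, nm_le0. specialize (Hb (x -v y)). rewrite lin_sub, E, vadd_oppr, nm_0 in Hb by assumption. nra. }
  assert (HRb : forall y, nm (R y) <= / c * nm y).
  { intro y. specialize (Hb (R y)). rewrite HR in Hb. apply Rmult_le_reg_l with c; [assumption|].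
    rewrite <- Rmult_assoc, Rinv_r by lra. lra. }
  exists R; split; [split|split; [|split]]; auto.
  - split; intros; apply Hinj; rewrite ?(lin_add _ _ HT), ?(lin_scal _ _ HT), !HR; reflexivity.
  - exists (/ c); apply HRb.
Qed.

(* [pi] is the Riesz projection onto [ker (K - a)^k] along the range of [(K - a)^k]. *)
Record split K (a : Cpx) (k : nat) (pi : op X) : Prop := {
  split_k : (1 <= k)%nat;
  split_lb : lb pi;
  split_idem : forall x, pi (pi x) = pi x;
  split_ker : forall x, Nat.iter k (Dop K a) (pi x) = vzero X;
  split_fix : forall x, Nat.iter k (Dop K a) x = vzero X -> pi x = x;
  split_ran : forall x, pi x = vzero X -> exists y, x = Nat.iter k (Dop K a) y;
  split_ran0 : forall y, pi (Nat.iter k (Dop K a) y) = vzero X;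
  split_fin : exists l, forall x, span l (pi x);
  split_low : exists c, 0 < c /\ forall x, pi x = vzero X -> c * nm x <= nm (Dop K a x);
  split_onto : forall x, pi x = vzero X -> exists y, pi y = vzero X /\ Dop K a y = x }.

(** An operator commuting with [K] preserves both the kernel and the range of the power of [K - a],
    hence commutes with the projection along this decomposition. *)
Lemma split_comm K a k pi A : split K a k pi -> linear A -> (forall x, A (K x) = K (A x)) ->
  forall x, A (pi x) = pi (A x).
Proof.
  intros H HA HAK x. pose proof (lb_lin (split_lb H)) as Hpi.
  assert (HD : forall n x, A (Nat.iter n (Dop K a) x) = Nat.iter n (Dop K a) (A x)).
  { intros n y; apply iter_comm. now apply Dop_comm. }
  assert (E1 : pi (A (pi x)) = A (pi x)).
  { apply (split_fix H). rewrite <- HD, (split_ker H). now apply lin_0. }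
  assert (E2 : pi (A (x -v pi x)) = vzero X).
  { destruct (@split_ran _ _ _ _ H (x -v pi x)) as [y Hy].
    - rewrite lin_sub, (split_idem H) by assumption; vec.
    - rewrite Hy, HD. apply (split_ran0 H). }
  rewrite <- E1. rewrite lin_sub, lin_sub in E2 by assumption. now apply sub_eq0 in E2.
Qed.

(** In an infinite-dimensional kernel the spans of successively independent vectors form a strictly
    ascending chain on which [K] is the scalar [a], contrary to [chain_up]. *)
Lemma ker_Dop_fin K a : compact_op K -> a <> C0 -> exists l, forall x, Dop K a x = vzero X -> span l x.
Proof.
  intros HK Ha. apply NNPP; intro Hn.
  assert (H : forall l, exists x, Dop K a x = vzero X /\ ~ span l x).
  { intro l. apply NNPP; intro Hm. apply Hn; exists l; intros x Hx. apply NNPP; intro. apply Hm; eauto. }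
  apply choice in H. destruct H as [f Hf].
  pose (s := fun n => Nat.iter n (fun l => f l :: l) nil).
  assert (Hs : forall n x, span (s n) x -> Dop K a x = vzero X).
  { intro n; induction n; intros x Hx.
    - simpl in Hx; subst. apply lin_0, lin_Dop, HK.
    - destruct Hx as [c [y [Hy ->]]]. rewrite lin_add, lin_scal by apply lin_Dop, HK.
      rewrite (IHn y Hy). replace (f (Nat.iter n (fun l => f l :: l) nil)) with (f (s n)) by reflexivity.
      rewrite (proj1 (Hf (s n))). vec. }
  apply (@chain_up K (fun n => span (s n)) (fun _ => a) (Cabs a) HK).
  - now apply Cabs_pos.
  - intro; apply span_subsp.
  - intro; apply span_closed.
  - intro n; split.
    + intros x Hx. apply span_incl with (s n); [intros b Hb; now right|assumption].
    + exists (f (s n)); split; [apply span_in; now left|apply Hf].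
  - intros n x Hx. pose proof (Hs n x Hx) as E. apply sub_eq0 in E. rewrite E.
    apply subsp_scal; [apply span_subsp|assumption].
  - intro; lra.
  - intros n x Hx. apply Hs in Hx. unfold Dop in Hx. rewrite Hx. apply subsp_0, span_subsp.
Qed.

Lemma iter_shift (V : Type) (f : V -> V) n (x : V) : Nat.iter n f (f x) = f (Nat.iter n f x).
Proof. induction n; simpl; congruence. Qed.

(** [chain_up] bounds the ascent of [K - a] and [chain_down] its descent; beyond both, kernel and
    range of the power are complementary. The lower bound of the power on its range makes the
    projection bounded. *)
Lemma split_exists K a : compact_op K -> a <> C0 -> exists k pi, split K a k pi.
Proof.
  intros HK Ha. set (D := Dop K a).
  pose proof (lb_Dop a (compact_lb HK)) as HD. fold D in HD.
  pose proof (fun n => lin_iter n (lb_lin HD)) as HL.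
  assert (HKD : forall n x, K (Nat.iter n D x) = Nat.iter n D (K x)).
  { intros; apply iter_comm. intro; apply K_Dop, HK. }
  assert (Ha0 : 0 < Cabs a) by now apply Cabs_pos.
  assert (H1 : exists k, forall x, Nat.iter (S k) D x = vzero X -> Nat.iter k D x = vzero X).
  { apply NNPP; intro Hn.
    apply (@chain_up K (fun n x => Nat.iter n D x = vzero X) (fun _ => a) (Cabs a) HK Ha0).
    - intro n; now apply ker_subsp.
    - intro n; apply ker_closed; now apply lb_iter.
    - intro n; split.
      + intros x Hx; simpl; rewrite Hx. apply lin_0, HD.
      + apply NNPP; intro Hm. apply Hn; exists n; intros x Hx. apply NNPP; intro. apply Hm; eauto.
    - intros n x Hx. rewrite <- HKD, Hx. apply lin_0, HK.
    - intro; lra.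
    - intros n x Hx. change (K x -v a *v x) with (D x). now rewrite iter_shift. }
  assert (H2 : exists k, forall x, exists y, Nat.iter k D x = Nat.iter (S k) D y).
  { apply NNPP; intro Hn.
    apply (@chain_down K (fun n y => exists x, y = Nat.iter n D x) (fun _ => a) (Cabs a) HK Ha0).
    - intro n; now apply range_subsp.
    - intro n. destruct (Dop_pow_form n HK Ha) as [K' [g [HK' [Hg E]]]].
      intros u l Hu Hl. destruct (@range_Dop_closed K' g HK' Hg u l) as [x Hx].
      + intro m; destruct (Hu m) as [x ->]. exists x; apply E.
      + assumption.
      + exists x; rewrite Hx; symmetry; apply E.
    - intro n; split.
      + intros x [y ->]. exists (D y). symmetry; apply iter_shift.
      + apply NNPP; intro Hm. apply Hn; exists n; intros x. apply NNPP; intro Hk. apply Hm.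
        exists (Nat.iter n D x); split; [eauto|]. intros [y Hy]. apply Hk; eauto.
    - intros n x [y ->]. exists (K y). apply HKD.
    - intro; lra.
    - intros n x [y ->]. exists y. reflexivity. }
  destruct H1 as [k1 H1]. destruct H2 as [k2 H2].
  assert (H1' : forall n x, Nat.iter (n + k1) D x = vzero X -> Nat.iter k1 D x = vzero X).
  { induction n; intros x Hx; [assumption|]. apply IHn.
    replace (S n + k1)%nat with (S k1 + n)%nat in Hx by lia. rewrite Nat.iter_add in Hx.
    apply H1 in Hx. rewrite <- Nat.iter_add in Hx. now replace (n + k1)%nat with (k1 + n)%nat by lia. }
  assert (H2' : forall n x, exists y, Nat.iter k2 D x = Nat.iter (n + k2) D y).
  { induction n; intro x; [now exists x|]. destruct (IHn x) as [y Hy]. destruct (H2 y) as [z Hz].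
    exists z. rewrite Hy, Nat.iter_add, Hz, <- Nat.iter_add. f_equal; lia. }
  (* Beyond both ascent and descent, and a successor, so that one factor [D] can be split off and
     eigenvectors lie in the kernel. *)
  set (k := S (k1 + k2)).
  assert (Hk1 : forall x, Nat.iter k D (Nat.iter k D x) = vzero X -> Nat.iter k D x = vzero X).
  { intros x Hx. rewrite <- Nat.iter_add in Hx. replace (k + k)%nat with ((k + k - k1) + k1)%nat in Hx by (unfold k; lia).
    apply H1' in Hx. replace k with ((k - k1) + k1)%nat by (unfold k; lia).
    rewrite Nat.iter_add, Hx. apply lin_0, HL. }
  assert (Hk2 : forall x, exists y, Nat.iter k D x = Nat.iter k D (Nat.iter k D y)).
  { intro x. destruct (H2' (k + k - k2)%nat (Nat.iter (k - k2) D x)) as [y Hy].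
    exists y. rewrite <- !Nat.iter_add in *. replace (k + k)%nat with (k + k - k2 + k2)%nat by (unfold k; lia).
    rewrite <- Hy. f_equal; unfold k; lia. }
  destruct (Dop_pow_form k HK Ha) as [K' [g [HK' [Hg E]]]]. fold D in E.
  assert (Hlow : exists c, 0 < c /\ forall x, (exists y, x = Nat.iter k D y) -> c * nm x <= nm (Nat.iter k D x)).
  { destruct (@lower_bound K' (fun x => exists y, x = Nat.iter k D y) g HK') as [c [Hc Hl]].
    - now apply range_subsp.
    - intros u l Hu Hl. destruct (@range_Dop_closed K' g HK' Hg u l) as [x Hx]; [|assumption|].
      + intro m; destruct (Hu m) as [x ->]. exists x; apply E.
      + exists x; rewrite Hx; symmetry; apply E.
    - assumption.
    - intros x [y ->]. rewrite <- E. apply Hk1.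
    - exists c; split; [assumption|]. intros x Hx. rewrite E. now apply Hl. }
  destruct Hlow as [c [Hc Hlow]].
  assert (Hdec : forall x, exists n, Nat.iter k D n = vzero X /\ exists y, x -v n = Nat.iter k D y).
  { intro x. destruct (Hk2 x) as [y Hy]. exists (x -v Nat.iter k D y); split.
    - rewrite (lin_sub _ _ (HL k)), Hy. vec.
    - exists y; vec. }
  apply choice in Hdec. destruct Hdec as [pi Hpi].
  assert (Huniq : forall x n, Nat.iter k D n = vzero X -> (exists y, x -v n = Nat.iter k D y) -> pi x = n).
  { intros x n Hn [y Hy]. destruct (Hpi x) as [Hp [z Hz]].
    apply sub_eq0. replace (pi x -v n) with (Nat.iter k D (y -v z)).
    2:{ rewrite (lin_sub _ _ (HL k)), <- Hy, <- Hz. vec. }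
    apply Hk1. rewrite (lin_sub y z (HL k)), <- Hy, <- Hz.
    replace (x -v n -v (x -v pi x)) with (pi x -v n) by vec.
    rewrite (lin_sub _ _ (HL k)), Hp, Hn. vec. }
  assert (Hplin : linear pi).
  { split.
    - intros x y. destruct (Hpi x) as [Hx [x' Hx']]. destruct (Hpi y) as [Hy [y' Hy']]. apply Huniq.
      + rewrite (lin_add _ _ (HL k)), Hx, Hy; vec.
      + exists (x' +v y'). rewrite (lin_add _ _ (HL k)), <- Hx', <- Hy'. vec.
    - intros b x. destruct (Hpi x) as [Hx [x' Hx']]. apply Huniq.
      + rewrite (lin_scal _ _ (HL k)), Hx; vec.
      + exists (b *v x'). rewrite (lin_scal _ _ (HL k)), <- Hx'. vec. }
  assert (Hran : forall x, pi x = vzero X -> exists y, x = Nat.iter k D y).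
  { intros x Hx. destruct (Hpi x) as [_ [y Hy]]. exists y. rewrite <- Hy, Hx; vec. }
  assert (Hran0 : forall y, pi (Nat.iter k D y) = vzero X).
  { intro y. apply Huniq; [apply lin_0, HL|]. exists y; vec. }
  exists k, pi. constructor; fold D.
  - unfold k; lia.
  - split; [assumption|]. destruct (lb_bound (lb_iter k HD)) as [B [HB HBb]]. exists (1 + / c * B). intro x.
    destruct (Hpi x) as [Hx Hy]. replace (pi x) with (x -v (x -v pi x)) by vec.
    eapply Rle_trans; [apply nm_sub|]. rewrite Rmult_plus_distr_r, Rmult_1_l. apply Rplus_le_compat_l.
    specialize (Hlow _ Hy). rewrite lin_sub, Hx in Hlow by apply HL.
    replace (Nat.iter k D x -v vzero X) with (Nat.iter k D x) in Hlow by vec.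
    apply Rmult_le_reg_l with c; [assumption|]. rewrite <- !Rmult_assoc, Rinv_r, Rmult_1_l by lra.
    eapply Rle_trans; [apply Hlow|apply HBb].
  - intro x. apply Huniq; [apply Hpi|]. exists (vzero X). rewrite (lin_0 (HL k)). vec.
  - intro x; apply Hpi.
  - intros x Hx; apply Huniq; [assumption|]. exists (vzero X). rewrite (lin_0 (HL k)). vec.
  - assumption.
  - assumption.
  - destruct (ker_Dop_fin HK' Hg) as [l Hl]. exists l; intro x. apply Hl. rewrite <- E. apply Hpi.
  (* The power [k] is [k1 + k2] further applications of [D] after the first one, so its lower bound
     divided by their norm is a lower bound for [D]. *)
  - destruct (lb_bound (lb_iter (k1 + k2) HD)) as [B [HB HBb]]. exists (/ B * c). split.
    + apply Rmult_lt_0_compat; [now apply Rinv_0_lt_compat|assumption].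
    + intros x Hx. specialize (Hlow x (Hran x Hx)). specialize (HBb (D x)). rewrite iter_shift in HBb.
      change (D (Nat.iter (k1 + k2) D x)) with (Nat.iter k D x) in HBb.
      apply Rmult_le_reg_l with B; [assumption|]. rewrite <- !Rmult_assoc, Rinv_r, Rmult_1_l by lra. lra.
  - intros x Hx. destruct (Hran x Hx) as [y ->]. destruct (Hk2 y) as [z Hz].
    exists (Nat.iter (k1 + k2) D (Nat.iter k D z)); split.
    + rewrite <- Nat.iter_add, Nat.add_comm, Nat.iter_add. apply Hran0.
    + rewrite Hz. reflexivity.
Qed.

(** The Fredholm alternative: an injective [K - a] has a zero Riesz projection, and [K - a] is onto
    the kernel of that projection. *)
Lemma resolvent_exists K a c : compact_op K -> a <> C0 -> 0 < c -> (forall x, c * nm x <= nm (Dop K a x)) ->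
  exists R, lb R /\ (forall x, R (Dop K a x) = x) /\ (forall y, Dop K a (R y) = y) /\ (forall y, nm (R y) <= / c * nm y).
Proof.
  intros HK Ha Hc Hlow. apply inverse_exists; auto; [apply lin_Dop, HK|].
  destruct (split_exists HK Ha) as [k [pi H]].
  assert (H0 : forall n x, Nat.iter n (Dop K a) x = vzero X -> x = vzero X).
  { induction n; intros x Hx; [assumption|]. apply IHn, nm_le0. specialize (Hlow (Nat.iter n (Dop K a) x)).
    simpl in Hx. rewrite Hx, nm_0 in Hlow. nra. }
  intro y. destruct (split_onto H (x := y)) as [x [_ Hx]]; [|now exists x].
  apply (H0 k). apply (split_ker H).
Qed.

(** Infinitely many eigenvalues would give a chain of spans of eigenvectors to which [chain_up]
    applies with [zeta] the eigenvalues. The chain is strict because an eigenvector in a span, for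
    an eigenvalue not yet listed, is pushed by [K] minus the last eigenvalue into the previous
    span. *)
Lemma eigenvalues_finite K delta : compact_op K -> 0 < delta ->
  exists l : list Cpx, forall z x, delta <= Cabs z -> x <> vzero X -> K x = z *v x -> In z l.
Proof.
  intros HK Hd. apply NNPP; intro Hn.
  assert (H : forall l : list (Cpx * X), exists p : Cpx * X, delta <= Cabs (fst p) /\ snd p <> vzero X /\
     K (snd p) = fst p *v snd p /\ ~ In (fst p) (map fst l)).
  { intro l. apply NNPP; intro Hm. apply Hn. exists (map fst l). intros z x Hz Hx E. apply NNPP; intro.
    apply Hm. exists (z, x); auto. }
  apply choice in H. destruct H as [f Hf].
  pose (s := fun n => Nat.iter n (fun l => f l :: l) nil).
  assert (HKs : forall n x, span (map snd (s n)) x -> span (map snd (s n)) (K x)).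
  { intros n; induction n; intros x Hx; simpl in *.
    - subst; apply lin_0, HK.
    - destruct Hx as [c [y [Hy ->]]]. fold (s n) in *. rewrite lin_add, lin_scal by apply HK.
      destruct (Hf (s n)) as [_ [_ [E _]]]. rewrite E. exists (Cmul c (fst (f (s n)))), (K y). split; [auto|vec]. }
  assert (Hind : forall n z x, span (map snd (s n)) x -> K x = z *v x -> ~ In z (map fst (s n)) -> x = vzero X).
  { induction n; intros z x Hx E Hz; [exact Hx|].
    apply (IHn z x); auto.
    - simpl in Hx, Hz. fold (s n) in *. destruct Hx as [c [y [Hy Ex]]].
      destruct (Hf (s n)) as [_ [_ [E' _]]].
      assert (Hne : z <> fst (f (s n))) by (intro; apply Hz; now left).
      pose proof (Csub_neq0 Hne) as Hne'.
      replace x with (Cinv (Csub z (fst (f (s n)))) *v (K y -v fst (f (s n)) *v y)).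
      + apply subsp_scal; [apply span_subsp|]. apply subsp_sub; [apply span_subsp|now apply HKs|].
        apply subsp_scal; [apply span_subsp|assumption].
      + assert (EK : K y = z *v x -v (Cmul c (fst (f (s n)))) *v snd (f (s n))).
        { rewrite <- E, Ex, lin_add, lin_scal, E' by apply HK. vec. }
        rewrite EK. replace y with (x -v c *v snd (f (s n))) by (rewrite Ex; vec).
        vec_pre; field; intro Hc; apply Hne'; rewrite <- Hc; ring.
    - intro; apply Hz; now right. }
  apply (@chain_up K (fun n => span (map snd (s n))) (fun n => fst (f (s n))) delta HK Hd).
  - intro; apply span_subsp.
  - intro; apply span_closed.
  - intro n; split.
    + intros x Hx. apply span_incl with (map snd (s n)); [intros b Hb; now right|assumption].
    + exists (snd (f (s n))); split; [apply span_in; now left|]. destruct (Hf (s n)) as [_ [H1 [H2 H3]]].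
      intro Hin. apply H1. eapply Hind; eauto.
  - apply HKs.
  - intro n; apply Hf.
  - intros n x [c [y [Hy ->]]]. destruct (Hf (s n)) as [_ [_ [E _]]]. fold (s n) in *.
    rewrite lin_add, lin_scal, E by apply HK.
    match goal with |- span ?l ?v => replace v with (K y -v fst (f (s n)) *v y) by vec end.
    apply subsp_sub; [apply span_subsp|now apply HKs|]. apply subsp_scal; [apply span_subsp|assumption].
Qed.

(** Local spectral radius zero at the vector [x]; the constant may depend on [x]. *)
Definition decays T x : Prop := forall eps, 0 < eps -> exists C, forall n, nm (Nat.iter n T x) <= C * eps ^ n.
Lemma decays_map T A x : lb A -> (forall x, A (T x) = T (A x)) -> decays T x -> decays T (A x).
Proof.
  intros HA HAT Hx eps He. destruct (Hx eps He) as [C HC]. destruct (lb_bound HA) as [B [HB HBb]].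
  exists (B * C); intro n. rewrite <- iter_comm by assumption. eapply Rle_trans; [apply HBb|].
  rewrite Rmult_assoc. apply Rmult_le_compat_l; [lra|apply HC].
Qed.
(** Decay passes from [x] to [(K - a) x], so by induction [x] is an eigenvector, whose iterates have
    norm [|a|^n] times that of [x]. *)
Lemma decays_gen_eigen K a k x : lb K -> a <> C0 -> Nat.iter k (Dop K a) x = vzero X -> decays K x -> x = vzero X.
Proof.
  intros HK Ha. revert x; induction k; intros x Hx Hd; [assumption|].
  assert (E : Dop K a x = vzero X).
  { apply IHk; [now rewrite iter_shift|]. apply decays_map; [now apply lb_Dop| |assumption].
    intro y. symmetry. apply K_Dop, HK. }
  apply sub_eq0 in E. pose proof (Cabs_pos Ha) as Hp. destruct (Hd (Cabs a / 2)) as [C HC]; [lra|].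
  apply nm_le0. apply le_pow_zero with (C := C) (eta := /2); [lra|]. intro n.
  assert (En : Nat.iter n K x = Cpow a n *v x).
  { clear - E HK. induction n; simpl; [vec|]. rewrite IHn, lin_scal, E by apply HK. vec. }
  specialize (HC n). rewrite En, vnorm_scal, Cabs_pow in HC. unfold Rdiv in HC. rewrite Rpow_mult_distr in HC.
  pose proof (pow_lt _ n Hp). apply Rmult_le_reg_l with (Cabs a ^ n); [assumption|]. nra.
Qed.

(** The projection onto all generalized eigenspaces for eigenvalues of modulus at least [delta].
    That it commutes with everything commuting with [K] is what later makes it usable as a cut. *)
Lemma spectral_proj K delta : compact_op K -> 0 < delta ->
  exists p, finrank p /\ (forall x, p (p x) = p x) /\
   (forall A, linear A -> (forall x, A (K x) = K (A x)) -> forall x, A (p x) = p (A x)) /\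
   (forall z x, delta <= Cabs z -> K x = z *v x -> p x = vzero X -> x = vzero X) /\
   (forall x, decays K x -> p x = vzero X).
Proof.
  intros HK Hd. destruct (eigenvalues_finite HK Hd) as [l Hl].
  assert (H : exists p, finrank p /\ (forall x, p (p x) = p x) /\
   (forall A, linear A -> (forall x, A (K x) = K (A x)) -> forall x, A (p x) = p (A x)) /\
   (forall z x, In z l -> z <> C0 -> K x = z *v x -> p x = vzero X -> x = vzero X) /\
   (forall x, decays K x -> p x = vzero X)).
  { clear Hl. induction l as [|a l IH].
    - exists (@opzero X); split; [split; [apply lb_opzero|exists nil; reflexivity]|split; [reflexivity|split; [|split; [|reflexivity]]]].
      + intros A HA _ x; unfold opzero; now apply lin_0.
      + intros z x [].
    - destruct IH as [p [[Hp [lp Hlp]] [Hpi [Hpc [Hpe Hpd]]]]].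
      destruct (classic (a = C0)) as [->|Ha].
      { exists p; split; [split; [assumption|now exists lp]|split; [assumption|split; [assumption|split; [|assumption]]]].
        intros z x [<-|Hz] Hz0; [congruence|]. now apply Hpe. }
      destruct (split_exists HK Ha) as [k [pi Hs]].
      pose proof (split_lb Hs) as Hpib. pose proof (lb_lin Hpib) as Hpil. pose proof (lb_lin Hp) as Hpl.
      assert (HKpi : forall x, K (pi x) = pi (K x)) by (intro; apply (split_comm Hs); [apply HK|reflexivity]).
      assert (Hcom : forall x, pi (p x) = p (pi x)) by (apply Hpc; [assumption|intro; symmetry; apply HKpi]).
      (* The join of two commuting projections; this form spares checking that Riesz projections for
         different eigenvalues annihilate each other, and tolerates repetitions in the list. *)
      exists (fun x => p x +v pi x -v p (pi x)). split; [split; [apply (lb_opsub (lb_opadd Hp Hpib) (lb_opcomp Hp Hpib))|]|split; [|split; [|split]]].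
      + destruct (split_fin Hs) as [lq Hlq]. exists (lp ++ lq). intro x.
        assert (S1 : forall x, span (lp ++ lq) (p x)) by (intro; eapply span_incl; [apply incl_appl, incl_refl|apply Hlp]).
        apply subsp_sub; [apply span_subsp| |apply S1]. apply subsp_add; [apply span_subsp|apply S1|].
        eapply span_incl; [apply incl_appr, incl_refl|apply Hlq].
      + intro x. repeat (progress (lpush Hpl; lpush Hpil)). repeat (progress rewrite ?Hcom, ?Hpi, ?(split_idem Hs)). vec.
      + intros A HA HAK x. rewrite lin_sub, lin_add by assumption.
        rewrite !(Hpc A HA HAK), !(split_comm Hs HA HAK). reflexivity.
      + intros z x Hz Hz0 E Hx.
        assert (E1 : pi x = vzero X).
        { apply (f_equal pi) in Hx. rewrite lin_sub, lin_add, lin_0, !Hcom, !(split_idem Hs) in Hx by assumption.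
          rewrite <- Hx. vec. }
        rewrite E1, (lin_0 Hpl) in Hx. destruct Hz as [<-|Hz].
        * rewrite <- E1. symmetry. apply (split_fix Hs). pose proof (split_k Hs).
          replace k with ((k - 1) + 1)%nat by lia. rewrite Nat.iter_add. simpl. unfold Dop at 2. rewrite E, vadd_oppr.
          apply lin_0, lin_iter, lin_Dop, HK.
        * apply (Hpe z); auto. rewrite <- Hx; vec.
      + intros x Hx. assert (E1 : pi x = vzero X).
        { apply (@decays_gen_eigen K a k); [now apply compact_lb|assumption|apply (split_ker Hs)|].
          apply decays_map; auto. }
        rewrite E1, (lin_0 Hpl), (Hpd x Hx). vec. }
  destruct H as [p [H1 [H2 [H3 [H4 H5]]]]]. exists p; split; [assumption|split; [assumption|split; [assumption|split; [|assumption]]]].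
  intros z x Hz E Hx. apply NNPP; intro Hn. apply Hn. apply (H4 z); auto.
  - now apply (Hl z x).
  - apply Cabs_neq0; lra.
Qed.
End Compact.

(** * Spectral radius without contour integrals *)

Definition Cis (t : R) : Cpx := mkC (cos t) (sin t).
(** A [2^j]-th root of -1: multiplication of [z] by it changes the sign of [z^(2^j)]. *)
Definition eC (j : nat) : Cpx := Cis (PI / 2 ^ j).
Lemma eC_0 : eC 0 = Copp Cone.
Proof. unfold eC, Cis; simpl. replace (PI / 1) with PI by field. rewrite cos_PI, sin_PI. apply Cpx_eq; simpl; ring. Qed.
Lemma eC_S j : Cmul (eC (S j)) (eC (S j)) = eC j.
Proof.
  unfold eC, Cis. assert (H : PI / 2 ^ j = 2 * (PI / 2 ^ S j)).
  { simpl. field. apply pow_nonzero; lra. }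
  rewrite H, cos_2a, sin_2a. apply Cpx_eq; simpl; ring.
Qed.
Lemma eC_pow j : Cpow (eC j) (2 ^ j) = Copp Cone.
Proof.
  assert (H : forall j n, Cpow (eC (S j)) (n + n) = Cpow (eC j) n).
  { intros i n. rewrite Cpow_add, <- Cpow_mul_l. now rewrite eC_S. }
  induction j.
  - simpl. rewrite eC_0. ring.
  - replace (2 ^ S j)%nat with (2 ^ j + 2 ^ j)%nat by (simpl; lia). rewrite H; apply IHj.
Qed.
Lemma Cabs_Cis t : Cabs (Cis t) = 1.
Proof.
  unfold Cabs, Cis; simpl. pose proof (sin2_cos2 t). unfold Rsqr in H.
  replace (cos t * cos t + sin t * sin t) with 1 by lra. apply sqrt_1.
Qed.
Lemma Cis_add s t : Cis (s + t) = Cmul (Cis s) (Cis t).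
Proof. unfold Cis. rewrite cos_plus, sin_plus. apply Cpx_eq; simpl; ring. Qed.
Lemma Cabs_eC j : Cabs (eC j) = 1.
Proof. apply Cabs_Cis. Qed.
(** The chord is [2 sin (t / 2)], which is at most the arc. *)
Lemma Cis_near t : 0 < t -> Cabs (Csub (Cis t) Cone) <= t.
Proof.
  intro Ht. apply le_of_sq; [lra|]. rewrite Cabs_sq. unfold Csq, Cis; simpl.
  assert (Hs : 0 <= sin (t / 2) * sin (t / 2) <= (t / 2) * (t / 2)).
  { pose proof (sin_lt_x (t / 2) ltac:(lra)).
    assert (- (t / 2) < sin (t / 2)).
    { pose proof (SIN_bound (t / 2)). destruct (Rle_lt_dec (t / 2) 1) as [H1|H1]; [|lra].
      assert (0 <= sin (t / 2)); [|lra]. apply sin_ge_0; [lra|]. pose proof PI2_1; lra. }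
    split; nra. }
  pose proof (sin2_cos2 t). unfold Rsqr in *.
  assert (cos t = 1 - 2 * sin (t / 2) * sin (t / 2)).
  { replace t with (2 * (t / 2)) at 1 by field. apply cos_2a_sin. }
  nra.
Qed.
Lemma eC_near j : Cabs (Csub (eC j) Cone) <= 4 * (/2) ^ j.
Proof.
  apply Rle_trans with (PI / 2 ^ j).
  - apply Cis_near, Rdiv_lt_0_compat; [apply PI_RGT_0|apply pow_lt; lra].
  - pose proof PI_4. unfold Rdiv. rewrite <- pow_inv. apply Rmult_le_compat_r; [|assumption].
    apply pow_le; lra.
Qed.
Lemma polar (z : Cpx) : Cabs z = 1 -> exists t, 0 <= t /\ z = Cis t.
Proof.
  intro H. pose proof (Cabs_sq z) as Hsq. rewrite H in Hsq. unfold Csq in Hsq. destruct z as [x y]; simpl in Hsq.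
  assert (Hx : -1 <= x <= 1) by nra.
  assert (Hs : sqrt (1 - x * x) = Rabs y).
  { replace (1 - x * x) with (Rsqr y) by (unfold Rsqr; lra). apply sqrt_Rsqr_abs. }
  destruct (Rle_lt_dec 0 y) as [Hy|Hy].
  - exists (acos x). split; [apply acos_bound|]. unfold Cis. apply Cpx_eq; simpl.
    + now rewrite cos_acos.
    + rewrite sin_acos by assumption. unfold Rsqr. rewrite Hs, Rabs_pos_eq; lra.
  - exists (2 * PI - acos x). pose proof (acos_bound x). pose proof PI_RGT_0. split; [lra|]. unfold Cis. apply Cpx_eq; simpl.
    + rewrite cos_minus, cos_2PI, sin_2PI, cos_acos by assumption. ring.
    + rewrite sin_minus, cos_2PI, sin_2PI, sin_acos by assumption. unfold Rsqr. rewrite Hs, Rabs_left; lra.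
Qed.

Definition Chalf : Cpx := RtoC (/2).
Lemma Chalf2 : Cadd Chalf Chalf = Cone.
Proof. apply Cpx_eq; simpl; lra. Qed.
Lemma nm_half (X : CBanach) (x : X) : nm (Chalf *v x) = / 2 * nm x.
Proof. unfold Chalf. apply nm_Rscal; lra. Qed.
Lemma half_add (X : CBanach) (x : X) : Chalf *v (x +v x) = x.
Proof. replace (x +v x) with (Cadd Cone Cone *v x) by vec. rewrite <- vscal_mul.
  replace (Cmul Chalf (Cadd Cone Cone)) with (Cadd Chalf Chalf) by ring. rewrite Chalf2. apply vscal_1. Qed.

(** * Means of resolvents over roots of unity *)

Section Circle.
Variable Y : CBanach.
Variable T : op Y.
Hypothesis HT : lb T.
Variables rho C Lam : R.
Hypothesis Hrho : 0 < rho.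
Hypothesis HC : 0 <= C.
(** [A0 z] is the inverse of [1 - T / z] on the circle of radius [rho], with bound [C] and Lipschitz
    constant [Lam] in [z]. *)
Variable A0 : Cpx -> op Y.
Hypothesis A0lin : forall z, Cabs z = rho -> linear (A0 z).
Hypothesis A0bd : forall z x, Cabs z = rho -> nm (A0 z x) <= C * nm x.
Hypothesis A0lip : forall z z' x, Cabs z = rho -> Cabs z' = rho -> nm (A0 z x -v A0 z' x) <= Lam * Cabs (Csub z z') * nm x.
Hypothesis A0inv : forall z x, Cabs z = rho -> A0 z (x -v Cinv z *v T x) = x.
Hypothesis A0comm : forall z x, Cabs z = rho -> T (A0 z x) = A0 z (T x).

(* [Aj j z] is the inverse of [1 - (T / z)^(2^j)]: the mean of the inverses of [1 - w] and [1 + w] is the inverse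
   of [1 - w^2], and the rotation by [eC j] turns [(T / z)^(2^j)] into its opposite. *)
Fixpoint Aj (j : nat) (z : Cpx) : op Y :=
  match j with O => A0 z | S j => fun x => Chalf *v (Aj j z x +v Aj j (Cmul z (eC j)) x) end.

Lemma circ_rot z j : Cabs z = rho -> Cabs (Cmul z (eC j)) = rho.
Proof. intro H. rewrite Cabs_mul, Cabs_eC, H; ring. Qed.
Lemma circ_neq0 z : Cabs z = rho -> z <> C0.
Proof. intro H; apply Cabs_neq0; lra. Qed.

Lemma Aj_lin j : forall z, Cabs z = rho -> linear (Aj j z).
Proof.
  induction j; intros z Hz; simpl; [now apply A0lin|].
  pose proof (IHj z Hz) as H1. pose proof (IHj _ (circ_rot j Hz)) as H2.
  split; intros; lpush H1; lpush H2; vec.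
Qed.
Lemma Aj_bd j : forall z x, Cabs z = rho -> nm (Aj j z x) <= C * nm x.
Proof.
  induction j; intros z x Hz; simpl; [now apply A0bd|].
  rewrite nm_half. pose proof (nm_add (Aj j z x) (Aj j (Cmul z (eC j)) x)).
  pose proof (IHj z x Hz). pose proof (IHj _ x (circ_rot j Hz)). lra.
Qed.
Lemma Aj_comm j : forall z x, Cabs z = rho -> T (Aj j z x) = Aj j z (T x).
Proof.
  induction j; intros z x Hz; simpl; [now apply A0comm|].
  lpush (lb_lin HT). rewrite IHj by assumption. rewrite IHj by now apply circ_rot. reflexivity.
Qed.
Lemma Aj_lip j : forall z z' x, Cabs z = rho -> Cabs z' = rho ->
  nm (Aj j z x -v Aj j z' x) <= Lam * Cabs (Csub z z') * nm x.
Proof.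
  induction j; intros z z' x Hz Hz'; simpl; [now apply A0lip|].
  replace (Chalf *v (Aj j z x +v Aj j (Cmul z (eC j)) x) -v Chalf *v (Aj j z' x +v Aj j (Cmul z' (eC j)) x))
    with (Chalf *v ((Aj j z x -v Aj j z' x) +v (Aj j (Cmul z (eC j)) x -v Aj j (Cmul z' (eC j)) x))) by vec.
  rewrite nm_half. pose proof (IHj z z' x Hz Hz'). pose proof (IHj _ _ x (circ_rot j Hz) (circ_rot j Hz')).
  replace (Csub (Cmul z (eC j)) (Cmul z' (eC j))) with (Cmul (Csub z z') (eC j)) in H0 by ring.
  rewrite Cabs_mul, Cabs_eC, Rmult_1_r in H0.
  pose proof (nm_add (Aj j z x -v Aj j z' x) (Aj j (Cmul z (eC j)) x -v Aj j (Cmul z' (eC j)) x)). lra.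
Qed.
Lemma Aj_iter_comm j z n x : Cabs z = rho -> Nat.iter n T (Aj j z x) = Aj j z (Nat.iter n T x).
Proof. intro Hz. symmetry. apply iter_comm. intro; symmetry; now apply Aj_comm. Qed.

Lemma Aj_inv j : forall z x, Cabs z = rho ->
  Aj j z (x -v Cinv (Cpow z (2 ^ j)) *v Nat.iter (2 ^ j) T x) = x.
Proof.
  induction j; intros z x Hz.
  - simpl. replace (Cmul z Cone) with z by ring. now apply A0inv.
  - pose proof (circ_neq0 Hz) as Hz0. set (N := (2 ^ j)%nat).
    assert (Hrot : Cpow (Cmul z (eC j)) N = Copp (Cpow z N)) by (rewrite Cpow_mul_l; unfold N; rewrite eC_pow; ring).
    pose proof (@Cpow_neq0 z N Hz0) as HzN.
    pose proof (lin_iter N (lb_lin HT)) as HL.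
    replace (2 ^ S j)%nat with (N + N)%nat by (unfold N; simpl; lia).
    set (w := x -v Cinv (Cpow z (N + N)) *v Nat.iter (N + N) T x).
    set (p := x +v Cinv (Cpow z N) *v Nat.iter N T x).
    set (q := x -v Cinv (Cpow z N) *v Nat.iter N T x).
    assert (E1 : w = p -v Cinv (Cpow z N) *v Nat.iter N T p).
    { unfold w, p. lpush HL. rewrite <- Nat.iter_add, Cpow_add. vec_pre; field; auto. }
    assert (E2 : w = q -v Cinv (Cpow (Cmul z (eC j)) N) *v Nat.iter N T q).
    { unfold w, q. lpush HL. rewrite <- Nat.iter_add, Cpow_add, Hrot. pose proof (Copp_neq0 HzN). vec_pre; field; repeat split; auto.
    }
    assert (F1 : Aj j z w = p) by (rewrite E1; exact (IHj z p Hz)).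
    assert (F2 : Aj j (Cmul z (eC j)) w = q) by (rewrite E2; exact (IHj _ q (circ_rot j Hz))).
    simpl. rewrite F1, F2.
    unfold p, q. match goal with |- Chalf *v ?v = _ => replace v with (x +v x) by vec end. apply half_add.
Qed.
(** The two terms of the mean are taken at points of the circle at distance at most [4 rho 2^-j], so
    the Lipschitz bound makes the steps geometric. *)
Lemma Aj_step j z x : Cabs z = rho -> nm (Aj (S j) z x -v Aj j z x) <= 2 * Lam * rho * nm x * (/2) ^ j.
Proof.
  intro Hz. simpl.
  replace (Chalf *v (Aj j z x +v Aj j (Cmul z (eC j)) x) -v Aj j z x) with (Chalf *v (Aj j (Cmul z (eC j)) x -v Aj j z x)).
  2:{ transitivity (Chalf *v (Aj j z x +v Aj j (Cmul z (eC j)) x) -v Chalf *v (Aj j z x +v Aj j z x)); [vec|].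
      now rewrite half_add. }
  rewrite nm_half. pose proof (Aj_lip j x (circ_rot j Hz) Hz).
  replace (Csub (Cmul z (eC j)) z) with (Cmul z (Csub (eC j) Cone)) in H by ring.
  rewrite Cabs_mul, Hz in H. pose proof (eC_near j). pose proof (nm_ge0 x).
  assert (HL : 0 <= Lam * nm x).
  { pose proof (A0lip x (z := z) (z' := Copp z) Hz ltac:(now rewrite Cabs_opp)) as HH.
    pose proof (nm_ge0 (A0 z x -v A0 (Copp z) x)).
    assert (0 < Cabs (Csub z (Copp z))).
    { replace (Csub z (Copp z)) with (Cmul (RtoC 2) z) by (apply Cpx_eq; simpl; ring).
      rewrite Cabs_mul, Cabs_RtoC_pos, Hz; lra. }
    apply Rnot_lt_le; intro. assert (Lam * Cabs (Csub z (Copp z)) * nm x < 0) by nra. lra. }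
  assert (Lam * (rho * Cabs (Csub (eC j) Cone)) * nm x <= Lam * nm x * (rho * (4 * (/ 2) ^ j))).
  { replace (Lam * (rho * Cabs (Csub (eC j) Cone)) * nm x) with (Lam * nm x * (rho * Cabs (Csub (eC j) Cone))) by ring.
    apply Rmult_le_compat_l; [assumption|]. apply Rmult_le_compat_l; lra. }
  lra.
Qed.
(** The means are Riemann sums for the Cauchy integral over the circle; the limit is the Riesz
    projection onto the part of the spectrum of [T] inside it. *)
Lemma Aj_lim z x : Cabs z = rho -> exists l, lim (fun j => Aj j z x) l.
Proof.
  intro Hz. apply complete_geom with (C := 2 * Lam * rho * nm x) (eta := /2); [lra|].
  intro j; now apply Aj_step.
Qed.
Lemma Aj_tail z x l j : Cabs z = rho -> lim (fun j => Aj j z x) l -> nm (l -v Aj j z x) <= 4 * Lam * rho * nm x * (/2) ^ j.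
Proof.
  intros Hz Hl.
  assert (Hk : forall k, nm (Aj (k + j) z x -v Aj j z x) <= 4 * Lam * rho * nm x * (/2) ^ j - 4 * Lam * rho * nm x * (/2) ^ (k + j)).
  { induction k; simpl Nat.add; [rewrite vadd_oppr, nm_0; lra|].
    pose proof (nm_tri (Aj (S (k + j)) z x) (Aj (k + j) z x) (Aj j z x)). pose proof (Aj_step (k + j) x Hz).
    simpl pow. lra. }
  apply (@lim_norm_le Y (fun k => Aj (k + j) z x -v Aj j z x)).
  - apply lim_minus; [|apply lim_const]. apply (lim_sub (phi := fun k => (k + j)%nat) Hl). intro; lia.
  - exists O; intros k _. eapply Rle_trans; [apply Hk|].
    assert (0 <= 4 * Lam * rho * nm x * (/ 2) ^ (k + j)); [|lra].
    apply Rmult_le_pos; [|apply pow_le; lra].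
    pose proof (Aj_step 0 x Hz). pose proof (nm_ge0 (Aj 1 z x -v Aj 0 z x)). simpl in *. lra.
Qed.

Lemma Aj_inv' j z x : Cabs z = rho -> Cinv (Cpow z (2 ^ j)) *v Nat.iter (2 ^ j) T (Aj j z x) = Aj j z x -v x.
Proof.
  intro Hz. rewrite <- (Aj_inv j x Hz) at 3. rewrite (Aj_iter_comm j _ x Hz).
  rewrite (lin_sub _ _ (Aj_lin j Hz)), (lin_scal _ _ (Aj_lin j Hz)). vec.
Qed.
Lemma Cabs_invpow z n : Cabs z = rho -> Cabs (Cinv (Cpow z n)) = / rho ^ n.
Proof. intro Hz. rewrite Cabs_inv, Cabs_pow, Hz; [reflexivity|]. apply Cpow_neq0. now apply circ_neq0. Qed.

(** On the part inside the circle the powers of [T] grow at most like [rho^n]. It suffices to treat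
    [Aj i], where [T^(2^i)] is [z^(2^i)] times the difference with the identity; further means
    preserve the bound. *)
Lemma Aj_forward i k : forall z x, Cabs z = rho -> nm (Nat.iter (2 ^ i) T (Aj (k + i) z x)) <= (C + 1) * rho ^ (2 ^ i) * nm x.
Proof.
  pose proof (pow_lt _ (2 ^ i) Hrho) as Hp.
  induction k; intros z x Hz.
  - pose proof (f_equal (vnorm Y) (Aj_inv' i x Hz)) as E. rewrite vnorm_scal, Cabs_invpow in E by assumption.
    pose proof (nm_sub (Aj i z x) x). pose proof (Aj_bd i x Hz).
    apply Rmult_le_reg_l with (/ rho ^ 2 ^ i); [now apply Rinv_0_lt_compat|]. simpl Nat.add. rewrite E.
    replace (/ rho ^ 2 ^ i * ((C + 1) * rho ^ 2 ^ i * nm x)) with ((C + 1) * nm x) by (field; lra). lra.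
  - simpl Nat.add. change (Aj (S (k + i)) z x) with (Chalf *v (Aj (k + i) z x +v Aj (k + i) (Cmul z (eC (k + i))) x)).
    lpush (lin_iter (2 ^ i) (lb_lin HT)). rewrite nm_half.
    pose proof (IHk z x Hz). pose proof (IHk _ x (circ_rot (k + i) Hz)).
    pose proof (nm_add (Nat.iter (2 ^ i) T (Aj (k + i) z x)) (Nat.iter (2 ^ i) T (Aj (k + i) (Cmul z (eC (k + i))) x))). lra.
Qed.
(** On the part outside the circle [T] is invertible: the complement of the mean lies in the range
    of [T^(2^i)], with preimages of size [rho^-(2^i)]. *)
Lemma Aj_backward i k : forall z x, Cabs z = rho ->
  exists g, Nat.iter (2 ^ i) T g = x -v Aj (k + i) z x /\ nm g <= C * / rho ^ (2 ^ i) * nm x.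
Proof.
  pose proof (pow_lt _ (2 ^ i) Hrho) as Hp.
  induction k; intros z x Hz.
  - exists (-v (Cinv (Cpow z (2 ^ i)) *v Aj i z x)). split.
    + lpush (lin_iter (2 ^ i) (lb_lin HT)). rewrite Aj_inv' by assumption. simpl; vec.
    + rewrite nm_opp, vnorm_scal, Cabs_invpow by assumption.
      pose proof (Aj_bd i x Hz). pose proof (Rinv_0_lt_compat _ Hp). nra.
  - destruct (IHk z x Hz) as [g1 [E1 H1]]. destruct (IHk _ x (circ_rot (k + i) Hz)) as [g2 [E2 H2]].
    exists (Chalf *v (g1 +v g2)). split.
    + lpush (lin_iter (2 ^ i) (lb_lin HT)). rewrite E1, E2. simpl Nat.add.
      change (Aj (S (k + i)) z x) with (Chalf *v (Aj (k + i) z x +v Aj (k + i) (Cmul z (eC (k + i))) x)).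
      match goal with |- _ = x -v ?b => transitivity (Chalf *v (x +v x) -v b); [vec|now rewrite half_add] end.
    + rewrite nm_half. pose proof (nm_add g1 g2). lra.
Qed.

(** If [T^(2^i)] is [o(rho^(2^i))], the means tend to the identity, and the geometric tail brings
    them near it at an index [j] controlled by [Lam rho] alone. The gained factor 1/2 is what allows
    a radius to be lowered. *)
Lemma circle_small j : 32 * Lam * rho * (/2) ^ j <= 1 ->
  (forall delta, 0 < delta -> exists j0, forall j x, (j0 <= j)%nat -> nm (Nat.iter (2 ^ j) T x) <= delta * rho ^ (2 ^ j) * nm x) ->
  forall y, nm (Nat.iter (2 ^ j) T y) <= / 2 * rho ^ (2 ^ j) * nm y.
Proof.
  intros Hj HQ y. set (z := RtoC rho).
  assert (Hz : Cabs z = rho) by (apply Cabs_RtoC_pos; lra).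
  pose proof (pow_lt _ (2 ^ j) Hrho) as Hp.
  assert (Hl : forall x, lim (fun j => Aj j z x) x).
  { intros x eps He. pose proof (nm_ge0 x).
    destruct (HQ (eps / (C * nm x + 1))) as [j0 Hj0]; [apply Rdiv_lt_0_compat; nra|].
    exists j0; intros n Hn. rewrite <- Aj_inv' by assumption. rewrite vnorm_scal, Cabs_invpow by assumption.
    specialize (Hj0 n (Aj n z x) Hn). pose proof (pow_lt _ (2 ^ n) Hrho) as Hpn. pose proof (Rinv_0_lt_compat _ Hpn).
    apply Rle_lt_trans with (eps / (C * nm x + 1) * nm (Aj n z x)).
    - apply Rmult_le_reg_l with (rho ^ 2 ^ n); [assumption|]. rewrite <- Rmult_assoc, Rinv_r, Rmult_1_l by lra. lra.
    - pose proof (Aj_bd n x Hz). assert (0 < eps / (C * nm x + 1)) by (apply Rdiv_lt_0_compat; nra).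
      assert (eps / (C * nm x + 1) * (C * nm x + 1) = eps) by (field; nra). nra. }
  (* [Aj j z] sends [w] to [y], so the tail estimate at [w] compares [w] with [y], that is, bounds
     [T^(2^j) y]; the constant 32 makes the tail at most an eighth of the norm of [w]. *)
  set (w := y -v Cinv (Cpow z (2 ^ j)) *v Nat.iter (2 ^ j) T y).
  pose proof (Aj_tail j Hz (Hl w)) as Ht. rewrite (Aj_inv j y Hz : Aj j z w = y) in Ht.
  assert (Hw : nm (w -v y) <= / 8 * nm w).
  { eapply Rle_trans; [apply Ht|]. pose proof (nm_ge0 w). nra. }
  assert (E : nm (w -v y) = / rho ^ 2 ^ j * nm (Nat.iter (2 ^ j) T y)).
  { unfold w. rewrite <- Cabs_invpow with (z := z) by assumption. rewrite <- vnorm_scal, nm_swap. f_equal. vec. }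
  pose proof (nm_rev w y). pose proof (nm_ge0 y).
  assert (H1 : / rho ^ 2 ^ j * nm (Nat.iter (2 ^ j) T y) <= / 2 * nm y) by lra.
  apply Rmult_le_reg_l with (/ rho ^ 2 ^ j); [now apply Rinv_0_lt_compat|].
  eapply Rle_trans; [apply H1|]. right; field; lra.
Qed.
End Circle.

(** * Resolvent bounds and the spectral radius *)

Section Resolvent.
Variable Y : CBanach.
Variable T : op Y.
Hypothesis HT : lb T.
Variables c M : R.
Hypothesis Hc : 0 < c.
Variable Om : Cpx -> Prop.
Hypothesis HM : forall z, Om z -> Cabs z <= M.
Hypothesis H0 : ~ Om C0.
Hypothesis Hres : forall z, Om z ->
  exists R, (forall x, R (Dop T z x) = x) /\ (forall x, Dop T z (R x) = x) /\ (forall y, nm (R y) <= / c * nm y).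

(** [A0 z] is [- z] times the resolvent of [T] at [z]. The Lipschitz constant has one term from the
    factor [z] and one from the resolvent identity. *)
Lemma circle_data : exists A0 : Cpx -> op Y, (forall z, Om z -> linear (A0 z)) /\
  (forall z x, Om z -> nm (A0 z x) <= (M / c) * nm x) /\
  (forall z z' x, Om z -> Om z' -> nm (A0 z x -v A0 z' x) <= (/ c + M / c * / c) * Cabs (Csub z z') * nm x) /\
  (forall z x, Om z -> A0 z (x -v Cinv z *v T x) = x) /\
  (forall z x, Om z -> T (A0 z x) = A0 z (T x)).
Proof.
  (* The identity is a mere default outside [Om]. *)
  assert (H : forall z, exists R : op Y, Om z -> (forall x, R (Dop T z x) = x) /\ (forall x, Dop T z (R x) = x) /\ (forall y, nm (R y) <= / c * nm y)).
  { intro z. destruct (classic (Om z)) as [Hz|Hz]; [destruct (Hres Hz) as [R HR]; exists R; auto|exists opid; tauto]. }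
  apply choice in H. destruct H as [R HR].
  assert (HD : forall z, linear (Dop T z)) by (intro; apply lin_Dop, HT).
  assert (Hinj : forall z x y, Om z -> Dop T z x = Dop T z y -> x = y).
  { intros z x y Hz E. destruct (HR z Hz) as [H1 _]. now rewrite <- (H1 x), E. }
  assert (HRl : forall z, Om z -> linear (R z)).
  { intros z Hz. destruct (HR z Hz) as [_ [H2 _]]. split; intros; apply (Hinj z); auto; rewrite ?(lin_add _ _ (HD z)), ?(lin_scal _ _ (HD z)), !H2; reflexivity. }
  assert (Hz0 : forall z, Om z -> z <> C0) by (intros z Hz ->; contradiction).
  assert (Hc' : 0 < / c) by now apply Rinv_0_lt_compat.
  exists (fun z x => -v (z *v R z x)). split; [|split; [|split; [|split]]].
  - intros z Hz. pose proof (HRl z Hz) as Hl. split; intros; lpush Hl; vec.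
  - intros z x Hz. rewrite nm_opp, vnorm_scal. destruct (HR z Hz) as [_ [_ H3]]. specialize (H3 x). specialize (HM Hz).
    unfold Rdiv; rewrite Rmult_assoc. apply Rmult_le_compat; auto; [apply Cabs_ge0|apply nm_ge0].
  - intros z z' x Hz Hz'. destruct (HR z Hz) as [H1 [H2 H3]]. destruct (HR z' Hz') as [H1' [H2' H3']].
    assert (E : R z x -v R z' x = Csub z z' *v R z (R z' x)).
    { rewrite <- (H1 (R z' x)) at 1. rewrite <- (H2' x) at 1.
      pose proof (HRl z Hz) as Hl. rewrite <- (lin_sub _ _ Hl), <- (lin_scal _ _ Hl). f_equal. unfold Dop. vec. }
    replace (-v (z *v R z x) -v (-v (z' *v R z' x))) with (-v (Csub z z' *v R z' x +v z *v (R z x -v R z' x))) by vec.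
    rewrite E, nm_opp. eapply Rle_trans; [apply nm_add|]. rewrite !vnorm_scal.
    pose proof (H3 (R z' x)). pose proof (H3' x). pose proof (HM Hz). pose proof (Cabs_ge0 (Csub z z')). pose proof (Cabs_ge0 z).
    pose proof (nm_ge0 (R z (R z' x))). pose proof (nm_ge0 x). pose proof (nm_ge0 (R z' x)).
    assert (nm (R z (R z' x)) <= / c * (/ c * nm x)) by nra.
    assert (Cabs z * nm (R z (R z' x)) <= M * (/ c * (/ c * nm x))) by (apply Rmult_le_compat; auto).
    replace ((/ c + M / c * / c) * Cabs (Csub z z') * nm x) with (Cabs (Csub z z') * (/ c * nm x) + Cabs (Csub z z') * (M * (/ c * (/ c * nm x)))) by (unfold Rdiv; ring).
    apply Rplus_le_compat; [now apply Rmult_le_compat_l|].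
    replace (Cabs z * (Cabs (Csub z z') * nm (R z (R z' x)))) with (Cabs (Csub z z') * (Cabs z * nm (R z (R z' x)))) by ring.
    now apply Rmult_le_compat_l.
  - intros z x Hz. destruct (HR z Hz) as [H1 _]. specialize (Hz0 z Hz). pose proof (HRl z Hz) as Hl.
    transitivity (R z (Dop T z x)); [|apply H1]. rewrite <- (lin_scal _ _ Hl), <- (lin_opp _ Hl). f_equal.
    unfold Dop. vec_pre; field; assumption.
  - intros z x Hz. destruct (HR z Hz) as [H1 [H2 _]]. lpush (lb_lin HT). do 2 f_equal.
    apply (Hinj z); [assumption|]. rewrite H2, <- K_Dop, H2 by apply HT. reflexivity.
Qed.
End Resolvent.

Lemma iter_bound (X : CBanach) (T : op X) B n x : 0 <= B -> (forall x, nm (T x) <= B * nm x) -> nm (Nat.iter n T x) <= B ^ n * nm x.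
Proof.
  intros HB H. induction n; simpl; [lra|]. eapply Rle_trans; [apply H|]. rewrite Rmult_assoc. now apply Rmult_le_compat_l.
Qed.
(** Division of the exponent by [N]; the constant [D] covers the finitely many remainders. *)
Lemma pow_bound_from_one (X : CBanach) (T : op X) r N : lb T -> 0 < r -> (1 <= N)%nat ->
  (forall x, nm (Nat.iter N T x) <= r ^ N * nm x) -> exists D, 0 < D /\ forall n x, nm (Nat.iter n T x) <= D * r ^ n * nm x.
Proof.
  intros HT Hr HN H. destruct (lb_bound HT) as [B [HB HBb]].
  assert (Hf : forall k, exists D, 0 < D /\ forall n x, (n < k)%nat -> nm (Nat.iter n T x) <= D * r ^ n * nm x).
  { induction k as [|k [D [HD IH]]]; [exists 1; split; [lra|intros; lia]|].
    exists (D + B ^ k / r ^ k). pose proof (pow_lt _ k HB). pose proof (pow_lt _ k Hr).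
    assert (0 < B ^ k / r ^ k) by now apply Rdiv_lt_0_compat. split; [lra|].
    intros n x Hn. pose proof (nm_ge0 x). destruct (Nat.eq_dec n k) as [->|Hne].
    - eapply Rle_trans; [apply iter_bound with (B := B); [lra|assumption]|].
      apply Rmult_le_compat_r; [assumption|]. rewrite Rmult_plus_distr_r.
      replace (B ^ k / r ^ k * r ^ k) with (B ^ k) by (field; lra). nra.
    - eapply Rle_trans; [apply IH; lia|]. pose proof (pow_lt _ n Hr).
      apply Rmult_le_compat_r; [assumption|]. apply Rmult_le_compat_r; lra. }
  destruct (Hf N) as [D [HD HDb]]. exists D; split; [assumption|].
  intro n. induction n as [n IHn] using (well_founded_ind Nat.lt_wf_0); intro x.
  destruct (Nat.lt_ge_cases n N) as [Hn|Hn]; [now apply HDb|].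
  assert (Hm : exists m, n = (N + m)%nat) by (exists (n - N)%nat; lia). destruct Hm as [m ->].
  rewrite Nat.iter_add. eapply Rle_trans; [apply H|].
  pose proof (pow_lt _ N Hr). specialize (IHn m ltac:(lia) x). rewrite pow_add.
  replace (D * (r ^ N * r ^ m) * nm x) with (r ^ N * (D * r ^ m * nm x)) by ring.
  apply Rmult_le_compat_l; lra.
Qed.

(* Cauchy's estimate, obtained by lowering the radius by the fixed factor [theta] until [rho] is reached. *)
Lemma spectral_radius_bound (X : CBanach) (T : op X) rho M c : lb T -> 0 < rho -> 0 < c ->
  (forall x, nm (T x) <= M / 2 * nm x) -> rho <= M ->
  (forall z, rho <= Cabs z <= M ->
     exists R, (forall x, R (Dop T z x) = x) /\ (forall x, Dop T z (R x) = x) /\ (forall y, nm (R y) <= / c * nm y)) ->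
  exists D, 0 < D /\ forall n x, nm (Nat.iter n T x) <= D * rho ^ n * nm x.
Proof.
  intros HT Hrho Hc HTM HM Hres.
  destruct (@circle_data X T HT c M Hc (fun z => rho <= Cabs z <= M)) as [A0 [P1 [P2 [P3 [P4 P5]]]]]; auto.
  { intros z [_ H]; exact H. }
  { rewrite Cabs_C0; lra. }
  assert (HM0 : 0 < M) by lra. assert (Hc' : 0 < / c) by now apply Rinv_0_lt_compat.
  set (Lam := / c + M / c * / c) in *.
  assert (HLam : 0 < Lam). { unfold Lam. assert (0 < M / c * / c) by (apply Rmult_lt_0_compat; [apply Rdiv_lt_0_compat|]; lra). lra. }
  (* One index [j] serves every radius between [rho] and [M], so each lowering of the radius is by
     the same factor. *)
  destruct (@pow_small (/2) (32 * Lam * M) 1) as [j Hj]; [lra|lra|]. specialize (Hj j (le_n _)).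
  set (N := (2 ^ j)%nat). assert (HN : (1 <= N)%nat) by (unfold N; clear; induction j; simpl; lia).
  set (Q := fun r => forall delta, 0 < delta -> exists j0, forall j x, (j0 <= j)%nat -> nm (Nat.iter (2 ^ j) T x) <= delta * r ^ (2 ^ j) * nm x).
  assert (HQN : forall r, rho <= r <= M -> Q r -> forall x, nm (Nat.iter N T x) <= / 2 * r ^ N * nm x).
  { intros r Hr HQ. apply (@circle_small X T HT r (M / c) Lam) with (A0 := A0); try lra; auto.
    - unfold Rdiv; apply Rmult_le_pos; lra.
    - intros z Hz; apply P1; lra.
    - intros z x Hz; apply P2; lra.
    - intros z z' x Hz Hz'; apply P3; lra.
    - intros z x Hz; apply P4; lra.
    - intros z x Hz; apply P5; lra.
    - assert (32 * Lam * r * (/ 2) ^ j <= 32 * Lam * M * (/ 2) ^ j); [|lra].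
      apply Rmult_le_compat_r; [apply pow_le; lra|]. apply Rmult_le_compat_l; lra. }
  assert (HN1 : 1 <= INR N) by (apply (le_INR 1); assumption).
  (* By Bernoulli's inequality [theta^N >= 3/4], so the bound [r'^N / 2] is at most
     [2/3 (theta r')^N] and the smaller radius inherits the property [Q]. *)
  set (theta := 1 - / (4 * INR N)).
  assert (Hth : 0 < / (4 * INR N) <= / 4). { split; [apply Rinv_0_lt_compat; lra|apply Rinv_le_contravar; lra]. }
  assert (Hth2 : 3 / 4 <= theta ^ N).
  { assert (Hb : forall n, 1 - INR n * / (4 * INR N) <= theta ^ n).
    { induction n; [simpl; lra|]. rewrite S_INR. simpl pow.
      assert (0 <= theta <= 1) by (unfold theta; lra).
      destruct (Rle_lt_dec 0 (1 - INR n * / (4 * INR N))) as [Hp|Hp].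
      - assert (theta * (1 - INR n * / (4 * INR N)) <= theta * theta ^ n) by (apply Rmult_le_compat_l; lra).
        pose proof (pos_INR n). unfold theta in *. nra.
      - assert (0 <= theta * theta ^ n) by (apply Rmult_le_pos; [|apply pow_le]; lra). lra. }
    eapply Rle_trans; [|apply Hb]. right; field; lra. }
  assert (Hdown : forall r r', rho <= r' <= M -> theta * r' <= r <= r' -> Q r' -> Q r).
  { intros r r' Hr' [Hr1 Hr2] HQ delta Hd.
    assert (Hthp : 0 < theta) by (unfold theta; lra).
    assert (Hr0 : 0 < r). { apply Rlt_le_trans with (theta * r'); [apply Rmult_lt_0_compat; lra|lra]. }
    assert (HNr : forall x, nm (Nat.iter N T x) <= (2 / 3 * r ^ N) * nm x).
    { intro x. eapply Rle_trans; [apply HQN; eassumption|]. apply Rmult_le_compat_r; [apply nm_ge0|].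
      pose proof (pow_lt _ N (ltac:(lra) : 0 < r')).
      assert ((theta * r') ^ N <= r ^ N) by (apply pow_incr; split; [apply Rmult_le_pos; lra|lra]).
      rewrite Rpow_mult_distr in *. nra. }
    destruct (@pow_small (2/3) 1 delta) as [k0 Hk0]; [lra|assumption|].
    exists (j + k0)%nat. intros j' x Hj'.
    replace (2 ^ j')%nat with (2 ^ (j' - j) * N)%nat.
    2:{ unfold N. rewrite <- Nat.pow_add_r. f_equal; lia. }
    assert (Hit : forall m x, nm (Nat.iter (m * N) T x) <= (2 / 3 * r ^ N) ^ m * nm x).
    { pose proof (pow_lt _ N Hr0). clear x. intro m; induction m; intro x; simpl; [lra|]. rewrite Nat.iter_add.
      eapply Rle_trans; [apply HNr|]. rewrite (Rmult_assoc (2 / 3 * r ^ N)). apply Rmult_le_compat_l; [lra|]. apply IHm. }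
    eapply Rle_trans; [apply Hit|]. apply Rmult_le_compat_r; [apply nm_ge0|].
    rewrite Rpow_mult_distr, <- pow_mult. rewrite (Nat.mul_comm N). apply Rmult_le_compat_r; [apply pow_le; lra|].
    specialize (Hk0 (2 ^ (j' - j))%nat). rewrite Rmult_1_l in Hk0. left; apply Hk0.
    assert (forall a, (a <= 2 ^ a)%nat). { clear. induction a; simpl; [lia|]. pose proof (Nat.pow_nonzero 2 a). lia. }
    specialize (H (j' - j)%nat). lia. }
  assert (HQM : Q M).
  { intros delta Hd. destruct (@pow_small (/2) 1 delta) as [k0 Hk0]; [lra|assumption|].
    exists k0; intros j' x Hj'. eapply Rle_trans; [apply iter_bound with (B := M / 2); [lra|assumption]|].
    apply Rmult_le_compat_r; [apply nm_ge0|]. unfold Rdiv. rewrite Rpow_mult_distr, Rmult_comm.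
    apply Rmult_le_compat_r; [apply pow_le; lra|].
    specialize (Hk0 (2 ^ j')%nat). rewrite Rmult_1_l in Hk0. left; apply Hk0.
    assert (forall a, (a <= 2 ^ a)%nat). { clear. induction a; simpl; [lia|]. pose proof (Nat.pow_nonzero 2 a). lia. }
    specialize (H j'). lia. }
  assert (Hthp : 0 < theta < 1) by (unfold theta; lra).
  assert (HQ : forall k r, rho <= r <= M -> M * theta ^ k <= r -> Q r).
  { induction k; intros r Hr Hk.
    - simpl in Hk. replace r with M by lra. assumption.
    - destruct (Rle_lt_dec (r / theta) M) as [Hle|Hlt].
      + assert (E : theta * (r / theta) = r) by (field; lra).
        assert (Hrr : r <= r / theta). { apply Rmult_le_reg_l with theta; [lra|]. rewrite E. nra. }
        apply Hdown with (r' := r / theta); [lra|lra|]. apply IHk; [lra|].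
        apply Rmult_le_reg_l with theta; [lra|]. rewrite E. simpl in Hk. lra.
      + apply Hdown with (r' := M); [lra| |assumption]. split; [|lra].
        assert (E : theta * (r / theta) = r) by (field; lra). rewrite <- E. apply Rmult_le_compat_l; lra. }
  destruct (@pow_small theta M rho) as [k Hk]; [lra|assumption|]. specialize (Hk k (le_n _)).
  apply pow_bound_from_one with (N := N); auto. intro x.
  eapply Rle_trans; [apply HQN; [split; [apply Rle_refl|assumption]|]|].
  - apply (HQ k); lra.
  - apply Rmult_le_compat_r; [apply nm_ge0|]. pose proof (pow_lt _ N Hrho). lra.
Qed.

(** For a compact operator absence of eigenvalues outside the circle gives a resolvent bound uniform
    on the whole annulus up to [M]. The norm bound is doubled in [M] to meet the starting condition
    of [spectral_radius_bound]. *)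
Lemma compact_radius (X : CBanach) (K : op X) rho : compact_op K -> 0 < rho ->
  (forall z x, rho <= Cabs z -> K x = z *v x -> x = vzero X) ->
  exists D, 0 < D /\ forall n x, nm (Nat.iter n K x) <= D * rho ^ n * nm x.
Proof.
  intros HK Hrho Hno. destruct (lb_bound (compact_lb HK)) as [B [HB HBb]].
  set (M := Rmax (2 * B) rho).
  assert (HM1 : 2 * B <= M) by apply Rmax_l. assert (HM2 : rho <= M) by apply Rmax_r.
  destruct (@lower_bound_unif X K (fun _ => True) (fun z => rho <= Cabs z <= M) M HK) as [c [Hc Hlow]].
  - repeat split.
  - intros u l _ _; exact I.
  - intros z l Hz Hl. assert (Hd : forall eps, 0 < eps -> rho - eps <= Cabs l <= M + eps).
    { intros eps He. destruct (Hl eps He) as [N HN]. specialize (HN N (le_n _)). specialize (Hz N).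
      pose proof (Cabs_tri (Csub (z N) l) l). replace (Cadd (Csub (z N) l) l) with (z N) in H by ring.
      pose proof (Cabs_tri (Copp (Csub (z N) l)) (z N)). replace (Cadd (Copp (Csub (z N) l)) (z N)) with l in H0 by ring.
      rewrite Cabs_opp in H0. lra. }
    split; apply Rnot_lt_le; intro Hlt.
    + specialize (Hd ((rho - Cabs l) / 2) ltac:(lra)). lra.
    + specialize (Hd ((Cabs l - M) / 2) ltac:(lra)). lra.
  - intros z [_ H]; exact H.
  - rewrite Cabs_C0; lra.
  - intros z x [Hz _] _ E. now apply (Hno z).
  - apply spectral_radius_bound with (M := M) (c := c); auto.
    + now apply compact_lb.
    + intro x. eapply Rle_trans; [apply HBb|]. apply Rmult_le_compat_r; [apply nm_ge0|]. lra.
    + intros z Hz. destruct (@resolvent_exists X K z c HK) as [R [_ [H1 [H2 H3]]]]; auto.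
      * apply Cabs_neq0; lra.
      * exists R; auto.
Qed.

Lemma quasinil_of_no_eigen (X : CBanach) (K : op X) : compact_op K ->
  (forall z x, z <> C0 -> K x = z *v x -> x = vzero X) -> quasinilpotent K.
Proof.
  intros HK H eps He.
  destruct (@compact_radius X K (eps / 2) HK) as [D [HD HDb]]; [lra| |].
  - intros z x Hz. apply H. apply Cabs_neq0; lra.
  - destruct (@pow_small (/2) D 1) as [N HN]; [lra|lra|].
    exists N. intros n Hn x _. specialize (HN n Hn). eapply Rle_trans; [apply HDb|].
    apply Rmult_le_compat_r; [apply nm_ge0|]. unfold Rdiv. rewrite Rpow_mult_distr.
    pose proof (pow_lt _ n He). nra.
Qed.
Lemma quasinil_decays (X : CBanach) (K : op X) x : lb K -> quasinilpotent K -> decays K x.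
Proof.
  intros HK H eps He. destruct (H eps He) as [N HN].
  destruct (@pow_bound_from_one X K eps (S N) HK He) as [D [_ HD]]; [lia| |].
  - intro y. apply HN; [lia|exact I].
  - exists (D * nm x). intro n. specialize (HD n x). lra.
Qed.

(** * Subquotients, spaces of operators and powers *)

Lemma inf_of_spec (E : R -> Prop) : (exists r, E r) -> (forall r, E r -> 0 <= r) ->
  (forall r, E r -> inf_of E <= r) /\ (forall m, (forall r, E r -> m <= r) -> m <= inf_of E).
Proof.
  intros [r0 Hr0] Hpos. unfold inf_of.
  assert (H : is_lub (fun y => E (- y)) (sup_of (fun y => E (- y)))).
  { apply sup_of_lub.
    - exists 0. intros y Hy. specialize (Hpos _ Hy). lra.
    - exists (- r0). now rewrite Ropp_involutive. }
  destruct H as [H1 H2]. split.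
  - intros r Hr. assert (- r <= sup_of (fun y => E (- y))) by (apply H1; now rewrite Ropp_involutive). lra.
  - intros m Hm. assert (sup_of (fun y => E (- y)) <= - m); [|lra].
    apply H2. intros y Hy. specialize (Hm _ Hy). lra.
Qed.

(** * The Banach space [X1 / X2] *)

Section SubQuot.
Variable X : CBanach.
Variables X1 X2 : X -> Prop.
Hypothesis H1s : subsp X1.
Hypothesis H1c : closed X1.
Hypothesis H2s : subsp X2.
Hypothesis H2c : closed X2.
Hypothesis H21 : forall x, X2 x -> X1 x.

(** [epsilon] applied to equivalent predicates returns equal values, by extensionality, so congruent
    vectors get the same representative and equality of classes is plain equality. *)
Definition sq_rep (x : X) : X := epsilon (inhabits (vzero X)) (fun y => X1 y /\ X2 (x -v y)).
Lemma sq_rep_spec x : X1 x -> X1 (sq_rep x) /\ X2 (x -v sq_rep x).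
Proof.
  intro Hx. apply (epsilon_spec (inhabits (vzero X)) (fun y => X1 y /\ X2 (x -v y))).
  exists x; split; [assumption|]. rewrite vadd_oppr. now apply subsp_0.
Qed.
Lemma sq_rep_eq x y : X2 (x -v y) -> sq_rep x = sq_rep y.
Proof.
  intro H. unfold sq_rep. f_equal. apply functional_extensionality; intro z. apply propositional_extensionality.
  split; intros [Hz H']; split; auto.
  - replace (y -v z) with ((x -v z) -v (x -v y)) by vec. now apply subsp_sub.
  - replace (x -v z) with ((y -v z) +v (x -v y)) by vec. now apply subsp_add.
Qed.
Lemma sq_rep_idem x : X1 x -> sq_rep (sq_rep x) = sq_rep x.
Proof.
  intro Hx. symmetry; apply sq_rep_eq. apply sq_rep_spec, Hx.
Qed.

Definition sqcar : Type := {x : X | X1 x /\ sq_rep x = x}.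
Definition sqlift (u : sqcar) : X := proj1_sig u.
Lemma sqlift_in u : X1 (sqlift u). Proof. exact (proj1 (proj2_sig u)). Qed.
Lemma sq_ex (x : X) : exists u : sqcar, X1 x -> X2 (x -v sqlift u).
Proof.
  destruct (classic (X1 x)) as [Hx|Hx].
  - exists (exist _ (sq_rep x) (conj (proj1 (sq_rep_spec Hx)) (sq_rep_idem Hx))). intros _. apply (sq_rep_spec Hx).
  - assert (H0 : X1 (vzero X)) by now apply subsp_0.
    exists (exist _ (sq_rep (vzero X)) (conj (proj1 (sq_rep_spec H0)) (sq_rep_idem H0))). tauto.
Qed.
(* Classes are chosen representatives; [sqcls x] is meaningful only for [x] in [X1]. *)
Definition sqcls (x : X) : sqcar := proj1_sig (constructive_indefinite_description _ (sq_ex x)).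
Lemma sqcls_spec x : X1 x -> X2 (x -v sqlift (sqcls x)).
Proof. intro Hx. unfold sqcls. destruct (constructive_indefinite_description _ (sq_ex x)) as [u Hu]. auto. Qed.
Lemma sq_eq u v : X2 (sqlift u -v sqlift v) -> u = v.
Proof.
  intro H. apply sq_rep_eq in H. destruct u as [x [Hx Ex]], v as [y [Hy Ey]]. simpl in H.
  assert (x = y) by congruence. subst y. f_equal. apply proof_irrelevance.
Qed.
Lemma sqcls_lift u : sqcls (sqlift u) = u.
Proof.
  apply sq_eq. replace (sqlift (sqcls (sqlift u)) -v sqlift u) with (-v (sqlift u -v sqlift (sqcls (sqlift u)))) by vec.
  apply subsp_opp; [assumption|]. apply sqcls_spec, sqlift_in.
Qed.
Lemma sqcls_eq x y : X1 x -> X1 y -> X2 (x -v y) -> sqcls x = sqcls y.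
Proof.
  intros Hx Hy H. apply sq_eq. pose proof (sqcls_spec Hx). pose proof (sqcls_spec Hy).
  replace (sqlift (sqcls x) -v sqlift (sqcls y)) with ((x -v y) -v (x -v sqlift (sqcls x)) +v (y -v sqlift (sqcls y))) by vec.
  apply subsp_add; auto. now apply subsp_sub.
Qed.
Lemma sqcls_eq_inv x y : X1 x -> X1 y -> sqcls x = sqcls y -> X2 (x -v y).
Proof.
  intros Hx Hy H. pose proof (sqcls_spec Hx) as Ha. pose proof (sqcls_spec Hy) as Hb. rewrite <- H in Hb.
  replace (x -v y) with ((x -v sqlift (sqcls x)) -v (y -v sqlift (sqcls x))) by vec. now apply subsp_sub.
Qed.

Definition qn (x : X) : R := inf_of (fun r => exists z, X2 z /\ r = nm (x -v z)).
Lemma qn_spec x : (forall z, X2 z -> qn x <= nm (x -v z)) /\ (forall m, (forall z, X2 z -> m <= nm (x -v z)) -> m <= qn x).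
Proof.
  destruct (@inf_of_spec (fun r => exists z, X2 z /\ r = nm (x -v z))) as [A B].
  - exists (nm (x -v vzero X)), (vzero X); split; [now apply subsp_0|reflexivity].
  - intros r [z [_ ->]]; apply nm_ge0.
  - split.
    + intros z Hz; apply A; eauto.
    + intros m Hm; apply B. intros r [z [Hz ->]]; auto.
Qed.
Lemma qn_near x eps : 0 < eps -> exists z, X2 z /\ nm (x -v z) < qn x + eps.
Proof.
  intro He. apply NNPP; intro Hn. assert (qn x + eps <= qn x); [|lra].
  apply (qn_spec x). intros z Hz. apply Rnot_lt_le; intro. apply Hn; eauto.
Qed.
Lemma qn_ge0 x : 0 <= qn x.
Proof. apply (qn_spec x). intros; apply nm_ge0. Qed.
Lemma qn_le x : qn x <= nm x.
Proof. replace x with (x -v vzero X) at 2 by vec. apply (qn_spec x). now apply subsp_0. Qed.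
Lemma qn_shift x y : X2 (x -v y) -> qn x <= qn y.
Proof.
  intro H. apply (qn_spec y). intros z Hz.
  replace (y -v z) with (x -v ((x -v y) +v z)) by vec. apply (qn_spec x). now apply subsp_add.
Qed.
Lemma qn_cls x : X1 x -> qn (sqlift (sqcls x)) = qn x.
Proof.
  intro Hx. pose proof (sqcls_spec Hx). apply Rle_antisym; apply qn_shift; [|assumption].
  replace (sqlift (sqcls x) -v x) with (-v (x -v sqlift (sqcls x))) by vec. now apply subsp_opp.
Qed.

Definition sqadd (u v : sqcar) := sqcls (sqlift u +v sqlift v).
Definition sqopp (u : sqcar) := sqcls (-v sqlift u).
Definition sqzero := sqcls (vzero X).
Definition sqscal c (u : sqcar) := sqcls (c *v sqlift u).
Definition sqnorm (u : sqcar) := qn (sqlift u).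

Lemma sqlift_cls x : X1 x -> exists z, X2 z /\ sqlift (sqcls x) = x +v z.
Proof.
  intro Hx. exists (sqlift (sqcls x) -v x). split; [|vec].
  replace (sqlift (sqcls x) -v x) with (-v (x -v sqlift (sqcls x))) by vec. apply subsp_opp; auto. now apply sqcls_spec.
Qed.

Lemma sqcls_add x y : X1 x -> X1 y -> sqcls (x +v y) = sqadd (sqcls x) (sqcls y).
Proof.
  intros Hx Hy. unfold sqadd. apply sqcls_eq; [now apply subsp_add|apply subsp_add; auto; apply sqlift_in|].
  destruct (sqlift_cls Hx) as [z [Hz ->]]. destruct (sqlift_cls Hy) as [w [Hw ->]].
  replace (x +v y -v (x +v z +v (y +v w))) with (-v (z +v w)) by vec. apply subsp_opp; auto. now apply subsp_add.
Qed.
Lemma sqcls_scal c x : X1 x -> sqcls (c *v x) = sqscal c (sqcls x).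
Proof.
  intros Hx. unfold sqscal. apply sqcls_eq; [now apply subsp_scal|apply subsp_scal; auto; apply sqlift_in|].
  destruct (sqlift_cls Hx) as [z [Hz ->]].
  replace (c *v x -v c *v (x +v z)) with (Copp c *v z) by vec. now apply subsp_scal.
Qed.
Lemma sqcls_opp x : X1 x -> sqcls (-v x) = sqopp (sqcls x).
Proof.
  intros Hx. unfold sqopp. apply sqcls_eq; [now apply subsp_opp|apply subsp_opp; auto; apply sqlift_in|].
  destruct (sqlift_cls Hx) as [z [Hz ->]].
  replace (-v x -v -v (x +v z)) with z by vec. assumption.
Qed.

(** A fast subsequence has differences of quotient norm below [2^-k]; these are lifted to vectors of
    that norm and summed in [X]. *)
Lemma sq_complete (u : nat -> sqcar) :
    (forall eps, eps > 0 -> exists N, forall m n, (m >= N)%nat -> (n >= N)%nat ->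
        sqnorm (sqadd (u m) (sqopp (u n))) < eps) ->
    exists l, forall eps, eps > 0 -> exists N, forall n, (n >= N)%nat -> sqnorm (sqadd (u n) (sqopp l)) < eps.
Proof.
  assert (Hsub : forall x v, X1 x -> sqnorm (sqadd v (sqopp (sqcls x))) = qn (sqlift v -v x)).
  { intros x v Hx. rewrite <- (sqcls_lift v) at 1. pose proof (sqlift_in v).
    rewrite <- sqcls_opp, <- sqcls_add by (auto; now apply subsp_opp). unfold sqnorm.
    apply qn_cls. now apply subsp_sub. }
  assert (Hsub' : forall v w, sqnorm (sqadd v (sqopp w)) = qn (sqlift v -v sqlift w)).
  { intros v w. rewrite <- (sqcls_lift w) at 1. apply Hsub, sqlift_in. }
  intro Hcau.
  destruct (@subseq_choice (fun k n => forall m m', (n <= m)%nat -> (n <= m')%nat -> qn (sqlift (u m) -v sqlift (u m')) < (/2) ^ k)) as [phi [Hphi HP]].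
  { intros k N. destruct (Hcau ((/2) ^ k)) as [N' HN']; [apply pow_lt; lra|].
    exists (max N N'); split; [lia|]. intros m m' Hm Hm'. rewrite <- Hsub'. apply HN'; lia. }
  assert (Hd : forall k, exists d, X1 d /\ X2 (d -v (sqlift (u (phi (S k))) -v sqlift (u (phi k)))) /\ nm d < (/2) ^ k).
  { intro k. specialize (HP k (phi (S k)) (phi k)). pose proof (Hphi k).
    specialize (HP ltac:(lia) (le_n _)). set (x := sqlift (u (phi (S k))) -v sqlift (u (phi k))) in *.
    destruct (@qn_near x ((/2) ^ k - qn x)) as [z [Hz Hn]]; [lra|].
    exists (x -v z). split; [|split; [|lra]].
    - apply subsp_sub; auto. apply subsp_sub; auto; apply sqlift_in.
    - replace (x -v z -v x) with (-v z) by vec. now apply subsp_opp. }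
  apply choice in Hd. destruct Hd as [d Hd].
  pose (x := fix x k := match k with O => sqlift (u (phi O)) | S k => x k +v d k end).
  assert (Hx1 : forall k, X1 (x k)).
  { induction k; simpl; [apply sqlift_in|]. apply subsp_add; auto. apply Hd. }
  assert (Hx2 : forall k, X2 (x k -v sqlift (u (phi k)))).
  { induction k; simpl; [rewrite vadd_oppr; now apply subsp_0|].
    replace (x k +v d k -v sqlift (u (phi (S k)))) with ((x k -v sqlift (u (phi k))) +v (d k -v (sqlift (u (phi (S k))) -v sqlift (u (phi k))))) by vec.
    apply subsp_add; auto. apply Hd. }
  destruct (@complete_geom X x 1 (/2)) as [l Hl]; [lra| |].
  { intro k; simpl. replace (x k +v d k -v x k) with (d k) by vec. destruct (Hd k) as [_ [_ H]]. lra. }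
  assert (Hl1 : X1 l) by (eapply H1c; eauto).
  exists (sqcls l). intros eps He.
  destruct (Hcau (eps / 2)) as [N1 HN1]; [lra|]. destruct (Hl (eps / 2)) as [N2 HN2]; [lra|].
  exists N1. intros n Hn. rewrite Hsub by assumption.
  set (k := max N1 N2). specialize (HN2 k ltac:(lia)). pose proof (incr_ge Hphi k).
  specialize (HN1 n (phi k) Hn ltac:(lia)). rewrite Hsub' in HN1.
  destruct (@qn_near (sqlift (u n) -v sqlift (u (phi k))) (eps / 2 - qn (sqlift (u n) -v sqlift (u (phi k))))) as [z [Hz Hn']]; [lra|].
  apply Rle_lt_trans with (nm (sqlift (u n) -v l -v (z -v (x k -v sqlift (u (phi k)))))).
  - apply qn_spec. apply subsp_sub; auto.
  - replace (sqlift (u n) -v l -v (z -v (x k -v sqlift (u (phi k))))) with ((sqlift (u n) -v sqlift (u (phi k)) -v z) +v (x k -v l)) by vec.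
    eapply Rle_lt_trans; [apply nm_add|]. lra.
Qed.

(** Ended by [Defined], since the operations on classes have to unfold by conversion afterwards. *)
Definition SubQuot : CBanach.
Proof.
  assert (Hz : X1 (vzero X)) by now apply subsp_0.
  assert (Hl := sqlift_in).
  refine (@Build_CBanach sqcar sqadd sqopp sqzero sqscal sqnorm _ _ _ _ _ _ _ _ _ _ _ sq_complete).
  - intros x y z. rewrite <- (sqcls_lift x), <- (sqcls_lift y), <- (sqcls_lift z).
    rewrite <- !sqcls_add by (auto; apply subsp_add; auto). now rewrite vadd_assoc.
  - intros x y. unfold sqadd. now rewrite vadd_comm.
  - intros x. rewrite <- (sqcls_lift x). unfold sqzero. rewrite <- sqcls_add by auto. now rewrite vadd_0.
  - intros x. rewrite <- (sqcls_lift x). unfold sqzero. rewrite <- sqcls_opp, <- sqcls_add by (auto; now apply subsp_opp). now rewrite vadd_opp.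
  - intros x. unfold sqscal. rewrite vscal_1. apply sqcls_lift.
  - intros a b x. rewrite <- (sqcls_lift x). rewrite <- !sqcls_scal by (auto; now apply subsp_scal). now rewrite vscal_mul.
  - intros a x y. rewrite <- (sqcls_lift x), <- (sqcls_lift y).
    rewrite <- sqcls_add, <- !sqcls_scal, <- sqcls_add by (auto; (try now apply subsp_scal); now apply subsp_add). now rewrite vscal_addv.
  - intros a b x. rewrite <- (sqcls_lift x).
    rewrite <- !sqcls_scal, <- sqcls_add by (auto; now apply subsp_scal). now rewrite vscal_adds.
  - intro x. split.
    + intro H. apply sq_eq. unfold sqzero. destruct (sqlift_cls Hz) as [z [HZ ->]].
      replace (sqlift x -v (vzero X +v z)) with (sqlift x -v z) by vec. apply subsp_sub; auto.
      apply (closed_closure H2c). intros eps He. destruct (@qn_near (sqlift x) eps He) as [w [Hw Hn]].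
      exists w; split; [assumption|]. unfold sqnorm in H; lra.
    + intros ->. unfold sqnorm, sqzero. rewrite qn_cls by assumption. apply Rle_antisym; [|apply qn_ge0].
      eapply Rle_trans; [apply qn_le|]. rewrite nm_0; lra.
  - intros x y. unfold sqnorm, sqadd. rewrite qn_cls by (apply subsp_add; auto).
    apply le_epsilon. intros eps He.
    destruct (@qn_near (sqlift x) (eps / 2)) as [z [HZ Hn]]; [lra|].
    destruct (@qn_near (sqlift y) (eps / 2)) as [w [Hw Hm]]; [lra|].
    apply Rle_trans with (nm (sqlift x +v sqlift y -v (z +v w))); [apply qn_spec; now apply subsp_add|].
    replace (sqlift x +v sqlift y -v (z +v w)) with ((sqlift x -v z) +v (sqlift y -v w)) by vec.
    eapply Rle_trans; [apply nm_add|]. lra.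
  - intros a x. unfold sqnorm, sqscal. rewrite qn_cls by (apply subsp_scal; auto).
    assert (Hle : forall b y, qn (b *v y) <= Cabs b * qn y).
    { intros b y. destruct (classic (b = C0)) as [->|Hb].
      - rewrite Cabs_C0, Rmult_0_l. eapply Rle_trans; [apply qn_le|]. rewrite vnorm_scal, Cabs_C0; lra.
      - pose proof (Cabs_pos Hb). apply Rmult_le_reg_l with (/ Cabs b); [now apply Rinv_0_lt_compat|].
        rewrite <- Rmult_assoc, Rinv_l, Rmult_1_l by lra. apply qn_spec. intros z HZ.
        apply Rmult_le_reg_l with (Cabs b); [assumption|]. rewrite <- Rmult_assoc, Rinv_r, Rmult_1_l by lra.
        rewrite <- vnorm_scal. replace (b *v (y -v z)) with (b *v y -v b *v z) by vec. apply qn_spec. now apply subsp_scal. }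
    apply Rle_antisym; [apply Hle|].
    destruct (classic (a = C0)) as [->|Ha]; [rewrite Cabs_C0, Rmult_0_l; apply qn_ge0|].
    pose proof (Cabs_pos Ha).
    specialize (Hle (Cinv a) (a *v sqlift x)). rewrite Cabs_inv in Hle by assumption.
    replace (Cinv a *v (a *v sqlift x)) with (sqlift x) in Hle by (vec_pre; field; assumption).
    apply Rmult_le_reg_l with (/ Cabs a); [now apply Rinv_0_lt_compat|].
    rewrite <- Rmult_assoc, Rinv_l, Rmult_1_l by lra. assumption.
Defined.

Definition qcls : X -> SubQuot := sqcls.
Definition qlift : SubQuot -> X := sqlift.
Lemma qlift_in u : X1 (qlift u). Proof. apply sqlift_in. Qed.
Lemma qcls_lift u : qcls (qlift u) = u. Proof. apply sqcls_lift. Qed.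
Lemma qcls_add x y : X1 x -> X1 y -> qcls (x +v y) = qcls x +v qcls y.
Proof. apply sqcls_add. Qed.
Lemma qcls_scal c x : X1 x -> qcls (c *v x) = c *v qcls x.
Proof. apply sqcls_scal. Qed.
Lemma qcls_sub x y : X1 x -> X1 y -> qcls (x -v y) = qcls x -v qcls y.
Proof. intros. rewrite (vopp_scal y), (vopp_scal (qcls y)), <- qcls_scal, <- qcls_add; auto. now apply subsp_scal. Qed.
Lemma qcls_0 : qcls (vzero X) = vzero SubQuot. Proof. reflexivity. Qed.
Lemma qcls_eq0 x : X1 x -> (qcls x = vzero SubQuot <-> X2 x).
Proof.
  intro Hx. assert (H0 : X1 (vzero X)) by now apply subsp_0. rewrite <- qcls_0. split.
  - intro H. apply sqcls_eq_inv in H; auto. now replace x with (x -v vzero X) by vec.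
  - intro H. apply sqcls_eq; auto. now replace (x -v vzero X) with x by vec.
Qed.
Lemma qcls_norm x : X1 x -> nm (qcls x) <= nm x.
Proof. intro Hx. change (qn (sqlift (sqcls x)) <= nm x). rewrite qn_cls by assumption. apply qn_le. Qed.
Lemma qcls_near u eps : 0 < eps -> exists x, X1 x /\ qcls x = u /\ nm x < nm u + eps.
Proof.
  intro He. destruct (@qn_near (qlift u) eps He) as [z [Hz Hn]]. pose proof (qlift_in u).
  exists (qlift u -v z). assert (X1 (qlift u -v z)) by (apply subsp_sub; auto).
  split; [assumption|split; [|assumption]]. rewrite <- (qcls_lift u) at 2. apply sqcls_eq; auto.
  replace (qlift u -v z -v qlift u) with (-v z) by vec. now apply subsp_opp.
Qed.

(** Defined on chosen representatives for every [A]; it is the induced operator when [A] is linear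
    and preserves [X1] and [X2]. *)
Definition qind (A : op X) : op SubQuot := fun u => qcls (A (qlift u)).
Definition preserves (A : op X) : Prop := (forall x, X1 x -> X1 (A x)) /\ (forall x, X2 x -> X2 (A x)).
Lemma qind_cls A x : linear A -> preserves A -> X1 x -> qind A (qcls x) = qcls (A x).
Proof.
  intros HA [P1 P2] Hx. unfold qind. apply sqcls_eq; [apply P1, sqlift_in|auto|].
  rewrite <- lin_sub by assumption. apply P2. change (X2 (sqlift (sqcls x) -v x)).
  replace (sqlift (sqcls x) -v x) with (-v (x -v sqlift (sqcls x))) by vec. apply subsp_opp; auto. now apply sqcls_spec.
Qed.
Lemma qind_lin A : linear A -> preserves A -> linear (qind A).
Proof.
  intros HA HP. split.
  - intros u v. rewrite <- (qcls_lift u), <- (qcls_lift v). pose proof (qlift_in u). pose proof (qlift_in v).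
    rewrite <- qcls_add, !qind_cls, lin_add, qcls_add; auto; try now apply (proj1 HP). now apply subsp_add.
  - intros c u. rewrite <- (qcls_lift u). pose proof (qlift_in u).
    rewrite <- qcls_scal, !qind_cls, lin_scal, qcls_scal; auto; try now apply (proj1 HP). now apply subsp_scal.
Qed.
Lemma qind_bound A C u : linear A -> preserves A -> 0 <= C -> (forall x, nm (A x) <= C * nm x) -> nm (qind A u) <= C * nm u.
Proof.
  intros HA HP HC HB. apply le_epsilon. intros eps He.
  destruct (@qcls_near u (eps / (C + 1))) as [x [Hx [<- Hn]]]; [apply Rdiv_lt_0_compat; lra|].
  rewrite qind_cls by assumption. eapply Rle_trans; [apply qcls_norm; now apply (proj1 HP)|].
  eapply Rle_trans; [apply HB|]. assert (eps / (C + 1) * (C + 1) = eps) by (field; lra).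
  assert (0 < eps / (C + 1)) by (apply Rdiv_lt_0_compat; lra). nra.
Qed.
Lemma qind_iter A n x : linear A -> preserves A -> X1 x -> Nat.iter n (qind A) (qcls x) = qcls (Nat.iter n A x).
Proof.
  intros HA HP Hx. induction n; [reflexivity|].
  change (qind A (Nat.iter n (qind A) (qcls x)) = qcls (A (Nat.iter n A x))). rewrite IHn. apply qind_cls; auto.
  clear IHn. induction n; simpl; auto. now apply (proj1 HP).
Qed.
Lemma preserves_iter A n : preserves A -> preserves (Nat.iter n A).
Proof. intros [P1 P2]; split; induction n; simpl; auto. Qed.
Lemma qind_iter_fun A n : linear A -> preserves A -> forall u, Nat.iter n (qind A) u = qind (Nat.iter n A) u.
Proof.
  intros HA HP u. rewrite <- (qcls_lift u). rewrite qind_iter, qind_cls; auto using qlift_in, lin_iter, preserves_iter.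
Qed.
Lemma qind_compact A : compact_op A -> preserves A -> compact_op (qind A).
Proof.
  intros HA HP. pose proof (compact_lin HA) as HL. apply compact_intro; [now apply qind_lin|].
  intros u [M HM].
  assert (H : forall n, exists x, X1 x /\ qcls x = u n /\ nm x < nm (u n) + 1) by (intro n; apply qcls_near; lra).
  apply choice in H. destruct H as [x Hx].
  destruct (@compact_subseq X A x HA) as [phi [y [Hp Hy]]].
  { exists (M + 1); intro n. destruct (Hx n) as [_ [_ H]]. specialize (HM n). lra. }
  assert (Hy1 : X1 y). { apply (H1c (u := fun n => A (x (phi n)))); [intro; apply (proj1 HP), Hx|assumption]. }
  exists phi, (qcls y); split; [assumption|]. intros eps He. destruct (Hy eps He) as [N HN].
  exists N; intros n Hn. destruct (Hx (phi n)) as [Hx1 [<- _]]. rewrite qind_cls by assumption.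
  assert (X1 (A (x (phi n)))) by now apply (proj1 HP).
  rewrite <- qcls_sub by assumption. eapply Rle_lt_trans; [apply qcls_norm; now apply subsp_sub|]. now apply HN.
Qed.
Lemma qind_quasinil A : linear A -> preserves A -> quasinilpotent A -> quasinilpotent (qind A).
Proof.
  intros HA HP H eps He. destruct (H eps He) as [N HN]. exists N; intros n Hn u _.
  rewrite qind_iter_fun by assumption. apply qind_bound.
  - now apply lin_iter.
  - now apply preserves_iter.
  - apply pow_le; lra.
  - intro x; now apply HN.
Qed.
End SubQuot.

(** * Norm-closed spaces of operators as Banach spaces *)

Section OpSpace.
Variable X : CBanach.
(** Closedness in the operator norm, phrased by pointwise estimates so that it can be checked
    without computing norms. *)
Definition opclosed (Y : op X -> Prop) : Prop := forall T, lb T ->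
  (forall eps, 0 < eps -> exists S, Y S /\ forall x, nm (T x -v S x) <= eps * nm x) -> Y T.
Variable Y : op X -> Prop.
Hypothesis Ylb : forall T, Y T -> lb T.
Hypothesis Ysub : is_subspace Y.
Hypothesis Ycl : opclosed Y.

Definition ocar : Type := {T : op X | Y T}.
Definition oval (T : ocar) : op X := proj1_sig T.
Lemma oval_in T : Y (oval T). Proof. exact (proj2_sig T). Qed.
Lemma oval_lb T : lb (oval T). Proof. apply Ylb, oval_in. Qed.
Lemma ocar_eq (S T : ocar) : (forall x, oval S x = oval T x) -> S = T.
Proof.
  intro H. destruct S as [S HS], T as [T HT]. simpl in H.
  assert (S = T) by (apply functional_extensionality, H). subst T. f_equal. apply proof_irrelevance.
Qed.
Definition ozero : ocar := exist _ (@opzero X) (proj1 Ysub).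
Definition oadd (S T : ocar) : ocar := exist _ (opadd (oval S) (oval T)) (proj1 (proj2 Ysub) _ _ (oval_in S) (oval_in T)).
Definition oscal c (T : ocar) : ocar := exist _ (opscal c (oval T)) (proj2 (proj2 Ysub) c _ (oval_in T)).
Definition oopp (T : ocar) : ocar := oscal (Copp Cone) T.
Definition onorm (T : ocar) : R := opnorm (oval T).

Lemma ocomplete (u : nat -> ocar) :
    (forall eps, eps > 0 -> exists N, forall m n, (m >= N)%nat -> (n >= N)%nat ->
        onorm (oadd (u m) (oopp (u n))) < eps) ->
    exists l, forall eps, eps > 0 -> exists N, forall n, (n >= N)%nat -> onorm (oadd (u n) (oopp l)) < eps.
Proof.
  intro Hc.
  assert (Hc' : forall eps, 0 < eps -> exists N, forall m n, (N <= m)%nat -> (N <= n)%nat -> forall x, nm (oval (u m) x -v oval (u n) x) <= eps * nm x).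
  { intros eps He. destruct (Hc eps He) as [N HN]. exists N; intros m n Hm Hn x.
    specialize (HN m n Hm Hn). pose proof (opnorm_spec x (oval_lb (oadd (u m) (oopp (u n))))).
    change (oval (oadd (u m) (oopp (u n))) x) with (oval (u m) x +v Copp Cone *v oval (u n) x) in H.
    rewrite <- vopp_scal in H. pose proof (nm_ge0 x). unfold onorm in HN. nra. }
  assert (H : forall x, exists l, lim (fun n => oval (u n) x) l).
  { intro x. apply vcomplete. intros eps He. pose proof (nm_ge0 x).
    destruct (Hc' (eps / (nm x + 1))) as [N HN]; [apply Rdiv_lt_0_compat; lra|].
    exists N; intros m n Hm Hn. specialize (HN m n Hm Hn x).
    assert (eps / (nm x + 1) * (nm x + 1) = eps) by (field; lra).
    assert (0 < eps / (nm x + 1)) by (apply Rdiv_lt_0_compat; lra). nra. }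
  apply choice in H. destruct H as [T HT].
  assert (Hconv : forall eps, 0 < eps -> exists N, forall n, (N <= n)%nat -> forall x, nm (T x -v oval (u n) x) <= eps * nm x).
  { intros eps He. destruct (Hc' eps He) as [N HN]. exists N; intros n Hn x.
    apply (@lim_norm_le X (fun m => oval (u m) x -v oval (u n) x)).
    - apply lim_minus; [apply HT|apply lim_const].
    - exists N; intros m Hm. now apply HN. }
  assert (HTl : lb T).
  { split.
    - split.
      + intros x y. apply (lim_unique (HT (x +v y))). apply lim_ext with (fun n => oval (u n) x +v oval (u n) y).
        * intro n. symmetry. apply lin_add, oval_lb.
        * now apply lim_add.
      + intros c x. apply (lim_unique (HT (c *v x))). apply lim_ext with (fun n => c *v oval (u n) x).
        * intro n. symmetry. apply lin_scal, oval_lb.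
        * now apply lim_scal.
    - destruct (Hconv 1) as [N HN]; [lra|]. destruct (lb_bound (oval_lb (u N))) as [B [HB HBb]].
      exists (1 + B); intro x. specialize (HN N (le_n _) x). specialize (HBb x). pose proof (nm_rev (T x) (oval (u N) x)). lra. }
  assert (HTY : Y T).
  { apply Ycl; [assumption|]. intros eps He. destruct (Hconv eps He) as [N HN]. exists (oval (u N)); split; [apply oval_in|]. now apply HN. }
  exists (exist _ T HTY). intros eps He. destruct (Hconv (eps / 2)) as [N HN]; [lra|].
  exists N; intros n Hn. apply Rle_lt_trans with (eps / 2); [|lra]. apply opnorm_le; [apply oval_lb|lra|].
  intro x. change (nm (oval (u n) x +v Copp Cone *v T x) <= eps / 2 * nm x).
  rewrite <- vopp_scal, nm_swap. now apply HN.
Qed.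

Definition OpSpace : CBanach.
Proof.
  refine (@Build_CBanach ocar oadd oopp ozero oscal onorm _ _ _ _ _ _ _ _ _ _ _ ocomplete);
    try (intros; apply ocar_eq; intro; unfold oopp; simpl; unfold opadd, opscal, opzero; vec).
  - intro T. split.
    + intro H. apply ocar_eq; intro x. change (oval T x = vzero X). apply nm_le0.
      eapply Rle_trans; [apply opnorm_spec, oval_lb|]. unfold onorm in H. rewrite H. lra.
    + intros ->. apply Rle_antisym; [|apply opnorm_ge0, oval_lb]. apply opnorm_le; [apply oval_lb|lra|].
      intro x. change (nm (vzero X) <= 0 * nm x). rewrite nm_0; lra.
  - intros S T. pose proof (opnorm_ge0 (oval_lb S)). pose proof (opnorm_ge0 (oval_lb T)).
    apply opnorm_le; [apply oval_lb|unfold onorm; lra|]. intro x.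
    change (nm (oval S x +v oval T x) <= (onorm S + onorm T) * nm x).
    eapply Rle_trans; [apply nm_add|]. rewrite Rmult_plus_distr_r. apply Rplus_le_compat; apply opnorm_spec, oval_lb.
  - intros c T. unfold onorm.
    assert (Hle : forall c T, opnorm (oval (oscal c T)) <= Cabs c * opnorm (oval T)).
    { intros d S. apply opnorm_le; [apply oval_lb|apply Rmult_le_pos; [apply Cabs_ge0|apply opnorm_ge0, oval_lb]|].
      intro x. change (nm (d *v oval S x) <= Cabs d * opnorm (oval S) * nm x). rewrite vnorm_scal, Rmult_assoc.
      apply Rmult_le_compat_l; [apply Cabs_ge0|apply opnorm_spec, oval_lb]. }
    apply Rle_antisym; [apply Hle|].
    destruct (classic (c = C0)) as [->|Hc]; [rewrite Cabs_C0, Rmult_0_l; apply opnorm_ge0, oval_lb|].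
    pose proof (Cabs_pos Hc). specialize (Hle (Cinv c) (oscal c T)). rewrite Cabs_inv in Hle by assumption.
    replace (oscal (Cinv c) (oscal c T)) with T in Hle.
    2:{ apply ocar_eq; intro x. change (oval T x = Cinv c *v (c *v oval T x)). vec_pre; field; assumption. }
    apply Rmult_le_reg_l with (/ Cabs c); [now apply Rinv_0_lt_compat|].
    rewrite <- Rmult_assoc, Rinv_l, Rmult_1_l by lra. assumption.
Defined.
End OpSpace.

(** * Finite powers with the sum norm *)

Section Power.
Variable X : CBanach.
Variable I : Type.
Variable en : list I.
Hypothesis Hen : forall i, In i en.

Fixpoint rsum (f : I -> R) (l : list I) : R := match l with nil => 0 | i :: l => f i + rsum f l end.
Lemma rsum_le f g l : (forall i, f i <= g i) -> rsum f l <= rsum g l.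
Proof. intro H; induction l; simpl; [lra|]. specialize (H a); lra. Qed.
Lemma rsum_ge0 f l : (forall i, 0 <= f i) -> 0 <= rsum f l.
Proof. intro H; induction l; simpl; [lra|]. specialize (H a); lra. Qed.
Lemma rsum_add f g l : rsum (fun i => f i + g i) l = rsum f l + rsum g l.
Proof. induction l; simpl; lra. Qed.
Lemma rsum_mul c f l : rsum (fun i => c * f i) l = c * rsum f l.
Proof. induction l; simpl; [lra|rewrite IHl; lra]. Qed.
Lemma rsum_ext f g l : (forall i, f i = g i) -> rsum f l = rsum g l.
Proof. intro H; induction l; simpl; [lra|now rewrite H, IHl]. Qed.
Lemma rsum_in f l i : (forall i, 0 <= f i) -> In i l -> f i <= rsum f l.
Proof.
  intro H; induction l; simpl; [tauto|]. intros [->|Hi].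
  - pose proof (rsum_ge0 l H); lra.
  - specialize (IHl Hi). specialize (H a). lra.
Qed.
Lemma rsum_const c l : rsum (fun _ => c) l = INR (length l) * c.
Proof. induction l; [simpl; lra|]. simpl rsum. simpl length. rewrite S_INR, IHl. lra. Qed.

Definition pnorm (x : I -> X) : R := rsum (fun i => nm (x i)) en.
Lemma pnorm_coord x i : nm (x i) <= pnorm x.
Proof. apply (rsum_in (f := fun i => nm (x i))); [intro; apply nm_ge0|apply Hen]. Qed.

Definition Pow : CBanach.
Proof.
  refine (@Build_CBanach (I -> X) (fun x y i => x i +v y i) (fun x i => -v x i) (fun _ => vzero X) (fun c x i => c *v x i) pnorm
     _ _ _ _ _ _ _ _ _ _ _ _);
   try (intros; apply functional_extensionality; intro; vec).
  - intro x; split.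
    + intro H. apply functional_extensionality; intro i. apply nm_le0. pose proof (pnorm_coord x i). lra.
    + intros ->. unfold pnorm. rewrite (rsum_ext (g := fun _ => 0)); [|intro; apply nm_0].
      rewrite rsum_const. lra.
  - intros x y. unfold pnorm. rewrite <- rsum_add. apply rsum_le. intro; apply nm_add.
  - intros c x. unfold pnorm. rewrite <- rsum_mul. apply rsum_ext. intro; apply vnorm_scal.
  - intros u Hu.
    assert (H : forall i, exists l, lim (fun n => u n i) l).
    { intro i. apply vcomplete. intros eps He. destruct (Hu eps He) as [N HN]. exists N; intros m n Hm Hn.
      eapply Rle_lt_trans; [|apply (HN m n Hm Hn)]. apply (pnorm_coord (fun i => u m i -v u n i)). }
    apply choice in H. destruct H as [l Hl]. exists l.
    assert (Hs : forall li, forall eps, 0 < eps -> exists N, forall n, (N <= n)%nat -> rsum (fun i => nm (u n i -v l i)) li < eps).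
    { induction li as [|i li IH]; intros eps He; [exists O; intros; simpl; lra|].
      destruct (IH (eps / 2)) as [N1 HN1]; [lra|]. destruct (Hl i (eps / 2)) as [N2 HN2]; [lra|].
      exists (max N1 N2); intros n Hn. specialize (HN1 n ltac:(lia)). specialize (HN2 n ltac:(lia)). simpl; lra. }
    intros eps He. destruct (Hs en eps He) as [N HN]. exists N; intros n Hn. apply HN; lia.
Defined.
Lemma pow_norm_le (x : Pow) c : (forall i, nm (x i) <= c) -> nm x <= INR (length en) * c.
Proof. intro H. change (pnorm x <= INR (length en) * c). rewrite <- rsum_const. apply rsum_le, H. Qed.
Lemma pow_coord (x : Pow) i : nm (x i) <= nm x.
Proof. apply pnorm_coord. Qed.
Lemma pow_lim (u : nat -> Pow) (l : Pow) : (forall i, lim (fun n => u n i) (l i)) -> lim u l.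
Proof.
  intro Hl.
  assert (Hs : forall li, forall eps, 0 < eps -> exists N, forall n, (N <= n)%nat -> rsum (fun i => nm (u n i -v l i)) li < eps).
  { induction li as [|i li IH]; intros eps He; [exists O; intros; simpl; lra|].
    destruct (IH (eps / 2)) as [N1 HN1]; [lra|]. destruct (Hl i (eps / 2)) as [N2 HN2]; [lra|].
    exists (max N1 N2); intros n Hn. specialize (HN1 n ltac:(lia)). specialize (HN2 n ltac:(lia)). simpl; lra. }
  intros eps He. destruct (Hs en eps He) as [N HN]. exists N; intros n Hn. apply HN; lia.
Qed.
End Power.

(** * Derivations of spaces of operators *)

Lemma Rdiv_le_0_compat (x y : R) : 0 <= x -> 0 < y -> 0 <= x / y.
Proof. intros. apply Rmult_le_pos; [assumption|]. left; now apply Rinv_0_lt_compat. Qed.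

(** Each entry cuts at most half off the current interval; the midpoint of what remains avoids the
    list. *)
Lemma avoid_list (l : list R) a b : a < b -> exists r, a < r < b /\ forall x, In x l -> r <> x.
Proof.
  intro H.
  assert (H' : exists c d, a <= c < d /\ d <= b /\ forall x, In x l -> x <= c \/ d <= x).
  { induction l as [|x l [c [d [Hc [Hd IH]]]]].
    - exists a, b; repeat split; try lra; intros x [].
    - destruct (Rle_lt_dec x ((c + d) / 2)) as [Hx|Hx].
      + exists (Rmax c x), d.
        assert (c <= Rmax c x) by apply Rmax_l. assert (x <= Rmax c x) by apply Rmax_r.
        assert (Rmax c x < d) by (apply Rmax_lub_lt; lra).
        repeat split; try lra. intros y [<-|Hy]; [lra|]. destruct (IH y Hy); lra.
      + exists c, (Rmin d x).
        assert (Rmin d x <= d) by apply Rmin_l. assert (Rmin d x <= x) by apply Rmin_r.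
        assert (c < Rmin d x) by (apply Rmin_glb_lt; lra).
        repeat split; try lra. intros y [<-|Hy]; [lra|]. destruct (IH y Hy); lra. }
  destruct H' as [c [d [Hc [Hd Hl]]]]. exists ((c + d) / 2); split; [lra|]. intros x Hx E. destruct (Hl x Hx); lra.
Qed.

(** Cantor's diagonal over nested subsequences, the [k]-th of which achieves closeness [1 / (k + 1)]
    between all of its members. *)
Lemma diagonal (Cl : R -> nat -> nat -> Prop) :
  (forall e e' m n, e <= e' -> Cl e m n -> Cl e' m n) ->
  (forall e phi, 0 < e -> incr phi -> exists sg, incr sg /\ forall m n, Cl e (phi (sg m)) (phi (sg n))) ->
  exists phi, incr phi /\ forall e, 0 < e -> exists N, forall m n, (N <= m)%nat -> (N <= n)%nat -> Cl e (phi m) (phi n).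
Proof.
  intros Hmon H.
  assert (Hpos : forall k, 0 < / (INR k + 1)) by (intro k; apply Rinv_0_lt_compat; pose proof (pos_INR k); lra).
  assert (H' : forall p : nat * {phi | incr phi}, exists sg, incr sg /\ forall m n, Cl (/ (INR (fst p) + 1)) (proj1_sig (snd p) (sg m)) (proj1_sig (snd p) (sg n))).
  { intros [k [phi Hphi]]; simpl. apply H; auto. }
  apply choice in H'. destruct H' as [f Hf].
  pose (psi := fix psi k : {phi | incr phi} := match k with O => exist _ (fun n => n) incr_id
     | S k' => let p := psi k' in exist _ (fun n => proj1_sig p (f (k', p) n)) (incr_comp (proj2_sig p) (proj1 (Hf (k', p)))) end).
  exists (fun n => proj1_sig (psi n) n). split.
  - intro n. simpl. set (p := psi n). pose proof (incr_ge (proj1 (Hf (n, p))) (S n)).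
    apply (incr_lt (proj2_sig p)). lia.
  - assert (Hr : forall k d n, exists m, (n <= m)%nat /\ proj1_sig (psi (d + k)%nat) n = proj1_sig (psi k) m).
    { intros k d; induction d; intro n; [exists n; auto|]. simpl.
      destruct (IHd (f ((d + k)%nat, psi (d + k)%nat) n)) as [m [Hm E]]. exists m; split; [|exact E].
      pose proof (incr_ge (proj1 (Hf ((d + k)%nat, psi (d + k)%nat))) n). lia. }
    intros e He. destruct (inv_small He) as [k Hk]. exists (S k). intros m n Hm Hn.
    destruct (Hr (S k) (m - S k)%nat m) as [m' [_ Em]]. destruct (Hr (S k) (n - S k)%nat n) as [n' [_ En]].
    replace (m - S k + S k)%nat with m in Em by lia. replace (n - S k + S k)%nat with n in En by lia.
    rewrite Em, En. apply Hmon with (/ (INR k + 1)); [left; apply Hk; lia|].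
    apply (Hf (k, psi k)).
Qed.

Lemma neumann (Y : CBanach) (T : op Y) theta : linear T -> 0 <= theta < 1 -> (forall x, nm (T x) <= theta * nm x) ->
  forall y, exists x, x -v T x = y.
Proof.
  intros HT Hth Hb y.
  pose (u := fix u n := match n with O => vzero Y | S n => y +v T (u n) end).
  destruct (@complete_geom Y u (nm y) theta Hth) as [x Hx].
  - induction n; simpl.
    + rewrite lin_0 by assumption. replace (y +v vzero Y -v vzero Y) with y by vec. lra.
    + replace (y +v T (y +v T (u n)) -v (y +v T (u n))) with (T (u (S n) -v u n)) by (rewrite lin_sub by assumption; simpl; vec).
      eapply Rle_trans; [apply Hb|]. rewrite <- Rmult_assoc, (Rmult_comm (nm y)), Rmult_assoc. now apply Rmult_le_compat_l.
  - exists x. assert (E : x = y +v T x).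
    { apply (lim_unique (lim_sub Hx (phi := S) (fun n => Nat.lt_succ_diag_r (S n)))). simpl.
      apply lim_add; [apply lim_const|]. apply lb_lim; [|assumption]. split; [assumption|exists theta; assumption]. }
    rewrite E at 1. vec.
Qed.

(** * Continuation of surjectivity *)

Section Surj.
Variable Y : CBanach.
Variable T : op Y.
Hypothesis HT : lb T.
Variable c : R.
Hypothesis Hc : 0 < c.
Definition surj (z : Cpx) : Prop := forall y, exists x, Dop T z x = y.
Definition low (z : Cpx) : Prop := forall x, c * nm x <= nm (Dop T z x).
(** [T - z'] is [T - z] followed by [1 + (z - z') R], with [R] the inverse at [z] of norm at most
    [1/c], and the second factor is invertible by a Neumann series. *)
Lemma surj_step z z' : low z -> surj z -> Cabs (Csub z z') < c -> surj z'.
Proof.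
  intros Hl Hs Hz.
  destruct (@inverse_exists Y (Dop T z) c) as [R [HR [_ [H2 H3]]]]; auto; [apply lin_Dop, HT|].
  intro y. pose proof (Cabs_ge0 (Csub z z')) as Hz0.
  destruct (@neumann Y (opscal (Csub z' z) R) (Cabs (Csub z z') * / c)) with (y := y) as [w Hw].
  - apply lin_opscal, HR.
  - split; [apply Rmult_le_pos; [assumption|left; now apply Rinv_0_lt_compat]|].
    apply Rmult_lt_reg_r with c; [assumption|]. rewrite Rmult_assoc, Rinv_l; lra.
  - intro x. unfold opscal. rewrite vnorm_scal, Rmult_assoc.
    replace (Csub z' z) with (Copp (Csub z z')) by ring. rewrite Cabs_opp. now apply Rmult_le_compat_l.
  - exists (R w). rewrite <- Hw. unfold opscal. rewrite <- (H2 w) at 2. unfold Dop. vec.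
Qed.
(** Since the lower bound [c] is the same along the path, steps of the fixed length [h] reach every
    point of it. *)
Lemma surj_chain (g : R -> Cpx) a : (forall t, 0 <= t <= a -> low (g t)) -> surj (g 0) ->
  (exists L, forall s t, 0 <= s <= t -> t <= a -> Cabs (Csub (g s) (g t)) <= L * (t - s)) ->
  forall t, 0 <= t <= a -> surj (g t).
Proof.
  intros Hl H0 [L HL].
  set (h := c / (Rabs L + 1) / 2). pose proof (Rabs_pos L). pose proof (Rle_abs L).
  assert (Hh : 0 < h) by (unfold h; apply Rdiv_lt_0_compat; [apply Rdiv_lt_0_compat|]; lra).
  assert (Hh2 : h * (Rabs L + 1) = c / 2) by (unfold h; field; lra).
  assert (Hk : forall k t, 0 <= t <= a -> t <= INR k * h -> surj (g t)).
  { induction k; intros t Ht Hk.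
    - simpl in Hk. replace t with 0 by lra. assumption.
    - rewrite S_INR in Hk. destruct (Rle_lt_dec t h) as [Hth|Hth].
      + apply surj_step with (g 0); auto; [apply Hl; lra|].
        eapply Rle_lt_trans; [apply HL; lra|]. nra.
      + apply surj_step with (g (t - h)); [apply Hl; lra|apply IHk; lra|].
        eapply Rle_lt_trans; [apply HL; lra|]. nra. }
  intros t Ht. destruct (INR_archimed h t Hh) as [k Hkt]. apply (Hk k); lra.
Qed.
End Surj.

(** * Compressions of iterated commutators *)

Section AdBounds.
Variable X : CBanach.
Implicit Types (a q T p : op X).


(** Powers of [a] are carried along on both sides: a commutator splits into two terms, each with one
    more power of [a] outside, so one application of [ad a] costs a factor [2 k]. *)
Lemma compress_bound a q T D k s : linear a -> linear q -> linear T -> 0 <= D -> 0 <= s -> 0 <= k ->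
  (forall x, a (q x) = q (a x)) -> (forall i x, nm (Nat.iter i a (q x)) <= D * k ^ i * nm x) ->
  (forall x, nm (T x) <= s * nm x) ->
  forall n i j x, nm (Nat.iter i a (q (Nat.iter n (ad a) T (Nat.iter j a (q x))))) <= D * D * s * k ^ (i + j) * (2 * k) ^ n * nm x.
Proof.
  intros Ha Hq HT HD Hs Hk Hcom Hb HTb n. induction n; intros i j x.
  - simpl. eapply Rle_trans; [apply Hb|]. rewrite pow_add.
    replace (D * D * s * (k ^ i * k ^ j) * 1 * nm x) with (D * k ^ i * (s * (D * k ^ j * nm x))) by ring.
    apply Rmult_le_compat_l; [apply Rmult_le_pos; [assumption|now apply pow_le]|].
    eapply Rle_trans; [apply HTb|]. apply Rmult_le_compat_l; auto.
  - change (Nat.iter (S n) (ad a) T) with (bracket a (Nat.iter n (ad a) T)).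
    unfold bracket, opsub, opcomp. pose proof (lin_iter i Ha) as Hi.
    lpush Hq. lpush Hi. rewrite <- Hcom. rewrite iter_shift.
    change (a (Nat.iter i a (q (Nat.iter n (ad a) T (Nat.iter j a (q x))))))
      with (Nat.iter (S i) a (q (Nat.iter n (ad a) T (Nat.iter j a (q x))))).
    change (a (Nat.iter j a (q x))) with (Nat.iter (S j) a (q x)).
    eapply Rle_trans; [apply nm_sub|]. pose proof (IHn (S i) j x). pose proof (IHn i (S j) x).
    replace (S i + j)%nat with (S (i + j)) in H by lia. replace (i + S j)%nat with (S (i + j)) in H0 by lia.
    simpl pow in *. lra.
Qed.

(** The projection removes the eigenvalues of modulus at least [k]. An eigenvector of [a (1 - p)]
    for such an eigenvalue is killed by [p], hence is an eigenvector of [a] in the kernel of [p],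
    hence zero. *)
Lemma spectral_cut a k : compact_op a -> 0 < k ->
  exists p D, finrank p /\ (forall x, p (p x) = p x) /\ 0 < D /\
   (forall A, linear A -> (forall x, A (a x) = a (A x)) -> forall x, A (p x) = p (A x)) /\
   (forall i x, nm (Nat.iter i a (x -v p x)) <= D * k ^ i * nm x) /\ (forall x, decays a x -> p x = vzero X).
Proof.
  intros Ha Hk. destruct (spectral_proj Ha Hk) as [p [Hp [Hpi [Hpc [Hpe Hpd]]]]].
  pose proof (lb_lin (proj1 Hp)) as Hpl. pose proof (compact_lin Ha) as Hal.
  assert (Hap : forall x, a (p x) = p (a x)) by (apply Hpc; auto).
  set (q := opsub opid p). assert (Hq : lb q) by (apply lb_opsub; [apply lb_opid|apply Hp]).
  destruct (@compact_radius X (opcomp a q) k) as [D [HD HDb]]; auto.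
  - now apply compact_comp_r.
  - intros z v Hz E. unfold opcomp, q, opsub, opid in E.
    assert (Hz0 : z <> C0) by (apply Cabs_neq0; lra).
    assert (Hpv : p v = vzero X).
    { apply (vscal_eq0 (c := z)); [|assumption]. rewrite <- (lin_scal _ _ Hpl), <- E, <- Hap.
      rewrite (lin_sub _ _ Hpl), Hpi, vadd_oppr. now apply lin_0. }
    apply (Hpe z v); auto. rewrite <- E, Hpv. f_equal; vec.
  - destruct (lb_bound Hq) as [B [HB HBb]].
    exists p, (D * B); split; [assumption|split; [assumption|split; [nra|split; [assumption|split; [|assumption]]]]].
    intros i x. assert (E : Nat.iter i a (x -v p x) = Nat.iter i (opcomp a q) (q x)).
    { induction i; [reflexivity|]. change (Nat.iter (S i) a (x -v p x)) with (a (Nat.iter i a (x -v p x))).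
      change (Nat.iter (S i) (opcomp a q) (q x)) with (a (q (Nat.iter i (opcomp a q) (q x)))). f_equal. rewrite <- IHi.
      unfold q, opsub, opid. rewrite (iter_comm (A := p)) by (intro; symmetry; apply Hap).
      replace (p (x -v p x)) with (vzero X) by (rewrite (lin_sub _ _ Hpl), Hpi; vec).
      rewrite lin_0 by now apply lin_iter. vec. }
    rewrite E. eapply Rle_trans; [apply HDb|].
    replace (D * B * k ^ i * nm x) with (D * k ^ i * (B * nm x)) by ring.
    apply Rmult_le_compat_l; [apply Rmult_le_pos; [lra|apply pow_le; lra]|apply HBb].
Qed.

(** If [(1 - p) T (1 - p) = 0], then [T = p T (1 - p) + T p]. *)
Lemma finrank_of_compress p T : finrank p -> lb T -> (forall x, T (x -v p x) -v p (T (x -v p x)) = vzero X) -> finrank T.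
Proof.
  intros [Hp [l Hl]] HT H. split; [assumption|]. exists (l ++ map T l). intro x. specialize (H x).
  assert (E : T x = p (T (x -v p x)) +v T (p x)).
  { apply sub_eq0 in H. rewrite <- H, <- lin_add by apply HT. f_equal; vec. }
  rewrite E. apply subsp_add; [apply span_subsp| |].
  - eapply span_incl; [apply incl_appl, incl_refl|apply Hl].
  - eapply span_incl; [apply incl_appr, incl_refl|].
    apply (span_least (l := l) (Z := fun y => span (map T l) (T y))); [| |apply Hl].
    + pose proof (span_subsp (map T l)) as Hs. split; [|split].
      * rewrite lin_0 by apply HT. now apply subsp_0.
      * intros y y' H1 H2. rewrite lin_add by apply HT. now apply subsp_add.
      * intros b y H1. rewrite lin_scal by apply HT. now apply subsp_scal.
    + intros v Hv. apply span_in, in_map, Hv.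
Qed.

Lemma compact_net (K : op X) eps : compact_op K -> 0 < eps -> exists l, forall x, nm x <= 1 -> exists y, In y l /\ nm (K x -v y) < eps.
Proof.
  intros HK He. apply NNPP; intro Hn.
  assert (H : forall l, exists x, nm x <= 1 /\ forall y, In y (map K l) -> eps <= nm (K x -v y)).
  { intro l. apply NNPP; intro Hm. apply Hn. exists (map K l). intros x Hx. apply NNPP; intro Hk. apply Hm.
    exists x; split; [assumption|]. intros y Hy. apply Rnot_lt_le; intro. apply Hk; eauto. }
  apply choice in H. destruct H as [f Hf].
  pose (s := fun n => Nat.iter n (fun l => f l :: l) nil).
  apply (@no_separated X K (fun n => f (s n)) eps HK); auto.
  - exists 1; intro; apply Hf.
  - intros m n Hmn. apply Hf. apply in_map.
    clear - Hmn. induction Hmn; [now left|]. now right.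
Qed.

(* Vala: for compact [k1], [k2] the map [T |-> k1 T k2] is compact. *)
Lemma sandwich_subseq k1 k2 (T : nat -> op X) s : compact_op k1 -> compact_op k2 -> (forall n, linear (T n)) -> 0 < s ->
  (forall n x, nm (T n x) <= s * nm x) ->
  exists phi, incr phi /\ forall e, 0 < e -> exists N, forall m n, (N <= m)%nat -> (N <= n)%nat ->
    forall x, nm (k1 (T (phi m) (k2 x)) -v k1 (T (phi n) (k2 x))) <= e * nm x.
Proof.
  intros H1 H2 HT Hs Hb.
  apply (@diagonal (fun e m n => forall x, nm (k1 (T m (k2 x)) -v k1 (T n (k2 x))) <= e * nm x)).
  { intros e e' m n He H x. eapply Rle_trans; [apply H|]. apply Rmult_le_compat_r; [apply nm_ge0|assumption]. }
  intros e phi He Hphi. destruct (lb_bound (compact_lb H1)) as [b [Hb0 Hbb]].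
  pose proof (compact_lin H1) as L1. pose proof (compact_lin H2) as L2.
  (* Replacing [k2 x] by a point of the net costs [e / 4] for each of the two operators, leaving
     [e / 2] for the net points themselves. *)
  set (d := e / (4 * b * s)). assert (Hd : 0 < d) by (apply Rdiv_lt_0_compat; nra).
  destruct (compact_net H2 Hd) as [l Hl].
  assert (Hsub : exists sg, incr sg /\ forall y, In y l -> exists w, lim (fun n => k1 (T (phi (sg n)) y)) w).
  { clear Hl. induction l as [|y l [sg [Hsg IH]]]; [exists (fun n => n); split; [apply incr_id|intros y []]|].
    destruct (@compact_subseq X k1 (fun n => T (phi (sg n)) y) H1) as [tau [w [Ht Hw]]].
    { exists (s * nm y); intro; apply Hb. }
    exists (fun n => sg (tau n)); split; [now apply incr_comp|].
    intros y' [<-|Hy']; [now exists w|]. destruct (IH y' Hy') as [w' Hw']. exists w'. apply (lim_sub Hw' Ht). }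
  destruct Hsub as [sg [Hsg Hlim]].
  assert (HN : exists N, forall y, In y l -> forall m n, (N <= m)%nat -> (N <= n)%nat -> nm (k1 (T (phi (sg m)) y) -v k1 (T (phi (sg n)) y)) < e / 2).
  { clear Hl. induction l as [|y l IH]; [exists O; intros y []|].
    destruct IH as [N1 HN1]; [intros; apply Hlim; now right|].
    destruct (Hlim y (or_introl eq_refl)) as [w Hw]. destruct (Hw (e / 4)) as [N2 HN2]; [lra|].
    exists (max N1 N2). intros y' [<-|Hy'] m n Hm Hn; [|apply HN1; auto; lia].
    pose proof (HN2 m ltac:(lia)). pose proof (HN2 n ltac:(lia)).
    pose proof (nm_tri (k1 (T (phi (sg m)) y)) w (k1 (T (phi (sg n)) y))). rewrite (nm_swap w) in H3. lra. }
  destruct HN as [N HN]. exists (fun n => sg (n + N)%nat). split; [intro n; apply Hsg|].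
  intros m n. set (m' := phi (sg (m + N)%nat)). set (n' := phi (sg (n + N)%nat)).
  assert (Hunit : forall x, nm x <= 1 -> nm (k1 (T m' (k2 x)) -v k1 (T n' (k2 x))) <= e).
  { intros x Hx. destruct (Hl x Hx) as [y [Hy Hny]].
    replace (k1 (T m' (k2 x)) -v k1 (T n' (k2 x))) with (k1 (T m' (k2 x -v y)) -v k1 (T n' (k2 x -v y)) +v (k1 (T m' y) -v k1 (T n' y))).
    2:{ rewrite !(lin_sub _ _ (HT _)), !(lin_sub _ _ L1). vec. }
    assert (HH : forall i, nm (k1 (T i (k2 x -v y))) <= e / 4).
    { intro i. eapply Rle_trans; [apply Hbb|]. specialize (Hb i (k2 x -v y)).
      apply Rle_trans with (b * (s * d)); [apply Rmult_le_compat_l; [lra|]; nra|]. right; unfold d; field; lra. }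
    eapply Rle_trans; [apply nm_add|]. eapply Rle_trans; [apply Rplus_le_compat_r, nm_sub|].
    pose proof (HH m'). pose proof (HH n'). specialize (HN y Hy (m + N)%nat (n + N)%nat ltac:(lia) ltac:(lia)).
    fold m' n' in HN. lra. }
  intro x. destruct (classic (x = vzero X)) as [->|Hx].
  - rewrite (lin_0 L2), !(lin_0 (HT _)), vadd_oppr, nm_0; lra.
  - pose proof (nm_pos Hx) as Hp. assert (Hi : 0 < / nm x) by now apply Rinv_0_lt_compat.
    specialize (Hunit (RtoC (/ nm x) *v x)). rewrite nm_Rscal, Rinv_l in Hunit by lra. specialize (Hunit (Rle_refl _)).
    rewrite (lin_scal _ _ L2), !(lin_scal _ _ (HT _)), !(lin_scal _ _ L1) in Hunit.
    match type of Hunit with nm (?c *v ?u -v ?c *v ?v) <= _ => replace (c *v u -v c *v v) with (c *v (u -v v)) in Hunit by vec end.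
    rewrite nm_Rscal in Hunit by lra.
    apply Rmult_le_reg_l with (/ nm x); [assumption|]. replace (/ nm x * (e * nm x)) with e by (field; lra). assumption.
Qed.
End AdBounds.

(** * The theorem of Wojtynski on spaces without finite rank operators *)

Section Wojtynski.
Variable X : CBanach.
Variable a : op X.
Variable Y : op X -> Prop.
Hypothesis Ha : compact_op a.
Hypothesis Ylb : forall T, Y T -> lb T.
Hypothesis Ysub : is_subspace Y.
Hypothesis Ycl : opclosed Y.
Hypothesis Yad : forall T, Y T -> Y (bracket a T).
Hypothesis Yfin : forall T, Y T -> finrank T -> forall x, T x = vzero X.

Let YS : CBanach := OpSpace Ylb Ysub Ycl.
Let val (T : YS) : op X := oval T.
Lemma val_lb (T : YS) : lb (val T). Proof. apply (oval_lb Ylb). Qed.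
Lemma val_in (T : YS) : Y (val T). Proof. apply oval_in. Qed.
Lemma val_eq (S T : YS) : (forall x, val S x = val T x) -> S = T. Proof. apply ocar_eq. Qed.
Lemma val_sub (S T : YS) x : val (S -v T) x = val S x -v val T x.
Proof. change (val S x +v Copp Cone *v val T x = val S x -v val T x). now rewrite <- vopp_scal. Qed.
Lemma val_scal c (T : YS) x : val (c *v T) x = c *v val T x. Proof. reflexivity. Qed.
Lemma nm_spec (T : YS) x : nm (val T x) <= nm T * nm x. Proof. apply opnorm_spec, val_lb. Qed.
Lemma nm_least (T : YS) C : 0 <= C -> (forall x, nm (val T x) <= C * nm x) -> nm T <= C.
Proof. intros; apply opnorm_le; auto. apply val_lb. Qed.

Definition adY : op YS := fun T => exist _ (bracket a (val T)) (Yad (val_in T)).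
Lemma val_adY (T : YS) : val (adY T) = bracket a (val T). Proof. reflexivity. Qed.
Let Hal := compact_lin Ha.

Lemma adY_lin : linear adY.
Proof.
  split.
  - intros S T. apply val_eq; intro x. change (a (val S x +v val T x) -v (val S (a x) +v val T (a x)) = (a (val S x) -v val S (a x)) +v (a (val T x) -v val T (a x))).
    rewrite (lin_add _ _ Hal). vec.
  - intros c T. apply val_eq; intro x. change (a (c *v val T x) -v c *v val T (a x) = c *v (a (val T x) -v val T (a x))).
    rewrite (lin_scal _ _ Hal). vec.
Qed.
Lemma adY_bound : exists B, 0 < B /\ forall T, nm (adY T) <= B * nm T.
Proof.
  destruct (lb_bound (compact_lb Ha)) as [b [Hb Hbb]]. exists (2 * b); split; [lra|]. intro T.
  pose proof (nm_ge0 T). apply nm_least; [nra|]. intro x. rewrite val_adY. unfold bracket, opsub, opcomp.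
  eapply Rle_trans; [apply nm_sub|]. pose proof (nm_spec T x). pose proof (nm_spec T (a x)).
  pose proof (Hbb (val T x)). pose proof (Hbb x). pose proof (nm_ge0 x).
  assert (nm T * nm (a x) <= nm T * (b * nm x)) by (apply Rmult_le_compat_l; lra). nra.
Qed.
Lemma adY_lb : lb adY.
Proof. split; [apply adY_lin|]. destruct adY_bound as [B [_ HB]]. now exists B. Qed.
Lemma val_iter n T : val (Nat.iter n adY T) = Nat.iter n (ad a) (val T).
Proof. induction n; [reflexivity|]. change (bracket a (val (Nat.iter n adY T)) = ad a (Nat.iter n (ad a) (val T))). now rewrite IHn. Qed.

Section Cut.
Variables (p : op X) (D k : R).
Hypothesis Hp : finrank p.
Hypothesis Hk : 0 < k.
Hypothesis HD : 0 < D.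
Hypothesis Hpa : forall x, a (p x) = p (a x).
Hypothesis Hcut : forall i x, nm (Nat.iter i a (x -v p x)) <= D * k ^ i * nm x.

Let q : op X := opsub opid p.
Lemma Hq : lb q. Proof. apply lb_opsub; [apply lb_opid|apply Hp]. Qed.

Lemma compress_iter (T : YS) n x : nm (q (val (Nat.iter n adY T) (q x))) <= D * D * nm T * (2 * k) ^ n * nm x.
Proof.
  pose proof (@compress_bound X a q (val T) D k (nm T) Hal (lb_lin Hq) (lb_lin (val_lb T)) (Rlt_le _ _ HD) (nm_ge0 T) (Rlt_le _ _ Hk)) as H.
  rewrite val_iter. specialize (H ltac:(intro y; unfold q, opsub, opid; rewrite (lin_sub _ _ Hal), Hpa; reflexivity) Hcut (nm_spec T) n O O x).
  simpl Nat.iter in H. simpl Nat.add in H. rewrite pow_O, Rmult_1_r in H. exact H.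
Qed.

(** Here the absence of finite rank elements enters: compression by [q = 1 - p] is injective on [Y],
    so estimates of compressions decide about elements. *)
Lemma compress_zero (T : YS) : (forall x, q (val T (q x)) = vzero X) -> T = vzero YS.
Proof.
  intro H. apply val_eq. intro x. change (val T x = vzero X). apply (Yfin (val_in T)).
  apply (finrank_of_compress Hp (val_lb T)). exact H.
Qed.

(** Under iteration an eigenvector grows like [z^n], its compression at most like [(2 k)^n]. *)
Lemma eigen_zero (T : YS) z : 2 * k < Cabs z -> adY T = z *v T -> T = vzero YS.
Proof.
  intros Hz E. apply compress_zero. intro x.
  assert (En : forall n, Nat.iter n adY T = Cpow z n *v T).
  { induction n; [change (T = Cone *v T); vec|]. change (adY (Nat.iter n adY T) = Cmul z (Cpow z n) *v T). rewrite IHn, (lin_scal _ _ adY_lin), E. vec. }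
  apply nm_le0. apply le_pow_zero with (C := D * D * nm T * nm x) (eta := 2 * k / Cabs z).
  - split; [apply Rdiv_le_0_compat; lra|]. apply Rmult_lt_reg_r with (Cabs z); [lra|]. unfold Rdiv. rewrite Rmult_assoc, Rinv_l; lra.
  - intro n. pose proof (compress_iter T n x) as H. rewrite En, val_scal, (lin_scal _ _ (lb_lin Hq)), vnorm_scal, Cabs_pow in H.
    assert (Hpz : 0 < Cabs z ^ n) by (apply pow_lt; lra).
    apply Rmult_le_reg_l with (Cabs z ^ n); [assumption|]. eapply Rle_trans; [apply H|]. right.
    unfold Rdiv. rewrite (Rpow_mult_distr (2 * k) (/ Cabs z)), pow_inv. field. lra.
Qed.

(** With [B1] and [B2] inverting [a - z] and [a + z], an approximate eigenvector satisfies
    [T = B1 a T B2 a] up to a small error. Two-sided multiplication by compact operators is compact,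
    so a subsequence converges in norm to an eigenvector of norm 1, which [eigen_zero] excludes. *)
Lemma lower_adY (Om : Cpx -> Prop) M : Cclosed Om -> (forall z, Om z -> 2 * k < Cabs z <= M) ->
  (forall z x, Om z -> a x = z *v x -> x = vzero X) -> (forall z x, Om z -> a x = Copp z *v x -> x = vzero X) ->
  exists c, 0 < c /\ forall z, Om z -> low adY c z.
Proof.
  intros HO HM He1 He2. apply NNPP; intro Hn.
  assert (H : forall n, exists s : Cpx * YS, Om (fst s) /\ nm (snd s) = 1 /\ nm (Dop adY (fst s) (snd s)) < / (INR n + 1)).
  { intro n. apply NNPP; intro Hm. apply Hn. exists (/ (INR n + 1)).
    assert (Hpos : 0 < / (INR n + 1)) by (apply Rinv_0_lt_compat; pose proof (pos_INR n); lra).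
    split; [assumption|]. intros z Hz T. apply Rnot_lt_le; intro Hlt.
    assert (Hx0 : 0 < nm T). { pose proof (nm_ge0 T); pose proof (nm_ge0 (Dop adY z T)). nra. }
    apply Hm. exists (z, RtoC (/ nm T) *v T); cbn [fst snd].
    assert (0 < / nm T) by now apply Rinv_0_lt_compat. split; [assumption|split].
    - rewrite nm_Rscal by lra. field; lra.
    - rewrite (lin_scal _ _ (lin_Dop z adY_lin)), nm_Rscal by lra.
      apply Rmult_lt_reg_l with (nm T); [assumption|]. rewrite <- Rmult_assoc, Rinv_r, Rmult_1_l by lra. lra. }
  apply choice in H. destruct H as [s Hs].
  destruct (@Cpx_subseq (fun n => fst (s n)) M) as [phi [z [Hphi Hz]]].
  { intro n; apply HM, Hs. }
  assert (HOz : Om z) by (apply (HO (fun n => fst (s (phi n)))); [intro; apply Hs|assumption]).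
  destruct (HM z HOz) as [Hz1 Hz2].
  assert (Hz0 : z <> C0) by (apply Cabs_neq0; lra).
  assert (Hinv : forall w, w <> C0 -> (forall x, a x = w *v x -> x = vzero X) ->
    exists B, lb B /\ (forall x, B (Dop a w x) = x) /\ (forall y, Dop a w (B y) = y)).
  { intros w Hw Hno. destruct (@lower_bound X a (fun _ => True) w Ha) as [c [Hc Hl]]; auto.
    - repeat split.
    - intros u l _ _; exact I.
    - intros x _ E. apply Hno. now apply sub_eq0.
    - destruct (@resolvent_exists X a w c Ha Hw Hc) as [B [HB [HB1 [HB2 _]]]]; [intro; now apply Hl|].
      exists B; auto. }
  destruct (Hinv z Hz0 (fun x => He1 z x HOz)) as [B1 [HB1 [HB1a HB1b]]].
  destruct (Hinv (Copp z) (Copp_neq0 Hz0) (fun x => He2 z x HOz)) as [B2 [HB2 [HB2a HB2b]]].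
  pose (T := fun n => snd (s (phi n))).
  destruct (@sandwich_subseq X (opcomp B1 a) (opcomp B2 a) (fun n => val (T n)) 1) as [psi [Hpsi Hcau]].
  { now apply compact_comp_l. }
  { now apply compact_comp_l. }
  { intro; apply val_lb. }
  { lra. }
  { intros n x. eapply Rle_trans; [apply nm_spec|]. destruct (Hs (phi n)) as [_ [H1 _]]. unfold T; rewrite H1; lra. }
  pose (E := fun n => adY (T n) -v z *v T n).
  assert (HE : lim E (vzero YS)).
  { intros eps Hep. destruct (@inv_small (eps / 2)) as [N1 HN1]; [lra|].
    destruct (Hz (eps / 2)) as [N2 HN2]; [lra|]. exists (max N1 N2); intros n Hnn.
    specialize (HN2 n ltac:(lia)). pose proof (incr_ge Hphi n). specialize (HN1 (phi n) ltac:(lia)).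
    destruct (Hs (phi n)) as [_ [H1 H2]]. fold (T n) in H1, H2.
    replace (E n -v vzero YS) with (Dop adY (fst (s (phi n))) (T n) +v Csub (fst (s (phi n))) z *v T n) by (unfold E, Dop; vec).
    eapply Rle_lt_trans; [apply nm_add|]. rewrite vnorm_scal, H1. lra. }
  (* Writing [E] for [a T - T a - z T], one has [(a - z) T = E + T a] and [T (a + z) = a T - E]. *)
  assert (Hrep : forall n x, val (T n) x = B1 (a (val (T n) (B2 (a x)))) +v (B1 (val (E n) x) -v B1 (val (E n) (B2 (a x))))).
  { intros n x. pose proof (val_lb (T n)) as HTn. pose proof (lb_lin HB1) as L1.
    assert (HEv : forall y, val (E n) y = a (val (T n) y) -v val (T n) (a y) -v z *v val (T n) y).
    { intro y. unfold E. rewrite val_sub, val_scal. reflexivity. }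
    assert (F : forall y, val (T n) y = B1 (val (E n) y +v val (T n) (a y))).
    { intro y. rewrite <- (HB1a (val (T n) y)). f_equal. rewrite HEv. unfold Dop; vec. }
    assert (G : val (T n) (a x) = a (val (T n) (B2 (a x))) -v val (E n) (B2 (a x))).
    { rewrite HEv. rewrite <- (HB2b (a x)) at 1. unfold Dop. rewrite (lin_sub _ _ (lb_lin HTn)), (lin_scal _ _ (lb_lin HTn)). vec. }
    rewrite F, G. lpush L1. vec. }
  destruct (lb_bound HB1) as [b1 [Hb1 Hb1b]]. destruct (lb_bound (lb_opcomp HB2 (compact_lb Ha))) as [b2 [Hb2 Hb2b]].
  destruct (vcomplete YS (fun n => T (psi n))) as [T0 HT0].
  { intros eps Hep. destruct (Hcau (eps / 4)) as [N1 HN1]; [lra|].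
    destruct (HE (eps / (4 * b1 * (1 + b2)))) as [N2 HN2]; [apply Rdiv_lt_0_compat; nra|].
    exists (max N1 N2); intros m n Hm Hnn.
    apply Rle_lt_trans with (3 / 4 * eps); [|lra]. apply nm_least; [lra|]. intro x.
    rewrite val_sub, (Hrep (psi m) x), (Hrep (psi n) x).
    match goal with |- nm (?u +v ?v -v (?u' +v ?v')) <= _ => replace (u +v v -v (u' +v v')) with ((u -v u') +v (v -v v')) by vec end.
    assert (HEb : forall i, (N2 <= i)%nat -> nm (B1 (val (E i) x) -v B1 (val (E i) (B2 (a x)))) <= eps / 4 * nm x).
    { intros i Hi. specialize (HN2 i Hi). replace (E i -v vzero YS) with (E i) in HN2 by vec.
      rewrite <- (lin_sub _ _ (lb_lin HB1)). eapply Rle_trans; [apply Hb1b|].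
      rewrite <- (lin_sub _ _ (lb_lin (val_lb (E i)))).
      pose proof (nm_spec (E i) (x -v B2 (a x))). pose proof (nm_sub x (B2 (a x))). pose proof (Hb2b x). unfold opcomp in H1.
      pose proof (nm_ge0 x). pose proof (nm_ge0 (E i)). pose proof (nm_ge0 (x -v B2 (a x))).
      assert (nm (val (E i) (x -v B2 (a x))) <= eps / (4 * b1 * (1 + b2)) * ((1 + b2) * nm x)).
      { eapply Rle_trans; [apply H|]. apply Rmult_le_compat; lra. }
      apply Rle_trans with (b1 * (eps / (4 * b1 * (1 + b2)) * ((1 + b2) * nm x))); [now apply Rmult_le_compat_l; [lra|]|].
      right; field; lra. }
    eapply Rle_trans; [apply nm_add|]. eapply Rle_trans; [apply Rplus_le_compat_l, nm_sub|].
    pose proof (incr_ge Hpsi m). pose proof (incr_ge Hpsi n).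
    pose proof (HEb (psi m) ltac:(lia)). pose proof (HEb (psi n) ltac:(lia)).
    specialize (HN1 m n ltac:(lia) ltac:(lia) x). unfold opcomp in HN1. lra. }
  assert (HT0' : lim (fun n => T (psi n)) T0) by (intros eps Hep; destruct (HT0 eps Hep) as [N HN]; exists N; intros; apply HN; lia).
  assert (Hzero : T0 = vzero YS).
  { apply (@eigen_zero T0 z Hz1). apply sub_eq0. apply (@lim_unique YS (fun n => E (psi n))).
    - unfold E. apply lim_minus; [exact (lb_lim adY_lb HT0')|now apply lim_scal].
    - apply (lim_sub HE Hpsi). }
  assert (1 <= nm T0); [|rewrite Hzero, nm_0 in *; lra].
  apply (lim_norm_ge HT0'). exists O; intros n _. destruct (Hs (phi (psi n))) as [_ [H1 _]]. unfold T; rewrite H1; lra.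
Qed.

Lemma Cclosed_norm_le (Q : Cpx -> R) L r : (forall z w, Rabs (Q z - Q w) <= L * Cabs (Csub z w)) -> Cclosed (fun z => Q z <= r).
Proof.
  intros HQ u l Hu Hl. apply Rnot_lt_le; intro Hlt.
  destruct (Hl ((Q l - r) / (Rabs L + 1))) as [N HN]; [pose proof (Rabs_pos L); apply Rdiv_lt_0_compat; lra|].
  specialize (HN N (le_n _)). specialize (Hu N). specialize (HQ (u N) l).
  pose proof (Rabs_pos L). pose proof (Rle_abs L). pose proof (Cabs_ge0 (Csub (u N) l)).
  assert ((Q l - r) / (Rabs L + 1) * (Rabs L + 1) = Q l - r) by (field; lra).
  pose proof (Rle_abs (- (Q (u N) - Q l))). rewrite Rabs_Ropp in H3. nra.
Qed.
Lemma Cabs_lip z w : Rabs (Cabs z - Cabs w) <= Cabs (Csub z w).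
Proof.
  pose proof (Cabs_tri (Csub z w) w). replace (Cadd (Csub z w) w) with z in H by ring.
  pose proof (Cabs_tri (Copp (Csub z w)) z). replace (Cadd (Copp (Csub z w)) z) with w in H0 by ring.
  rewrite Cabs_opp in H0. apply Rabs_le; lra.
Qed.

Lemma surj_large z B : 0 < B -> (forall T, nm (adY T) <= B * nm T) -> B < Cabs z -> surj adY z.
Proof.
  intros HB HBb Hz T. assert (Hz0 : z <> C0) by (apply Cabs_neq0; lra).
  destruct (@neumann YS (opscal (Cinv z) adY) (B / Cabs z)) with (y := Copp (Cinv z) *v T) as [S HS].
  - apply lin_opscal, adY_lin.
  - split; [apply Rdiv_le_0_compat; lra|]. apply Rmult_lt_reg_r with (Cabs z); [lra|]. unfold Rdiv; rewrite Rmult_assoc, Rinv_l; lra.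
  - intro S. unfold opscal. rewrite vnorm_scal, Cabs_inv by assumption. pose proof (HBb S).
    replace (B / Cabs z * nm S) with (/ Cabs z * (B * nm S)) by (unfold Rdiv; ring).
    apply Rmult_le_compat_l; [left; apply Rinv_0_lt_compat|]; lra.
  - exists S. replace T with (Copp z *v (Copp (Cinv z) *v T)) by (vec_pre; field; assumption).
    rewrite <- HS. unfold opscal, Dop. vec_pre; field; assumption.
Qed.

Lemma cis_lip (w : Cpx) s t : s <= t -> Cabs (Csub (Cmul w (Cis s)) (Cmul w (Cis t))) <= Cabs w * (t - s).
Proof.
  intro Hst. destruct (Req_dec s t) as [->|Hne].
  - replace (Csub (Cmul w (Cis t)) (Cmul w (Cis t))) with C0 by ring. rewrite Cabs_C0. lra.
  - replace t with (s + (t - s)) at 1 by ring. rewrite Cis_add.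
    replace (Csub (Cmul w (Cis s)) (Cmul w (Cmul (Cis s) (Cis (t - s))))) with (Copp (Cmul w (Cmul (Cis s) (Csub (Cis (t - s)) Cone)))) by ring.
    rewrite Cabs_opp, !Cabs_mul, Cabs_Cis, Rmult_1_l. apply Rmult_le_compat_l; [apply Cabs_ge0|]. apply Cis_near; lra.
Qed.

(* The resolvent of [adY] is followed from infinity along the ray through [e], then along the circle. *)
Lemma on_circle rho e : 2 * k < rho -> Cabs e = 1 ->
  (forall z x, Cabs z = rho -> a x = z *v x -> x = vzero X) ->
  (forall t z x, rho <= t -> z = Cmul (RtoC t) e \/ z = Copp (Cmul (RtoC t) e) -> a x = z *v x -> x = vzero X) ->
  exists c, 0 < c /\ (forall z, Cabs z = rho -> low adY c z) /\ (forall z, Cabs z = rho -> surj adY z).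
Proof.
  intros Hrho He Hcirc Hray. destruct adY_bound as [B [HB HBb]].
  set (M := Rmax (B + 1) rho). assert (HM1 : B + 1 <= M) by apply Rmax_l. assert (HM2 : rho <= M) by apply Rmax_r.
  destruct (@lower_adY (fun z => Cabs z = rho) rho) as [c1 [Hc1 Hl1]].
  { intros u l Hu Hl. apply Rle_antisym.
    - apply (@Cclosed_norm_le Cabs 1 rho) with u; [intros; rewrite Rmult_1_l; apply Cabs_lip|intro; rewrite Hu; lra|assumption].
    - apply Ropp_le_cancel. apply (@Cclosed_norm_le (fun z => - Cabs z) 1 (- rho)) with u; [|intro; rewrite Hu; lra|assumption].
      intros z w. replace (- Cabs z - - Cabs w) with (- (Cabs z - Cabs w)) by ring. rewrite Rabs_Ropp, Rmult_1_l. apply Cabs_lip. }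
  { intros z ->; lra. }
  { intros z x Hz. now apply Hcirc. }
  { intros z x Hz. apply Hcirc. now rewrite Cabs_opp. }
  assert (Htr : forall t, 0 <= t -> Cabs (Cmul (RtoC t) e) = t).
  { intros t Ht. rewrite Cabs_mul, Cabs_RtoC_pos, He; lra. }
  destruct (@lower_adY (fun z => exists t, rho <= t <= M /\ z = Cmul (RtoC t) e) M) as [c2 [Hc2 Hl2]].
  { intros u l Hu Hl. exists (Cabs l).
    assert (Hu' : forall n, rho <= Cabs (u n) <= M /\ u n = Cmul (RtoC (Cabs (u n))) e).
    { intro n. destruct (Hu n) as [t [Ht ->]]. rewrite Htr by lra. auto. }
    split; [split|].
    - apply Ropp_le_cancel. apply (@Cclosed_norm_le (fun z => - Cabs z) 1 (- rho)) with u; [|intro n; destruct (Hu' n); lra|assumption].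
      intros z w. replace (- Cabs z - - Cabs w) with (- (Cabs z - Cabs w)) by ring. rewrite Rabs_Ropp, Rmult_1_l. apply Cabs_lip.
    - apply (@Cclosed_norm_le Cabs 1 M) with u; [intros; rewrite Rmult_1_l; apply Cabs_lip|intro n; apply Hu'|assumption].
    - assert (Hle : Cabs (Csub l (Cmul (RtoC (Cabs l)) e)) <= 0).
      { apply (@Cclosed_norm_le (fun z => Cabs (Csub z (Cmul (RtoC (Cabs z)) e))) 2 0) with u; [| |assumption].
        - intros z w. eapply Rle_trans; [apply Cabs_lip|].
          replace (Csub (Csub z (Cmul (RtoC (Cabs z)) e)) (Csub w (Cmul (RtoC (Cabs w)) e)))
            with (Cadd (Csub z w) (Copp (Cmul (RtoC (Cabs z - Cabs w)) e))) by (apply Cpx_eq; simpl; ring).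
          eapply Rle_trans; [apply Cabs_tri|]. rewrite Cabs_opp, Cabs_mul, Cabs_RtoC, He. pose proof (Cabs_lip z w). lra.
        - intro n. destruct (Hu' n) as [_ E]. rewrite <- E. replace (Csub (u n) (u n)) with C0 by ring. rewrite Cabs_C0. lra. }
      pose proof (Cabs_ge0 (Csub l (Cmul (RtoC (Cabs l)) e))).
      assert (E : Csub l (Cmul (RtoC (Cabs l)) e) = C0) by (apply Cabs_eq0; lra).
      replace l with (Cadd (Csub l (Cmul (RtoC (Cabs l)) e)) (Cmul (RtoC (Cabs l)) e)) at 1 by ring. rewrite E; ring. }
  { intros z [t [Ht ->]]. rewrite Htr; lra. }
  { intros z x [t [Ht ->]]. apply (Hray t); auto. lra. }
  { intros z x [t [Ht ->]]. apply (Hray t); auto. lra. }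
  assert (Hrs : surj adY (Cmul (RtoC rho) e)).
  { replace rho with (M - (M - rho)) by ring.
    apply (@surj_chain YS adY adY_lb c2 Hc2 (fun t => Cmul (RtoC (M - t)) e) (M - rho)).
    - intros t Ht. apply Hl2. exists (M - t); split; [lra|reflexivity].
    - apply (surj_large HB HBb). rewrite Htr; lra.
    - exists 1. intros s t Hs Ht. replace (Csub (Cmul (RtoC (M - s)) e) (Cmul (RtoC (M - t)) e)) with (Cmul (RtoC (t - s)) e) by (apply Cpx_eq; simpl; ring).
      rewrite Htr; lra.
    - lra. }
  exists c1; split; [assumption|split; [assumption|]].
  intros z Hz. assert (Hw : Cmul (RtoC rho) e <> C0) by (apply Cabs_neq0; rewrite Htr; lra).
  destruct (@polar (Cmul z (Cinv (Cmul (RtoC rho) e)))) as [t [Ht E]].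
  { rewrite Cabs_mul, Cabs_inv, Htr, Hz by (assumption || lra). field; lra. }
  replace z with (Cmul (Cmul (RtoC rho) e) (Cis t)) by (rewrite <- E; field; split; intro Hc; apply Hw; rewrite Hc; ring).
  apply (@surj_chain YS adY adY_lb c1 Hc1 (fun s => Cmul (Cmul (RtoC rho) e) (Cis s)) t).
  - intros s Hs. apply Hl1. rewrite Cabs_mul, Cabs_Cis, Htr; lra.
  - replace (Cmul (Cmul (RtoC rho) e) (Cis 0)) with (Cmul (RtoC rho) e); [assumption|].
    unfold Cis. rewrite cos_0, sin_0. apply Cpx_eq; simpl; ring.
  - exists rho. intros s r Hs Hr. eapply Rle_trans; [apply cis_lip; lra|]. rewrite Htr; lra.
  - lra.
Qed.

(** The limit [J] of the means is the identity: [T - Aj T] is the image under the [2^i]-th power of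
    [adY] of an element of size [rho^-(2^i)], so its compression is at most of order
    [(2 k / rho)^(2^i)] and vanishes in the limit. Then [Aj_forward] bounds the powers of [adY]
    themselves. *)
Lemma circle_growth rho c : 2 * k < rho -> 0 < c -> (forall z, Cabs z = rho -> low adY c z) -> (forall z, Cabs z = rho -> surj adY z) ->
  exists C, 0 <= C /\ forall i T, nm (Nat.iter (2 ^ i) adY T) <= (C + 1) * rho ^ (2 ^ i) * nm T.
Proof.
  intros Hrho Hc Hlow Hsurj.
  destruct (@circle_data YS adY adY_lb c rho Hc (fun z => Cabs z = rho)) as [A0 [P1 [P2 [P3 [P4 P5]]]]].
  { intros z ->; lra. }
  { rewrite Cabs_C0; lra. }
  { intros z Hz. destruct (@inverse_exists YS (Dop adY z) c) as [R [_ HR]]; auto.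
    - apply lin_Dop, adY_lin.
    - apply (Hlow z Hz).
    - apply (Hsurj z Hz).
    - exists R; apply HR. }
  assert (Hrho0 : 0 < rho) by lra.
  assert (HC : 0 <= rho / c) by (apply Rdiv_le_0_compat; lra).
  set (z := RtoC rho). assert (Hz : Cabs z = rho) by (apply Cabs_RtoC_pos; lra).
  assert (Hlim : forall T, lim (fun j => Aj A0 j z T) T).
  { intro T. destruct (@Aj_lim YS rho (/ c + rho / c * / c) Hrho0 A0 P3 z T Hz) as [J HJ].
    assert (E : T -v J = vzero YS); [|apply sub_eq0 in E; now rewrite <- E in HJ]. apply compress_zero. intro x.
    assert (Hcont : lim (fun j => q (val (T -v Aj A0 j z T) (q x))) (q (val (T -v J) (q x)))).
    { apply (lb_lim Hq). intros eps Hep.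
      pose proof (nm_ge0 (q x)). destruct (HJ (eps / (nm (q x) + 1))) as [N HN]; [apply Rdiv_lt_0_compat; lra|].
      exists N; intros n Hn. specialize (HN n Hn).
      rewrite <- val_sub. eapply Rle_lt_trans; [apply nm_spec|].
      replace (T -v Aj A0 n z T -v (T -v J)) with (-v (Aj A0 n z T -v J)) by vec. rewrite nm_opp.
      pose proof (nm_ge0 (Aj A0 n z T -v J)).
      assert (eps / (nm (q x) + 1) * (nm (q x) + 1) = eps) by (field; lra). nra. }
    apply nm_le0. apply le_pow_zero with (C := D * D * (rho / c) * nm T * nm x) (eta := 2 * k / rho).
    - split; [apply Rdiv_le_0_compat; lra|]. apply Rmult_lt_reg_r with rho; [lra|]. unfold Rdiv. rewrite Rmult_assoc, Rinv_l; lra.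
    - intro n0.
      assert (Hi : forall i, nm (q (val (T -v J) (q x))) <= D * D * (rho / c) * nm T * nm x * (2 * k / rho) ^ (2 ^ i)).
      { intro i. apply (lim_norm_le Hcont). exists i. intros j Hj.
        destruct (@Aj_backward YS adY adY_lb rho (rho / c) Hrho0 A0 P1 P2 P4 P5 i (j - i) z T Hz) as [g [Eg Hg]].
        replace (j - i + i)%nat with j in Eg by lia. rewrite <- Eg. eapply Rle_trans; [apply compress_iter|].
        assert (Hpr : 0 < rho ^ 2 ^ i) by now apply pow_lt. assert (Hpk : 0 < (2 * k) ^ 2 ^ i) by (apply pow_lt; lra).
        replace (D * D * (rho / c) * nm T * nm x * (2 * k / rho) ^ 2 ^ i)
          with (D * D * (rho / c * / rho ^ 2 ^ i * nm T) * (2 * k) ^ 2 ^ i * nm x).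
        2:{ unfold Rdiv. rewrite (Rpow_mult_distr (2 * k) (/ rho)), pow_inv. field. lra. }
        apply Rmult_le_compat_r; [apply nm_ge0|]. apply Rmult_le_compat_r; [lra|].
        apply Rmult_le_compat_l; [nra|assumption]. }
      eapply Rle_trans; [apply (Hi n0)|].
      assert (H2 : (n0 <= 2 ^ n0)%nat) by (clear; induction n0; simpl; [lia|]; pose proof (Nat.pow_nonzero 2 n0); lia).
      assert (Hk1 : 0 <= 2 * k / rho <= 1).
      { split; [apply Rdiv_le_0_compat; lra|]. apply Rmult_le_reg_r with rho; [lra|]. unfold Rdiv. rewrite Rmult_assoc, Rinv_l; lra. }
      apply Rmult_le_compat_l.
      + apply Rmult_le_pos; [apply Rmult_le_pos; [apply Rmult_le_pos; [nra|assumption]|]|]; apply nm_ge0.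
      + replace (2 ^ n0)%nat with (n0 + (2 ^ n0 - n0))%nat by lia. rewrite pow_add.
        assert (0 <= (2 * k / rho) ^ n0) by (apply pow_le; lra).
        assert ((2 * k / rho) ^ (2 ^ n0 - n0) <= 1 ^ (2 ^ n0 - n0)) by (apply pow_incr; lra). rewrite pow1 in *. nra. }
  exists (rho / c); split; [assumption|]. intros i T.
  apply (@lim_norm_le YS (fun j => Nat.iter (2 ^ i) adY (Aj A0 (j + i) z T))).
  - apply lb_lim; [apply lb_iter, adY_lb|]. apply (lim_sub (phi := fun j => (j + i)%nat) (Hlim T)). intro; lia.
  - exists O. intros j _. apply (@Aj_forward YS adY adY_lb rho (rho / c) Hrho0 A0 P1 P2 P4 P5 i j z T Hz).
Qed.

Lemma adY_quasinil rho e : 2 * k < rho -> Cabs e = 1 ->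
  (forall z x, Cabs z = rho -> a x = z *v x -> x = vzero X) ->
  (forall t z x, rho <= t -> z = Cmul (RtoC t) e \/ z = Copp (Cmul (RtoC t) e) -> a x = z *v x -> x = vzero X) ->
  exists G, 0 < G /\ forall n T, nm (Nat.iter n adY T) <= G * (2 * rho) ^ n * nm T.
Proof.
  intros Hrho He Hcirc Hray. destruct (on_circle Hrho He Hcirc Hray) as [c [Hc [Hlow Hsurj]]].
  destruct (circle_growth Hrho Hc Hlow Hsurj) as [C [HC H]].
  destruct (@pow_small (/2) (C + 1) 1) as [i Hi]; [lra|lra|].
  assert (H2 : (i <= 2 ^ i)%nat) by (clear; induction i; simpl; [lia|]; pose proof (Nat.pow_nonzero 2 i); lia).
  apply pow_bound_from_one with (N := (2 ^ i)%nat); [apply adY_lb|lra| |].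
  - pose proof (Nat.pow_nonzero 2 i). lia.
  - intro T. eapply Rle_trans; [apply H|]. apply Rmult_le_compat_r; [apply nm_ge0|].
    rewrite Rpow_mult_distr. apply Rmult_le_compat_r; [apply pow_le; lra|].
    specialize (Hi _ H2). rewrite pow_inv in Hi. assert (0 < 2 ^ 2 ^ i) by (apply pow_lt; lra).
    apply Rmult_le_reg_r with (/ 2 ^ 2 ^ i); [now apply Rinv_0_lt_compat|]. rewrite Rinv_r; lra.
Qed.
End Cut.

(** The resolvent of [ad a] is continued along a ray and a circle. [lower_adY] asks that both
    [a - z] and [a + z] be injective there, so radius and direction are chosen to avoid the finitely
    many eigenvalues of modulus at least [eps / 4] and their negatives. *)
Theorem ad_quasinil_of_no_finrank eps : 0 < eps -> exists G, 0 < G /\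
  forall n T x, Y T -> nm (Nat.iter n (ad a) T x) <= G * eps ^ n * (opnorm T * nm x).
Proof.
  intro He. destruct (@eigenvalues_finite X a (eps / 4) Ha) as [l Hl]; [lra|].
  destruct (@avoid_list (map Cabs l) (eps / 4) (eps / 2)) as [rho [Hrho Hav]]; [lra|].
  (* A line through 0 contains [z] together with [-z], so one condition on its slope [s] excludes
     both. *)
  destruct (@avoid_list (map (fun z => cim z / cre z) l) 0 1) as [s [Hs Hav2]]; [lra|].
  set (r := sqrt (1 + s * s)). assert (Hr2 : r * r = 1 + s * s) by (apply sqrt_sqrt; nra).
  assert (Hr : 0 < r) by (apply sqrt_lt_R0; nra).
  set (e := mkC (/ r) (s / r)).
  assert (Hee : Cabs e = 1).
  { unfold Cabs, e; simpl. replace (/ r * / r + s / r * (s / r)) with ((1 + s * s) / (r * r)) by (field; lra).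
    rewrite Hr2. replace ((1 + s * s) / (1 + s * s)) with 1 by (field; nra). apply sqrt_1. }
  (* With [k = eps / 16] and [rho] between [eps / 4] and [eps / 2] one has [2 k < rho] and
     [2 rho < eps]. *)
  destruct (@spectral_cut X a (eps / 16) Ha) as [p [D [Hp [Hpi [HD [Hpc [Hcut _]]]]]]]; [lra|].
  assert (Hpa : forall x, a (p x) = p (a x)) by (apply Hpc; [apply Ha|reflexivity]).
  destruct (@adY_quasinil p D (eps / 16) Hp ltac:(lra) HD) with (rho := rho) (e := e) as [G [HG HGb]]; auto.
  - lra.
  - intros z x Hz E. apply NNPP; intro Hx. apply (Hav rho); [|reflexivity]. rewrite <- Hz. apply in_map. apply (Hl z x); auto; lra.
  - intros t z x Ht Hz E. apply NNPP; intro Hx. apply (Hav2 s); [|reflexivity].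
    assert (Hin : In z l).
    { apply (Hl z x); auto. destruct Hz as [->| ->]; rewrite ?Cabs_opp, Cabs_mul, Cabs_RtoC_pos, Hee; lra. }
    replace s with (cim z / cre z); [now apply (in_map (fun z => cim z / cre z))|].
    assert (Ht' : 0 < t * / r) by (apply Rmult_lt_0_compat; [lra|now apply Rinv_0_lt_compat]).
    assert (Hz2 : cim z = s * cre z /\ cre z <> 0).
    { destruct Hz as [->| ->]; simpl; (split; [unfold Rdiv; ring|intro; lra]). }
    destruct Hz2 as [-> Hz2]. field; assumption.
  - exists G; split; [assumption|]. intros n T x HT. pose (T' := exist _ T HT : YS).
    specialize (HGb n T'). pose proof (val_iter n T') as E. change (val T') with T in E. rewrite <- E.
    eapply Rle_trans; [apply nm_spec|]. rewrite <- Rmult_assoc. apply Rmult_le_compat_r; [apply nm_ge0|].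
    eapply Rle_trans; [apply HGb|]. change (nm T') with (opnorm T). apply Rmult_le_compat_r; [apply opnorm_ge0, (Ylb HT)|].
    apply Rmult_le_compat_l; [lra|]. apply pow_incr; lra.
Qed.
End Wojtynski.

(** * Jacobson's theorem *)

Section Jacobson.
Variable X : CBanach.
Implicit Types (S T : op X -> Prop) (s t : op X) (ws : list (op X)) (A B K : X -> Prop).

Definition wapp ws (x : X) : X := fold_right (fun s y => s y) x ws.
Lemma wapp_app ws ws' x : wapp (ws ++ ws') x = wapp ws (wapp ws' x).
Proof. unfold wapp. apply fold_right_app. Qed.
Lemma wapp_lin ws : Forall (fun s => linear s) ws -> linear (wapp ws).
Proof.
  induction 1; [apply lin_opid|]. exact (lin_opcomp H IHForall).
Qed.
Lemma wapp_inv ws A x : Forall (fun s => forall x, A x -> A (s x)) ws -> A x -> A (wapp ws x).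
Proof. induction 1; simpl; auto. Qed.

(** [S] is closed under brackets but need not be a subspace: homogeneous elements of different
    degrees are never added. Nilpotency is relative, from [B] into [A]. *)
Record lie_on S A B : Prop := {
  lie_lin : forall s, S s -> linear s;
  lie_br : forall s t, S s -> S t -> S (bracket s t);
  lie_A : forall s x, S s -> A x -> A (s x);
  lie_B : forall s x, S s -> B x -> B (s x);
  lie_nil : forall s, S s -> exists k, forall x, B x -> A (Nat.iter k s x) }.

Lemma word_long S A B N : lie_on S A B -> (forall ws, Forall S ws -> length ws = N -> forall x, B x -> A (wapp ws x)) ->
  forall ws x, Forall S ws -> (N <= length ws)%nat -> B x -> A (wapp ws x).
Proof.
  intros H HN ws x Hws Hl Hx.
  rewrite <- (firstn_skipn N ws) in Hws |- *. apply Forall_app in Hws. destruct Hws as [H1 H2].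
  rewrite wapp_app. apply HN; auto.
  - rewrite length_firstn. lia.
  - apply wapp_inv; auto. eapply Forall_impl; [|apply H2]. intros s Hs y. now apply (lie_B H).
Qed.

(* Jacobson's theorem on weakly closed sets of nilpotent maps, relative to a pair [A <= B].  A counterexample
   with [A] maximal is refuted by looking at a minimal [K] annihilated modulo [A] by a Lie subset. *)
Lemma jacobson_rel l B : subsp B -> (forall x, B x -> span l x) ->
  forall A, subsp A -> (forall x, A x -> B x) -> forall S, lie_on S A B ->
  exists N, forall ws, Forall S ws -> length ws = N -> forall x, B x -> A (wapp ws x).
Proof.
  intros HB Hl. apply NNPP; intro Hn.
  pose (F := fun A => subsp A /\ (forall x, A x -> B x) /\ exists S, lie_on S A B /\
     ~ exists N, forall ws, Forall S ws -> length ws = N -> forall x, B x -> A (wapp ws x)).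
  destruct (@subsp_max_exists X l F) as [A [[HA [HAB [S [HS Hbad]]]] Hmax]].
  { apply NNPP; intro Hm. apply Hn. intros A HA HAB S HS. apply NNPP; intro Hk. apply Hm. exists A; unfold F; eauto. }
  { intros A [HA [HAB _]]; split; auto. }
  assert (HAneB : exists x, B x /\ ~ A x).
  { apply NNPP; intro Hm. apply Hbad. exists O. intros ws _ Hlen x Hx. destruct ws; [|discriminate]. simpl.
    apply NNPP; intro; apply Hm; eauto. }
  (* [ann] and [kr] are a Galois connection between subspaces of [B] and subsets of [S]; [K] will be
     a minimal closed element not contained in [A]. *)
  pose (ann := fun K s => S s /\ forall z, K z -> A (s z)).
  pose (kr := fun T z => B z /\ forall t, T t -> A (t z)).
  assert (Hkr : forall T, (forall t, T t -> S t) -> subsp (kr T)).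
  { intros T HT. split; [|split].
    - split; [now apply subsp_0|]. intros t Ht. rewrite lin_0 by (apply (lie_lin HS); auto). now apply subsp_0.
    - intros x y [H1 H2] [H3 H4]. split; [now apply subsp_add|]. intros t Ht. rewrite lin_add by (apply (lie_lin HS); auto). apply subsp_add; auto.
    - intros c x [H1 H2]. split; [now apply subsp_scal|]. intros t Ht. rewrite lin_scal by (apply (lie_lin HS); auto). apply subsp_scal; auto. }
  assert (Hann : forall K, (forall s t, ann K s -> ann K t -> ann K (bracket s t))).
  { intros K s t [H1 H2] [H3 H4]. split; [now apply (lie_br HS)|]. intros z Hz. unfold bracket, opsub, opcomp.
    apply subsp_sub; auto; apply (lie_A HS); auto. }
  destruct (@subsp_min_exists X l (fun K => (exists T, (forall t, T t -> S t) /\ (forall s t, T s -> T t -> T (bracket s t)) /\ K = kr T) /\ exists z, K z /\ ~ A z))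
    as [K [[[T0 [HT0 [_ EK]]] [z0 [Hz0 Hz0A]]] Hmin]].
  { exists (kr (fun _ => False)). split.
    - exists (fun _ => False); repeat split; tauto.
    - destruct HAneB as [x [Hx Hx']]. exists x; split; [split; [assumption|tauto]|assumption]. }
  { intros K [[T [HT [_ ->]]] _]. split; [now apply Hkr|]. intros x [Hx _]; auto. }
  assert (HKB : forall x, K x -> B x) by (rewrite EK; intros x [H _]; auto).
  assert (HAK : forall x, A x -> K x).
  { rewrite EK; intros x Hx; split; auto. intros t Ht. apply (lie_A HS); auto. }
  assert (HKs : subsp K) by (rewrite EK; now apply Hkr).
  set (T := ann K).
  assert (HTS : forall t, T t -> S t) by (intros t [H _]; auto).
  assert (HT0T : forall t, T0 t -> T t).
  { intros t Ht; split; auto. rewrite EK. intros z [_ Hz]. auto. }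
  assert (HTlie : forall A', (forall s x, S s -> A' x -> A' (s x)) -> (forall x, A x -> A' x) -> lie_on T A' B).
  { intros A' H1 H2. constructor.
    - intros; apply (lie_lin HS); auto.
    - apply Hann.
    - intros; apply H1; auto.
    - intros; apply (lie_B HS); auto.
    - intros s Hs. destruct (lie_nil HS (HTS s Hs)) as [k Hk]. exists k; auto. }
  (* [K] is strictly larger than [A], so by maximality of [A] the pair formed by [K] and [B] is no
     counterexample for [T]. *)
  assert (HIH : exists N, forall ws, Forall T ws -> length ws = N -> forall x, B x -> K (wapp ws x)).
  { apply NNPP; intro Hm. apply Hz0A. apply (Hmax K); auto.
    split; [assumption|split; [assumption|]]. exists T; split; [|assumption].
    constructor.
    - intros; apply (lie_lin HS); auto.
    - apply Hann.
    - intros s x [_ Hs] Hx. apply HAK; auto.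
    - intros; apply (lie_B HS); auto.
    - intros s Hs. destruct (lie_nil HS (HTS s Hs)) as [k Hk]. exists k; auto. }
  destruct HIH as [N HN].
  assert (HTA : lie_on T A B) by (apply HTlie; [apply (lie_A HS)|auto]).
  set (N1 := Datatypes.S N).
  assert (HN1 : forall ws, Forall T ws -> length ws = N1 -> forall x, B x -> A (wapp ws x)).
  { intros ws Hws Hlen x Hx. destruct ws as [|t ws]; [discriminate|]. inversion Hws; subst. simpl.
    match goal with H : T t |- _ => apply H end. apply HN; auto. }
  pose proof (word_long HTA HN1) as Hlong.
  destruct (classic (exists s, S s /\ ~ T s)) as [[s0 [Hs0 Hs0T]]|Hall].
  2:{ apply Hbad. exists N1. intros ws Hws. apply HN1. eapply Forall_impl; [|apply Hws].
      intros s Hs. apply NNPP; intro; apply Hall; eauto. }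
  (* Otherwise bracketing with elements of [T] never enters [T]. Expanded, a [2 N1]-fold bracket has
     in each term at least [N1] factors from [T] on one side of [s0], so it maps [B] into [A] and
     lies in [T] after all. *)
  assert (Hnorm : exists s, S s /\ ~ T s /\ forall t, T t -> T (bracket s t)).
  { apply NNPP; intro Hm.
    assert (Hstep : forall s, S s -> ~ T s -> exists t, T t /\ ~ T (bracket s t)).
    { intros s H1 H2. apply NNPP; intro Hk. apply Hm. exists s; split; [assumption|split; [assumption|]].
      intros t Ht. apply NNPP; intro; apply Hk; eauto. }
    assert (Hk : forall k, exists u, S u /\ ~ T u /\ forall ws1 ws2, Forall T ws1 -> Forall T ws2 ->
       (2 * N1 <= length ws1 + length ws2 + k)%nat -> forall x, B x -> A (wapp ws1 (u (wapp ws2 x)))).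
    { induction k as [|k [u [Hu [HuT IH]]]].
      - exists s0; split; [assumption|split; [assumption|]]. intros ws1 ws2 H1 H2 Hlen x Hx.
        destruct (Nat.le_gt_cases N1 (length ws2)) as [H|H].
        + apply wapp_inv; [|apply (lie_A HS); auto].
          eapply Forall_impl; [|apply H1]. intros s Hs y. apply (lie_A HS); auto.
        + apply Hlong; auto; [lia|]. apply (lie_B HS); auto. apply wapp_inv; auto.
          eapply Forall_impl; [|apply H2]. intros s Hs y. apply (lie_B HS); auto.
      - destruct (Hstep u Hu HuT) as [t [Ht HtT]]. exists (bracket u t).
        split; [apply (lie_br HS); auto|split; [assumption|]]. intros ws1 ws2 H1 H2 Hlen x Hx.
        unfold bracket, opsub, opcomp. rewrite lin_sub.
        2:{ apply wapp_lin. eapply Forall_impl; [|apply H1]. intros s Hs. apply (lie_lin HS); auto. }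
        apply subsp_sub; [assumption| |].
        + apply (IH ws1 (t :: ws2)); auto. simpl; lia.
        + change (wapp ws1 (t (u (wapp ws2 x)))) with (wapp ws1 (wapp (t :: nil) (u (wapp ws2 x)))). rewrite <- wapp_app.
          apply IH; auto; [apply Forall_app; auto|]. rewrite length_app; simpl; lia. }
    destruct (Hk (2 * N1)%nat) as [u [Hu [HuT Hw]]]. apply HuT. split; [assumption|].
    intros z Hz. apply (Hw nil nil); auto; try (simpl; lia). }
  destruct Hnorm as [s [Hs [HsT Hnorm]]].
  assert (HsK : forall z, K z -> K (s z)).
  { intros z Hz. pose proof Hz as Hz'. rewrite EK in Hz' |- *. split; [apply (lie_B HS); auto|]. intros t Ht.
    replace (t (s z)) with (s (t z) -v bracket s t z) by (unfold bracket, opsub, opcomp; vec).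
    apply subsp_sub; [assumption| |].
    - apply (lie_A HS); auto. now apply Hz'.
    - apply Hnorm; auto. }
  (* [s] acts nilpotently on [K] modulo [A], so [K'] is not contained in [A]. Minimality of [K] then
     gives [K' = K], which says that [s] lies in [T]. *)
  pose (K' := fun z => K z /\ A (s z)).
  assert (HK' : exists z, K' z /\ ~ A z).
  { destruct (lie_nil HS Hs) as [k Hk].
    assert (Hgo : forall j z, K z -> A (Nat.iter j s z) -> ~ A z -> exists z, K' z /\ ~ A z).
    { induction j; intros z Hz Hj HzA; [contradiction|].
      destruct (classic (A (s z))) as [Hsz|Hsz]; [exists z; split; [split|]; assumption|].
      apply (IHj (s z)); auto. now rewrite iter_shift. }
    apply (Hgo k z0); auto. }
  apply HsT. split; [assumption|].
  assert (Hsub : forall z, kr (ann K') z -> K' z).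
  { intros z [HzB Hz]. split.
    - rewrite EK. split; [assumption|]. intros t Ht. apply Hz. split; auto. intros w [Hw _]. now apply (HT0T t Ht).
    - apply Hz. split; [assumption|]. now intros w [_ Hw]. }
  intros z Hz. apply (Hmin (kr (ann K'))) in Hz.
  - apply Hsub in Hz. apply Hz.
  - split.
    + exists (ann K'); split; [intros t [H _]; auto|split; [apply Hann|reflexivity]].
    + destruct HK' as [w [Hw HwA]]. exists w; split; [|assumption]. split; [apply HKB, Hw|]. intros t [_ Ht]; auto.
  - intros w Hw. apply Hsub in Hw. apply Hw.
Qed.

Lemma jacobson l B S : subsp B -> (forall x, B x -> span l x) -> (forall s, S s -> linear s) ->
  (forall s t, S s -> S t -> S (bracket s t)) -> (forall s x, S s -> B x -> B (s x)) ->
  (forall s, S s -> exists k, forall x, B x -> Nat.iter k s x = vzero X) ->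
  exists N, forall ws, Forall S ws -> length ws = N -> forall x, B x -> wapp ws x = vzero X.
Proof.
  intros HB Hl Hlin Hbr HSB Hnil.
  apply (@jacobson_rel l B HB Hl (fun x => x = vzero X)).
  - split; [reflexivity|split; intros; subst; vec].
  - intros x ->. now apply subsp_0.
  - constructor; auto. intros s x Hs ->. now apply lin_0, Hlin.
Qed.

(** If [W] lies in the span of its own images, it lies in the span of its images under words of
    every length, and long words vanish. *)
Lemma jacobson_fix l B S (W : X -> Prop) : subsp B -> (forall x, B x -> span l x) -> (forall s, S s -> linear s) ->
  (forall s t, S s -> S t -> S (bracket s t)) -> (forall s x, S s -> B x -> B (s x)) ->
  (forall s, S s -> exists k, forall x, B x -> Nat.iter k s x = vzero X) ->
  (forall x, W x -> B x) -> (forall x, W x -> lspan (fun y => exists s w, S s /\ W w /\ y = s w) x) ->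
  forall x, W x -> x = vzero X.
Proof.
  intros HB Hl Hlin Hbr HSB Hnil HWB HW.
  destruct (jacobson HB Hl Hlin Hbr HSB Hnil) as [N HN].
  assert (H : forall n x, W x -> lspan (fun y => exists ws w, Forall S ws /\ length ws = n /\ W w /\ y = wapp ws w) x).
  { induction n; intros x Hx.
    - apply lspan_in. exists nil, x; auto.
    - specialize (HW x Hx). revert HW. apply lspan_least; [apply lspan_subsp|].
      intros y [s [w [Hs [Hw ->]]]]. specialize (IHn w Hw). revert IHn.
      apply (lspan_least (Z := fun y => lspan (fun y0 => exists ws w0, Forall S ws /\ length ws = Datatypes.S n /\ W w0 /\ y0 = wapp ws w0) (s y))).
      + pose proof (Hlin s Hs) as L. split; [|split].
        * rewrite (lin_0 L); constructor.
        * intros a b Ha Hb. rewrite (lin_add _ _ L). now apply lspan_add.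
        * intros c a Ha. rewrite (lin_scal _ _ L). now apply subsp_scal; [apply lspan_subsp|].
      + intros z [ws [w' [Hws [Hlen [Hw' ->]]]]]. apply lspan_in. exists (s :: ws), w'. repeat split; auto. simpl; congruence. }
  intros x Hx. specialize (H N x Hx). revert H.
  apply (lspan_least (Z := fun x => x = vzero X)).
  - split; [reflexivity|split; intros; subst; vec].
  - intros y [ws [w [Hws [Hlen [Hw ->]]]]]. apply HN; auto.
Qed.
End Jacobson.

(** * Nilpotency from decay, and finite rank limits of Volterra operators *)

Section Nilpotent.
Variable X : CBanach.

Lemma lcomb_bound (l : list X) : forall cs m b, 0 <= m -> 0 <= b -> (forall c, In c cs -> Cabs c <= m) -> (forall v, In v l -> nm v <= b) ->
  nm (lcomb cs l) <= INR (length l) * (m * b).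
Proof.
  induction l as [|v l IH]; intros cs m b Hm Hb Hc Hv.
  - destruct cs; simpl; rewrite nm_0; lra.
  - assert (0 <= m * b) by now apply Rmult_le_pos. simpl length. rewrite S_INR. pose proof (pos_INR (length l)).
    destruct cs as [|c cs]; simpl lcomb; [rewrite nm_0; nra|].
    eapply Rle_trans; [apply nm_add|]. rewrite vnorm_scal.
    assert (nm (lcomb cs l) <= INR (length l) * (m * b)) by (apply IH; auto; intros; [apply Hc|apply Hv]; now right).
    assert (Cabs c * nm v <= m * b) by (apply Rmult_le_compat; [apply Cabs_ge0|apply nm_ge0|apply Hc; now left|apply Hv; now left]).
    lra.
Qed.
Lemma lcomb_lin (T : op X) : linear T -> forall l cs, T (lcomb cs l) = lcomb cs (map T l).
Proof.
  intro HT; induction l as [|v l IH]; intros [|c cs]; simpl; try (now apply lin_0).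
  now rewrite lin_add, lin_scal, IH.
Qed.
Lemma list_norm_bound (l : list X) : exists b, 0 <= b /\ forall v, In v l -> nm v <= b.
Proof.
  induction l as [|v l [b [Hb IH]]]; [exists 0; split; [lra|intros v []]|].
  exists (Rmax b (nm v)); split; [eapply Rle_trans; [apply Hb|apply Rmax_l]|].
  intros w [<-|Hw]; [apply Rmax_r|]. eapply Rle_trans; [now apply IH|apply Rmax_l].
Qed.

(** The images of [B] stabilise at some [E] with [T E = E]. On [E] preimages cost at most a factor
    [Q] per step, whereas decay is uniform there and may be taken at a rate faster than [1/Q]; so
    [E] is zero. *)
Lemma decays_nilpotent (T : op X) l B : linear T -> subsp B -> (forall x, B x -> span l x) -> (forall x, B x -> B (T x)) ->
  (forall x, B x -> decays T x) -> exists k, forall x, B x -> Nat.iter k T x = vzero X.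
Proof.
  intros HT HB Hl HTB Hd.
  assert (HBi : forall n x, B x -> B (Nat.iter n T x)) by (induction n; simpl; auto).
  destruct (@chain_stops_down X l (fun n y => exists x, B x /\ y = Nat.iter n T x)) as [k Hk].
  - intro n. pose proof (lin_iter n HT) as L. split; [|split].
    + exists (vzero X); split; [now apply subsp_0|now rewrite (lin_0 L)].
    + intros x y [x' [Hx ->]] [y' [Hy ->]]. exists (x' +v y'); split; [now apply subsp_add|now rewrite (lin_add _ _ L)].
    + intros c x [x' [Hx ->]]. exists (c *v x'); split; [now apply subsp_scal|now rewrite (lin_scal _ _ L)].
  - intros n x [y [Hy ->]]. exists (T y); split; [auto|]. symmetry; apply iter_shift.
  - intros x [y [Hy ->]]. apply Hl, Hy.
  - pose (E := fun y => exists x, B x /\ y = Nat.iter k T x).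
    assert (HE : subsp E).
    { pose proof (lin_iter k HT) as L. split; [|split].
      + exists (vzero X); split; [now apply subsp_0|now rewrite (lin_0 L)].
      + intros x y [x' [Hx ->]] [y' [Hy ->]]. exists (x' +v y'); split; [now apply subsp_add|now rewrite (lin_add _ _ L)].
      + intros c x [x' [Hx ->]]. exists (c *v x'); split; [now apply subsp_scal|now rewrite (lin_scal _ _ L)]. }
    assert (HEB : forall y, E y -> B y) by (intros y [x [Hx ->]]; auto).
    destruct (@subsp_span X l E HE) as [e He]; [intros x Hx; auto|].
    destruct (proj2 (span_analytic e)) as [C [HC Hcoef]].
    assert (Hpre : exists e', map T e' = e /\ forall v, In v e' -> E v).
    { assert (Hee : forall v, In v e -> E v) by (intros v Hv; apply He, span_in, Hv).
      clear - Hee Hk HT. induction e as [|v e IH]; [exists nil; split; [reflexivity|intros v []]|].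
      destruct IH as [e' [E1 E2]]; [intros; apply Hee; now right|].
      destruct (Hk v) as [x [Hx Ex]]; [apply Hee; now left|].
      exists (Nat.iter k T x :: e'); split; [simpl; f_equal; auto|].
      intros w [<-|Hw]; [exists x; auto|auto]. }
    destruct Hpre as [e' [Ee' He']].
    destruct (list_norm_bound e') as [b [Hb Hbb]].
    set (Q := INR (length e') * (C * b) + 1).
    assert (HQ : 0 < Q). { unfold Q. pose proof (pos_INR (length e')). assert (0 <= C * b) by (apply Rmult_le_pos; lra). nra. }
    assert (Hback : forall x, E x -> exists y, E y /\ T y = x /\ nm y <= Q * nm x).
    { intros x Hx. destruct (Hcoef x) as [cs [Hlen [Ex Hcs]]]; [now apply He|].
      exists (lcomb cs e'); split; [|split].
      - apply (span_least (l := e') (Z := E)); auto. apply lcomb_span.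
      - now rewrite lcomb_lin, Ee'.
      - pose proof (nm_ge0 x). eapply Rle_trans; [apply (@lcomb_bound e' cs (C * nm x) b); auto; apply Rmult_le_pos; lra|].
        unfold Q. nra. }
    assert (Hbackn : forall n x, E x -> exists y, E y /\ Nat.iter n T y = x /\ nm y <= Q ^ n * nm x).
    { induction n; intros x Hx; [exists x; repeat split; auto; simpl; lra|].
      destruct (Hback x Hx) as [y [Hy [Ey Ny]]]. destruct (IHn y Hy) as [z [Hz [Ez Nz]]].
      exists z; split; [assumption|split; [simpl; congruence|]]. simpl.
      assert (0 <= Q ^ n) by (apply pow_le; lra). nra. }
    assert (Hunif : forall eps, 0 < eps -> exists D, 0 <= D /\ forall n x, E x -> nm (Nat.iter n T x) <= D * eps ^ n * nm x).
    { intros eps Hep.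
      assert (Hle : exists D, 0 <= D /\ forall v, In v e -> forall n, nm (Nat.iter n T v) <= D * eps ^ n).
      { assert (Hee : forall v, In v e -> decays T v) by (intros v Hv; apply Hd, HEB, He, span_in, Hv).
        clear - Hee Hep. induction e as [|v e IH]; [exists 0; split; [lra|intros v []]|].
        destruct IH as [D [HD IH]]; [intros; apply Hee; now right|].
        destruct (Hee v (or_introl eq_refl) eps Hep) as [D' HD'].
        exists (Rmax D D'); split; [eapply Rle_trans; [apply HD|apply Rmax_l]|].
        intros w [<-|Hw] n.
        - eapply Rle_trans; [apply HD'|]. apply Rmult_le_compat_r; [apply pow_le; lra|apply Rmax_r].
        - eapply Rle_trans; [now apply IH|]. apply Rmult_le_compat_r; [apply pow_le; lra|apply Rmax_l]. }
      destruct Hle as [D [HD HDb]]. exists (INR (length e) * (C * D)). split.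
      { apply Rmult_le_pos; [apply pos_INR|]. apply Rmult_le_pos; lra. }
      intros n x Hx. destruct (Hcoef x) as [cs [Hlen [Ex Hcs]]]; [now apply He|].
      rewrite Ex at 1. rewrite lcomb_lin by now apply lin_iter.
      pose proof (nm_ge0 x). pose proof (pow_le eps n (Rlt_le _ _ Hep)).
      eapply Rle_trans; [apply (@lcomb_bound _ cs (C * nm x) (D * eps ^ n)); auto|].
      - apply Rmult_le_pos; lra.
      - now apply Rmult_le_pos.
      - intros v Hv. apply in_map_iff in Hv. destruct Hv as [w [<- Hw]]. now apply HDb.
      - rewrite length_map. right; ring. }
    exists k. intros x Hx. set (y := Nat.iter k T x). assert (Hy : E y) by (exists x; auto).
    (* A preimage under [T^n] costs [Q^n], so this rate leaves the factor [2^-n]. *)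
    destruct (Hunif (/ (2 * Q))) as [D [HD HDb]]; [apply Rinv_0_lt_compat; lra|].
    apply nm_le0. apply le_pow_zero with (C := D * nm y) (eta := /2); [lra|]. intro n.
    destruct (Hbackn n y Hy) as [z [Hz [Ez Nz]]]. specialize (HDb n z Hz). rewrite Ez in HDb.
    eapply Rle_trans; [apply HDb|]. rewrite pow_inv, Rpow_mult_distr.
    assert (0 < 2 ^ n) by (apply pow_lt; lra). assert (0 < Q ^ n) by now apply pow_lt.
    apply Rle_trans with (D * / (2 ^ n * Q ^ n) * (Q ^ n * nm y)).
    + apply Rmult_le_compat_l; [|assumption]. apply Rmult_le_pos; [assumption|]. left; apply Rinv_0_lt_compat; nra.
    + right. rewrite pow_inv. field. split; lra.
Qed.

(* A finite rank limit [f] of compact quasinilpotent operators: the averages [Aj] of the resolvents of a nearby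
   [b] tend to the identity, but on an eigenvector of [f] they are close to numbers tending to zero. *)
Lemma finrank_limit_no_eigen (f : op X) z0 v : finrank f ->
  (forall eps, 0 < eps -> exists b, compact_op b /\ quasinilpotent b /\ forall x, nm (f x -v b x) <= eps * nm x) ->
  z0 <> C0 -> f v = z0 *v v -> v = vzero X.
Proof.
  intros Hf Hlim Hz0 Ev. apply NNPP; intro Hv. pose proof (nm_pos Hv) as Hvp. pose proof (Cabs_pos Hz0) as Hzp.
  pose proof (compact_finrank Hf) as Hfc.
  destruct (@eigenvalues_finite X f (Cabs z0 / 2) Hfc) as [l Hl]; [lra|].
  destruct (@avoid_list (map Cabs l) (Cabs z0 / 2) (Cabs z0)) as [rho [Hrho Hav]]; [lra|].
  destruct (@lower_bound_unif X f (fun _ => True) (fun z => Cabs z = rho) rho Hfc) as [c [Hc Hlow]].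
  - repeat split.
  - intros u y _ _; exact I.
  - intros u w Hu Hw. apply NNPP; intro Hne.
    destruct (Hw (Rabs (Cabs w - rho))) as [N HN]; [apply Rabs_pos_lt; lra|]. specialize (HN N (le_n _)).
    pose proof (Cabs_tri (Csub (u N) w) w). replace (Cadd (Csub (u N) w) w) with (u N) in H by ring.
    pose proof (Cabs_tri (Copp (Csub (u N) w)) (u N)). replace (Cadd (Copp (Csub (u N) w)) (u N)) with w in H0 by ring.
    rewrite Cabs_opp in H0. rewrite Hu in *. revert HN. unfold Rabs. destruct (Rcase_abs (Cabs w - rho)); lra.
  - intros z ->; lra.
  - rewrite Cabs_C0; lra.
  - intros z x Hz _ E. apply NNPP; intro Hx. apply (Hav rho); [|reflexivity]. rewrite <- Hz. apply in_map.
    apply (Hl z x); auto. lra.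
  - assert (Hgap : 0 < Cabs z0 - rho) by lra.
    set (C := rho / (c / 2)). assert (HC : 0 < C) by (apply Rdiv_lt_0_compat; lra).
    (* The first bound lets [b] inherit half of the lower bound of [f] on the circle, the second
       makes the error [dl] at the eigenvector at most a quarter of its norm. *)
    set (eps := Rmin (c / 2) ((Cabs z0 - rho) / (4 * C))).
    assert (Heps : 0 < eps). { apply Rmin_glb_lt; [lra|]. apply Rdiv_lt_0_compat; lra. }
    assert (He1 : eps <= c / 2) by apply Rmin_l. assert (He2 : eps <= (Cabs z0 - rho) / (4 * C)) by apply Rmin_r.
    destruct (Hlim eps Heps) as [b [Hb [Hbq Hbf]]].
    assert (Hlowb : forall z x, Cabs z = rho -> c / 2 * nm x <= nm (Dop b z x)).
    { intros z x Hz. specialize (Hlow z x Hz I). specialize (Hbf x).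
      replace (Dop f z x) with (Dop b z x +v (f x -v b x)) in Hlow by (unfold Dop; vec).
      pose proof (nm_add (Dop b z x) (f x -v b x)). pose proof (nm_ge0 x). nra. }
    assert (Hrho0 : 0 < rho) by lra.
    destruct (@circle_data X b (compact_lb Hb) (c / 2) rho ltac:(lra) (fun z => Cabs z = rho)) as [A0 [P1 [P2 [P3 [P4 P5]]]]].
    { intros z ->; lra. }
    { rewrite Cabs_C0; lra. }
    { intros z Hz. destruct (@resolvent_exists X b z (c / 2) Hb) as [R [_ HR]].
      - apply Cabs_neq0; lra.
      - lra.
      - intro x; now apply Hlowb.
      - exists R; apply HR. }
    fold C in P2.
    assert (Hu1 : forall z n, Cabs z = rho -> (1 <= n)%nat -> 1 < Cabs (Cpow (Cmul z0 (Cinv z)) n)).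
    { intros z n Hz Hn. rewrite Cabs_pow. apply Rlt_pow_R1; [|lia].
      assert (z <> C0) by (apply Cabs_neq0; lra). rewrite Cabs_mul, Cabs_inv, Hz by assumption.
      apply Rmult_lt_reg_r with rho; [lra|]. rewrite Rmult_assoc, Rinv_l; lra. }
    (* The means computed for the scalar [z0] in place of the operator; they obey the same
       recursion, so the initial closeness persists for all [j]. *)
    set (aj := fun j z => Cinv (Csub Cone (Cpow (Cmul z0 (Cinv z)) (2 ^ j)))).
    assert (Hpow2 : forall j, (1 <= 2 ^ j)%nat) by (intro j; pose proof (Nat.pow_nonzero 2 j); lia).
    assert (Hden : forall w, 1 < Cabs w -> Csub Cone w <> C0).
    { intros w Hw E. apply Csub_neq0 in E; [assumption|]. intro E'. rewrite <- E', Cabs_1 in Hw. lra. }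
    set (dl := C * eps / (Cabs z0 - rho) * nm v).
    assert (Hdl : dl <= / 4 * nm v).
    { unfold dl. apply Rmult_le_compat_r; [lra|]. apply Rmult_le_reg_r with (Cabs z0 - rho); [assumption|].
      unfold Rdiv. rewrite Rmult_assoc, Rinv_l, Rmult_1_r by lra.
      apply Rle_trans with (C * ((Cabs z0 - rho) / (4 * C))); [apply Rmult_le_compat_l; lra|]. right; field; lra. }
    assert (Hclose : forall j z, Cabs z = rho -> nm (Aj A0 j z v -v aj j z *v v) <= dl).
    { induction j; intros z Hz.
      - assert (Hz1 : z <> C0) by (apply Cabs_neq0; lra).
        pose proof (P1 z Hz) as L. pose proof (Hu1 z 1%nat Hz (le_n _)) as Hu. simpl in Hu.
        set (w := Cmul z0 (Cinv z)) in *.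
        assert (Hw1 : 1 < Cabs w) by (replace w with (Cmul w Cone) by ring; assumption).
        pose proof (Hden w Hw1) as Hd1.
        unfold aj. change (2 ^ 0)%nat with 1%nat. fold w. simpl Aj. simpl Cpow. replace (Cmul w Cone) with w by ring.
        assert (EA : A0 z v -v Cinv (Csub Cone w) *v v = Cinv (Csub Cone w) *v (Cinv z *v A0 z (b v -v f v))).
        { pose proof (P4 z v Hz) as E4. rewrite (lin_sub _ _ L), (lin_scal _ _ L) in E4.
          rewrite (lin_sub _ _ L), Ev, (lin_scal _ _ L). rewrite <- E4 at 2. unfold w in *. vec_pre; field; repeat split; auto.
          all: intro Hc0; apply Hd1; try (rewrite <- Hc0; field; assumption).
          all: transitivity (Cmul (Csub z z0) (Cinv z)); [field; assumption|rewrite Hc0; ring]. }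
        rewrite EA, !vnorm_scal, !Cabs_inv by assumption. rewrite Hz.
        pose proof (P2 z (b v -v f v) Hz). specialize (Hbf v). rewrite nm_swap in Hbf.
        assert (Hdd : (Cabs z0 - rho) / rho <= Cabs (Csub Cone w)).
        { pose proof (Cabs_tri (Csub Cone w) w). replace (Cadd (Csub Cone w) w) with Cone in H0 by ring.
          pose proof (Cabs_tri (Copp (Csub Cone w)) Cone). replace (Cadd (Copp (Csub Cone w)) Cone) with w in H1 by ring.
          rewrite Cabs_opp, Cabs_1 in H1. unfold w in H1 at 1. rewrite Cabs_mul, Cabs_inv, Hz in H1 by assumption.
          replace ((Cabs z0 - rho) / rho) with (Cabs z0 * / rho - 1) by (field; lra). lra. }
        assert (Hdp : 0 < (Cabs z0 - rho) / rho) by (apply Rdiv_lt_0_compat; lra).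
        assert (Hi : / Cabs (Csub Cone w) <= / ((Cabs z0 - rho) / rho)) by (apply Rinv_le_contravar; lra).
        assert (0 < / rho) by (apply Rinv_0_lt_compat; lra).
        apply Rle_trans with (/ ((Cabs z0 - rho) / rho) * (/ rho * (C * (eps * nm v)))).
        + apply Rmult_le_compat; [left; apply Rinv_0_lt_compat; lra|apply Rmult_le_pos; [lra|apply nm_ge0]|assumption|].
          apply Rmult_le_compat_l; [lra|]. eapply Rle_trans; [apply H|]. apply Rmult_le_compat_l; lra.
        + unfold dl. right. field. lra.
      - assert (Hz1 : z <> C0) by (apply Cabs_neq0; lra).
        pose proof (IHj z Hz) as I1. pose proof (IHj _ (circ_rot j Hz)) as I2.
        assert (Ea : aj (S j) z = Cmul Chalf (Cadd (aj j z) (aj j (Cmul z (eC j))))).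
        { unfold aj. set (N := (2 ^ j)%nat). replace (2 ^ S j)%nat with (N + N)%nat by (unfold N; simpl; lia).
          assert (Hej : eC j <> C0) by (apply Cabs_neq0; rewrite Cabs_eC; lra).
          replace (Cmul z0 (Cinv (Cmul z (eC j)))) with (Cmul (Cmul z0 (Cinv z)) (Cinv (eC j))) by (field; auto).
          rewrite (Cpow_mul_l (Cmul z0 (Cinv z)) (Cinv (eC j))), Cpow_add.
          assert (Epow : Cpow (Cinv (eC j)) N = Copp Cone).
          { assert (E1 : Cmul (Cpow (Cinv (eC j)) N) (Cpow (eC j) N) = Cone).
            { rewrite <- Cpow_mul_l. replace (Cmul (Cinv (eC j)) (eC j)) with Cone by (field; assumption).
              clear. induction N; simpl; [reflexivity|rewrite IHN; ring]. }
            change (Cpow (eC j) N) with (Cpow (eC j) (2 ^ j)) in E1. rewrite eC_pow in E1.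
              transitivity (Copp (Cmul (Cpow (Cinv (eC j)) N) (Copp Cone))); [ring|now rewrite E1]. }
          rewrite Epow. set (u := Cpow (Cmul z0 (Cinv z)) N).
          assert (Hu : 1 < Cabs u) by (apply Hu1; [assumption|apply Hpow2]).
          assert (H1 : Csub Cone u <> C0) by now apply Hden.
          assert (H2 : Csub Cone (Copp u) <> C0) by (apply Hden; now rewrite Cabs_opp).
          assert (H3 : Csub Cone (Cmul u u) <> C0).
          { replace (Csub Cone (Cmul u u)) with (Cmul (Csub Cone u) (Csub Cone (Copp u))) by ring. now apply Cmul_neq0. }
          replace (Cmul u (Copp Cone)) with (Copp u) by ring.
          assert (E2 : Cadd (Cinv (Csub Cone u)) (Cinv (Csub Cone (Copp u))) = Cmul (Cadd Cone Cone) (Cinv (Csub Cone (Cmul u u)))).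
          { field. repeat split; auto. }
          rewrite E2. replace (Cmul Chalf (Cmul (Cadd Cone Cone) (Cinv (Csub Cone (Cmul u u))))) with (Cmul (Cadd Chalf Chalf) (Cinv (Csub Cone (Cmul u u)))) by ring.
          rewrite Chalf2. ring. }
        rewrite Ea. simpl Aj.
        match goal with |- nm (?h *v (?p +v ?r) -v _) <= _ =>
          match type of I1 with nm (_ -v ?p') <= _ => match type of I2 with nm (_ -v ?r') <= _ =>
          replace (nm (h *v (p +v r) -v Cmul h (Cadd (aj j z) (aj j (Cmul z (eC j)))) *v v)) with (nm (h *v ((p -v p') +v (r -v r')))) by (f_equal; vec) end end end.
        rewrite nm_half. match goal with |- / 2 * nm (?p +v ?r) <= _ => pose proof (nm_add p r) end. lra. }
    set (z := RtoC rho). assert (Hz : Cabs z = rho) by (apply Cabs_RtoC_pos; lra).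
    destruct (Hbq (rho / 2)) as [N1 HN1]; [lra|].
    destruct (@pow_small (/2) C (/4)) as [N2 HN2]; [lra|lra|].
    destruct (@pow_small (rho / Cabs z0) 1 (/5)) as [N3 HN3].
    { split; [apply Rdiv_le_0_compat; lra|]. apply Rmult_lt_reg_r with (Cabs z0); [lra|]. unfold Rdiv; rewrite Rmult_assoc, Rinv_l; lra. }
    { lra. }
    (* At this index the mean at [v] is within a quarter of [v], because [b] is quasinilpotent,
       while the scalar [aj] is at most 1/4, because [z0] lies outside the circle. With [dl] this
       makes three quarters in all. *)
    set (j := (N1 + N2 + N3)%nat).
    assert (Hj : (j <= 2 ^ j)%nat) by (clear; generalize j as n; induction n; simpl; [lia|]; pose proof (Nat.pow_nonzero 2 n); lia).
    assert (Hone : nm (Aj A0 j z v -v v) <= / 4 * nm v).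
    { rewrite <- (@Aj_inv' X b (compact_lb Hb) rho Hrho0 A0 P1 P4 P5 j z v Hz).
      rewrite vnorm_scal, (Cabs_invpow Hrho0 _ Hz).
      assert (Hpr : 0 < rho ^ 2 ^ j) by now apply pow_lt.
      pose proof (HN1 (2 ^ j)%nat ltac:(unfold j in *; lia) (Aj A0 j z v) I) as H1.
      pose proof (@Aj_bd X rho C A0 P2 j z v Hz) as H2.
      specialize (HN2 (2 ^ j)%nat ltac:(unfold j in *; lia)).
      apply Rmult_le_reg_l with (rho ^ 2 ^ j); [assumption|]. rewrite <- Rmult_assoc, Rinv_r, Rmult_1_l by lra.
      eapply Rle_trans; [apply H1|]. unfold Rdiv. rewrite Rpow_mult_distr, Rmult_assoc. apply Rmult_le_compat_l; [lra|].
      assert (0 <= (/ 2) ^ 2 ^ j) by (apply pow_le; lra). nra. }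
    pose proof (Hclose j z Hz) as Hcl.
    assert (Haj : Cabs (aj j z) <= / 4).
    { unfold aj. set (u := Cpow (Cmul z0 (Cinv z)) (2 ^ j)).
      assert (Hz1 : z <> C0) by (apply Cabs_neq0; lra).
      assert (Hu : 5 <= Cabs u).
      { unfold u. rewrite Cabs_pow, Cabs_mul, Cabs_inv, Hz by assumption.
        specialize (HN3 (2 ^ j)%nat ltac:(unfold j in *; lia)). rewrite Rmult_1_l in HN3.
        assert (Hq : 0 < (rho / Cabs z0) ^ 2 ^ j) by (apply pow_lt, Rdiv_lt_0_compat; lra).
        replace (Cabs z0 * / rho) with (/ (rho / Cabs z0)) by (field; lra). rewrite pow_inv.
        rewrite <- (Rinv_inv 5). apply Rinv_le_contravar; lra. }
      rewrite Cabs_inv by (apply Hden; lra). apply Rinv_le_contravar; [lra|].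
      pose proof (Cabs_tri (Copp (Csub Cone u)) Cone). replace (Cadd (Copp (Csub Cone u)) Cone) with u in H by ring.
      rewrite Cabs_opp, Cabs_1 in H. lra. }
    assert (Hfin : nm v <= nm (Aj A0 j z v -v v) + nm (Aj A0 j z v -v aj j z *v v) + nm (aj j z *v v)).
    { replace v with ((-v (Aj A0 j z v -v v)) +v (Aj A0 j z v -v aj j z *v v) +v aj j z *v v) at 1 by vec.
      eapply Rle_trans; [apply nm_add|]. apply Rplus_le_compat_r. eapply Rle_trans; [apply nm_add|]. rewrite nm_opp. lra. }
    rewrite vnorm_scal in Hfin. assert (Cabs (aj j z) * nm v <= / 4 * nm v) by (apply Rmult_le_compat_r; lra). lra.
Qed.
End Nilpotent.

(** * Exponentials *)

Lemma exp_pow_nat a n : exp a ^ n = exp (INR n * a).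
Proof.
  induction n; [simpl; now rewrite Rmult_0_l, exp_0|]. simpl pow. rewrite IHn, <- exp_plus, S_INR. f_equal; ring.
Qed.
Lemma pow2_pos k : 0 < 2 ^ k. Proof. apply pow_lt; lra. Qed.
Lemma INR_pow2 k : INR (2 ^ k) = 2 ^ k.
Proof. rewrite pow_INR. reflexivity. Qed.

Section Exponential.
Variable X : CBanach.
Implicit Types (m A B P Q : op X) (x y : X).

Lemma iter_diff P Q c d : linear P -> 1 <= c -> 0 <= d -> (forall x, nm (P x) <= c * nm x) -> (forall x, nm (Q x) <= c * nm x) ->
  (forall x, nm (P x -v Q x) <= d * nm x) ->
  forall n x, nm (Nat.iter n P x -v Nat.iter n Q x) <= INR n * (c ^ n * d) * nm x.
Proof.
  intros HL Hc Hd HP HQ HPQ n x. induction n; [simpl; rewrite vadd_oppr, nm_0; lra|].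
  rewrite S_INR. simpl Nat.iter. simpl pow.
  replace (P (Nat.iter n P x) -v Q (Nat.iter n Q x)) with
    (P (Nat.iter n P x -v Nat.iter n Q x) +v (P (Nat.iter n Q x) -v Q (Nat.iter n Q x))) by (rewrite (lin_sub _ _ HL); vec).
  eapply Rle_trans; [apply nm_add|].
  pose proof (HP (Nat.iter n P x -v Nat.iter n Q x)). pose proof (HPQ (Nat.iter n Q x)).
  assert (Hc0 : 0 <= c) by lra. pose proof (iter_bound n x Hc0 HQ).
  pose proof (nm_ge0 x). assert (1 <= c ^ n) by now apply pow_R1_Rle. pose proof (pos_INR n).
  assert (H5 : nm (P (Nat.iter n P x -v Nat.iter n Q x)) <= c * (INR n * (c ^ n * d) * nm x)).
  { eapply Rle_trans; [eassumption|]. apply Rmult_le_compat_l; lra. }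
  assert (H6 : nm (P (Nat.iter n Q x) -v Q (Nat.iter n Q x)) <= c * c ^ n * d * nm x).
  { eapply Rle_trans; [eassumption|]. apply Rle_trans with (d * (c ^ n * nm x)); [now apply Rmult_le_compat_l|].
    assert (0 <= c ^ n * nm x) by (apply Rmult_le_pos; lra). assert (0 <= d * (c ^ n * nm x)) by now apply Rmult_le_pos. nra. }
  lra.
Qed.
Lemma iter_double (f : X -> X) n x : Nat.iter (n + n) f x = Nat.iter n (fun y => f (f y)) x.
Proof.
  induction n; [reflexivity|]. replace (S n + S n)%nat with (S (S (n + n))) by lia. simpl. now rewrite IHn.
Qed.

(** The Euler step of size [2^-k]. The exponential is defined as the limit of [(1 + 2^-k m)^(2^k)],
    since iterates are easily pushed through subspaces and intertwining maps. *)
Definition estep k m : op X := fun x => x +v RtoC (/ 2 ^ k) *v m x.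
Definition eseq m k : op X := Nat.iter (2 ^ k) (estep k m).
Definition ex m : op X := fun x => epsilon (inhabits (vzero X)) (fun y => lim (fun k => eseq m k x) y).

Lemma inv2_pos k : 0 < / 2 ^ k. Proof. apply Rinv_0_lt_compat, pow2_pos. Qed.
Lemma lin_estep k m : linear m -> linear (estep k m).
Proof. intro H; split; intros; unfold estep; [rewrite (lin_add _ _ H)|rewrite (lin_scal _ _ H)]; vec. Qed.
Lemma estep_bound k m M x : 0 <= M -> (forall x, nm (m x) <= M * nm x) -> nm (estep k m x) <= exp (/ 2 ^ k * M) * nm x.
Proof.
  intros HM Hm. unfold estep. pose proof (inv2_pos k). pose proof (nm_ge0 x).
  eapply Rle_trans; [apply nm_add|]. rewrite nm_Rscal by lra.
  assert (/ 2 ^ k * nm (m x) <= / 2 ^ k * (M * nm x)) by (apply Rmult_le_compat_l; [lra|auto]).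
  pose proof (exp_ineq1_le (/ 2 ^ k * M)). assert ((1 + / 2 ^ k * M) * nm x <= exp (/ 2 ^ k * M) * nm x) by now apply Rmult_le_compat_r. lra.
Qed.
Lemma expM_pow k M : exp (/ 2 ^ k * M) ^ (2 ^ k) = exp M.
Proof. rewrite exp_pow_nat, INR_pow2. f_equal. pose proof (pow2_pos k). field; lra. Qed.
Lemma exp_ge1 M : 0 <= M -> 1 <= exp M.
Proof. intro. pose proof (exp_ineq1_le M). lra. Qed.
Lemma eseq_bound k m M x : 0 <= M -> (forall x, nm (m x) <= M * nm x) -> nm (eseq m k x) <= exp M * nm x.
Proof.
  intros HM Hm. rewrite <- (expM_pow k M). apply iter_bound; [left; apply exp_pos|]. intro; now apply estep_bound.
Qed.

(* Replacing one factor by another with the same first-order term costs [O(4^-k)], hence [O(2^-k)] over [2^k] factors. *)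
Lemma eseq_compare k P Q M D x : linear P -> 0 <= M -> 0 <= D ->
  (forall x, nm (P x) <= exp (/ 2 ^ k * M) * nm x) -> (forall x, nm (Q x) <= exp (/ 2 ^ k * M) * nm x) ->
  (forall x, nm (P x -v Q x) <= / 2 ^ k * / 2 ^ k * D * nm x) ->
  nm (Nat.iter (2 ^ k) P x -v Nat.iter (2 ^ k) Q x) <= exp M * D * nm x * (/ 2) ^ k.
Proof.
  intros HL HM HD HP HQ HPQ. pose proof (inv2_pos k) as Hi. pose proof (pow2_pos k).
  eapply Rle_trans.
  - apply (@iter_diff P Q (exp (/ 2 ^ k * M)) (/ 2 ^ k * / 2 ^ k * D)); auto.
    + apply exp_ge1. apply Rmult_le_pos; lra.
    + apply Rmult_le_pos; [|assumption]. apply Rmult_le_pos; lra.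
  - rewrite expM_pow, INR_pow2, pow_inv. right. field. lra.
Qed.

(** Two half steps differ from one full step by the square of [2^-(k+1) m], so passing from [k] to
    [k + 1] changes the product by order [2^-k]. *)
Lemma ex_lim m x : lb m -> lim (fun k => eseq m k x) (ex m x).
Proof.
  intro Hm. unfold ex. apply epsilon_spec. destruct (lb_bound Hm) as [M [HM HmM]].
  apply (@complete_geom X (fun k => eseq m k x) (exp M * (M * M / 4) * nm x) (/ 2)); [lra|].
  intro k. unfold eseq. replace (2 ^ S k)%nat with (2 ^ k + 2 ^ k)%nat by (simpl; lia). rewrite iter_double.
  pose proof (lb_lin Hm) as L. pose proof (inv2_pos k) as Hi.
  assert (E2 : / 2 ^ S k = / 2 ^ k / 2) by (simpl; pose proof (pow2_pos k); field; lra).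
  assert (Eexp : exp (/ 2 ^ S k * M) * exp (/ 2 ^ S k * M) = exp (/ 2 ^ k * M)) by (rewrite <- exp_plus; f_equal; rewrite E2; field; pose proof (pow2_pos k); lra).
  apply eseq_compare with (P := fun y => estep (S k) m (estep (S k) m y)); try lra.
  - apply (lin_opcomp (lin_estep (S k) L) (lin_estep (S k) L)).
  - assert (0 <= M * M) by (apply Rmult_le_pos; lra). lra.
  - intro y. rewrite <- Eexp, Rmult_assoc.
    eapply Rle_trans; [apply estep_bound with (M := M); auto; lra|]. apply Rmult_le_compat_l; [left; apply exp_pos|].
    apply estep_bound; auto; lra.
  - intro y. apply estep_bound; auto; lra.
  - intro y.
    assert (E : estep (S k) m (estep (S k) m y) -v estep k m y = RtoC (/ 2 ^ k * / 2 ^ k / 4) *v m (m y)).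
    { unfold estep. rewrite (lin_add _ _ L), (lin_scal _ _ L).
      assert (Ec : RtoC (/ 2 ^ k) = Cadd (RtoC (/ 2 ^ S k)) (RtoC (/ 2 ^ S k))) by (rewrite E2; apply Cpx_eq; simpl; lra).
      assert (Ed : RtoC (/ 2 ^ k * / 2 ^ k / 4) = Cmul (RtoC (/ 2 ^ S k)) (RtoC (/ 2 ^ S k))) by (rewrite E2; apply Cpx_eq; simpl; field; pose proof (pow2_pos k); lra).
      rewrite Ec, Ed. vec. }
    rewrite E, nm_Rscal.
    + replace (/ 2 ^ k * / 2 ^ k * (M * M / 4) * nm y) with (/ 2 ^ k * / 2 ^ k / 4 * (M * (M * nm y))) by lra.
      apply Rmult_le_compat_l; [assert (0 <= / 2 ^ k * / 2 ^ k) by (apply Rmult_le_pos; lra); lra|].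
      eapply Rle_trans; [apply HmM|]. apply Rmult_le_compat_l; [lra|apply HmM].
    + assert (0 <= / 2 ^ k * / 2 ^ k) by (apply Rmult_le_pos; lra); lra.
Qed.
Lemma ex_eq m x y : lb m -> lim (fun k => eseq m k x) y -> ex m x = y.
Proof. intros Hm H. exact (lim_unique (ex_lim x Hm) H). Qed.
Lemma ex_bound m M x : lb m -> 0 <= M -> (forall x, nm (m x) <= M * nm x) -> nm (ex m x) <= exp M * nm x.
Proof. intros Hm HM H. apply (lim_norm_le (ex_lim x Hm)). exists O. intros. now apply eseq_bound. Qed.
Lemma lb_ex m : lb m -> lb (ex m).
Proof.
  intro Hm. pose proof (fun k => lin_iter (2 ^ k) (lin_estep k (lb_lin Hm))) as L. split; [split|].
  - intros x y. apply (ex_eq Hm). eapply lim_ext; [|apply (lim_add (ex_lim x Hm) (ex_lim y Hm))].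
    intro k. unfold eseq. now rewrite (lin_add _ _ (L k)).
  - intros c x. apply (ex_eq Hm). eapply lim_ext; [|apply (lim_scal c (ex_lim x Hm))].
    intro k. unfold eseq. now rewrite (lin_scal _ _ (L k)).
  - destruct (lb_bound Hm) as [M [HM HmM]]. exists (exp M). intro. apply ex_bound; auto; lra.
Qed.
Lemma ex_inv_subsp m (Z : X -> Prop) : lb m -> subsp Z -> closed Z -> (forall x, Z x -> Z (m x)) -> forall x, Z x -> Z (ex m x).
Proof.
  intros Hm HZ HZc HmZ x Hx. apply (HZc (fun k => eseq m k x)); [|now apply ex_lim].
  intro k. unfold eseq. assert (H : forall n, Z (Nat.iter n (estep k m) x)); [|apply H].
  induction n; simpl; [assumption|]. unfold estep at 1. apply subsp_add; auto. apply subsp_scal; auto.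
Qed.

(** For commuting [A] and [B] the two products have factors differing by [4^-k A B] only. *)
Lemma ex_add A B x : lb A -> lb B -> (forall x, A (B x) = B (A x)) -> ex (opadd A B) x = ex A (ex B x).
Proof.
  intros HA HB Hc. pose proof (lb_lin HA) as LA. pose proof (lb_lin HB) as LB.
  pose proof (lb_opadd HA HB) as HS.
  destruct (lb_bound HA) as [MA [HMA HAM]]. destruct (lb_bound HB) as [MB [HMB HBM]].
  set (g := fun k => eseq A k (eseq B k x)).
  assert (Hg : lim g (ex A (ex B x))).
  { intros eps He. pose proof (exp_pos MA) as Hep.
    destruct (ex_lim x HB (eps := eps / 2 / exp MA)) as [N1 HN1]; [apply Rdiv_lt_0_compat; lra|].
    destruct (ex_lim (ex B x) HA (eps := eps / 2)) as [N2 HN2]; [lra|].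
    exists (max N1 N2). intros n Hn. specialize (HN1 n ltac:(lia)). specialize (HN2 n ltac:(lia)). unfold g.
    eapply Rle_lt_trans; [apply (nm_tri _ (eseq A n (ex B x)))|].
    assert (H1 : nm (eseq A n (eseq B n x) -v eseq A n (ex B x)) <= exp MA * nm (eseq B n x -v ex B x)).
    { assert (L : linear (eseq A n)) by apply lin_iter, lin_estep, LA. rewrite <- (lin_sub _ _ L). apply eseq_bound; auto; lra. }
    assert (H2 : exp MA * nm (eseq B n x -v ex B x) < exp MA * (eps / 2 / exp MA)) by now apply Rmult_lt_compat_l.
    replace (exp MA * (eps / 2 / exp MA)) with (eps / 2) in H2 by (field; lra). lra. }
  apply (ex_eq HS).
  assert (Hd : lim (fun k => eseq (opadd A B) k x -v g k) (vzero X)).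
  { apply (@lim_small X _ _ (fun k => exp (MA + MB) * (MA * MB) * nm x * (/ 2) ^ k)).
    - intro k.
      replace (eseq (opadd A B) k x -v g k -v vzero X) with (eseq (opadd A B) k x -v g k) by vec.
      assert (Eg : g k = Nat.iter (2 ^ k) (fun y => estep k A (estep k B y)) x).
      { unfold g, eseq. assert (Hcc : forall y, estep k A (estep k B y) = estep k B (estep k A y)).
        { intro y. unfold estep. rewrite (lin_add _ _ LA), (lin_add _ _ LB), (lin_scal _ _ LA), (lin_scal _ _ LB), Hc. vec. }
        generalize (2 ^ k)%nat as n. induction n; [reflexivity|]. simpl. rewrite <- IHn.
        rewrite <- (iter_comm (T := estep k A) (A := estep k B) n); [|intro; now rewrite Hcc]. now rewrite Hcc. }
      rewrite Eg. pose proof (inv2_pos k) as Hi. apply eseq_compare; try lra.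
      + apply lin_estep, HS.
      + apply Rmult_le_pos; lra.
      + intro y. apply estep_bound; [lra|]. intro z. unfold opadd. eapply Rle_trans; [apply nm_add|]. rewrite Rmult_plus_distr_r. now apply Rplus_le_compat.
      + intro y. rewrite Rmult_plus_distr_l, exp_plus, Rmult_assoc.
        eapply Rle_trans; [apply estep_bound with (M := MA); auto; lra|]. apply Rmult_le_compat_l; [left; apply exp_pos|].
        apply estep_bound; auto; lra.
      + intro y.
        assert (E : estep k (opadd A B) y -v estep k A (estep k B y) = -v (RtoC (/ 2 ^ k * / 2 ^ k) *v A (B y))).
        { unfold estep, opadd. rewrite (lin_add _ _ LA), (lin_scal _ _ LA).
          replace (RtoC (/ 2 ^ k * / 2 ^ k)) with (Cmul (RtoC (/ 2 ^ k)) (RtoC (/ 2 ^ k))) by (apply Cpx_eq; simpl; ring). vec. }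
        rewrite E, nm_opp, nm_Rscal by (apply Rmult_le_pos; lra).
        rewrite !(Rmult_assoc (_ * _)). apply Rmult_le_compat_l; [apply Rmult_le_pos; lra|].
        eapply Rle_trans; [apply HAM|]. rewrite Rmult_assoc. apply Rmult_le_compat_l; [lra|apply HBM].
    - intros eps He. destruct (@pow_small (/2) (exp (MA + MB) * (MA * MB) * nm x) eps) as [N HN]; [lra|lra|]. exists N; intros; apply HN; lia. }
  rewrite <- (@vadd_0 X (ex A (ex B x))).
  eapply lim_ext; [|apply (lim_add Hd Hg)]. intro k; cbv beta. vec.
Qed.

Lemma opneg_bound m M : (forall x, nm (m x) <= M * nm x) -> forall x, nm (opscal (Copp Cone) m x) <= M * nm x.
Proof. intros H x. unfold opscal. rewrite <- vopp_scal, nm_opp. auto. Qed.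

Lemma iter_first_order d D x : linear d -> 0 <= D -> (forall x, nm (d x) <= D * nm x) -> forall n,
  nm (Nat.iter n (opadd (@opid X) d) x -v x -v RtoC (INR n) *v d x) <= INR n * INR n * ((1 + D) ^ n * (D * D)) * nm x.
Proof.
  intros L HD Hd. set (P := opadd (@opid X) d). assert (LP : linear P) by now apply lin_opadd; [exact (@lin_opid X)|].
  assert (HP : forall y, nm (P y) <= (1 + D) * nm y).
  { intro y. eapply Rle_trans; [apply nm_add|]. unfold opid. specialize (Hd y). lra. }
  induction n.
  - simpl. replace (x -v x -v RtoC 0 *v d x) with (vzero X) by (change (RtoC 0) with C0; vec). rewrite nm_0; lra.
  - rewrite S_INR. simpl Nat.iter. simpl pow.
    replace (P (Nat.iter n P x) -v x -v RtoC (INR n + 1) *v d x) with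
      (P (Nat.iter n P x -v x -v RtoC (INR n) *v d x) +v RtoC (INR n) *v d (d x)).
    2:{ rewrite !(lin_sub _ _ LP), (lin_scal _ _ LP). replace (RtoC (INR n + 1)) with (Cadd (RtoC (INR n)) Cone) by (apply Cpx_eq; simpl; ring).
        change (P x) with (x +v d x). change (P (d x)) with (d x +v d (d x)). vec. }
    eapply Rle_trans; [apply nm_add|]. rewrite nm_Rscal by apply pos_INR.
    pose proof (pos_INR n) as Hn. pose proof (nm_ge0 x) as Hx.
    assert (H1 : nm (P (Nat.iter n P x -v x -v RtoC (INR n) *v d x)) <= (1 + D) * (INR n * INR n * ((1 + D) ^ n * (D * D)) * nm x)).
    { eapply Rle_trans; [apply HP|]. apply Rmult_le_compat_l; lra. }
    assert (H2 : INR n * nm (d (d x)) <= INR n * (D * D * nm x)).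
    { apply Rmult_le_compat_l; [assumption|]. eapply Rle_trans; [apply Hd|]. rewrite Rmult_assoc. apply Rmult_le_compat_l; auto. }
    assert (Hc : 1 <= (1 + D) * (1 + D) ^ n) by (apply (pow_R1_Rle (1 + D) (S n)); lra).
    set (c := (1 + D) * (1 + D) ^ n) in *. set (q := D * D * nm x) in *.
    assert (Hq : 0 <= q) by (apply Rmult_le_pos; [apply Rmult_le_pos|]; assumption).
    replace ((1 + D) * (INR n * INR n * ((1 + D) ^ n * (D * D)) * nm x)) with (INR n * INR n * c * q) in H1 by (unfold c, q; ring).
    replace ((INR n + 1) * (INR n + 1) * (c * (D * D)) * nm x) with ((INR n + 1) * (INR n + 1) * c * q) by (unfold q; ring).
    assert (0 <= INR n * q) by now apply Rmult_le_pos. assert (0 <= c * q) by (apply Rmult_le_pos; lra).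
    assert (INR n * q <= INR n * q * c) by nra. nra.
Qed.
Lemma ex_first_order m M x : lb m -> 0 <= M -> (forall x, nm (m x) <= M * nm x) ->
  nm (ex m x -v x -v m x) <= exp M * (M * M) * nm x.
Proof.
  intros Hm HM HmM. pose proof (ex_lim x Hm) as H.
  apply (lim_norm_le (u := fun k => eseq m k x -v x -v m x)).
  - apply lim_minus; [apply lim_minus; [assumption|apply lim_const]|apply lim_const].
  - exists O. intros k _. pose proof (inv2_pos k) as Hi. pose proof (pow2_pos k).
    pose proof (@iter_first_order (opscal (RtoC (/ 2 ^ k)) m) (/ 2 ^ k * M) x) as H1.
    eapply Rle_trans; [eapply Rle_trans; [|apply (H1 (lin_opscal _ (lb_lin Hm)) ltac:(apply Rmult_le_pos; lra)) with (n := (2 ^ k)%nat)]|].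
    + right. unfold eseq. f_equal. f_equal. rewrite INR_pow2. unfold opscal.
      rewrite <- vscal_mul. replace (Cmul (RtoC (2 ^ k)) (RtoC (/ 2 ^ k))) with Cone by (apply Cpx_eq; simpl; field; lra).
      now rewrite vscal_1.
    + intro y. unfold opscal. rewrite nm_Rscal, Rmult_assoc by lra. apply Rmult_le_compat_l; [lra|auto].
    + rewrite INR_pow2.
      replace (2 ^ k * 2 ^ k * ((1 + / 2 ^ k * M) ^ 2 ^ k * (/ 2 ^ k * M * (/ 2 ^ k * M))) * nm x) with ((1 + / 2 ^ k * M) ^ 2 ^ k * (M * M * nm x)) by (field; lra).
      rewrite !Rmult_assoc. apply Rmult_le_compat_r.
      * apply Rmult_le_pos; [assumption|]. apply Rmult_le_pos; [assumption|apply nm_ge0].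
      * rewrite <- (expM_pow k M). apply pow_incr. split; [|apply exp_ineq1_le].
        assert (0 <= / 2 ^ k * M) by (apply Rmult_le_pos; lra). lra.
Qed.
End Exponential.

(** Used with [J] the embedding of constants into [U^G], and with [J] the evaluation of operators at
    a vector. *)
Lemma ex_intertwine (X Z : CBanach) (J : X -> Z) (C : R) (m : op X) (m' : op Z) x :
  (forall x y, J (x +v y) = J x +v J y) -> (forall c x, J (c *v x) = c *v J x) -> (forall x, nm (J x) <= C * nm x) ->
  lb m -> lb m' -> (forall x, J (m x) = m' (J x)) -> J (ex m x) = ex m' (J x).
Proof.
  intros Ja Js Jb Hm Hm' Hc. symmetry. apply (ex_eq Hm').
  assert (E : forall k, J (eseq m k x) = eseq m' k (J x)).
  { intro k. unfold eseq. generalize (2 ^ k)%nat as n. induction n; [reflexivity|]. simpl. unfold estep at 1 3. now rewrite Ja, Js, Hc, IHn. }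
  assert (Jsub : forall u w, J (u -v w) = J u -v J w) by (intros; rewrite (vopp_scal w), (vopp_scal (J w)), Ja, Js; reflexivity).
  apply (@lim_small _ _ _ (fun k => (Rabs C + 1) * nm (eseq m k x -v ex m x))).
  - intro k. rewrite <- E, <- Jsub. eapply Rle_trans; [apply Jb|]. apply Rmult_le_compat_r; [apply nm_ge0|]. pose proof (Rle_abs C); lra.
  - intros eps He. pose proof (Rabs_pos C). destruct (ex_lim x Hm (eps := eps / (Rabs C + 1))) as [N HN]; [apply Rdiv_lt_0_compat; lra|].
    exists N; intros n Hn. specialize (HN n Hn). apply Rmult_lt_reg_l with (/ (Rabs C + 1)); [apply Rinv_0_lt_compat; lra|].
    rewrite <- Rmult_assoc, Rinv_l, Rmult_1_l by lra. unfold Rdiv in HN. lra.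
Qed.

(* [exp(ad m) T = exp(m) T exp(-m)], because [ad m] is the sum of the commuting multiplications by [m] and [-m]. *)
Lemma ex_conj_in (X : CBanach) (m : op X) (Y : op X -> Prop) T : lb m -> (forall T, Y T -> lb T) -> is_subspace Y -> opclosed Y ->
  (forall T, Y T -> Y (bracket m T)) -> Y T -> Y (fun x => ex m (T (ex (opscal (Copp Cone) m) x))).
Proof.
  intros Hm Ylb Ysub Ycl Yad HT.
  assert (Bsub : is_subspace (@lb X)) by (split; [apply lb_opzero|split; [apply lb_opadd|apply lb_opscal]]).
  assert (Bcl : opclosed (@lb X)) by (intros S HS _; exact HS).
  set (B := OpSpace (fun S (H : @lb X S) => H) Bsub Bcl).
  set (val := fun S : B => oval S). assert (Vlb : forall S, lb (val S)) by (intro S; exact (proj2_sig S)).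
  assert (Veq : forall S S' : B, (forall x, val S x = val S' x) -> S = S') by (intros S S'; apply ocar_eq).
  assert (Vnm : forall (S : B) x, nm (val S x) <= nm S * nm x) by (intros S x; apply opnorm_spec, Vlb).
  assert (Vle : forall (S : B) C, 0 <= C -> (forall x, nm (val S x) <= C * nm x) -> nm S <= C) by (intros S C HC H; apply opnorm_le; auto; apply Vlb).
  destruct (lb_bound Hm) as [M [HM HmM]]. pose proof (lb_lin Hm) as L.
  set (Lm := (fun S : B => exist _ (opcomp m (val S)) (lb_opcomp Hm (Vlb S))) : op B).
  set (Rm := (fun S : B => exist _ (opcomp (val S) (opscal (Copp Cone) m)) (lb_opcomp (Vlb S) (lb_opscal (Copp Cone) Hm))) : op B).
  assert (HLm : lb Lm).
  { split; [split|exists M].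
    - intros S S'. apply Veq; intro x. exact (lin_add (val S x) (val S' x) L).
    - intros c S. apply Veq; intro x. exact (lin_scal c (val S x) L).
    - intro S. apply Vle; [apply Rmult_le_pos; [lra|apply nm_ge0]|]. intro x. change (nm (m (val S x)) <= M * nm S * nm x).
      eapply Rle_trans; [apply HmM|]. rewrite Rmult_assoc. apply Rmult_le_compat_l; [lra|apply Vnm]. }
  assert (HRm : lb Rm).
  { split; [split|exists M].
    - intros S S'. apply Veq; reflexivity.
    - intros c S. apply Veq; reflexivity.
    - intro S. apply Vle; [apply Rmult_le_pos; [lra|apply nm_ge0]|]. intro x. change (nm (val S (opscal (Copp Cone) m x)) <= M * nm S * nm x).
      eapply Rle_trans; [apply Vnm|]. rewrite (Rmult_comm M), Rmult_assoc. apply Rmult_le_compat_l; [apply nm_ge0|now apply opneg_bound]. }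
  set (T0 := (exist _ T (Ylb T HT)) : B).
  assert (E : forall x, val (ex (opadd Lm Rm) T0) x = ex m (T (ex (opscal (Copp Cone) m) x))).
  { intro x. rewrite ex_add; [|assumption|assumption|intro S; apply Veq; reflexivity].
    rewrite (@ex_intertwine B X (fun S => val S x) (nm x) Lm m); auto; try reflexivity.
    2:{ intro S. rewrite Rmult_comm. apply Vnm. }
    f_equal. pose proof (lb_opscal (Copp Cone) Hm) as Hm'.
    assert (H1 : lim (fun k => val (eseq Rm k T0) x) (val (ex Rm T0) x)).
    { intros eps He. pose proof (nm_ge0 x) as Hx. destruct (ex_lim T0 HRm (eps := eps / (nm x + 1))) as [N HN]; [apply Rdiv_lt_0_compat; lra|].
      exists N; intros n Hn. specialize (HN n Hn).
      assert (H2 : nm (val (eseq Rm n T0) x -v val (ex Rm T0) x) <= nm (eseq Rm n T0 -v ex Rm T0) * nm x).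
      { eapply Rle_trans; [|apply Vnm]. right. f_equal. change (val (eseq Rm n T0) x -v val (ex Rm T0) x = val (eseq Rm n T0) x +v Copp Cone *v val (ex Rm T0) x). now rewrite <- vopp_scal. }
      eapply Rle_lt_trans; [apply H2|]. apply Rle_lt_trans with (nm (eseq Rm n T0 -v ex Rm T0) * (nm x + 1)); [pose proof (nm_ge0 (eseq Rm n T0 -v ex Rm T0)); nra|].
      apply Rlt_le_trans with (eps / (nm x + 1) * (nm x + 1)); [apply Rmult_lt_compat_r; lra|right; field; lra]. }
    apply (lim_unique H1). eapply lim_ext; [|apply (lb_lim (Ylb T HT) (ex_lim x Hm'))].
    intro k. unfold eseq. generalize (2 ^ k)%nat as n.
    assert (Hn : forall n (S : B) y, val (Nat.iter n (estep k Rm) S) y = val S (Nat.iter n (estep k (opscal (Copp Cone) m)) y)).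
    { induction n; intros S y; [reflexivity|]. rewrite (Nat.iter_succ_r n _ (estep k Rm) S), IHn. simpl Nat.iter.
      change (val S (Nat.iter n (estep k (opscal (Copp Cone) m)) y) +v RtoC (/ 2 ^ k) *v val S (opscal (Copp Cone) m (Nat.iter n (estep k (opscal (Copp Cone) m)) y)) = val S (estep k (opscal (Copp Cone) m) (Nat.iter n (estep k (opscal (Copp Cone) m)) y))).
      unfold estep at 3. now rewrite (lin_add _ _ (lb_lin (Vlb S))), (lin_scal _ _ (lb_lin (Vlb S))). }
    intro n. symmetry. apply (Hn n T0 x). }
  replace (fun x => ex m (T (ex (opscal (Copp Cone) m) x))) with (val (ex (opadd Lm Rm) T0)) by (apply functional_extensionality; exact E).
  apply (@ex_inv_subsp B (opadd Lm Rm) (fun S => Y (val S))); [now apply lb_opadd| | | |exact HT].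
  - split; [apply Ysub|split].
    + intros S S'; apply Ysub.
    + intros c S; apply Ysub.
  - intros u S Hu HS. apply Ycl; [apply Vlb|]. intros eps He. destruct (HS eps He) as [N HN]. exists (val (u N)); split; [apply Hu|].
    intro x. specialize (HN N (le_n _)). rewrite nm_swap. eapply Rle_trans; [|apply Rmult_le_compat_r; [apply nm_ge0|left; exact HN]].
    eapply Rle_trans; [|apply Vnm]. right. f_equal. change (val (u N) x -v val S x = val (u N) x +v Copp Cone *v val S x). now rewrite <- vopp_scal.
  - intros S HS. specialize (Yad _ HS).
    replace (val (opadd Lm Rm S)) with (bracket m (val S)); [assumption|].
    apply functional_extensionality; intro x. change (m (val S x) -v val S (m x) = m (val S x) +v val S (Copp Cone *v m x)).
    now rewrite (lin_scal _ _ (lb_lin (Vlb S))), <- vopp_scal.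
Qed.

(** * Graded spaces *)

Section GroupFacts.
Variable G : AbGroup.
Implicit Types (g h k : G).
Definition gsub g h : G := gadd g (gopp h).
Lemma gadd_0r g : gadd g gzero = g. Proof. rewrite gadd_comm. apply gadd_0. Qed.
Lemma gsub_addK g h : gadd h (gsub g h) = g.
Proof. unfold gsub. rewrite (@gadd_comm G g), gadd_assoc, (@gadd_comm G h), gadd_opp. apply gadd_0. Qed.
Lemma gsub_unique g h k : gadd h k = g -> k = gsub g h.
Proof. intros <-. unfold gsub. rewrite (@gadd_comm G h), <- gadd_assoc, (@gadd_comm G h), gadd_opp, gadd_0r. reflexivity. Qed.
Lemma gsub_add g h k : gsub (gsub g h) k = gsub g (gadd h k).
Proof. apply gsub_unique. rewrite <- gadd_assoc. now rewrite !gsub_addK. Qed.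
Lemma gsub_swap g h k : gsub (gsub g h) k = gsub (gsub g k) h.
Proof. now rewrite !gsub_add, gadd_comm. Qed.
End GroupFacts.

Section FinrankOps.
Variable X : CBanach.
Lemma span_map (Z : CBanach) (J : X -> Z) l x : (forall x y, J (x +v y) = J x +v J y) -> (forall c x, J (c *v x) = c *v J x) ->
  span l x -> span (map J l) (J x).
Proof.
  intros Ja Js. revert x. induction l as [|v l IH]; intros x Hx.
  - simpl in *. subst. rewrite <- (@vscal_C0 X (vzero X)), Js. apply vscal_C0.
  - destruct Hx as [c [y [Hy ->]]]. exists c, (J y). split; [now apply IH|]. now rewrite Ja, Js.
Qed.
Lemma finrank_comp_l (A T : op X) : lb A -> finrank T -> finrank (opcomp A T).
Proof.
  intros HA [HT [l Hl]]. split; [now apply lb_opcomp|]. exists (map A l). intro x.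
  exact (span_map (proj1 (lb_lin HA)) (proj2 (lb_lin HA)) (Hl x)).
Qed.
Lemma finrank_comp_r (A T : op X) : lb A -> finrank T -> finrank (opcomp T A).
Proof. intros HA [HT [l Hl]]. split; [now apply lb_opcomp|]. exists l. intro x. apply Hl. Qed.
Lemma finrank_add (A T : op X) : finrank A -> finrank T -> finrank (opadd A T).
Proof.
  intros [HA [l Hl]] [HT [l' Hl']]. split; [now apply lb_opadd|]. exists (l ++ l'). intro x. unfold opadd.
  apply subsp_add; [apply span_subsp| |].
  - apply (span_incl (l := l)); auto. now apply incl_appl, incl_refl.
  - apply (span_incl (l := l')); auto. now apply incl_appr, incl_refl.
Qed.
Lemma finrank_scal c (A : op X) : finrank A -> finrank (opscal c A).
Proof. intros [HA [l Hl]]. split; [now apply lb_opscal|]. exists l. intro x. unfold opscal. apply subsp_scal; [apply span_subsp|auto]. Qed.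
Lemma finrank_bracket (A T : op X) : finrank A -> finrank T -> finrank (bracket A T).
Proof.
  intros HA HT.
  replace (bracket A T) with (opadd (opcomp A T) (opscal (Copp Cone) (opcomp T A))).
  - apply finrank_add; [|apply finrank_scal]; apply finrank_comp_l; auto; [apply HA|apply HT].
  - apply functional_extensionality; intro. unfold bracket, opsub, opadd, opscal. now rewrite <- vopp_scal.
Qed.

(** Closure in the operator norm within the bounded operators. *)
Definition opcl (S : op X -> Prop) (T : op X) : Prop :=
  lb T /\ forall eps, 0 < eps -> exists s, S s /\ forall x, nm (T x -v s x) <= eps * nm x.
Lemma opcl_in (S : op X -> Prop) T : lb T -> S T -> opcl S T.
Proof. intros H HT; split; [assumption|]. intros eps He; exists T; split; [assumption|]. intro x. rewrite vadd_oppr, nm_0. apply Rmult_le_pos; [lra|apply nm_ge0]. Qed.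
Lemma opcl_closed (S : op X -> Prop) : opclosed (opcl S).
Proof.
  intros T HT H. split; [assumption|]. intros eps He. destruct (H (eps / 2)) as [T' [[_ HT'] HTT]]; [lra|].
  destruct (HT' (eps / 2)) as [s [Hs Hss]]; [lra|]. exists s; split; [assumption|]. intro x.
  eapply Rle_trans; [apply (nm_tri _ (T' x))|]. specialize (HTT x). specialize (Hss x). lra.
Qed.
Lemma opcl_sub (S : op X -> Prop) : is_subspace S -> is_subspace (opcl S).
Proof.
  intros [H0 [Ha Hs]]. split; [|split].
  - apply opcl_in; [apply lb_opzero|assumption].
  - intros A B [HA HA'] [HB HB']. split; [now apply lb_opadd|]. intros eps He.
    destruct (HA' (eps / 2)) as [s [H1 H2]]; [lra|]. destruct (HB' (eps / 2)) as [t [H3 H4]]; [lra|].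
    exists (opadd s t); split; [auto|]. intro x. unfold opadd. specialize (H2 x). specialize (H4 x).
    replace (A x +v B x -v (s x +v t x)) with ((A x -v s x) +v (B x -v t x)) by vec.
    eapply Rle_trans; [apply nm_add|]. lra.
  - intros c A [HA HA']. split; [now apply lb_opscal|]. intros eps He. pose proof (Cabs_ge0 c).
    destruct (HA' (eps / (Cabs c + 1))) as [s [H1 H2]]; [apply Rdiv_lt_0_compat; lra|].
    exists (opscal c s); split; [auto|]. intro x. unfold opscal. specialize (H2 x). pose proof (nm_ge0 x).
    replace (c *v A x -v c *v s x) with (c *v (A x -v s x)) by vec. rewrite vnorm_scal.
    apply Rle_trans with (Cabs c * (eps / (Cabs c + 1) * nm x)); [now apply Rmult_le_compat_l|].
    apply Rle_trans with ((Cabs c + 1) * (eps / (Cabs c + 1) * nm x)).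
    + apply Rmult_le_compat_r; [|lra]. apply Rmult_le_pos; [|assumption]. left; apply Rdiv_lt_0_compat; lra.
    + right; field; lra.
Qed.
Lemma opcl_bracket (S S' R : op X -> Prop) A B : (forall s t, S s -> S' t -> R (bracket s t)) ->
  (forall s, S s -> lb s) -> (forall s, S' s -> lb s) -> opcl S A -> opcl S' B -> opcl R (bracket A B).
Proof.
  intros HR HS HS' [HA HA'] [HB HB']. split; [now apply lb_bracket|]. intros eps He.
  destruct (lb_bound HA) as [a [Ha Hab]]. destruct (lb_bound HB) as [b [Hb Hbb]].
  (* The bound by 1 keeps the norms of the approximants below [a + 1] and [b + 1]; the remaining
     errors then sum to [2 (a + b + 1) d]. *)
  set (d := Rmin 1 (eps / (2 * (a + b + 1)))).
  assert (Hd : 0 < d) by (apply Rmin_glb_lt; [lra|apply Rdiv_lt_0_compat; lra]).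
  assert (Hd1 : d <= 1) by apply Rmin_l. assert (Hd2 : d <= eps / (2 * (a + b + 1))) by apply Rmin_r.
  destruct (HA' d Hd) as [s [Hs Hss]]. destruct (HB' d Hd) as [t [Ht Htt]].
  exists (bracket s t); split; [auto|]. intro x. unfold bracket, opsub, opcomp.
  pose proof (lb_lin HA) as LA. pose proof (lb_lin HB) as LB.
  replace (A (B x) -v B (A x) -v (s (t x) -v t (s x))) with
    ((A (B x -v t x) +v (A (t x) -v s (t x))) -v (B (A x -v s x) +v (B (s x) -v t (s x)))) by (rewrite (lin_sub _ _ LA), (lin_sub _ _ LB); vec).
  pose proof (nm_ge0 x) as Hx.
  assert (Hsx : nm (s x) <= (a + 1) * nm x).
  { replace (s x) with (A x -v (A x -v s x)) by vec. eapply Rle_trans; [apply nm_sub|].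
    specialize (Hab x). specialize (Hss x). nra. }
  assert (Htx : nm (t x) <= (b + 1) * nm x).
  { replace (t x) with (B x -v (B x -v t x)) by vec. eapply Rle_trans; [apply nm_sub|].
    specialize (Hbb x). specialize (Htt x). nra. }
  assert (H1 : nm (A (B x -v t x)) <= a * (d * nm x)) by (eapply Rle_trans; [apply Hab|]; apply Rmult_le_compat_l; [lra|auto]).
  assert (H2 : nm (B (A x -v s x)) <= b * (d * nm x)) by (eapply Rle_trans; [apply Hbb|]; apply Rmult_le_compat_l; [lra|auto]).
  assert (H3 : nm (A (t x) -v s (t x)) <= d * ((b + 1) * nm x)) by (eapply Rle_trans; [apply Hss|]; apply Rmult_le_compat_l; [lra|auto]).
  assert (H4 : nm (B (s x) -v t (s x)) <= d * ((a + 1) * nm x)) by (eapply Rle_trans; [apply Htt|]; apply Rmult_le_compat_l; [lra|auto]).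
  eapply Rle_trans; [apply nm_sub|]. eapply Rle_trans; [apply Rplus_le_compat; apply nm_add|].
  assert (H5 : d * (2 * (a + b + 1)) <= eps).
  { apply Rle_trans with (eps / (2 * (a + b + 1)) * (2 * (a + b + 1))); [apply Rmult_le_compat_r; lra|right; field; lra]. }
  assert (d * (2 * (a + b + 1)) * nm x <= eps * nm x) by now apply Rmult_le_compat_r. lra.
Qed.
End FinrankOps.

(** * Convolution operators on [U^G] *)

Section GradedPower.
Variable U : CBanach.
Variable G : AbGroup.
Variable en : list G.
Hypothesis Hen : forall g, In g en.
Implicit Types (l m : G) (A T : op U).

Definition PU : CBanach := Pow U Hen.
Definition diag (x : U) : PU := fun _ => x.
(** [A] tensored with the translation by [m]. On the constants [diag] it acts as [A], whatever [m]
    is, which is how statements on [U^G] return to [U]. *)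
Definition tens m A : op PU := fun x n => A (x (gsub n m)).
Definition iota m (x : U) : PU := fun n => if excluded_middle_informative (n = m) then x else vzero U.
(** The coefficient of [y] at [l], read off from the image of a point mass at zero; the coefficients
    determine an operator commuting with translations. *)
Definition comp l (y : op PU) : op U := fun x => y (iota gzero x) l.

Lemma iota_add m x y : iota m (x +v y) = iota m x +v iota m y.
Proof.
  apply functional_extensionality; intro n. change (iota m (x +v y) n = iota m x n +v iota m y n).
  unfold iota. destruct (excluded_middle_informative (n = m)); vec.
Qed.
Lemma iota_scal m c x : iota m (c *v x) = c *v iota m x.
Proof.
  apply functional_extensionality; intro n. change (iota m (c *v x) n = c *v iota m x n).
  unfold iota. destruct (excluded_middle_informative (n = m)); vec.
Qed.
Lemma iota_norm m x : nm (iota m x) <= INR (length en) * nm x.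
Proof. apply pow_norm_le. intro n. unfold iota. destruct (excluded_middle_informative (n = m)); [lra|rewrite nm_0; apply nm_ge0]. Qed.
Lemma diag_norm x : nm (diag x) <= INR (length en) * nm x.
Proof. apply pow_norm_le. intro; unfold diag; lra. Qed.
Lemma norm_diag x : nm x <= nm (diag x).
Proof. exact (pow_coord (diag x) gzero). Qed.

Lemma tens_iota m l A x : linear A -> tens m A (iota l x) = iota (gadd l m) (A x).
Proof.
  intro HA. apply functional_extensionality; intro n. unfold tens, iota.
  destruct (excluded_middle_informative (gsub n m = l)) as [E|E]; destruct (excluded_middle_informative (n = gadd l m)) as [E'|E']; auto.
  - exfalso; apply E'. subst l. rewrite gadd_comm. symmetry; apply gsub_addK.
  - exfalso; apply E. subst n. symmetry. apply gsub_unique. apply gadd_comm.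
  - now apply lin_0.
Qed.
Lemma lb_tens m A : lb A -> lb (tens m A).
Proof.
  intro HA. pose proof (lb_lin HA) as L. split; [split|].
  - intros x y. apply functional_extensionality; intro n. exact (lin_add (x (gsub n m)) (y (gsub n m)) L).
  - intros c x. apply functional_extensionality; intro n. exact (lin_scal c (x (gsub n m)) L).
  - destruct (lb_bound HA) as [M [HM HAM]]. exists (INR (length en) * M). intro x. rewrite Rmult_assoc.
    apply pow_norm_le. intro n. unfold tens. eapply Rle_trans; [apply HAM|]. apply Rmult_le_compat_l; [lra|].
    exact (pow_coord x (gsub n m)).
Qed.
Lemma compact_tens m A : compact_op A -> compact_op (tens m A).
Proof.
  intro HA. apply compact_intro; [apply lb_lin, lb_tens, compact_lb, HA|]. intros u [M Hu].
  assert (H : forall l : list G, exists phi, incr phi /\ forall n, In n l -> exists y, lim (fun i => A (u (phi i) n)) y).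
  { induction l as [|n l [phi [Hphi IH]]]; [exists (fun i => i); split; [apply incr_id|intros n []]|].
    destruct (@compact_subseq U A (fun i => u (phi i) n) HA) as [psi [y [Hpsi Hy]]].
    { exists M. intro i. eapply Rle_trans; [exact (pow_coord (u (phi i)) n)|apply Hu]. }
    exists (fun i => phi (psi i)); split; [now apply incr_comp|]. intros n' [<-|Hn']; [now exists y|].
    destruct (IH n' Hn') as [y' Hy']. exists y'. exact (lim_sub Hy' Hpsi). }
  destruct (H en) as [phi [Hphi Hy]].
  assert (Hy' : forall n, exists y, lim (fun i => A (u (phi i) n)) y) by auto. apply choice in Hy'. destruct Hy' as [y Hy'].
  exists phi, (fun n => y (gsub n m)). split; [assumption|]. apply pow_lim. intro n. exact (Hy' (gsub n m)).
Qed.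

(** The sum is built along [en], passing over repeated entries, since [en] may list an element more
    than once. *)
Lemma pow_iota (x : PU) : lspan (fun z => exists m, z = iota m (x m)) x.
Proof.
  assert (H : forall l : list G, lspan (fun z => exists m, z = iota m (x m)) ((fun n => if excluded_middle_informative (In n l) then x n else vzero U) : PU)).
  { induction l as [|m l IH].
    - match goal with |- lspan _ ?z => replace z with (vzero PU) end; [constructor|].
      apply functional_extensionality; intro n. now destruct (excluded_middle_informative (In n nil)).
    - destruct (classic (In m l)) as [Hm|Hm].
      + match type of IH with lspan _ ?z => match goal with |- lspan _ ?z' => replace z' with z end end; [assumption|].
        apply functional_extensionality; intro n.
        destruct (excluded_middle_informative (In n l)) as [H1|H1]; destruct (excluded_middle_informative (In n (m :: l))) as [H2|H2]; auto.
        * exfalso; apply H2; now right.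
        * destruct H2 as [->|H2]; contradiction.
      + match type of IH with lspan _ ?z => match goal with |- lspan _ ?z' => replace z' with (Cone *v iota m (x m) +v z) end end.
        * constructor; [now exists m|assumption].
        * apply functional_extensionality; intro n.
          match goal with |- (Cone *v ?a +v ?b) n = _ => change (Cone *v a n +v b n = if excluded_middle_informative (In n (m :: l)) then x n else vzero U) end.
          unfold iota. cbv beta.
          destruct (excluded_middle_informative (n = m)) as [->|E].
          -- destruct (excluded_middle_informative (In m l)) as [H1|H1]; [contradiction|].
             destruct (excluded_middle_informative (In m (m :: l))) as [H2|H2]; [vec|exfalso; apply H2; now left].
          -- destruct (excluded_middle_informative (In n l)) as [H1|H1]; destruct (excluded_middle_informative (In n (m :: l))) as [H2|H2]; try vec.
             ++ exfalso; apply H2; now right.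
             ++ destruct H2 as [H2|H2]; [congruence|contradiction]. }
  specialize (H en). match type of H with lspan _ ?z => replace z with x in H end; [assumption|].
  apply functional_extensionality; intro n. destruct (excluded_middle_informative (In n en)) as [H1|H1]; [reflexivity|]. exfalso; apply H1, Hen.
Qed.

Lemma lb_comp l (y : op PU) : lb y -> lb (comp l y).
Proof.
  intros Hy. pose proof (lb_lin Hy) as L. split; [split|].
  - intros x x'. unfold comp. rewrite iota_add, (lin_add _ _ L). reflexivity.
  - intros c x. unfold comp. rewrite iota_scal, (lin_scal _ _ L). reflexivity.
  - destruct (lb_bound Hy) as [M [HM HyM]]. exists (M * INR (length en)). intro x.
    eapply Rle_trans; [exact (pow_coord (y (iota gzero x)) l)|]. eapply Rle_trans; [apply HyM|].
    rewrite Rmult_assoc. apply Rmult_le_compat_l; [lra|apply iota_norm].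
Qed.
Lemma comp_finrank l (y : op PU) : finrank y -> finrank (comp l y).
Proof.
  intros [Hy [b Hb]]. split; [now apply lb_comp|]. exists (map (fun z : PU => z l) b). intro x.
  exact (@span_map PU U (fun z => z l) b (y (iota gzero x)) (fun _ _ => eq_refl) (fun _ _ => eq_refl) (Hb _)).
Qed.

(* Operators on [U^G] commuting with the translations are convolution operators; [Ypow] consists of those
   whose kernel is homogeneous, up to closure. *)
Variable S : G -> op U -> Prop.
Hypothesis Ssub : forall g, is_subspace (S g).
Hypothesis Slb : forall g s, S g s -> lb s.
Hypothesis Sbr : forall g h s t, S g s -> S h t -> S (gadd g h) (bracket s t).

Definition Ypow (y : op PU) : Prop :=
  lb y /\ (forall m x, y (tens m opid x) = tens m opid (y x)) /\ forall l, opcl (S l) (comp l y).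

Lemma Ypow_lb y : Ypow y -> lb y. Proof. now intros [H _]. Qed.
Lemma Ypow_sub : is_subspace Ypow.
Proof.
  split; [|split].
  - split; [apply lb_opzero|split; [reflexivity|]]. intro l. exact (proj1 (opcl_sub (Ssub l))).
  - intros A B [HA [HA1 HA2]] [HB [HB1 HB2]]. split; [now apply lb_opadd|split].
    + intros m x. unfold opadd. rewrite HA1, HB1. reflexivity.
    + intro l. exact (proj1 (proj2 (opcl_sub (Ssub l))) _ _ (HA2 l) (HB2 l)).
  - intros c A [HA [HA1 HA2]]. split; [now apply lb_opscal|split].
    + intros m x. unfold opscal. rewrite HA1. reflexivity.
    + intro l. exact (proj2 (proj2 (opcl_sub (Ssub l))) c _ (HA2 l)).
Qed.
Lemma Ypow_closed : opclosed Ypow.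
Proof.
  intros y Hy H. split; [assumption|split].
  - intros m x. pose proof (lb_tens m (@lb_opid U)) as Ht. destruct (lb_bound Ht) as [M [HM HtM]].
    apply sub_eq0, nm_le0. apply le_epsilon. intros eps He. rewrite Rplus_0_l.
    pose proof (nm_ge0 x). pose proof (nm_ge0 (tens m opid x)).
    destruct (H (eps / (nm (tens m opid x) + M * nm x + 1))) as [z [[Hz [Hz1 _]] Hzy]].
    { apply Rdiv_lt_0_compat; [assumption|]. assert (0 <= M * nm x) by (apply Rmult_le_pos; lra). lra. }
    set (d := eps / (nm (tens m opid x) + M * nm x + 1)) in *.
    replace (y (tens m opid x) -v tens m opid (y x)) with ((y (tens m opid x) -v z (tens m opid x)) -v tens m opid (y x -v z x)).
    2:{ rewrite (lin_sub _ _ (lb_lin Ht)), Hz1. vec. }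
    eapply Rle_trans; [apply nm_sub|]. pose proof (Hzy (tens m opid x)).
    assert (nm (tens m opid (y x -v z x)) <= M * (d * nm x)) by (eapply Rle_trans; [apply HtM|]; apply Rmult_le_compat_l; [lra|apply Hzy]).
    assert (Hp : 0 <= M * nm x) by (apply Rmult_le_pos; lra).
    assert (Hd : d * (nm (tens m opid x) + M * nm x + 1) = eps) by (unfold d; field; lra).
    assert (0 < d) by (apply Rdiv_lt_0_compat; lra). nra.
  - intro l. apply opcl_closed; [now apply lb_comp|]. intros eps He. pose proof (pos_INR (length en)).
    destruct (H (eps / (INR (length en) + 1))) as [z [[_ [_ Hz]] Hzy]]; [apply Rdiv_lt_0_compat; lra|].
    exists (comp l z); split; [apply Hz|]. intro x.
    eapply Rle_trans; [exact (pow_coord (y (iota gzero x) -v z (iota gzero x)) l)|]. eapply Rle_trans; [apply Hzy|].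
    pose proof (iota_norm gzero x). pose proof (nm_ge0 x).
    apply Rle_trans with (eps / (INR (length en) + 1) * ((INR (length en) + 1) * nm x)).
    + apply Rmult_le_compat_l; [left; apply Rdiv_lt_0_compat; lra|lra].
    + right; field; lra.
Qed.
Lemma comp_tens l m A : linear A -> comp l (tens m A) = if excluded_middle_informative (l = m) then A else opzero.
Proof.
  intro HA. apply functional_extensionality; intro x. unfold comp. rewrite tens_iota, gadd_0 by assumption.
  unfold iota. now destruct (excluded_middle_informative (l = m)).
Qed.
Lemma Ypow_tens m A : opcl (S m) A -> Ypow (tens m A).
Proof.
  intro HA. split; [now apply lb_tens, HA|split].
  - intros n x. apply functional_extensionality; intro k. unfold tens, opid. now rewrite gsub_swap.
  - intro l. rewrite comp_tens by apply lb_lin, HA. destruct (excluded_middle_informative (l = m)) as [->|E]; [assumption|].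
    exact (proj1 (opcl_sub (Ssub l))).
Qed.
Lemma Ypow_iota y m x l : Ypow y -> y (iota m x) l = comp (gsub l m) y x.
Proof.
  intros [_ [H _]]. unfold comp. replace (iota m x) with (tens m opid (iota gzero x)).
  - rewrite H. reflexivity.
  - rewrite tens_iota by apply lin_opid. now rewrite gadd_0.
Qed.
(** The coefficient at [l] of the bracket is the bracket of [s] with the coefficient of [y] at
    [l - m]: translation invariance turns the shifted point mass into a shifted index. *)
Lemma Ypow_ad m s y : S m s -> Ypow y -> Ypow (bracket (tens m s) y).
Proof.
  intros Hs HY. pose proof HY as [Hy [Hy1 Hy2]]. pose proof (Slb Hs) as Hsl. pose proof (lb_lin Hsl) as Ls.
  pose proof (lb_tens m Hsl) as Ht. split; [now apply lb_bracket|split].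
  - intros n x. pose proof (lb_lin (lb_tens n (@lb_opid U))) as Ln. unfold bracket, opsub, opcomp. rewrite (lin_sub _ _ Ln).
    assert (Hc : forall z, tens m s (tens n opid z) = tens n opid (tens m s z)).
    { intro z. apply functional_extensionality; intro k. unfold tens, opid. now rewrite gsub_swap. }
    now rewrite Hy1, !Hc, Hy1.
  - intro l.
    replace (comp l (bracket (tens m s) y)) with (bracket s (comp (gsub l m) y)).
    + rewrite <- (gsub_addK l m) at 1. apply (opcl_bracket (S := S m) (S' := S (gsub l m))); auto.
      * intros; eapply Slb; eauto.
      * intros; eapply Slb; eauto.
      * now apply opcl_in.
    + apply functional_extensionality; intro x.
      change (s (comp (gsub l m) y x) -v comp (gsub l m) y (s x) = tens m s (y (iota gzero x)) l -v y (tens m s (iota gzero x)) l).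
      rewrite tens_iota, gadd_0, (Ypow_iota m (s x) l HY) by assumption. reflexivity.
Qed.
Lemma Ypow_eq0 y : Ypow y -> (forall l x, comp l y x = vzero U) -> forall x, y x = vzero PU.
Proof.
  intros HY H x. apply (lspan_least (P := fun z => exists m, z = iota m (x m)) (Z := fun z => y z = vzero PU)); [apply ker_subsp, lb_lin, HY| |apply pow_iota].
  intros z [m ->]. apply functional_extensionality; intro l. rewrite (Ypow_iota m (x m) l HY). apply H.
Qed.
(** A constant is the sum of its point masses, so on constants [y] acts as the sum of its
    coefficients. *)
Lemma Ypow_diag y x l : Ypow y -> lspan (fun z => exists l, z = comp l y x) (y (diag x) l).
Proof.
  intro HY.
  apply (lspan_least (P := fun z => exists m, z = iota m (diag x m)) (Z := fun w => lspan (fun z => exists l, z = comp l y x) (y w l))); [| |apply pow_iota].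
  - pose proof (lb_lin (Ypow_lb HY)) as L. pose proof (lspan_subsp (fun z => exists l, z = comp l y x)) as Q. split; [|split].
    + rewrite (lin_0 L). constructor.
    + intros a b Ha Hb. rewrite (lin_add _ _ L). exact (subsp_add Q Ha Hb).
    + intros c a Ha. rewrite (lin_scal _ _ L). exact (subsp_scal c Q Ha).
  - intros z [m ->]. rewrite (Ypow_iota m _ l HY). apply lspan_in. now exists (gsub l m).
Qed.
End GradedPower.

(** * Invariance of generalized eigenspaces *)

Section GeneralizedEigen.
Variable X : CBanach.
Implicit Types (a T pi : op X).

(** Quasinilpotence of [ad a] at the single operator [T]. *)
Definition ad_decays a T : Prop :=
  linear T /\ forall eps, 0 < eps -> exists C, forall n x, nm (Nat.iter n (ad a) T x) <= C * eps ^ n * nm x.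
Lemma ad_decays_ad a T : linear a -> ad_decays a T -> ad_decays a (ad a T).
Proof.
  intros Ha [HT H]. split; [now apply lin_bracket|]. intros eps He. destruct (H eps He) as [C HC].
  exists (C * eps). intros n x. rewrite iter_shift. specialize (HC (S n) x). simpl in HC. rewrite <- Rmult_assoc in HC. exact HC.
Qed.

(* [(a - al) w_n = w_(n+1)] for [w_n = (1 - pi) ((ad a)^n T) v], and [a - al] is bounded below on the range of [1 - pi]. *)
Lemma gen_eigen_invariant a al k pi T v : linear a -> split a al k pi -> ad_decays a T -> pi v = v -> pi (T v) = T v.
Proof.
  intros Ha Hs HT Hv.
  assert (Hpa : forall x, a (pi x) = pi (a x)) by (intro; now apply (split_comm Hs)).
  pose proof (lb_lin (split_lb Hs)) as Lp. pose proof (lin_Dop al Ha) as LD.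
  assert (Hgo : forall j v, pi v = v -> Nat.iter j (Dop a al) v = vzero X -> forall T, ad_decays a T -> pi (T v) = T v).
  { clear T v HT Hv. induction j; intros v Hv Hj T HT.
    - simpl in Hj. subst v. destruct HT as [L _]. now rewrite (lin_0 L), (lin_0 Lp).
    - set (v' := Dop a al v).
      assert (Hv' : pi v' = v') by (unfold v', Dop; rewrite (lin_sub _ _ Lp), (lin_scal _ _ Lp), <- Hpa, Hv; reflexivity).
      assert (Hj' : Nat.iter j (Dop a al) v' = vzero X) by (unfold v'; now rewrite iter_shift).
      destruct (split_low Hs) as [c [Hc Hlow]]. destruct (lb_bound (split_lb Hs)) as [P [HP HPb]].
      set (w := fun n => Nat.iter n (ad a) T v -v pi (Nat.iter n (ad a) T v)).
      assert (Hdn : forall n, ad_decays a (Nat.iter n (ad a) T)) by (induction n; [assumption|now apply ad_decays_ad]).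
      assert (Hw : forall n, Dop a al (w n) = w (S n)).
      { intro n. pose proof (IHj v' Hv' Hj' _ (Hdn n)) as E. destruct (Hdn n) as [Ln _].
        assert (Ev : v' = a v -v al *v v) by reflexivity.
        rewrite Ev, (lin_sub _ _ Ln), (lin_scal _ _ Ln), (lin_sub _ _ Lp), (lin_scal _ _ Lp) in E.
        unfold w. rewrite (lin_sub _ _ LD). simpl Nat.iter. set (T' := Nat.iter n (ad a) T) in *.
        change (ad a T' v) with (a (T' v) -v T' (a v)). unfold Dop. rewrite (lin_sub _ _ Lp), Hpa.
        replace (pi (T' (a v))) with (T' (a v) -v al *v T' v +v al *v pi (T' v)).
        + vec.
        + rewrite <- E. vec. }
      assert (Hpw : forall n, pi (w n) = vzero X) by (intro n; unfold w; rewrite (lin_sub _ _ Lp), (split_idem Hs); vec).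
      assert (Hwn : forall n, c ^ n * nm (w O) <= nm (w n)).
      { induction n; [simpl; lra|]. rewrite <- Hw. eapply Rle_trans; [|apply Hlow, Hpw]. simpl. rewrite Rmult_assoc. apply Rmult_le_compat_l; lra. }
      destruct (proj2 HT (c / 2) ltac:(lra)) as [C HC].
      symmetry. apply sub_eq0. apply nm_le0. apply le_pow_zero with (C := (1 + P) * (C * nm v)) (eta := / 2); [lra|].
      intro n. change (T v -v pi (T v)) with (w O). assert (Hcn : 0 < c ^ n) by now apply pow_lt.
      apply Rmult_le_reg_l with (c ^ n); [assumption|]. eapply Rle_trans; [apply Hwn|].
      assert (H1 : nm (w n) <= (1 + P) * (C * (c / 2) ^ n * nm v)).
      { unfold w. eapply Rle_trans; [apply nm_sub|]. specialize (HPb (Nat.iter n (ad a) T v)). specialize (HC n v). nra. }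
      eapply Rle_trans; [apply H1|]. unfold Rdiv. rewrite Rpow_mult_distr. right; ring. }
  apply (Hgo k v Hv); [|assumption]. rewrite <- Hv. apply (split_ker Hs).
Qed.
End GeneralizedEigen.

Section SpanFacts.
Variable X : CBanach.
Implicit Types (P : X -> Prop) (l : list X).
Lemma lspan_finite P x : lspan P x -> exists l, (forall v, In v l -> P v) /\ span l x.
Proof.
  induction 1 as [|c x y Hx Hy [l [Hl Hs]]]; [exists nil; split; [intros v []|reflexivity]|].
  exists (x :: l); split; [intros v [<-|Hv]; auto|]. now exists c, y.
Qed.
Lemma lspan_finite_list P l0 : (forall x, In x l0 -> lspan P x) -> exists l, (forall v, In v l -> P v) /\ forall x, span l0 x -> span l x.
Proof.
  intro H. assert (H1 : exists l, (forall v, In v l -> P v) /\ forall x, In x l0 -> span l x).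
  { induction l0 as [|x l0 IH]; [exists nil; split; intros v []|].
    destruct IH as [l [Hl Hs]]; [intros; apply H; now right|].
    destruct (lspan_finite (H x (or_introl eq_refl))) as [l' [Hl' Hs']].
    exists (l' ++ l); split.
    - intros v Hv. apply in_app_or in Hv. destruct Hv; auto.
    - intros y [<-|Hy]; [apply (span_incl (l := l')); auto; now apply incl_appl, incl_refl|].
      apply (span_incl (l := l)); auto. now apply incl_appr, incl_refl. }
  destruct H1 as [l [Hl Hs]]. exists l; split; [assumption|]. intros x. apply span_least; [apply span_subsp|assumption].
Qed.
Lemma lspan_range_fin (tl : list (op X)) : (forall t, In t tl -> finrank t) ->
  exists l, forall x, lspan (fun y => exists t z, In t tl /\ y = t z) x -> span l x.
Proof.
  intro H. assert (H1 : exists l, forall t z, In t tl -> span l (t z)).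
  { induction tl as [|t tl IH]; [exists nil; intros t z []|].
    destruct IH as [l Hl]; [intros; apply H; now right|]. destruct (H t (or_introl eq_refl)) as [_ [l' Hl']].
    exists (l' ++ l). intros t' z [<-|Ht].
    - apply (span_incl (l := l')); auto. now apply incl_appl, incl_refl.
    - apply (span_incl (l := l)); auto. now apply incl_appr, incl_refl. }
  destruct H1 as [l Hl]. exists l. intro x. apply lspan_least; [apply span_subsp|]. intros y [t [z [Ht ->]]]. auto.
Qed.
Lemma map_choice (V : Type) (P : V -> Prop) (f : V -> X) l : (forall v, In v l -> exists w, P w /\ v = f w) ->
  exists ws, (forall w, In w ws -> P w) /\ l = map f ws.
Proof.
  induction l as [|v l IH]; intro H; [exists nil; split; [intros w []|reflexivity]|].
  destruct IH as [ws [H1 H2]]; [intros; apply H; now right|]. destruct (H v (or_introl eq_refl)) as [w [Hw Ew]].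
  exists (w :: ws); split; [intros w' [<-|Hw']; auto|]. simpl; congruence.
Qed.
Lemma Forall2_map (V : Type) (R : X -> X -> Prop) (f g : V -> X) (l : list V) : (forall v, In v l -> R (f v) (g v)) -> Forall2 R (map f l) (map g l).
Proof. induction l; intro H; simpl; constructor; [apply H; now left|apply IHl; intros; apply H; now right]. Qed.
End SpanFacts.

(** * Norm convergence and exponentials near the identity *)

Section OpConvergence.
Variable X : CBanach.
Definition opconv (A : nat -> op X) (B : op X) : Prop :=
  forall eps, 0 < eps -> exists N, forall n, (N <= n)%nat -> forall x, nm (A n x -v B x) <= eps * nm x.
Lemma opconv_comp A A' B B' : lb A' -> lb B' -> opconv A A' -> opconv B B' -> opconv (fun n => opcomp (A n) (B n)) (opcomp A' B').
Proof.
  intros HA HB H1 H2 eps He. destruct (lb_bound HA) as [a [Ha Hab]]. destruct (lb_bound HB) as [b [Hb Hbb]].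
  set (d := Rmin 1 (eps / (a + b + 1))).
  assert (Hd : 0 < d) by (apply Rmin_glb_lt; [lra|apply Rdiv_lt_0_compat; lra]).
  assert (Hd1 : d <= 1) by apply Rmin_l. assert (Hd2 : d <= eps / (a + b + 1)) by apply Rmin_r.
  destruct (H1 d Hd) as [N1 HN1]. destruct (H2 d Hd) as [N2 HN2]. exists (max N1 N2). intros n Hn x.
  specialize (HN1 n ltac:(lia) (B n x)). specialize (HN2 n ltac:(lia) x). unfold opcomp.
  replace (A n (B n x) -v A' (B' x)) with ((A n (B n x) -v A' (B n x)) +v A' (B n x -v B' x)) by (rewrite (lin_sub _ _ (lb_lin HA)); vec).
  pose proof (nm_ge0 x) as Hx.
  assert (Hbx : nm (B n x) <= (b + 1) * nm x).
  { replace (B n x) with ((B n x -v B' x) +v B' x) by vec. eapply Rle_trans; [apply nm_add|]. specialize (Hbb x). nra. }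
  assert (H3 : nm (A' (B n x -v B' x)) <= a * (d * nm x)) by (eapply Rle_trans; [apply Hab|]; apply Rmult_le_compat_l; lra).
  assert (H4 : d * nm (B n x) <= d * ((b + 1) * nm x)) by (apply Rmult_le_compat_l; lra).
  eapply Rle_trans; [apply nm_add|].
  assert (H5 : d * (a + b + 1) <= eps) by (apply Rle_trans with (eps / (a + b + 1) * (a + b + 1)); [apply Rmult_le_compat_r; lra|right; field; lra]).
  assert (d * (a + b + 1) * nm x <= eps * nm x) by now apply Rmult_le_compat_r. lra.
Qed.
Lemma opconv_const B : opconv (fun _ => B) B.
Proof. intros eps He. exists O. intros n _ x. rewrite vadd_oppr, nm_0. apply Rmult_le_pos; [lra|apply nm_ge0]. Qed.

Lemma small_inv C eps : 0 <= C -> 0 < eps -> exists N, forall n, (N <= n)%nat -> C * / (INR n + 1) <= eps.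
Proof.
  intros HC He. destruct (@inv_small (eps / (C + 1))) as [N HN]; [apply Rdiv_lt_0_compat; lra|]. exists N. intros n Hn.
  specialize (HN n Hn). pose proof (pos_INR n). assert (0 < / (INR n + 1)) by (apply Rinv_0_lt_compat; lra).
  apply Rle_trans with ((C + 1) * (eps / (C + 1))); [nra|right; field; lra].
Qed.

Definition tiny n (s : op X) : op X := opscal (RtoC (/ (INR n + 1))) s.
Definition expn n s : op X := ex (tiny n s).
Definition expni n s : op X := ex (opscal (Copp Cone) (tiny n s)).
(** The difference quotient of the exponential at step [1 / (n + 1)]: a combination of the identity
    and of an exponential that converges in norm to [s]. *)
Definition expq n s : op X := fun x => RtoC (INR n + 1) *v (expn n s x -v x).
Lemma lb_tiny n (s : op X) : lb s -> lb (tiny n s). Proof. apply lb_opscal. Qed.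
Lemma inv_pos n : 0 < / (INR n + 1). Proof. apply Rinv_0_lt_compat. pose proof (pos_INR n); lra. Qed.
Lemma inv_le1 n : / (INR n + 1) <= 1.
Proof. rewrite <- Rinv_1. apply Rinv_le_contravar; [lra|]. pose proof (pos_INR n); lra. Qed.
Lemma tiny_bound n (s : op X) M x : 0 <= M -> (forall x, nm (s x) <= M * nm x) -> nm (tiny n s x) <= M * / (INR n + 1) * nm x.
Proof.
  intros HM H. unfold tiny, opscal. pose proof (inv_pos n). rewrite nm_Rscal by lra. rewrite (Rmult_comm M), Rmult_assoc. apply Rmult_le_compat_l; [lra|auto].
Qed.
Lemma expn_near n (s m : op X) M x : lb s -> 0 <= M -> (forall x, nm (s x) <= M * nm x) -> lb m ->
  (forall x, nm (m x) <= M * / (INR n + 1) * nm x) -> nm (ex m x -v x -v m x) <= exp M * (M * M) * / (INR n + 1) * / (INR n + 1) * nm x.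
Proof.
  intros Hs HM H Hm Hmb. pose proof (inv_pos n) as Hi. pose proof (inv_le1 n) as Hi1.
  assert (HMi : 0 <= M * / (INR n + 1)) by (apply Rmult_le_pos; lra).
  eapply Rle_trans; [apply (@ex_first_order X m (M * / (INR n + 1)) x); auto|].
  assert (He : exp (M * / (INR n + 1)) <= exp M).
  { destruct (Rle_lt_or_eq_dec (M * / (INR n + 1)) M) as [Hlt|Heq]; [nra|left; now apply exp_increasing|rewrite Heq; lra]. }
  pose proof (nm_ge0 x).
  replace (exp M * (M * M) * / (INR n + 1) * / (INR n + 1) * nm x) with (exp M * (M * / (INR n + 1) * (M * / (INR n + 1))) * nm x) by ring.
  apply Rmult_le_compat_r; [assumption|]. apply Rmult_le_compat_r; [now apply Rmult_le_pos|assumption].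
Qed.
Lemma ex_to_id (m : nat -> op X) (s : op X) : lb s -> (forall n, lb (m n)) ->
  (forall M, 0 <= M -> (forall x, nm (s x) <= M * nm x) -> forall n x, nm (m n x) <= M * / (INR n + 1) * nm x) ->
  opconv (fun n => ex (m n)) opid.
Proof.
  intros Hs Hm Hmb. destruct (lb_bound Hs) as [M [HM HMs]]. specialize (Hmb M ltac:(lra) HMs).
  intros eps He. pose proof (exp_pos M) as Hep.
  destruct (@small_inv (exp M * (M * M) + M) eps) as [N HN]; [assert (0 <= M * M) by nra; nra|assumption|].
  exists N. intros n Hn x. specialize (HN n Hn). unfold opid.
  pose proof (@expn_near n s (m n) M x Hs ltac:(lra) HMs (Hm n) (Hmb n)) as H1. specialize (Hmb n x).
  replace (ex (m n) x -v x) with ((ex (m n) x -v x -v m n x) +v m n x) by vec. eapply Rle_trans; [apply nm_add|].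
  pose proof (inv_pos n) as Hi. pose proof (inv_le1 n) as Hi1. pose proof (nm_ge0 x) as Hx.
  set (i := / (INR n + 1)) in *. set (E := exp M * (M * M)) in *.
  assert (HE : 0 <= E) by (unfold E; apply Rmult_le_pos; nra).
  assert (E * i * i <= E * i) by (assert (0 <= E * i) by (apply Rmult_le_pos; lra); nra).
  assert (E * i * i * nm x <= E * i * nm x) by now apply Rmult_le_compat_r.
  assert ((E + M) * i * nm x <= eps * nm x) by now apply Rmult_le_compat_r. lra.
Qed.
Lemma expni_id (s : op X) : lb s -> opconv (fun n => expni n s) opid.
Proof. intro Hs. apply (ex_to_id Hs); [intro; now apply lb_opscal, lb_tiny|]. intros. apply opneg_bound. intro; now apply tiny_bound. Qed.
Lemma expq_conv (s : op X) : lb s -> opconv (fun n => expq n s) s.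
Proof.
  intros Hs. destruct (lb_bound Hs) as [M [HM HMs]]. intros eps He. pose proof (exp_pos M) as Hep.
  destruct (@small_inv (exp M * (M * M)) eps) as [N HN]; [nra|assumption|].
  exists N. intros n Hn x. specialize (HN n Hn). unfold expq. pose proof (pos_INR n) as Hp.
  replace (RtoC (INR n + 1) *v (expn n s x -v x) -v s x) with (RtoC (INR n + 1) *v (expn n s x -v x -v tiny n s x)).
  2:{ unfold tiny, opscal. replace (s x) with (Cmul (RtoC (INR n + 1)) (RtoC (/ (INR n + 1))) *v s x) at 2; [vec|].
      replace (Cmul (RtoC (INR n + 1)) (RtoC (/ (INR n + 1)))) with Cone by (apply Cpx_eq; simpl; field; lra). apply vscal_1. }
  rewrite nm_Rscal by lra. pose proof (inv_pos n) as Hi. pose proof (nm_ge0 x) as Hx.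
  eapply Rle_trans; [apply Rmult_le_compat_l; [lra|]; apply (@expn_near n s (tiny n s) M x); auto; try lra; [now apply lb_tiny|intro; apply tiny_bound; auto; lra]|].
  replace ((INR n + 1) * (exp M * (M * M) * / (INR n + 1) * / (INR n + 1) * nm x)) with (exp M * (M * M) * / (INR n + 1) * nm x) by (field; lra).
  now apply Rmult_le_compat_r.
Qed.
End OpConvergence.

(** * The irreducible case *)

Section GroupWords.
Variable X : CBanach.
Implicit Types (ws : list (op X)) (x : X).
Fixpoint sublists ws : list (list (op X)) :=
  match ws with nil => nil :: nil | s :: ws => map (cons s) (sublists ws) ++ sublists ws end.
Lemma sublists_nil ws : In nil (sublists ws).
Proof. induction ws; simpl; [now left|]. apply in_or_app; now right. Qed.
Lemma sublists_Forall (P : op X -> Prop) ws w : Forall P ws -> In w (sublists ws) -> Forall P w.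
Proof.
  intro H. revert w. induction H as [|s ws Hs _ IH]; intros w Hw; simpl in Hw.
  - destruct Hw as [<-|[]]; constructor.
  - apply in_app_or in Hw. destruct Hw as [Hw|Hw]; [|auto]. apply in_map_iff in Hw. destruct Hw as [w' [<- Hw']]. constructor; auto.
Qed.

Definition gword n ws : op X := wapp (map (expn n) ws).
Definition qword n ws : op X := wapp (map (expq n) ws).
(** Inverse exponentials in reversed order: the inverse of [gword n ws]. *)
Fixpoint gwordi n ws : op X := match ws with nil => opid | s :: ws => opcomp (gwordi n ws) (expni n s) end.

Lemma lb_gword n ws : Forall (fun s => lb s) ws -> lb (gword n ws).
Proof. induction 1 as [|s ws Hs _ IH]; [apply lb_opid|]. exact (lb_opcomp (lb_ex (lb_tiny n Hs)) IH). Qed.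
Lemma gwordi_id ws : Forall (fun s => lb s) ws -> opconv (fun n => gwordi n ws) opid.
Proof.
  induction 1 as [|s ws Hs _ IH]; [exact (opconv_const opid)|].
  exact (opconv_comp (@lb_opid X) (@lb_opid X) IH (expni_id Hs)).
Qed.
Lemma lb_wapp ws : Forall (fun s => lb s) ws -> lb (wapp ws).
Proof. induction 1 as [|s ws Hs _ IH]; [apply lb_opid|]. exact (lb_opcomp Hs IH). Qed.
Lemma qword_conv ws : Forall (fun s => lb s) ws -> opconv (fun n => qword n ws) (wapp ws).
Proof.
  induction 1 as [|s ws Hs Hws IH]; [exact (opconv_const opid)|].
  exact (opconv_comp Hs (lb_wapp Hws) (expq_conv Hs) IH).
Qed.
Lemma qword_lspan n ws x : Forall (fun s => lb s) ws -> lspan (fun y => exists w, In w (sublists ws) /\ y = gword n w x) (qword n ws x).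
Proof.
  induction 1 as [|s ws Hs Hws IH]; [apply lspan_in; exists nil; split; [now left|reflexivity]|].
  change (qword n (s :: ws) x) with (RtoC (INR n + 1) *v (expn n s (qword n ws x) -v qword n ws x)).
  apply subsp_scal; [apply lspan_subsp|]. apply subsp_sub; [apply lspan_subsp| |].
  - assert (L : linear (expn n s)) by (apply lb_lin, lb_ex, lb_tiny, Hs).
    apply (lspan_least (P := fun y => exists w, In w (sublists ws) /\ y = gword n w x)
      (Z := fun z => lspan (fun y => exists w, In w (sublists (s :: ws)) /\ y = gword n w x) (expn n s z))); [| |exact IH].
    + split; [|split].
      * rewrite (lin_0 L); constructor.
      * intros a b Ha Hb. rewrite (lin_add _ _ L). now apply lspan_add.
      * intros c a Ha. rewrite (lin_scal _ _ L). apply subsp_scal; [apply lspan_subsp|assumption].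
    + intros y [w [Hw ->]]. apply lspan_in. exists (s :: w); split; [|reflexivity]. simpl. apply in_or_app; left. now apply in_map.
  - revert IH. apply lspan_mono. intros y [w [Hw ->]]. exists w; split; [|reflexivity]. simpl. apply in_or_app; now right.
Qed.
Lemma opconv_at (A : nat -> op X) B x eta : opconv A B -> 0 < eta -> exists N, forall n, (N <= n)%nat -> nm (A n x -v B x) < eta.
Proof.
  intros H He. pose proof (nm_ge0 x). destruct (H (eta / (nm x + 1))) as [N HN]; [apply Rdiv_lt_0_compat; lra|].
  exists N; intros n Hn. eapply Rle_lt_trans; [apply HN, Hn|].
  apply Rlt_le_trans with (eta / (nm x + 1) * (nm x + 1)); [|right; field; lra].
  apply Rmult_lt_compat_l; [apply Rdiv_lt_0_compat; lra|lra].
Qed.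
End GroupWords.

Lemma uniform_index (V : Type) (P : V -> nat -> Prop) (l : list V) : (forall v, In v l -> exists N, forall n, (N <= n)%nat -> P v n) ->
  exists N, forall n, (N <= n)%nat -> forall v, In v l -> P v n.
Proof.
  induction l as [|v l IH]; intro H; [exists O; intros n _ v []|].
  destruct IH as [N HN]; [intros; apply H; now right|]. destruct (H v (or_introl eq_refl)) as [N' HN'].
  exists (max N N'). intros n Hn w [<-|Hw]; [apply HN'; lia|apply HN; auto; lia].
Qed.

Section Core.
Variable U : CBanach.
Variable G : AbGroup.
Variable en : list G.
Hypothesis Hen : forall g, In g en.
Variable S : G -> op U -> Prop.
Hypothesis Ssub : forall g, is_subspace (S g).
Hypothesis Svol : forall g s, S g s -> volterra s.
Hypothesis Sbr : forall g h s t, S g s -> S h t -> S (gadd g h) (bracket s t).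
Hypothesis Sirr : forall Z : U -> Prop, subsp Z -> closed Z -> (forall g s x, S g s -> Z x -> Z (s x)) ->
  (exists x, Z x /\ x <> vzero U) -> forall x, Z x.

Let hom (s : op U) : Prop := exists g, S g s.
Let Slb : forall g s, S g s -> lb s := fun g s H => compact_lb (proj1 (Svol H)).
Let P := PU U Hen.
Let Y := @Ypow U G en Hen S.

Lemma hom_lb s : hom s -> lb s.
Proof. intros [g H]. exact (Slb H). Qed.
Lemma homs_lb ws : Forall hom ws -> Forall (fun s => lb s) ws.
Proof. apply Forall_impl. intros s; apply hom_lb. Qed.

Lemma opcl_finrank_decays g t x : opcl (S g) t -> finrank t -> decays t x.
Proof.
  intros [Ht Hc] Hf. apply quasinil_decays; [assumption|]. apply quasinil_of_no_eigen; [now apply compact_finrank|].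
  intros z v Hz Ev. apply (finrank_limit_no_eigen Hf (z0 := z)); [|assumption|assumption].
  intros eps He. destruct (Hc eps He) as [s [Hs Hss]]. destruct (Svol Hs). exists s; auto.
Qed.

(** Finite rank operators in a single closed component. They are closed under brackets though not
    under sums, which is the shape that Jacobson's theorem accepts. *)
Definition nilfin (t : op U) : Prop := exists g, opcl (S g) t /\ finrank t.
Lemma nilfin_bracket s t : nilfin s -> nilfin t -> nilfin (bracket s t).
Proof.
  intros [g [Hs Hfs]] [h [Ht Hft]]. exists (gadd g h). split; [|now apply finrank_bracket].
  apply (opcl_bracket (S := S g) (S' := S h)); auto; intros; eapply Slb; eauto.
Qed.

Lemma no_finrank_limit g f x1 : opcl (S g) f -> finrank f -> f x1 = vzero U.
Proof.
  intros Hf Hfin. apply NNPP; intro Hx1. pose proof (proj1 Hf) as Hfl. pose proof (lb_lin Hfl) as Lf.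
  set (e0 := f x1) in *.
  set (E := fun y => exists x, y = f x). assert (HE : subsp E) by now apply range_subsp.
  destruct (proj2 Hfin) as [lf Hlf].
  set (Q := fun y => exists ws, Forall hom ws /\ y = f (wapp ws e0)).
  assert (HQE : forall y, lspan Q y -> E y) by (intro y; apply lspan_least; [assumption|]; intros z [ws [_ ->]]; now exists (wapp ws e0)).
  assert (HEspan : forall y, E y -> span lf y) by (intros y [x ->]; auto).
  assert (HQc : closed (lspan Q)) by (apply (@subsp_span_closed U lf); [apply lspan_subsp|auto]).
  (* By irreducibility the words applied to [e0] span a dense subspace; [f] maps it into [lspan Q],
     which is closed as a subspace of finite dimension. *)
  assert (HEQ : forall y, E y -> lspan Q y).
  { set (D := lspan (fun y => exists ws, Forall hom ws /\ y = wapp ws e0)).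
    assert (HD : forall x, closure D x).
    { apply Sirr.
      - apply closure_subsp, lspan_subsp.
      - apply closure_closed.
      - intros h s x Hs Hx. pose proof (Slb Hs) as Hsl. pose proof (lb_lin Hsl) as Ls.
        destruct (closure_lim Hx) as [u [Hu Hux]].
        apply (closure_closed (u := fun n => s (u n))); [|now apply lb_lim].
        intro n. apply closure_in. specialize (Hu n). revert Hu.
        apply (lspan_least (Z := fun y => D (s y))).
        + split; [|split].
          * rewrite (lin_0 Ls); constructor.
          * intros a b Ha Hb. rewrite (lin_add _ _ Ls). now apply lspan_add.
          * intros c a Ha. rewrite (lin_scal _ _ Ls). apply subsp_scal; [apply lspan_subsp|assumption].
        + intros y [ws [Hws ->]]. apply lspan_in. exists (s :: ws); split; [constructor; [now exists h|assumption]|reflexivity].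
      - exists e0; split; [|assumption]. apply closure_in, lspan_in. exists nil; split; [constructor|reflexivity]. }
    intros y [x ->]. destruct (closure_lim (HD x)) as [u [Hu Hux]].
    apply (HQc (fun n => f (u n))); [|now apply lb_lim]. intro n. specialize (Hu n). revert Hu.
    apply (lspan_least (Z := fun y => lspan Q (f y))).
    - split; [|split].
      + rewrite (lin_0 Lf); constructor.
      + intros a b Ha Hb. rewrite (lin_add _ _ Lf). now apply lspan_add.
      + intros c a Ha. rewrite (lin_scal _ _ Lf). apply subsp_scal; [apply lspan_subsp|assumption].
    - intros z [ws [Hws ->]]. apply lspan_in. now exists ws. }
  destruct (@subsp_span U lf E HE HEspan) as [l1 Hl1].
  destruct (@lspan_finite_list U Q l1) as [l2 [Hl2 Hl12]]; [intros x Hx; apply HEQ, Hl1, span_in, Hx|].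
  destruct (@map_choice U (list (op U)) (Forall hom) (fun ws => f (wapp ws e0)) l2 Hl2) as [yl [Hyl El2]].
  assert (HEl2 : forall y, E y -> span l2 y) by (intros y Hy; apply Hl12, Hl1, Hy).
  (* The index set of the translates: all exponential words that arise when the words of [yl] are
     replaced by difference quotients and expanded. *)
  set (SL := flat_map (@sublists U) yl).
  assert (HSL : forall w, In w SL -> Forall hom w).
  { intros w Hw. apply in_flat_map in Hw. destruct Hw as [ws [H1 H2]]. apply (sublists_Forall (Hyl _ H1) H2). }
  destruct (@span_perturb U l2) as [eta [Heta Hpert]].
  (* Only finitely many pairs occur, so one [n] suffices: [gwordi n w] tends to the identity and
     [qword n ws] to the word itself. *)
  assert (Hn : exists n, forall w, In w SL -> forall ws, In ws yl -> nm (f (gwordi n w (qword n ws e0)) -v f (wapp ws e0)) < eta).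
  { destruct (@uniform_index (list (op U)) (fun w n => forall ws, In ws yl -> nm (f (gwordi n w (qword n ws e0)) -v f (wapp ws e0)) < eta) SL) as [N HN].
    - intros w Hw. apply uniform_index. intros ws Hws.
      pose proof (homs_lb (HSL w Hw)) as Hwl. pose proof (homs_lb (Hyl ws Hws)) as Hwsl.
      pose proof (opconv_comp Hfl (lb_opcomp (@lb_opid U) (lb_wapp Hwsl)) (opconv_const f)
        (opconv_comp (@lb_opid U) (lb_wapp Hwsl) (gwordi_id Hwl) (qword_conv Hwsl))) as Hc.
      exact (opconv_at e0 Hc Heta).
    - exists N. intros; now apply (HN N (le_n _)). }
  destruct Hn as [n Hn].
  set (W := lspan (fun y => exists w e, In w SL /\ E e /\ y = gword n w e)).
  assert (HqW : forall ws, In ws yl -> W (qword n ws e0)).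
  { intros ws Hws. eapply lspan_mono; [|apply (qword_lspan n e0 (homs_lb (Hyl ws Hws)))].
    intros y [w [Hw ->]]. exists w, e0. split; [apply in_flat_map; now exists ws|split; [now exists x1|reflexivity]]. }
  set (fw := fun w x => gword n w (f (gwordi n w x))).
  assert (HW1 : forall x, W x -> lspan (fun y => exists w z, In w SL /\ W z /\ y = fw w z) x).
  { intro x. apply lspan_least; [apply lspan_subsp|]. intros y [w [e [Hw [He ->]]]].
    pose proof (lb_lin (lb_gword n (homs_lb (HSL w Hw)))) as Lg.
    (* These vectors are within [eta] of the spanning list [l2], so they still span [E]; applying
       [gword n w] exhibits [w E] as spanned by images of elements of [W] under the conjugate
       [fw w]. *)
    set (l3 := map (fun ws => f (gwordi n w (qword n ws e0))) yl).
    assert (Hl3 : forall y, E y -> span l3 y).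
    { apply (@half_dist_dense U E (span l3)); [apply span_subsp|apply span_closed| |assumption|].
      - intro y. apply span_least; [assumption|]. intros v Hv. apply in_map_iff in Hv. destruct Hv as [ws [<- _]]. now eexists.
      - intros y Hy. destruct (Hpert l3) with (x := y) as [y' [H1 H2]]; [|now apply HEl2|now exists y'].
        rewrite El2. apply Forall2_map. intros ws Hws. rewrite nm_swap. now apply Hn. }
    specialize (Hl3 e He). revert Hl3.
    apply (span_least (Z := fun v => lspan (fun y => exists w z, In w SL /\ W z /\ y = fw w z) (gword n w v))).
    - split; [|split].
      + rewrite (lin_0 Lg); constructor.
      + intros a b Ha Hb. rewrite (lin_add _ _ Lg). now apply lspan_add.
      + intros c a Ha. rewrite (lin_scal _ _ Lg). apply subsp_scal; [apply lspan_subsp|assumption].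
    - intros v Hv. apply in_map_iff in Hv. destruct Hv as [ws [<- Hws]]. apply lspan_in. exists w, (qword n ws e0). auto. }
  (* The conjugation is lifted to [U^G] letter by letter, where [ex_conj_in] keeps it inside [Y]; on
     constants the lift is the conjugate in [U]. *)
  assert (Hconj : forall w, Forall hom w -> exists y, Y y /\ finrank y /\ forall x, y (diag Hen x) = diag Hen (fw w x)).
  { unfold fw. induction 1 as [|s w [h Hs] Hw [y [HY [Hyf Hyd]]]].
    - exists (tens (Hen := Hen) g f). split; [now apply Ypow_tens|]. split; [|reflexivity].
      split; [now apply lb_tens|].
      assert (Ht : exists l : list P, forall i x, In i en -> span l (iota Hen i (f x))).
      { assert (H : forall li : list G, exists l : list P, forall i x, In i li -> span l (iota Hen i (f x))).
        { induction li as [|i li [l IH]]; [exists nil; intros i x []|]. exists (map (iota Hen i) lf ++ l). intros i' x [<-|Hi].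
          - apply (span_incl (l := map (iota Hen i) lf)); [now apply incl_appl, incl_refl|].
            exact (span_map (iota_add Hen i) (iota_scal Hen i) (Hlf x)).
          - apply (span_incl (l := l)); [now apply incl_appr, incl_refl|auto]. }
        apply H. }
      destruct Ht as [l Hl]. exists l. intro x.
      apply (lspan_least (P := fun z => exists m, z = iota Hen m (tens (Hen := Hen) g f x m)) (Z := span l)); [apply span_subsp| |apply pow_iota].
      intros z [m ->]. apply Hl, Hen.
    - pose proof (Slb Hs) as Hsl. pose proof (lb_tiny n Hsl) as Htl.
      assert (Hts : S h (tiny n s)) by (apply (proj2 (proj2 (Ssub h))), Hs).
      set (m := tens (Hen := Hen) h (tiny n s)). assert (Hm : lb m) by now apply lb_tens.
      exists (fun z => ex m (y (ex (opscal (Copp Cone) m) z))). split; [|split].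
      + apply ex_conj_in; auto.
        * intros T HT. exact (Ypow_lb HT).
        * exact (Ypow_sub Hen Ssub).
        * apply Ypow_closed.
        * intros T HT. exact (Ypow_ad Slb Sbr Hts HT).
      + apply (finrank_comp_l (A := ex m) (T := fun z => y (ex (opscal (Copp Cone) m) z))); [now apply lb_ex|].
        apply (finrank_comp_r (A := ex (opscal (Copp Cone) m)) (T := y)); [now apply lb_ex, lb_opscal|assumption].
      + intro x. cbv beta.
        rewrite <- (@ex_intertwine U (PU U Hen) (diag Hen) (INR (length en)) (opscal (Copp Cone) (tiny n s)) (opscal (Copp Cone) m) x);
          [|reflexivity|reflexivity|apply diag_norm|now apply lb_opscal|now apply lb_opscal|reflexivity].
        rewrite Hyd.
        rewrite <- (@ex_intertwine U (PU U Hen) (diag Hen) (INR (length en)) (tiny n s) m); [reflexivity|reflexivity|reflexivity|apply diag_norm|assumption|assumption|reflexivity]. }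
  (* A conjugate of [f] is not homogeneous, but it is the sum of the coefficients of its lift, and
     each of these is in [nilfin]. *)
  assert (HTL : forall sl, (forall w, In w sl -> Forall hom w) -> exists tl, (forall t, In t tl -> nilfin t) /\
     forall w, In w sl -> forall x, lspan (fun y => exists t, In t tl /\ y = t x) (fw w x)).
  { induction sl as [|w sl IH]; intro Hsl; [exists nil; split; [intros t []|intros w []]|].
    destruct IH as [tl [H1 H2]]; [intros; apply Hsl; now right|].
    destruct (Hconj w (Hsl w (or_introl eq_refl))) as [y [HY [Hyf Hyd]]].
    exists (map (fun l => comp l y) en ++ tl). split.
    - intros t Ht. apply in_app_or in Ht. destruct Ht as [Ht|Ht]; [|auto]. apply in_map_iff in Ht. destruct Ht as [l [<- _]].
      exists l. split; [apply HY|now apply comp_finrank].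
    - intros w' [<-|Hw'] x.
      + pose proof (Ypow_diag (S := S) x gzero HY) as Hd. rewrite Hyd in Hd. change (diag Hen (fw w x) gzero) with (fw w x) in Hd.
        revert Hd. apply lspan_mono. intros z [l ->]. exists (comp l y). split; [|reflexivity].
        apply in_or_app; left. apply (in_map (fun l => comp l y)), Hen.
      + eapply lspan_mono; [|apply (H2 w' Hw' x)]. intros z [t [Ht ->]]. exists t; split; [|reflexivity]. apply in_or_app; now right. }
  destruct (HTL SL HSL) as [tl [Htl Hfw]].
  set (Z := lspan (fun y => exists t z, In t tl /\ y = t z)).
  destruct (@lspan_range_fin U tl) as [lz Hlz]; [intros t Ht; now destruct (Htl t Ht) as [? [_ ?]]|].
  (* Operators with range in the finite-dimensional [Z]; the restriction survives brackets and
     provides the space on which Jacobson's theorem is applied. *)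
  set (S' := fun t => nilfin t /\ forall x, Z (t x)).
  assert (HZs : subsp Z) by apply lspan_subsp.
  assert (HWZ' : forall x, W x -> lspan (fun y => exists s w, S' s /\ W w /\ y = s w) x).
  { intros x Hx. specialize (HW1 x Hx). revert HW1. apply lspan_least; [apply lspan_subsp|]. intros y [w [z [Hw [Hz ->]]]].
    eapply lspan_mono; [|apply (Hfw w Hw z)]. intros y [t [Ht ->]]. exists t, z. split; [|auto]. split; [auto|].
    intro x'. apply lspan_in. now exists t, x'. }
  assert (HW0 : forall x, W x -> x = vzero U).
  { apply (@jacobson_fix U lz Z S' W); auto.
    - intros s [[h [[Hs _] _]] _]. now apply lb_lin.
    - intros s t [H1 H2] [H3 H4]. split; [now apply nilfin_bracket|]. intro x. unfold bracket, opsub, opcomp. apply subsp_sub; auto.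
    - intros s x [_ Hs] _. apply Hs.
    - intros s [[h [Hs Hsf]] HsZ]. apply (@decays_nilpotent U s lz Z); auto; [apply lb_lin, Hs|].
      intros x _. now apply (opcl_finrank_decays x Hs).
    - intros x Hx. specialize (HWZ' x Hx). revert HWZ'. apply lspan_least; [assumption|]. intros y [s [w [[_ Hs] [_ ->]]]]. apply Hs. }
  assert (He0 : E e0) by now exists x1.
  (* Without words the span of [l2] would be zero; with one, the empty sublist puts [e0] itself into
     [W]. *)
  destruct yl as [|ws yl].
  - apply Hx1. specialize (HEl2 e0 He0). now rewrite El2 in HEl2.
  - apply Hx1. apply HW0. apply lspan_in. exists nil, e0. split; [|split; [assumption|reflexivity]].
    apply in_flat_map. exists ws. split; [now left|apply sublists_nil].
Qed.

Variable al : list (G * op U).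
Hypothesis Hal : Forall (fun p => S (fst p) (snd p)) al.
Let a : op U := fold_right (fun p acc => opadd (snd p) acc) opzero al.
Let at_ : op P := fold_right (fun p acc => opadd (tens (Hen := Hen) (fst p) (snd p)) acc) opzero al.

Lemma compact_sum (l : list (G * op U)) : Forall (fun p => S (fst p) (snd p)) l ->
  compact_op (fold_right (fun p acc => opadd (snd p) acc) opzero l).
Proof. induction 1 as [|p l Hp _ IH]; [apply compact_zero|]. simpl. apply compact_add; [apply (Svol Hp)|assumption]. Qed.
Lemma compact_tens_sum (l : list (G * op U)) : Forall (fun p => S (fst p) (snd p)) l ->
  compact_op (fold_right (fun p acc => opadd (tens (Hen := Hen) (fst p) (snd p)) acc) opzero l).
Proof. induction 1 as [|p l Hp _ IH]; [apply compact_zero|]. simpl. apply compact_add; [apply compact_tens, (Svol Hp)|assumption]. Qed.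
Lemma tens_sum_diag (l : list (G * op U)) x :
  fold_right (fun p acc => opadd (tens (Hen := Hen) (fst p) (snd p)) acc) opzero l (diag Hen x) =
  diag Hen (fold_right (fun p acc => opadd (snd p) acc) opzero l x).
Proof. induction l as [|p l IH]; [reflexivity|]. 
  change (tens (Hen := Hen) (fst p) (snd p) (diag Hen x) +v
    fold_right (fun p acc => opadd (tens (Hen := Hen) (fst p) (snd p)) acc) opzero l (diag Hen x) =
    diag Hen (snd p x +v fold_right (fun p acc => opadd (snd p) acc) opzero l x)).
  rewrite IH. reflexivity.
Qed.
Lemma Ypow_ad_sum (l : list (G * op U)) y : Forall (fun p => S (fst p) (snd p)) l -> Y y ->
  Y (bracket (fold_right (fun p acc => opadd (tens (Hen := Hen) (fst p) (snd p)) acc) opzero l) y).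
Proof.
  intros H HY. pose proof (lb_lin (Ypow_lb HY)) as Ly.
  induction H as [|p l Hp _ IH]; simpl.
  - replace (bracket opzero y) with (@opzero P); [apply (Ypow_sub Hen Ssub)|].
    apply functional_extensionality; intro x. unfold bracket, opsub, opcomp, opzero. rewrite (lin_0 Ly). vec.
  - set (A := tens (Hen := Hen) (fst p) (snd p)) in *. set (B := fold_right (fun p acc => opadd (tens (Hen := Hen) (fst p) (snd p)) acc) opzero l) in *.
    replace (bracket (opadd A B) y) with (opadd (bracket A y) (bracket B y)).
    + apply (proj1 (proj2 (Ypow_sub Hen Ssub))); [exact (Ypow_ad Slb Sbr Hp HY)|exact IH].
    + apply functional_extensionality; intro x. unfold bracket, opsub, opcomp, opadd. rewrite (lin_add _ _ Ly). vec.
Qed.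

Lemma irreducible_no_eigen z v : z <> C0 -> a v = z *v v -> v = vzero U.
Proof.
  intros Hz Ev. apply NNPP; intro Hv. pose proof (compact_sum Hal) as Hac. fold a in Hac.
  pose proof (compact_tens_sum Hal) as Hat. fold at_ in Hat. pose proof (compact_lin Hac) as La.
  assert (Hdec : forall g s, S g s -> ad_decays a s).
  { intros g s Hs. pose proof (Slb Hs) as Hsl. split; [now apply lb_lin|]. intros eps He.
    assert (HYs : Y (tens (Hen := Hen) g s)) by (apply Ypow_tens; [assumption|now apply opcl_in]).
    destruct (ad_quasinil_of_no_finrank (a := at_) (Y := Y) Hat) with (eps := eps) as [C [HC HCb]]; auto.
    - intros T HT. exact (Ypow_lb HT).
    - exact (Ypow_sub Hen Ssub).
    - apply Ypow_closed.
    - intros T HT. apply (Ypow_ad_sum Hal HT).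
    - intros T HT HTf. apply (Ypow_eq0 HT). intros l x. apply (@no_finrank_limit l); [apply HT|now apply comp_finrank].
    - exists (C * (opnorm (tens (Hen := Hen) g s) * INR (length en))). intros n x.
      (* On constants [at_] acts as [a], so the decay obtained on [U^G] is inherited by the iterates
         of [ad a] at [s]. *)
      assert (Hd : Nat.iter n (ad at_) (tens (Hen := Hen) g s) (diag Hen x) = diag Hen (Nat.iter n (ad a) s x)).
      { revert x. induction n; intro x; [reflexivity|]. simpl. unfold ad at 1 3, bracket, opsub, opcomp.
        assert (Had : forall u, at_ (diag Hen u) = diag Hen (a u)) by (intro; apply tens_sum_diag).
        rewrite Had, !IHn, Had. reflexivity. }
      eapply Rle_trans; [apply (norm_diag Hen)|]. rewrite <- Hd. eapply Rle_trans; [now apply HCb|].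
      pose proof (pow_le eps n ltac:(lra)). pose proof (opnorm_ge0 (Ypow_lb HYs)).
      apply Rle_trans with (C * eps ^ n * (opnorm (tens (Hen := Hen) g s) * (INR (length en) * nm x))).
      + apply Rmult_le_compat_l; [apply Rmult_le_pos; lra|]. apply Rmult_le_compat_l; [assumption|]. apply diag_norm.
      + right; ring. }
  destruct (split_exists Hac Hz) as [k [pi Hs]]. pose proof (lb_lin (split_lb Hs)) as Lp.
  assert (Hall : forall x, pi x = x).
  { apply Sirr.
    - split; [apply (lin_0 Lp)|split]; intros; [rewrite (lin_add _ _ Lp)|rewrite (lin_scal _ _ Lp)]; congruence.
    - intros u l Hu Hl. apply (lim_unique (lb_lim (split_lb Hs) Hl)). eapply lim_ext; [|exact Hl]. intro n; now rewrite Hu.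
    - intros g s x Hs' Hx. apply (gen_eigen_invariant La Hs (Hdec g s Hs') Hx).
    - exists v; split; [|assumption]. apply (split_fix Hs).
      pose proof (split_k Hs). destruct k as [|k]; [lia|]. rewrite Nat.iter_succ_r.
      replace (Dop a z v) with (vzero U) by (unfold Dop; rewrite Ev; vec).
      apply lin_0, lin_iter, lin_Dop, La. }
  destruct (split_fin Hs) as [l Hl].
  (* Here [W] is the single eigenvector: [z v = a v] is a sum of vectors [s v] with [s] homogeneous,
     and [z] is nonzero. *)
  apply Hv. apply (@jacobson_fix U l (fun _ => True) hom (fun x => x = v)); auto.
  - repeat split.
  - intros x _. rewrite <- Hall. apply Hl.
  - intros s Hsh. apply lb_lin, hom_lb, Hsh.
  - intros s t [g Hg] [h Hh]. exists (gadd g h); auto.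
  - intros s [g Hg]. destruct (@decays_nilpotent U s l (fun _ => True)) as [j Hj]; auto.
    + apply lb_lin, (Slb Hg).
    + repeat split.
    + intros x _. rewrite <- Hall. apply Hl.
    + intros x _. apply quasinil_decays; [apply (Slb Hg)|apply (Svol Hg)].
    + exists j; auto.
  - intros x ->.
    assert (Q : lspan (fun y => exists s w, hom s /\ w = v /\ y = s w) (a v)).
    { unfold a. rewrite Forall_forall in Hal. clear - Hal. induction al as [|p l0 IH]; [constructor|].
      simpl. unfold opadd at 1. apply lspan_add.
      - apply lspan_in. exists (snd p), v. split; [|auto]. exists (fst p). apply Hal; now left.
      - apply IH. intros; apply Hal; now right. }
    pose proof (subsp_scal (Cinv z) (lspan_subsp _) Q) as Q2. rewrite Ev in Q2.
    replace (Cinv z *v (z *v v)) with v in Q2; [exact Q2|]. vec_pre; field; assumption.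
Qed.
End Core.

(** * Sums of Volterra components *)

Section QindAlg.
Variable X : CBanach.
Variables X1 X2 : X -> Prop.
Hypothesis H1s : subsp X1.
Hypothesis H1c : closed X1.
Hypothesis H2s : subsp X2.
Hypothesis H2c : closed X2.
Hypothesis H21 : forall x, X2 x -> X1 x.
Let Q := SubQuot H1s H1c H2s H2c H21.
Let q (A : op X) : op Q := qind A.
Let cls (x : X) : Q := qcls H1s H1c H2s H2c H21 x.

Lemma qind_ext (T T' : op Q) : (forall x, X1 x -> T (cls x) = T' (cls x)) -> T = T'.
Proof. intro H. apply functional_extensionality; intro u. rewrite <- (qcls_lift u). apply H, qlift_in. Qed.
Lemma preserves_add A B : preserves X1 X2 A -> preserves X1 X2 B -> preserves X1 X2 (opadd A B).
Proof. intros [A1 A2] [B1 B2]; split; intros x Hx; apply (subsp_add (x := A x) (y := B x)); auto. Qed.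
Lemma preserves_scal c A : preserves X1 X2 A -> preserves X1 X2 (opscal c A).
Proof. intros [A1 A2]; split; intros x Hx; apply (subsp_scal c (x := A x)); auto. Qed.
Lemma preserves_bracket A B : preserves X1 X2 A -> preserves X1 X2 B -> preserves X1 X2 (bracket A B).
Proof.
  intros [A1 A2] [B1 B2]; split; intros x Hx; apply (subsp_sub (x := A (B x)) (y := B (A x))); auto.
Qed.

Lemma qind_add A B : linear A -> linear B -> preserves X1 X2 A -> preserves X1 X2 B -> q (opadd A B) = opadd (q A) (q B).
Proof.
  intros LA LB HA HB. apply qind_ext. intros x Hx. unfold opadd at 2, q, cls.
  rewrite !qind_cls; auto using lin_opadd, preserves_add. apply qcls_add; [now apply HA|now apply HB].
Qed.
Lemma qind_scal c A : linear A -> preserves X1 X2 A -> q (opscal c A) = opscal c (q A).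
Proof.
  intros LA HA. apply qind_ext. intros x Hx. unfold opscal at 2, q, cls.
  rewrite !qind_cls; auto using lin_opscal, preserves_scal. apply qcls_scal; now apply HA.
Qed.
Lemma qind_bracket A B : linear A -> linear B -> preserves X1 X2 A -> preserves X1 X2 B -> q (bracket A B) = bracket (q A) (q B).
Proof.
  intros LA LB HA HB. apply qind_ext. intros x Hx. unfold bracket at 2, opsub, opcomp, q, cls.
  pose proof (proj1 HA _ Hx). pose proof (proj1 HB _ Hx).
  rewrite !qind_cls; auto using lin_bracket, preserves_bracket. apply qcls_sub; [now apply HA|now apply HB].
Qed.

Variable G : AbGroup.
Variable M : G -> op X -> Prop.
Hypothesis Msub : forall g, is_subspace (M g).
Hypothesis Mlin : forall g s, M g s -> linear s.
Hypothesis Mbr : forall g h s t, M g s -> M h t -> M (gadd g h) (bracket s t).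
Hypothesis Mpres : forall g s, M g s -> preserves X1 X2 s.
Definition qfam (g : G) (t : op Q) : Prop := exists s, M g s /\ t = q s.
Lemma qfam_sub g : is_subspace (qfam g).
Proof.
  destruct (Msub g) as [M0 [Ma Ms]]. split; [|split].
  - exists opzero. split; [assumption|reflexivity].
  - intros A B [s [Hs ->]] [t [Ht ->]]. exists (opadd s t); split; [auto|]. symmetry. apply qind_add; eauto.
  - intros c A [s [Hs ->]]. exists (opscal c s); split; [auto|]. symmetry. apply qind_scal; eauto.
Qed.
Lemma qfam_bracket g h s t : qfam g s -> qfam h t -> qfam (gadd g h) (bracket s t).
Proof.
  intros [s' [Hs ->]] [t' [Ht ->]]. exists (bracket s' t'); split; [auto|]. symmetry. apply qind_bracket; eauto.
Qed.
Lemma qfam_sum al : Forall (fun p => M (fst p) (snd p)) al -> forall x, X1 x ->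
  X1 (fold_right (fun p acc => opadd (snd p) acc) opzero al x) /\
  fold_right (fun p acc => opadd (snd p) acc) opzero (map (fun p => (fst p, q (snd p))) al) (cls x) =
  cls (fold_right (fun p acc => opadd (snd p) acc) opzero al x).
Proof.
  intros H x Hx. induction H as [|p al Hp H [IH1 IH2]]; [split; [exact (subsp_0 H1s)|reflexivity]|].
  pose proof (proj1 (Mpres Hp) x Hx) as Hpx. split; [exact (subsp_add H1s Hpx IH1)|].
  change (q (snd p) (cls x) +v fold_right (fun p acc => opadd (snd p) acc) opzero (map (fun p => (fst p, q (snd p))) al) (cls x) =
    cls (snd p x +v fold_right (fun p acc => opadd (snd p) acc) opzero al x)).
  rewrite IH2. unfold q, cls. rewrite qind_cls by eauto. symmetry. now apply qcls_add.
Qed.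
Lemma qfam_list al : Forall (fun p => M (fst p) (snd p)) al -> Forall (fun p => qfam (fst p) (snd p)) (map (fun p => (fst p, q (snd p))) al).
Proof. induction 1 as [|p al Hp _ IH]; simpl; constructor; auto. now exists (snd p). Qed.
End QindAlg.

(** * Restriction to an invariant subspace *)

Section Restriction.
Variable X : CBanach.
Lemma zero_subsp : subsp (fun x => x = vzero X).
Proof. split; [reflexivity|split; intros; subst; vec]. Qed.
Lemma zero_closed : closed (fun x => x = vzero X).
Proof. intros u l Hu Hl. apply (lim_unique Hl). eapply lim_ext; [|apply lim_const]. intro n; simpl. now rewrite Hu. Qed.

(** The Fredholm alternative for the restriction of [a], obtained by viewing [Z] as the subquotient
    of [Z] by zero. *)
Lemma invariant_surj (a : op X) z (Z : X -> Prop) : compact_op a -> z <> C0 -> subsp Z -> closed Z -> (forall x, Z x -> Z (a x)) ->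
  (forall x, Z x -> Dop a z x = vzero X -> x = vzero X) -> forall x, Z x -> exists y, Z y /\ Dop a z y = x.
Proof.
  intros Ha Hz Hs Hc Hinv Hinj x Hx.
  assert (H0 : forall x, x = vzero X -> Z x) by (intros ? ->; now apply subsp_0).
  set (Q := SubQuot Hs Hc zero_subsp zero_closed H0). set (cls := fun x => qcls Hs Hc zero_subsp zero_closed H0 x : Q).
  pose proof (compact_lin Ha) as La.
  assert (Hp : preserves Z (fun x => x = vzero X) a) by (split; [assumption|intros ? ->; now apply lin_0]).
  pose proof (qind_compact Hs Hc zero_subsp zero_closed H0 Ha Hp) as Hqc.
  set (qa := qind (H1s := Hs) (H1c := Hc) (H2s := zero_subsp) (H2c := zero_closed) (H21 := H0) a) in *.
  assert (HD : forall y, Z y -> Dop qa z (cls y) = cls (Dop a z y)).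
  { intros y Hy. unfold Dop, cls, qa. rewrite qind_cls by assumption.
    rewrite qcls_sub; auto; [|now apply subsp_scal]. now rewrite qcls_scal. }
  destruct (split_exists Hqc Hz) as [k [pi Hpi]].
  assert (Hker : forall u, Dop qa z u = vzero Q -> u = vzero Q).
  { intros u Hu. rewrite <- (qcls_lift u) in Hu |- *. pose proof (qlift_in u) as Hi. set (y := qlift u) in *.
    apply (qcls_eq0 Hs Hc zero_subsp zero_closed H0 Hi). apply Hinj; [assumption|].
    pose proof (HD y Hi) as E. unfold cls in E. rewrite Hu in E. symmetry in E.
    apply qcls_eq0 in E; [assumption|]. apply (subsp_sub (x := a y) (y := z *v y)); auto. now apply subsp_scal. }
  assert (Hpi0 : forall u, pi u = vzero Q).
  { intro u. pose proof (split_ker Hpi u) as E. revert E. generalize (pi u) as w. generalize k as n.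
    induction n; intros w E; [assumption|]. apply IHn. apply Hker. exact E. }
  destruct (split_onto Hpi (Hpi0 (cls x))) as [u [_ Hu]].
  exists (qlift u). pose proof (qlift_in u) as Hi. split; [assumption|].
  rewrite <- (qcls_lift u) in Hu. pose proof (HD (qlift u) Hi) as E. unfold cls in E. rewrite E in Hu. unfold cls in Hu.
  assert (HDi : Z (Dop a z (qlift u))) by (apply (subsp_sub (x := a (qlift u)) (y := z *v qlift u)); auto; now apply subsp_scal).
  apply sub_eq0. apply (qcls_eq0 Hs Hc zero_subsp zero_closed H0); [now apply subsp_sub|].
  rewrite qcls_sub, Hu by assumption. apply vadd_oppr.
Qed.
End Restriction.

(** * Reduction to an irreducible subquotient *)

Section VolterraGraded.
Variable X : CBanach.
Variable G : AbGroup.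
Variable en : list G.
Hypothesis Hen : forall g, In g en.
Variable M : G -> op X -> Prop.
Hypothesis Msub : forall g, is_subspace (M g).
Hypothesis Mvol : forall g s, M g s -> volterra s.
Hypothesis Mbr : forall g h s t, M g s -> M h t -> M (gadd g h) (bracket s t).
Variable al : list (G * op X).
Hypothesis Hal : Forall (fun p => M (fst p) (snd p)) al.
Let a : op X := fold_right (fun p acc => opadd (snd p) acc) opzero al.
Let hom (s : op X) : Prop := exists g, M g s.
Let invar (Z : X -> Prop) : Prop := subsp Z /\ closed Z /\ forall s x, hom s -> Z x -> Z (s x).

Lemma hom_clb s : hom s -> lb s.
Proof. intros [g H]. apply compact_lb, (Mvol H). Qed.
Lemma invar_sum Z (l : list (G * op X)) x : invar Z -> Forall (fun p => M (fst p) (snd p)) l -> Z x ->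
  Z (fold_right (fun p acc => opadd (snd p) acc) opzero l x).
Proof.
  intros [Hs [_ Hi]] H Hx. induction H as [|p l Hp _ IH]; [exact (subsp_0 Hs)|].
  apply (subsp_add (x := snd p x) Hs); [|exact IH]. apply Hi; [now exists (fst p)|exact Hx].
Qed.
Definition cyclic (v : X) : X -> Prop := closure (lspan (fun y => exists ws, Forall hom ws /\ y = wapp ws v)).
Lemma cyclic_invar v : invar (cyclic v).
Proof.
  split; [apply closure_subsp, lspan_subsp|split; [apply closure_closed|]].
  intros s x Hs Hx. pose proof (hom_clb Hs) as Hsl. pose proof (lb_lin Hsl) as Ls.
  destruct (closure_lim Hx) as [u [Hu Hux]].
  apply (closure_closed (u := fun n => s (u n))); [|now apply lb_lim].
  intro n. apply closure_in. specialize (Hu n). revert Hu.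
  apply (lspan_least (Z := fun x => lspan (fun y => exists ws, Forall hom ws /\ y = wapp ws v) (s x))).
  - split; [|split].
    + rewrite (lin_0 Ls); constructor.
    + intros b c Hb Hc. rewrite (lin_add _ _ Ls). now apply lspan_add.
    + intros c b Hb. rewrite (lin_scal _ _ Ls). apply subsp_scal; [apply lspan_subsp|assumption].
  - intros y [ws [Hws ->]]. apply lspan_in. exists (s :: ws); split; [now constructor|reflexivity].
Qed.
Lemma cyclic_self v : cyclic v v.
Proof. apply closure_in, lspan_in. exists nil; split; [constructor|reflexivity]. Qed.
Lemma cyclic_least v Z x : invar Z -> Z v -> cyclic v x -> Z x.
Proof.
  intros [Hs [Hc Hi]] Hv. apply closure_min; [|assumption]. intro y. apply lspan_least; [assumption|].
  intros w [ws [Hws ->]]. apply wapp_inv; [|assumption]. eapply Forall_impl; [|apply Hws]. intros s Hsh z Hz. now apply Hi.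
Qed.

Theorem graded_no_eigen z v : z <> C0 -> a v = z *v v -> v = vzero X.
Proof.
  intros Hz Ev. apply NNPP; intro Hv.
  pose proof (compact_sum Mvol Hal) as Hac. fold a in Hac.
  pose proof (compact_lin Hac) as La. pose proof (lin_Dop z La) as LD.
  destruct (split_exists Hac Hz) as [k [pi Hpi]]. pose proof (lb_lin (split_lb Hpi)) as Lp. destruct (split_fin Hpi) as [l Hl].
  assert (Hainv : forall Z, invar Z -> forall x, Z x -> Z (a x)) by (intros Z HZ x Hx; now apply invar_sum).
  assert (HDinv : forall Z, invar Z -> forall x, Z x -> Z (Dop a z x)).
  { intros Z HZ x Hx. destruct HZ as [Hs HZ']. apply (subsp_sub (x := a x) (y := z *v x)); [assumption| |now apply subsp_scal]. apply Hainv; [split|]; assumption. }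
  set (V := fun x => pi x = x).
  assert (HVs : subsp V) by (split; [apply (lin_0 Lp)|split; unfold V; intros; [rewrite (lin_add _ _ Lp)|rewrite (lin_scal _ _ Lp)]; congruence]).
  assert (HDV : forall x, V x -> V (Dop a z x)).
  { intros x Hx. unfold V. rewrite <- (split_comm Hpi LD), Hx; [reflexivity|]. intro y. symmetry. now apply K_Dop. }
  assert (HkerV : forall x, Dop a z x = vzero X -> V x).
  { intros x Hx. apply (split_fix Hpi). pose proof (split_k Hpi). destruct k as [|n]; [lia|]. rewrite Nat.iter_succ_r, Hx.
    apply lin_0, lin_iter, LD. }
  (* Closed invariant subspaces satisfy no chain condition, but their intersections with the
     finite-dimensional generalized eigenspace [V] do. *)
  destruct (@subsp_min_exists X l (fun Z => (exists X1, invar X1 /\ forall x, Z x <-> V x /\ X1 x) /\ exists x, Z x /\ x <> vzero X))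
    as [V1 [[[X0 [HX0 HV1]] [w [Hw Hw0]]] Hmin]].
  { exists V. split; [|exists v; split; [|assumption]].
    - exists (fun _ => True). split; [|intros; tauto]. repeat split.
    - apply HkerV. unfold Dop. rewrite Ev. vec. }
  { intros Z [[X1 [HX1 HZ]] _]. split.
    - destruct HX1 as [Hs1 _]. pose proof (subsp_and HVs Hs1) as Hb. destruct Hb as [B0 [B1 B2]]. split; [|split].
      + now apply HZ.
      + intros x y Hx Hy. apply HZ. apply B1; now apply HZ.
      + intros c x Hx. apply HZ. apply B2; now apply HZ.
    - intros x Hx. apply HZ in Hx. destruct Hx as [Hx _]. unfold V in Hx. rewrite <- Hx. apply Hl. }
  assert (He : exists v1, V1 v1 /\ v1 <> vzero X /\ Dop a z v1 = vzero X).
  { assert (Hg : forall j x, V1 x -> x <> vzero X -> Nat.iter j (Dop a z) x = vzero X -> exists v1, V1 v1 /\ v1 <> vzero X /\ Dop a z v1 = vzero X).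
    { induction j; intros x Hx Hx0 Hj; [contradiction|]. destruct (classic (Dop a z x = vzero X)) as [H|H]; [now exists x|].
      apply (IHj (Dop a z x)); [|assumption|now rewrite iter_shift]. apply HV1 in Hx. apply HV1. split; [apply HDV, Hx|]. apply HDinv; [assumption|apply Hx]. }
    apply (Hg k w Hw Hw0). apply HV1 in Hw. destruct Hw as [Hw _]. rewrite <- Hw. apply (split_ker Hpi). }
  destruct He as [v1 [Hv1 [Hv10 HDv1]]]. pose proof (proj1 (HV1 v1) Hv1) as [Hv1V Hv1X0].
  (* By minimality of [V1] an invariant subspace of [X1] that meets [V] contains [v1], hence is all
     of [X1]. *)
  set (X1 := cyclic v1). pose proof (cyclic_invar v1) as HX1. fold X1 in HX1.
  assert (HX10 : forall x, X1 x -> X0 x) by (intros x Hx; now apply (cyclic_least HX0 Hv1X0)).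
  (* The largest invariant subspace of [X1] on which [pi] vanishes. *)
  set (X2 := fun x => X1 x /\ forall ws, Forall hom ws -> pi (wapp ws x) = vzero X).
  assert (Hwl : forall ws, Forall hom ws -> lb (fun x => pi (wapp ws x))).
  { intros ws Hws. apply (lb_opcomp (split_lb Hpi)). apply lb_wapp. eapply Forall_impl; [|apply Hws]. intros s; apply hom_clb. }
  assert (HX2 : invar X2).
  { destruct HX1 as [Hs1 [Hc1 Hi1]]. split; [|split].
    - split; [|split].
      + split; [now apply subsp_0|]. intros ws Hws. apply (lin_0 (lb_lin (Hwl ws Hws))).
      + intros x y [Hx Hx'] [Hy Hy']. split; [now apply subsp_add|]. intros ws Hws. rewrite (lin_add _ _ (lb_lin (Hwl ws Hws))), Hx', Hy' by assumption. vec.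
      + intros c x [Hx Hx']. split; [now apply subsp_scal|]. intros ws Hws. rewrite (lin_scal _ _ (lb_lin (Hwl ws Hws))), Hx' by assumption. vec.
    - intros u y Hu Hy. split; [apply (Hc1 u); [intro n; apply Hu|assumption]|]. intros ws Hws.
      apply (ker_closed (Hwl ws Hws) (u := u)); [|assumption]. intro n. now apply Hu.
    - intros s x Hs [Hx Hx']. split; [now apply Hi1|]. intros ws Hws. replace (wapp ws (s x)) with (wapp (ws ++ s :: nil) x) by apply wapp_app.
      apply Hx'. apply Forall_app; auto. }
  assert (HX21 : forall x, X2 x -> X1 x) by (intros x [H _]; exact H).
  destruct HX1 as [Hs1 [Hc1 Hi1]]. destruct HX2 as [Hs2 [Hc2 Hi2]].
  set (U := SubQuot Hs1 Hc1 Hs2 Hc2 HX21). set (cls := fun x => qcls Hs1 Hc1 Hs2 Hc2 HX21 x : U).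
  set (q := fun s : op X => qind (H1s := Hs1) (H1c := Hc1) (H2s := Hs2) (H2c := Hc2) (H21 := HX21) s : op U).
  assert (Hpres : forall s, hom s -> preserves X1 X2 s) by (intros s Hs; split; intros x Hx; auto).
  set (S := fun g (t : op U) => exists s, M g s /\ t = q s).
  assert (Mlin : forall g s, M g s -> linear s) by (intros g s Hs; apply compact_lin, (Mvol Hs)).
  assert (Mpres : forall g s, M g s -> preserves X1 X2 s) by (intros g s Hs; apply Hpres; now exists g).
  assert (Hlin : forall s, hom s -> linear s) by (intros s Hs; apply lb_lin, hom_clb, Hs).
  apply Hv10.
  assert (Hcls : cls v1 = vzero U).
  { pose proof (qfam_sum Hs1 Hc1 Hs2 Hc2 HX21 Mlin Mpres Hal (cyclic_self v1)) as [_ Hqsum].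
    apply (@irreducible_no_eigen U G en Hen S) with (al := map (fun p => (fst p, q (snd p))) al) (z := z).
    - exact (qfam_sub Hs1 Hc1 Hs2 Hc2 HX21 Msub Mlin Mpres).
    - intros g t [s [Hs ->]]. destruct (Mvol Hs) as [H1 H2]. assert (hom s) by now exists g. split.
      + apply qind_compact; auto.
      + apply qind_quasinil; auto.
    - exact (qfam_bracket Mlin Mbr Mpres).
    - intros Z HZs HZc HZi [u [Hu Hu0]].
      set (Z' := fun x => X1 x /\ Z (cls x)).
      assert (HZ' : invar Z').
      { split; [|split].
        - split; [|split].
          + split; [now apply subsp_0|]. change (Z (vzero U)). now apply subsp_0.
          + intros x y [Hx Hx'] [Hy Hy']. split; [now apply subsp_add|]. unfold cls. rewrite qcls_add by assumption. now apply subsp_add.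
          + intros c x [Hx Hx']. split; [now apply subsp_scal|]. unfold cls. rewrite qcls_scal by assumption. now apply subsp_scal.
        - intros x y Hx Hy. assert (Hy1 : X1 y) by (apply (Hc1 x); [intro n; apply Hx|assumption]). split; [assumption|].
          apply (HZc (fun n => cls (x n))); [intro n; apply Hx|].
          intros eps Hep. destruct (Hy eps Hep) as [N HN]. exists N; intros n Hn. cbv beta.
          replace (cls (x n) -v cls y) with (cls (x n -v y)) by (apply qcls_sub; auto; apply Hx).
          eapply Rle_lt_trans; [apply qcls_norm|now apply HN]. apply subsp_sub; auto. apply Hx.
        - intros s x Hs [Hx Hx']. split; [now apply Hi1|]. destruct Hs as [g Hg]. assert (hom s) by now exists g.
          replace (cls (s x)) with (q s (cls x)) by (apply qind_cls; auto). apply (HZi g); [now exists s|assumption]. }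
      (* If [Z'] met [V] in zero only, [a - z] would be injective and so surjective on it. Then [Z']
         lies in the range of the [k]-th power, [pi] kills it, and it is contained in [X2], contrary
         to the nonzero class [u]. *)
      assert (HVZ : exists x, V x /\ Z' x /\ x <> vzero X).
      { apply NNPP; intro Hn.
        assert (Hnot : forall x, V x -> Z' x -> x = vzero X) by (intros x H1 H2; apply NNPP; intro; apply Hn; eauto).
        assert (Hsurj : forall x, Z' x -> exists y, Z' y /\ Dop a z y = x).
        { destruct HZ' as [Z1 [Z2 Z3]]. apply (invariant_surj Hac Hz Z1 Z2).
          - intros x Hx. apply (Hainv Z'); [split; [|split]; assumption|assumption].
          - intros x Hx Hd. apply Hnot; auto. }
        assert (Hsurjk : forall j x, Z' x -> exists y, Z' y /\ Nat.iter j (Dop a z) y = x).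
        { induction j; intros x Hx; [now exists x|]. destruct (Hsurj x Hx) as [y [Hy Ey]]. destruct (IHj y Hy) as [y' [Hy' Ey']].
          exists y'; split; [assumption|]. simpl. congruence. }
        assert (Hpi0 : forall x, Z' x -> pi x = vzero X).
        { intros x Hx. destruct (Hsurjk k x Hx) as [y [_ <-]]. apply (split_ran0 Hpi). }
        apply Hu0. rewrite <- (qcls_lift u) in Hu |- *. apply qcls_eq0; [apply qlift_in|]. split; [apply qlift_in|].
        intros ws Hws. apply Hpi0. apply wapp_inv; [|split; [apply qlift_in|exact Hu]].
        eapply Forall_impl; [|apply Hws]. intros s Hs y Hy. now apply (proj2 (proj2 HZ')). }
      destruct HVZ as [x0 [Hx0V [Hx0Z Hx00]]].
      assert (Hv1Z : Z' v1).
      { assert (H : (fun x => V x /\ Z' x) v1); [|apply H]. apply (Hmin (fun x => V x /\ Z' x)); auto.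
        - split; [exists Z'; split; [assumption|tauto]|]. exists x0; tauto.
        - intros x [HxV [Hx1 _]]. apply HV1. auto. }
      intro u'. rewrite <- (qcls_lift u'). apply (cyclic_least HZ' Hv1Z). apply qlift_in.
    - exact (qfam_list Hs1 Hc1 Hs2 Hc2 HX21 Hal).
    - assumption.
    - etransitivity; [exact Hqsum|]. fold a. change (cls (a v1) = z *v cls v1).
      replace (z *v cls v1) with (cls (z *v v1)) by (apply qcls_scal, cyclic_self). f_equal. apply sub_eq0. exact HDv1. }
  (* Membership of [v1] in [X2], taken at the empty word, says that [pi] kills [v1], while [pi]
     fixes it. *)
  apply (qcls_eq0 Hs1 Hc1 Hs2 Hc2 HX21 (cyclic_self v1)) in Hcls. destruct Hcls as [_ H]. specialize (H nil (Forall_nil _)).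
  simpl in H. rewrite <- H. symmetry. exact Hv1V.
Qed.
End VolterraGraded.

(** * Engel components *)

Section SumOf.
Variable X : CBanach.
Variable G : AbGroup.
Variable S : G -> op X -> Prop.
Hypothesis Ssub : forall g, is_subspace (S g).
Lemma sum_of_in g A : S g A -> sum_of S A.
Proof.
  intro H. exists ((g, A) :: nil). split; [now constructor|]. simpl. apply functional_extensionality; intro x.
  unfold opadd, opzero. vec.
Qed.
Lemma sum_of_least (Z : op X -> Prop) A : is_subspace Z -> (forall g A, S g A -> Z A) -> sum_of S A -> Z A.
Proof.
  intros [Z0 [Za _]] HZ [l [Hl ->]]. induction Hl as [|p l Hp _ IH]; [assumption|]. simpl. apply Za; eauto.
Qed.
Lemma sum_of_sub : is_subspace (sum_of S).
Proof.
  split; [|split].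
  - exists nil. split; [constructor|reflexivity].
  - intros A B [l [Hl ->]] [l' [Hl' ->]]. exists (l ++ l'). split; [apply Forall_app; auto|].
    clear. induction l as [|p l IH]; simpl; [apply functional_extensionality; intro; unfold opadd, opzero; vec|].
    rewrite <- IH. apply functional_extensionality; intro; unfold opadd. vec.
  - intros c A [l [Hl ->]]. exists (map (fun p => (fst p, opscal c (snd p))) l). split.
    + induction Hl as [|p l Hp _ IH]; simpl; constructor; auto. apply (proj2 (proj2 (Ssub (fst p)))), Hp.
    + clear. induction l as [|p l IH]; simpl; [apply functional_extensionality; intro; unfold opscal, opzero; vec|].
      rewrite <- IH. apply functional_extensionality; intro; unfold opadd, opscal. vec.
Qed.
End SumOf.

Section RestrictedVolterra.
Variable X : CBanach.
Variable G : AbGroup.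
Variable en : list G.
Hypothesis Hen : forall g, In g en.
Variable M : G -> op X -> Prop.
Hypothesis Msub : forall g, is_subspace (M g).
Hypothesis Mcomp : forall g s, M g s -> compact_op s.
Hypothesis Mbr : forall g h s t, M g s -> M h t -> M (gadd g h) (bracket s t).

(** Without eigenvectors in [Z] the restrictions of the components are Volterra, so the Volterra
    case applies on the quotient of [Z] by zero; its norm is the original one and the decay carries
    back. *)
Lemma graded_decays_on al (Z : X -> Prop) : Forall (fun p => M (fst p) (snd p)) al -> subsp Z -> closed Z ->
  (forall g s x, M g s -> Z x -> Z (s x)) -> (forall g s z x, M g s -> z <> C0 -> Z x -> s x = z *v x -> x = vzero X) ->
  forall x, Z x -> decays (fold_right (fun p acc => opadd (snd p) acc) opzero al) x.
Proof.
  intros Hal HZ HZc Hinv Hno.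
  assert (H0 : forall x, x = vzero X -> Z x) by (intros ? ->; now apply subsp_0).
  set (a := fold_right (fun p acc => opadd (snd p) acc) opzero al).
  assert (Mlin : forall g s, M g s -> linear s) by (intros g s Hs; apply compact_lin, (Mcomp Hs)).
  assert (Mpres : forall g s, M g s -> preserves Z (fun x => x = vzero X) s).
  { intros g s Hs; split; [intros; eapply Hinv; eauto|intros ? ->; eapply lin_0; eauto]. }
  set (Q := SubQuot HZ HZc (@zero_subsp X) (@zero_closed X) H0). set (cls := fun x => qcls HZ HZc (@zero_subsp X) (@zero_closed X) H0 x : Q).
  set (q := fun s : op X => qind (H1s := HZ) (H1c := HZc) (H2s := @zero_subsp X) (H2c := @zero_closed X) (H21 := H0) s : op Q).
  pose proof (qfam_list HZ HZc (@zero_subsp X) (@zero_closed X) H0 Hal) as Hql.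
  pose proof (qfam_sum HZ HZc (@zero_subsp X) (@zero_closed X) H0 Mlin Mpres Hal) as Hqs. fold a in Hqs.
  set (qa := fold_right (fun p acc => opadd (snd p) acc) opzero (map (fun p => (fst p, q (snd p))) al)).
  assert (Hvol : forall g t, qfam (H1s := HZ) (H1c := HZc) (H2s := @zero_subsp X) (H2c := @zero_closed X) (H21 := H0) M g t -> volterra t).
  { intros g t [s [Hs ->]]. assert (Hc : compact_op (q s)) by (apply qind_compact; eauto). split; [exact Hc|].
    apply (quasinil_of_no_eigen Hc). intros z u Hz Hu. rewrite <- (qcls_lift u) in Hu |- *. pose proof (qlift_in u) as Hi.
    set (y := qlift u) in *. change (qcls HZ HZc (@zero_subsp X) (@zero_closed X) H0 y = vzero Q). apply qcls_eq0; [assumption|].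
    apply (Hno g s z y); auto. apply sub_eq0. pose proof (Hinv g s y Hs Hi) as Hsy. assert (Hzy : Z (z *v y)) by now apply subsp_scal.
    apply (qcls_eq0 HZ HZc (@zero_subsp X) (@zero_closed X) H0); [now apply subsp_sub|].
    rewrite qcls_sub, qcls_scal by assumption. unfold q in Hu. rewrite qind_cls in Hu by eauto. rewrite Hu. apply vadd_oppr. }
  assert (Hqac : compact_op qa) by exact (compact_sum Hvol Hql).
  assert (Hqq : quasinilpotent qa).
  { apply (quasinil_of_no_eigen Hqac). intros z u Hz Hu.
    apply (graded_no_eigen Hen (qfam_sub HZ HZc (@zero_subsp X) (@zero_closed X) H0 Msub Mlin Mpres) Hvol (qfam_bracket Mlin Mbr Mpres) Hql Hz Hu). }
  intros x Hx eps He. destruct (quasinil_decays (cls x) (compact_lb Hqac) Hqq He) as [C HC]. exists C. intro n.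
  assert (Hn : Z (Nat.iter n a x) /\ Nat.iter n qa (cls x) = cls (Nat.iter n a x)).
  { induction n as [|n [I1 I2]]; [split; [assumption|reflexivity]|]. simpl. destruct (Hqs _ I1) as [J1 J2]. split; [exact J1|]. exact (eq_trans (f_equal qa I2) J2). }
  destruct Hn as [Hn1 Hn2]. specialize (HC n). rewrite Hn2 in HC. eapply Rle_trans; [|exact HC].
  apply le_epsilon. intros e Hep. destruct (@qcls_near X Z _ HZ HZc (@zero_subsp X) (@zero_closed X) H0 (cls (Nat.iter n a x)) e Hep) as [y [Hy [Ey Ny]]].
  assert (E : y -v Nat.iter n a x = vzero X).
  { apply (qcls_eq0 HZ HZc (@zero_subsp X) (@zero_closed X) H0); [now apply subsp_sub|]. rewrite qcls_sub, Ey by assumption. apply vadd_oppr. }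
  apply sub_eq0 in E. rewrite <- E at 1. left. exact Ny.
Qed.
End RestrictedVolterra.

(** * Riesz projections of Engel elements commute *)

Section EngelCommute.
Variable X : CBanach.
(* On [ker pi] put [Phi_n = pi (ad b)^n T].  Then [Phi_n D = D Phi_n - Phi_(n+1)] with [D = b - be] nilpotent on the range of [pi]
   and invertible on [ker pi], so the maps [D^j Phi_n] vanish by downward induction on [j]. *)
Lemma split_comm_engel (b : op X) be k pi T : lb b -> split b be k pi -> ad_decays b T -> forall x, T (pi x) = pi (T x).
Proof.
  intros Hbl Hs HT. pose proof (lb_lin Hbl) as Hb. pose proof (lb_lin (split_lb Hs)) as Lp. pose proof (lin_Dop be Hb) as LD.
  assert (Hpb : forall x, b (pi x) = pi (b x)) by (intro; now apply (split_comm Hs)).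
  assert (HpD : forall x, Dop b be (pi x) = pi (Dop b be x)) by (intro x; unfold Dop; now rewrite (lin_sub _ _ Lp), (lin_scal _ _ Lp), Hpb).
  assert (HV : forall x, pi (T (pi x)) = T (pi x)) by (intro; apply (gen_eigen_invariant Hb Hs HT), (split_idem Hs)).
  assert (Hdn : forall n, ad_decays b (Nat.iter n (ad b) T)) by (induction n; [assumption|now apply ad_decays_ad]).
  set (Phi := fun n x => pi (Nat.iter n (ad b) T x)).
  assert (HPhi : forall n x, Phi n (Dop b be x) = Dop b be (Phi n x) -v Phi (S n) x).
  { intros n x. unfold Phi. destruct (Hdn n) as [Ln _]. rewrite HpD, <- (lin_sub _ _ Lp). f_equal. simpl. set (T' := Nat.iter n (ad b) T) in *.
    change (ad b T' x) with (b (T' x) -v T' (b x)). unfold Dop. rewrite (lin_sub _ _ Ln), (lin_scal _ _ Ln). vec. }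
  destruct (split_low Hs) as [c [Hc Hlow]]. destruct (lb_bound (split_lb Hs)) as [P [HP HPb]].
  assert (Hj : forall i j, (i + j = k)%nat -> forall n x, pi x = vzero X -> Nat.iter j (Dop b be) (Phi n x) = vzero X).
  { induction i as [|i IH]; intros j Hij n x Hx; [simpl in Hij; subst j; apply (split_ker Hs)|].
    specialize (IH (S j) ltac:(lia)). set (Dj := Nat.iter j (Dop b be)). assert (LDj : linear Dj) by now apply lin_iter.
    assert (Hstep : forall n x, pi x = vzero X -> exists y, pi y = vzero X /\ c * nm y <= nm x /\ Dj (Phi n x) = -v Dj (Phi (S n) y)).
    { intros n' x' Hx'. destruct (split_onto Hs Hx') as [y [Hy Ey]]. exists y. split; [assumption|split].
      - rewrite <- Ey. now apply Hlow.
      - rewrite <- Ey at 1. rewrite HPhi, (lin_sub _ _ LDj). specialize (IH n' y Hy). simpl in IH. rewrite <- iter_shift in IH. unfold Dj. rewrite IH. vec. }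
    assert (Hm : forall m n x, pi x = vzero X -> exists y, pi y = vzero X /\ c ^ m * nm y <= nm x /\ nm (Dj (Phi n x)) = nm (Dj (Phi (n + m)%nat y))).
    { induction m as [|m IHm]; intros n' x' Hx'; [exists x'; rewrite Nat.add_0_r; repeat split; auto; simpl; lra|].
      destruct (Hstep n' x' Hx') as [y [Hy [Ny Ey]]]. destruct (IHm (S n') y Hy) as [w [Hw [Nw Ew]]].
      exists w. split; [assumption|split].
      - simpl. rewrite Rmult_assoc. eapply Rle_trans; [|exact Ny]. apply Rmult_le_compat_l; lra.
      - rewrite Ey, nm_opp, Ew. do 3 f_equal. lia. }
    destruct (lb_bound (lb_iter j (lb_Dop be Hbl))) as [d0 [Hd0 Hd0b]]. fold Dj in Hd0b.
    destruct (proj2 HT (c / 2) ltac:(lra)) as [C HC].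
    apply nm_le0. apply le_pow_zero with (C := d0 * (P * (Rabs C * (c / 2) ^ n * nm x))) (eta := / 2); [lra|]. intro m.
    destruct (Hm m n x Hx) as [y [Hy [Ny Ey]]]. rewrite Ey.
    eapply Rle_trans; [apply Hd0b|]. rewrite Rmult_assoc. apply Rmult_le_compat_l; [lra|].
    eapply Rle_trans; [apply HPb|]. rewrite Rmult_assoc. apply Rmult_le_compat_l; [lra|].
    eapply Rle_trans; [apply HC|]. pose proof (Rle_abs C). pose proof (Rabs_pos C). pose proof (nm_ge0 y).
    assert (Hp : 0 <= (c / 2) ^ (n + m)) by (apply pow_le; lra).
    apply Rle_trans with (Rabs C * (c / 2) ^ (n + m) * nm y).
    { apply Rmult_le_compat_r; [assumption|]. now apply Rmult_le_compat_r. }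
    rewrite pow_add. unfold Rdiv at 2. rewrite (Rpow_mult_distr c (/ 2) m).
    assert (0 <= Rabs C * (c / 2) ^ n) by (apply Rmult_le_pos; [assumption|apply pow_le; lra]).
    assert (0 <= (/ 2) ^ m) by (apply pow_le; lra).
    replace (Rabs C * ((c / 2) ^ n * (c ^ m * (/ 2) ^ m)) * nm y) with (Rabs C * (c / 2) ^ n * (/ 2) ^ m * (c ^ m * nm y)) by ring.
    replace (Rabs C * (c / 2) ^ n * nm x * (/ 2) ^ m) with (Rabs C * (c / 2) ^ n * (/ 2) ^ m * nm x) by ring.
    apply Rmult_le_compat_l; [now apply Rmult_le_pos|assumption]. }
  intro x. rewrite <- HV. symmetry. apply sub_eq0. destruct HT as [LT _]. rewrite <- (lin_sub _ _ Lp), <- (lin_sub _ _ LT).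
  apply (Hj k 0%nat ltac:(lia) 0%nat). rewrite (lin_sub _ _ Lp), (split_idem Hs). apply vadd_oppr.
Qed.
End EngelCommute.

Lemma initial_bound (u : nat -> R) N : exists C, 0 <= C /\ forall n, (n < N)%nat -> u n <= C.
Proof.
  induction N as [|N [C [HC H]]]; [exists 0; split; [lra|intros; lia]|].
  exists (Rmax C (u N)). split; [eapply Rle_trans; [exact HC|apply Rmax_l]|]. intros n Hn.
  destruct (Nat.eq_dec n N) as [->|E]; [apply Rmax_r|]. eapply Rle_trans; [apply H; lia|apply Rmax_l].
Qed.

(** * The corner of a finite rank projection *)

Section Corner.
Variable X : CBanach.
Variable q : op X.
Hypothesis Hq : finrank q.
Hypothesis Hqq : forall x, q (q x) = q x.
Let Lq : linear q := lb_lin (proj1 Hq).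

Definition corner (y : op X) : Prop := lb y /\ forall x, q (y (q x)) = y x.
Lemma corner_lb y : corner y -> lb y. Proof. now intros [H _]. Qed.
Lemma corner_sub : is_subspace corner.
Proof.
  split; [|split].
  - split; [apply lb_opzero|]. intro x. apply (lin_0 Lq).
  - intros A B [HA HA'] [HB HB']. split; [now apply lb_opadd|]. intro x. unfold opadd. now rewrite (lin_add _ _ Lq), HA', HB'.
  - intros c A [HA HA']. split; [now apply lb_opscal|]. intro x. unfold opscal. now rewrite (lin_scal _ _ Lq), HA'.
Qed.
Lemma corner_closed : opclosed corner.
Proof.
  intros y Hy H. split; [assumption|]. intro x. destruct (lb_bound (proj1 Hq)) as [c [Hc Hcb]].
  apply sub_eq0, nm_le0. apply le_epsilon. intros eps He. rewrite Rplus_0_l. pose proof (nm_ge0 x).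
  destruct (H (eps / ((c * c + 1) * (nm x + 1)))) as [z [[Hz Hz'] Hzy]].
  { apply Rdiv_lt_0_compat; [assumption|]. apply Rmult_lt_0_compat; nra. }
  set (d := eps / ((c * c + 1) * (nm x + 1))) in *.
  assert (Hd : 0 < d) by (apply Rdiv_lt_0_compat; [assumption|]; apply Rmult_lt_0_compat; nra).
  replace (q (y (q x)) -v y x) with (q (y (q x) -v z (q x)) -v (y x -v z x)) by (rewrite (lin_sub _ _ Lq), Hz'; vec).
  eapply Rle_trans; [apply nm_sub|].
  assert (H1 : nm (q (y (q x) -v z (q x))) <= c * (d * (c * nm x))).
  { eapply Rle_trans; [apply Hcb|]. apply Rmult_le_compat_l; [lra|]. eapply Rle_trans; [apply Hzy|]. apply Rmult_le_compat_l; [lra|apply Hcb]. }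
  specialize (Hzy x).
  assert (H2 : d * ((c * c + 1) * (nm x + 1)) = eps) by (unfold d; field; nra).
  assert (0 <= d * (c * c + 1)) by (apply Rmult_le_pos; nra). nra.
Qed.

Definition CornerSp : CBanach := OpSpace corner_lb corner_sub corner_closed.
Let val (y : CornerSp) : op X := oval y.
(** By compactness of [T |-> q T q] the identity of the corner is compact, so its eigenspace at 1,
    which is the whole corner, has finite dimension. *)
Lemma corner_fin : exists l : list CornerSp, forall y, span l y.
Proof.
  assert (Vsub : forall (S T : CornerSp) x, val (S -v T) x = val S x -v val T x).
  { intros S T x. change (val S x +v Copp Cone *v val T x = val S x -v val T x). now rewrite <- vopp_scal. }
  assert (Vlb : forall S : CornerSp, lb (val S)) by (intro S; apply corner_lb, oval_in).
  assert (Vle : forall (S : CornerSp) C, 0 <= C -> (forall x, nm (val S x) <= C * nm x) -> nm S <= C) by (intros S C HC H; apply opnorm_le; auto).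
  assert (Hid : compact_op (@opid CornerSp)).
  { apply compact_intro; [apply lin_opid|]. intros u [M HM]. pose proof (compact_finrank Hq) as Hqc.
    assert (HM0 : 0 <= M) by (eapply Rle_trans; [apply nm_ge0|apply (HM O)]).
    destruct (@sandwich_subseq X q q (fun n => val (u n)) (M + 1) Hqc Hqc) as [phi [Hphi Hcau]]; [intro n; apply lb_lin, Vlb|lra| |].
    { intros n x. eapply Rle_trans; [apply opnorm_spec, Vlb|]. apply Rmult_le_compat_r; [apply nm_ge0|]. specialize (HM n). change (nm (u n) <= M + 1). lra. }
    destruct (vcomplete CornerSp (fun n => u (phi n))) as [y Hy].
    - intros eps He. destruct (Hcau (eps / 2)) as [N HN]; [lra|]. exists N. intros m n Hm Hn.
      apply Rle_lt_trans with (eps / 2); [|lra]. apply Vle; [lra|]. intro x. rewrite Vsub. specialize (HN m n Hm Hn x).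
      destruct (oval_in (u (phi m))) as [_ E1]. destruct (oval_in (u (phi n))) as [_ E2].
      unfold val in *. rewrite E1, E2 in HN. exact HN.
    - exists phi, y. split; [assumption|exact Hy]. }
  destruct (@ker_Dop_fin CornerSp opid Cone Hid Cone_neq0) as [l Hl]. exists l. intro y. apply Hl. unfold Dop, opid. rewrite vscal_1. apply vadd_oppr.
Qed.
End Corner.

(** * Locally finitely subgraded algebras *)

Section EngelPart.
Variable X : CBanach.
Variable G : AbGroup.
Variable L : op X -> Prop.
Variable Lg : G -> op X -> Prop.
Hypothesis Lcomp : forall A, L A -> compact_op A.
Hypothesis Lsg : subgraded L Lg.
Hypothesis Llf : locally_finitely_subgraded Lg.

Lemma L_hom g A : Lg g A -> L A.
Proof. intro H. apply (proj1 (proj2 Lsg)). now apply (sum_of_in H). Qed.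
Lemma L_sub : is_subspace L.
Proof.
  destruct Lsg as [H1 [H2 _]]. destruct (sum_of_sub H1) as [H3 [H4 H5]]. split; [|split].
  - now apply H2.
  - intros A B HA HB. apply H2. apply H4; now apply H2.
  - intros c A HA. apply H2. apply H5; now apply H2.
Qed.
Lemma L_ind (Z : op X -> Prop) A : is_subspace Z -> (forall g A, Lg g A -> Z A) -> L A -> Z A.
Proof. intros HZ H HA. apply (proj1 (proj2 Lsg)) in HA. revert HA. now apply sum_of_least. Qed.
Lemma L_lin A : L A -> linear A. Proof. intro H; apply compact_lin, Lcomp, H. Qed.
Lemma L_lb A : L A -> lb A. Proof. intro H; apply compact_lb, Lcomp, H. Qed.
Lemma bracket_sub_r (A : op X) : linear A -> is_subspace (fun B => L (bracket A B)).
Proof.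
  intro LA. destruct L_sub as [L0 [La Ls]]. split; [|split].
  - replace (bracket A opzero) with (@opzero X); [assumption|]. apply functional_extensionality; intro x.
    unfold bracket, opsub, opcomp, opzero. rewrite (lin_0 LA). vec.
  - intros B B' H1 H2. replace (bracket A (opadd B B')) with (opadd (bracket A B) (bracket A B')); [auto|].
    apply functional_extensionality; intro x. unfold bracket, opsub, opcomp, opadd. rewrite (lin_add _ _ LA). vec.
  - intros c B H1. replace (bracket A (opscal c B)) with (opscal c (bracket A B)); [auto|].
    apply functional_extensionality; intro x. unfold bracket, opsub, opcomp, opscal. rewrite (lin_scal _ _ LA). vec.
Qed.
Lemma bracket_sub_l (B : op X) : linear B -> is_subspace (fun A => L (bracket A B)).
Proof.
  intro LB. destruct L_sub as [L0 [La Ls]]. split; [|split].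
  - replace (bracket opzero B) with (@opzero X); [assumption|]. apply functional_extensionality; intro x.
    unfold bracket, opsub, opcomp, opzero. rewrite (lin_0 LB). vec.
  - intros A A' H1 H2. replace (bracket (opadd A A') B) with (opadd (bracket A B) (bracket A' B)); [auto|].
    apply functional_extensionality; intro x. unfold bracket, opsub, opcomp, opadd. rewrite (lin_add _ _ LB). vec.
  - intros c A H1. replace (bracket (opscal c A) B) with (opscal c (bracket A B)); [auto|].
    apply functional_extensionality; intro x. unfold bracket, opsub, opcomp, opscal. rewrite (lin_scal _ _ LB). vec.
Qed.
Lemma L_bracket A B : L A -> L B -> L (bracket A B).
Proof.
  intros HA HB. apply (L_ind (A := A) (Z := fun A => L (bracket A B))); [apply bracket_sub_l, L_lin, HB| |assumption].
  intros g A' HA'. apply (L_ind (A := B) (Z := fun B => L (bracket A' B))); [apply bracket_sub_r, L_lin, (L_hom HA')| |assumption].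
  intros h B' HB'. apply (@L_hom (gadd g h)), Lsg; assumption.
Qed.
Lemma L_ad_iter a A n : L a -> L A -> L (Nat.iter n (ad a) A).
Proof. intros Ha HA. induction n; [assumption|]. now apply L_bracket. Qed.

(** Local finiteness is applied to the homogeneous summands of [A], and the sum is decomposed anew
    inside the finitely graded subalgebra. The new summands are again homogeneous for [Lg], so
    assumptions on its components apply to them. *)
Lemma finite_decomposition A : L A -> exists (Lam : AbGroup) (en : list Lam) (M : Lam -> op X -> Prop) al,
  (forall g, In g en) /\ (forall g, is_subspace (M g)) /\ (forall g h s t, M g s -> M h t -> M (gadd g h) (bracket s t)) /\
  (forall d s, M d s -> exists g, Lg g s) /\ Forall (fun p => M (fst p) (snd p)) al /\
  A = fold_right (fun p acc => opadd (snd p) acc) opzero al.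
Proof.
  intro HA. apply (proj1 (proj2 Lsg)) in HA. destruct HA as [l [Hl ->]].
  destruct (@Llf (map snd l)) as [Lam [M [[en Hen] [[[M1 [M2 M3]] M4] HM]]]].
  { clear - Hl. induction Hl as [|p l Hp _ IH]; simpl; constructor; auto. now exists (fst p). }
  destruct (sum_of_sub M1) as [S0 [Sa _]].
  assert (Hs : sum_of M (fold_right (fun p acc => opadd (snd p) acc) (@opzero X) l)).
  { clear - HM S0 Sa. induction l as [|p l IH]; [exact S0|]. simpl in HM. inversion HM; subst. simpl. apply Sa; auto. }
  destruct Hs as [al [Hal E]]. exists Lam, en, M, al. split; [assumption|split; [assumption|split; [assumption|split; [|split; assumption]]]].
  intros d s Hs. destruct (M4 d) as [g Hg]. eauto.
Qed.

Theorem volterra_part : (forall g A, Lg g A -> volterra A) -> forall A, L A -> volterra A.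
Proof.
  intros Hvol A HA. split; [now apply Lcomp|]. apply quasinil_of_no_eigen; [now apply Lcomp|]. intros z v Hz Ev.
  destruct (finite_decomposition HA) as [Lam [en [M [al [H1 [H2 [H3 [H4 [H5 ->]]]]]]]]].
  apply (graded_no_eigen H1 H2) with (al := al) (z := z); auto.
  intros g s Hs. destruct (H4 g s Hs) as [h Hh]. eauto.
Qed.

Hypothesis Leng : forall g A, Lg g A -> engel L A.

(** The Engel condition speaks of large [n] only; the first iterates are absorbed into the
    constant. *)
Lemma engel_ad_decays g b T : Lg g b -> L T -> ad_decays b T.
Proof.
  intros Hb HT. split; [now apply L_lin|]. intros eps He. destruct (Leng Hb) as [HbL Hs].
  destruct (Hs eps He) as [N HN]. pose proof (fun n => L_lb (L_ad_iter n HbL HT)) as Hl.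
  destruct (initial_bound (fun n => opnorm (Nat.iter n (ad b) T) / eps ^ n) N) as [C [HC HCn]].
  exists (C + opnorm T). intros n x. eapply Rle_trans; [apply opnorm_spec, Hl|]. apply Rmult_le_compat_r; [apply nm_ge0|].
  assert (Hp : 0 < eps ^ n) by now apply pow_lt. pose proof (opnorm_ge0 (L_lb HT)).
  destruct (Nat.le_gt_cases N n) as [Hn|Hn].
  - specialize (HN n Hn T HT). assert (0 <= C * eps ^ n) by (apply Rmult_le_pos; lra). lra.
  - specialize (HCn n Hn). apply Rle_trans with (C * eps ^ n); [|nra].
    apply Rmult_le_reg_r with (/ eps ^ n); [now apply Rinv_0_lt_compat|]. rewrite Rmult_assoc, Rinv_r, Rmult_1_r by lra. exact HCn.
Qed.
Lemma split_comm_L g b be k pi T : Lg g b -> split b be k pi -> L T -> forall x, T (pi x) = pi (T x).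
Proof. intros Hb Hs HT. apply (split_comm_engel (L_lb (L_hom Hb)) Hs (engel_ad_decays Hb HT)). Qed.

(* Nothing survives off a large enough finite rank projection [q] commuting with [L]: on the intersection of the kernels
   of the spectral projections of homogeneous elements, [L] consists of Volterra operators. *)
Lemma commuting_projection a p : L a -> finrank p -> (forall A, linear A -> (forall x, A (a x) = a (A x)) -> forall x, A (p x) = p (A x)) ->
  (forall x, decays a x -> p x = vzero X) ->
  exists q, finrank q /\ (forall x, q (q x) = q x) /\ (forall T, L T -> forall x, T (q x) = q (T x)) /\
    forall x, p x = x -> q x = vzero X -> x = vzero X.
Proof.
  intros Ha Hp Hpc Hpd. pose proof (lb_lin (proj1 Hp)) as Lp. destruct (proj2 Hp) as [l Hl].
  set (Qs := fun q => finrank q /\ (forall x, q (q x) = q x) /\ forall T, L T -> forall x, T (q x) = q (T x)).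
  assert (HQ0 : Qs opzero).
  { split; [split; [apply lb_opzero|exists nil; intro x; reflexivity]|split; [reflexivity|]]. intros T HT x. apply (lin_0 (L_lin HT)). }
  (* Among the commuting projections, [q] is taken with the smallest part of the range of [p] left
     in its kernel. *)
  destruct (@subsp_min_exists X l (fun Z => exists q, Qs q /\ forall x, Z x <-> p x = x /\ q x = vzero X)) as [Z [[q [HQ HZ]] Hmin]].
  { exists (fun x => p x = x /\ opzero x = vzero X), opzero. split; [assumption|tauto]. }
  { intros Z [q [[Hq _] HZ]]. pose proof (lb_lin (proj1 Hq)) as Lq. split.
    - split; [|split].
      + apply HZ. split; [apply (lin_0 Lp)|apply (lin_0 Lq)].
      + intros x y Hx Hy. apply HZ in Hx, Hy. apply HZ. rewrite (lin_add _ _ Lp), (lin_add _ _ Lq). destruct Hx as [-> ->], Hy as [-> ->]. split; vec.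
      + intros c x Hx. apply HZ in Hx. apply HZ. rewrite (lin_scal _ _ Lp), (lin_scal _ _ Lq). destruct Hx as [-> ->]. split; vec.
    - intros x Hx. apply HZ in Hx. destruct Hx as [Hx _]. rewrite <- Hx. apply Hl. }
  exists q. destruct HQ as [Hq [Hqq Hqc]]. split; [assumption|split; [assumption|split; [assumption|]]].
  pose proof (lb_lin (proj1 Hq)) as Lq.
  (* The common kernel of all spectral projections of homogeneous elements at nonzero eigenvalues;
     [L] preserves it, as these projections commute with [L]. *)
  set (X0 := fun x => forall g b be k pi, Lg g b -> be <> C0 -> split b be k pi -> pi x = vzero X).
  assert (HZX0 : forall x, Z x -> X0 x).
  { intros x Hx g b be k pi Hb Hbe Hs. pose proof (lb_lin (split_lb Hs)) as Lpi.
    assert (Hqpi : forall y, q (pi y) = pi (q y)) by (intro y; apply (split_comm Hs Lq); intro; symmetry; apply Hqc, (L_hom Hb)).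
    (* The join of [q] and [pi]. It leaves no more than [q] does, so by minimality it leaves the
       same, and [pi] already vanishes on that part. *)
    set (q' := opadd q (opsub pi (opcomp q pi))).
    assert (HQ' : Qs q').
    { assert (Hpif : finrank pi) by (split; [apply (split_lb Hs)|apply (split_fin Hs)]).
      split; [|split].
      - apply finrank_add; [assumption|].
        replace (opsub pi (opcomp q pi)) with (opadd pi (opscal (Copp Cone) (opcomp q pi))) by (apply functional_extensionality; intro; unfold opsub, opadd, opscal; now rewrite <- vopp_scal).
        apply finrank_add; [assumption|]. apply finrank_scal, finrank_comp_l; [apply Hq|assumption].
      - intro y.
        assert (E1 : q (q' y) = q y) by (unfold q', opadd, opsub, opcomp; rewrite (lin_add _ _ Lq), (lin_sub _ _ Lq), !Hqq; vec).
        assert (E2 : pi (q' y) = pi y).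
        { unfold q', opadd, opsub, opcomp. rewrite (lin_add _ _ Lpi), (lin_sub _ _ Lpi), (split_idem Hs), Hqpi, (split_idem Hs). vec. }
        unfold q' at 1, opadd, opsub, opcomp. now rewrite E1, E2.
      - intros T HT y. pose proof (L_lin HT) as LT. unfold q', opadd, opsub, opcomp.
        rewrite (lin_add _ _ LT), (lin_sub _ _ LT), !Hqc, !(split_comm_L Hb Hs HT) by assumption. reflexivity. }
    assert (HZ' : (fun x => p x = x /\ q' x = vzero X) x).
    { apply (Hmin (fun x => p x = x /\ q' x = vzero X)); [exists q'; split; [assumption|tauto]| |assumption].
      intros y [Hy1 Hy2]. apply HZ. split; [assumption|].
      assert (E : q (q' y) = q y) by (unfold q', opadd, opsub, opcomp; rewrite (lin_add _ _ Lq), (lin_sub _ _ Lq), !Hqq; vec).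
      rewrite <- E, Hy2. apply (lin_0 Lq). }
    destruct HZ' as [_ H']. apply HZ in Hx. destruct Hx as [_ Hx].
    assert (E : q' x = pi x). { unfold q', opadd, opsub, opcomp. rewrite Hqpi, Hx, (lin_0 Lpi). vec. }
    now rewrite <- E. }
  intros x Hpx Hqx.
  assert (Hx0 : X0 x) by (apply HZX0, HZ; auto).
  (* On [X0] the element [a] decays by the Volterra case, whereas [p] kills every vector of
     decay. *)
  rewrite <- Hpx. apply Hpd.
  destruct (finite_decomposition Ha) as [Lam [en [M [al [H1 [H2 [H3 [H4 [H5 ->]]]]]]]]].
  apply (graded_decays_on H1 H2) with (Z := X0); auto.
  - intros g s Hs. destruct (H4 g s Hs) as [h Hh]. apply Lcomp, (L_hom Hh).
  - split; [|split].
    + intros g b be k pi Hb Hbe Hs. apply (lin_0 (lb_lin (split_lb Hs))).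
    + intros y z Hy Hz g b be k pi Hb Hbe Hs. rewrite (lin_add _ _ (lb_lin (split_lb Hs))), (Hy g b be k pi), (Hz g b be k pi) by assumption. vec.
    + intros c y Hy g b be k pi Hb Hbe Hs. rewrite (lin_scal _ _ (lb_lin (split_lb Hs))), (Hy g b be k pi) by assumption. vec.
  - intros u y Hu Hy g b be k pi Hb Hbe Hs. apply (ker_closed (split_lb Hs) (u := u)); [|assumption]. intro n. now apply (Hu n g b be k pi).
  - intros d s y Hs Hy g b be k pi Hb Hbe Hsp. destruct (H4 d s Hs) as [h Hh]. pose proof (L_hom Hh) as HsL.
    rewrite <- (split_comm_L Hb Hsp HsL), (Hy g b be k pi) by assumption. apply (lin_0 (L_lin HsL)).
  - intros d s z y Hs Hz Hy Ey. destruct (H4 d s Hs) as [h Hh]. pose proof (L_hom Hh) as HsL.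
    destruct (split_exists (Lcomp HsL) Hz) as [k [pi Hsp]]. rewrite <- (Hy h s z k pi Hh Hz Hsp). symmetry. apply (split_fix Hsp).
    pose proof (split_k Hsp). destruct k as [|k]; [lia|]. rewrite Nat.iter_succ_r.
    replace (Dop s z y) with (vzero X) by (unfold Dop; rewrite Ey; vec). apply lin_0, lin_iter, lin_Dop, L_lin, HsL.
Qed.

(** The maps [ad b] with [b] homogeneous are closed under brackets, by the Jacobi identity, and
    nilpotent on a finite-dimensional space, by the Engel condition. The powers of [ad a] are
    combinations of words in them, so one [N] serves all [v]. *)
Lemma ad_nilpotent_corner a q : L a -> finrank q -> (forall x, q (q x) = q x) -> (forall T, L T -> forall x, T (q x) = q (T x)) ->
  exists N, forall v, L v -> forall x, Nat.iter N (ad a) v (q x) = vzero X.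
Proof.
  intros Ha Hq Hqq Hqc. set (B := CornerSp Hq). set (val := fun y : B => (oval y : op X)).
  destruct (corner_fin Hq) as [l Hl].
  assert (Veq : forall S T : B, (forall x, val S x = val T x) -> S = T) by (intros S T; apply ocar_eq).
  assert (Vlb : forall S : B, lb (val S)) by (intro S; apply (corner_lb (q := q)), oval_in).
  assert (Hex : forall b, L b -> forall y : B, exists w : B, val w = bracket b (val y)).
  { intros b Hb y. destruct (oval_in y) as [Hy Hy']. assert (Hc : corner q (bracket b (val y))).
    { split; [apply lb_bracket; [now apply L_lb|assumption]|]. intro x. unfold bracket, opsub, opcomp.
      rewrite (lin_sub _ _ (lb_lin (proj1 Hq))), <- (Hqc b Hb), Hy'.
      f_equal. rewrite (Hqc b Hb). f_equal. exact (Hy' (b x)). }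
    now exists (exist _ _ Hc). }
  (* For [b] in [L] the bracket stays in the corner and [epsilon] finds it; [inhabits y] merely
     supplies inhabitedness for other [b]. *)
  set (adB := fun b (y : B) => epsilon (inhabits y) (fun w : B => val w = bracket b (val y))).
  assert (HadB : forall b, L b -> forall y, val (adB b y) = bracket b (val y)).
  { intros b Hb y. unfold adB. apply epsilon_spec. auto. }
  assert (HadBlin : forall b, L b -> linear (adB b)).
  { intros b Hb. pose proof (L_lin Hb) as Lb. split.
    - intros S T. apply Veq; intro x. rewrite HadB by assumption.
      change (val (adB b S +v adB b T) x) with (val (adB b S) x +v val (adB b T) x). rewrite !HadB by assumption.
      change (b (val S x +v val T x) -v (val S (b x) +v val T (b x)) = b (val S x) -v val S (b x) +v (b (val T x) -v val T (b x))).
      rewrite (lin_add _ _ Lb). vec.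
    - intros c S. apply Veq; intro x. rewrite HadB by assumption.
      change (val (c *v adB b S) x) with (c *v val (adB b S) x). rewrite !HadB by assumption.
      change (b (c *v val S x) -v c *v val S (b x) = c *v (b (val S x) -v val S (b x))).
      rewrite (lin_scal _ _ Lb). vec. }
  (* Only corner elements of the form [v q] with [v] in [L] are used, because the Engel condition
     gives decay on [L] alone. *)
  set (W := fun y : B => exists v, L v /\ forall x, val y x = v (q x)).
  assert (HWad : forall b y, L b -> W y -> W (adB b y)).
  { intros b y Hb [v [Hv Ey]]. exists (bracket b v). split; [now apply L_bracket|]. intro x. rewrite HadB by assumption.
    unfold bracket, opsub, opcomp. rewrite !Ey. now rewrite (Hqc b Hb). }
  assert (HWs : subsp W).
  { destruct L_sub as [L0 [La Ls]]. split; [|split].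
    - exists opzero. split; [assumption|]. reflexivity.
    - intros y z [v [Hv Ey]] [w [Hw Ez]]. exists (opadd v w). split; [auto|]. intro x.
      change (val y x +v val z x = v (q x) +v w (q x)). now rewrite Ey, Ez.
    - intros c y [v [Hv Ey]]. exists (opscal c v). split; [auto|]. intro x. change (c *v val y x = c *v v (q x)). now rewrite Ey. }
  set (S := fun t : op B => exists g b, Lg g b /\ t = adB b).
  destruct (@jacobson B l W S) as [N HN]; auto.
  - intros s [g [b [Hb ->]]]. apply HadBlin, (L_hom Hb).
  - intros s t [g [b [Hb ->]]] [h [c [Hc ->]]]. exists (gadd g h), (bracket b c). pose proof (proj2 (proj2 Lsg) g h b c Hb Hc) as Hbc.
    split; [assumption|]. apply functional_extensionality; intro y. apply Veq; intro x.
    rewrite (HadB _ (L_hom Hbc)).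
    change (val (bracket (adB b) (adB c) y) x) with (val (adB b (adB c y)) x +v Copp Cone *v val (adB c (adB b y)) x).
    pose proof (L_hom Hb) as Hb'. pose proof (L_hom Hc) as Hc'. rewrite !HadB by assumption.
    unfold bracket, opsub, opcomp. rewrite !(lin_sub _ _ (L_lin Hb')), !(lin_sub _ _ (L_lin Hc')), !(lin_sub _ _ (lb_lin (Vlb y))). vec.
  - intros s y [g [b [Hb ->]]] Hy. apply HWad; [apply (L_hom Hb)|assumption].
  - intros s [g [b [Hb ->]]]. pose proof (L_hom Hb) as Hb'.
    apply (@decays_nilpotent B (adB b) l W); auto.
    intros y [v [Hv Ey]] eps He. destruct (proj2 (engel_ad_decays Hb Hv) eps He) as [C HC].
    destruct (lb_bound (proj1 Hq)) as [c [Hc Hcb]]. exists (Rabs C * c). intro n.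
    assert (En : forall x, val (Nat.iter n (adB b) y) x = Nat.iter n (ad b) v (q x)).
    { induction n as [|n IH]; [exact Ey|]. intro x. change (val (adB b (Nat.iter n (adB b) y)) x = ad b (Nat.iter n (ad b) v) (q x)).
      rewrite HadB by assumption. unfold bracket, opsub, opcomp, ad, bracket, opsub, opcomp. rewrite !IH. now rewrite (Hqc b Hb'). }
    assert (Hen0 : 0 < eps ^ n) by now apply pow_lt. pose proof (Rabs_pos C).
    apply opnorm_le; [apply Vlb|apply Rmult_le_pos; [apply Rmult_le_pos; lra|lra]|]. intro x. change (nm (val (Nat.iter n (adB b) y) x) <= Rabs C * c * eps ^ n * nm x).
    rewrite En. eapply Rle_trans; [apply HC|]. specialize (Hcb x). pose proof (Rle_abs C). pose proof (nm_ge0 (q x)).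
    apply Rle_trans with (Rabs C * eps ^ n * (c * nm x)); [|right; ring].
    apply Rle_trans with (Rabs C * eps ^ n * nm (q x)); [apply Rmult_le_compat_r; [assumption|]; apply Rmult_le_compat_r; lra|].
    apply Rmult_le_compat_l; [apply Rmult_le_pos; lra|assumption].
  - assert (Hsum : forall b, L b -> forall z, lspan (fun w => exists t, S t /\ w = t z) (adB b z)).
    { intros b Hb z. apply (proj1 (proj2 Lsg)) in Hb. destruct Hb as [bl [Hbl ->]].
      assert (H : L (fold_right (fun p acc => opadd (snd p) acc) (@opzero X) bl) /\
        lspan (fun w => exists t, S t /\ w = t z) (adB (fold_right (fun p acc => opadd (snd p) acc) (@opzero X) bl) z)); [|apply H].
      destruct L_sub as [L0 [La _]].
      induction Hbl as [|p0 bl Hp0 _ [IH1 IH2]].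
      - split; [exact L0|]. replace (adB (fold_right (fun p acc => opadd (snd p) acc) (@opzero X) nil) z) with (vzero B); [constructor|].
        apply Veq; intro x. rewrite (HadB _ L0). change (vzero X = vzero X -v val z (vzero X)). rewrite (lin_0 (lb_lin (Vlb z))). vec.
      - set (b := fold_right (fun p acc => opadd (snd p) acc) (@opzero X) bl) in *.
        change (fold_right (fun p acc => opadd (snd p) acc) (@opzero X) (p0 :: bl)) with (opadd (snd p0) b).
        pose proof (L_hom Hp0) as Hp0L. split; [auto|].
        replace (adB (opadd (snd p0) b) z) with (adB (snd p0) z +v adB b z).
        + apply lspan_add; [|assumption]. apply lspan_in. exists (adB (snd p0)). split; [|reflexivity]. now exists (fst p0), (snd p0).
        + apply Veq; intro x. rewrite (HadB (opadd (snd p0) b)) by auto.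
          change (val (adB (snd p0) z +v adB b z) x) with (val (adB (snd p0) z) x +v val (adB b z) x). rewrite !HadB by assumption.
          unfold bracket, opsub, opcomp, opadd. rewrite (lin_add _ _ (lb_lin (Vlb z))). vec. }
    assert (Hwords : forall n y, lspan (fun w => exists ws, Forall S ws /\ length ws = n /\ w = wapp ws y) (Nat.iter n (adB a) y)).
    { intros n y. induction n as [|n IH]; [apply lspan_in; exists nil; auto|]. pose proof (HadBlin a Ha) as La.
      change (Nat.iter (Datatypes.S n) (adB a) y) with (adB a (Nat.iter n (adB a) y)). revert IH.
      apply (lspan_least (Z := fun z => lspan (fun w => exists ws, Forall S ws /\ length ws = Datatypes.S n /\ w = wapp ws y) (adB a z))).
      - split; [|split].
        + rewrite (lin_0 La); constructor.
        + intros u w Hu Hw. rewrite (lin_add _ _ La). now apply lspan_add.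
        + intros c u Hu. rewrite (lin_scal _ _ La). apply subsp_scal; [apply lspan_subsp|assumption].
      - intros z [ws [Hws [Hlen ->]]]. eapply lspan_mono; [|apply (Hsum a Ha)]. intros w [t [Ht ->]].
        exists (t :: ws). split; [now constructor|split; [simpl; congruence|reflexivity]]. }
    exists N. intros v Hv x.
    assert (Hcv : corner q (fun x => v (q x))).
    { split; [exact (lb_opcomp (L_lb Hv) (proj1 Hq))|]. intro x'. now rewrite Hqq, <- (Hqc v Hv), Hqq. }
    set (y := exist _ _ Hcv : B). assert (Hy : W y) by (exists v; split; [assumption|reflexivity]).
    assert (E0 : Nat.iter N (adB a) y = vzero B).
    { specialize (Hwords N y). revert Hwords. apply (lspan_least (Z := fun z => z = vzero B)); [apply zero_subsp|].
      intros z [ws [Hws [Hlen ->]]]. now apply HN. }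
    assert (En : forall n x, val (Nat.iter n (adB a) y) x = Nat.iter n (ad a) v (q x)).
    { induction n as [|n IH]; [reflexivity|]. intro x'. change (val (adB a (Nat.iter n (adB a) y)) x' = ad a (Nat.iter n (ad a) v) (q x')).
      rewrite HadB by assumption. unfold ad, bracket, opsub, opcomp. rewrite !IH. now rewrite (Hqc a Ha). }
    rewrite <- En, E0. reflexivity.
Qed.

(** On the range of [q] the iterates of [ad a] vanish from [N0] on. From then on [(ad a)^n v] lives
    off [q], where the powers of [a] grow at most like [k^n] and [compress_bound] applies. *)
Theorem all_engel a : L a -> forall eps, 0 < eps -> exists N, forall n, (N <= n)%nat -> forall v, L v ->
  opnorm (Nat.iter n (ad a) v) <= eps ^ n * opnorm v.
Proof.
  (* [compress_bound] works at the rate [2 k = eps / 2]; the spare factor [2^-n] swallows the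
     constant [E]. *)
  intros Ha eps He. set (k := eps / 4). assert (Hk : 0 < k) by (unfold k; lra). pose proof (L_lin Ha) as La.
  destruct (spectral_cut (Lcomp Ha) Hk) as [p [D [Hp [Hpp [HD [Hpc [Hcut Hpd]]]]]]].
  destruct (commuting_projection Ha Hp Hpc Hpd) as [q [Hq [Hqq [Hqc Hker]]]].
  destruct (ad_nilpotent_corner Ha Hq Hqq Hqc) as [N0 HN0].
  pose proof (lb_lin (proj1 Hp)) as Lp. pose proof (lb_lin (proj1 Hq)) as Lq.
  set (q1 := opsub opid q). assert (Hq1 : lb q1) by (apply lb_opsub; [apply lb_opid|apply Hq]). pose proof (lb_lin Hq1) as Lq1.
  assert (Hpq : forall x, q (p x) = p (q x)) by (apply Hpc; [assumption|]; intro; symmetry; apply Hqc, Ha).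
  (* These vectors lie in the range of [p] and in the kernel of [q], which meet in zero only. *)
  assert (Hpq1 : forall x, p (q1 x) = vzero X).
  { intro x. apply Hker; [apply Hpp|]. rewrite Hpq. unfold q1, opsub, opid. rewrite (lin_sub _ _ Lq), Hqq, vadd_oppr. apply (lin_0 Lp). }
  destruct (lb_bound Hq1) as [d [Hd Hdb]].
  assert (Hcut1 : forall i x, nm (Nat.iter i a (q1 x)) <= D * d * k ^ i * nm x).
  { intros i x. specialize (Hcut i (q1 x)). rewrite Hpq1 in Hcut. replace (q1 x -v vzero X) with (q1 x) in Hcut by vec.
    eapply Rle_trans; [apply Hcut|]. replace (D * d * k ^ i * nm x) with (D * k ^ i * (d * nm x)) by ring.
    apply Rmult_le_compat_l; [|apply Hdb]. apply Rmult_le_pos; [lra|apply pow_le; lra]. }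
  assert (Hcq1 : forall T, L T -> forall x, T (q1 x) = q1 (T x)).
  { intros T HT x. unfold q1, opsub, opid. rewrite (lin_sub _ _ (L_lin HT)). now rewrite (Hqc T HT). }
  assert (Hq1q1 : forall x, q1 (q1 x) = q1 x).
  { intro x. unfold q1, opsub, opid. rewrite (lin_sub _ _ Lq), Hqq. vec. }
  set (E := D * d * (D * d)). assert (HE : 0 <= E) by (unfold E; assert (0 <= D * d) by (apply Rmult_le_pos; lra); now apply Rmult_le_pos).
  destruct (@pow_small (/ 2) E 1) as [N1 HN1]; [lra|lra|].
  exists (max N0 N1). intros n Hn v Hv. specialize (HN1 n ltac:(lia)). pose proof (opnorm_ge0 (L_lb Hv)) as Hs.
  assert (Hen : 0 < eps ^ n) by now apply pow_lt.
  apply opnorm_le; [apply L_lb, L_ad_iter; assumption|apply Rmult_le_pos; lra|]. intro x.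
  set (Tn := Nat.iter n (ad a) v). assert (HTn : L Tn) by now apply L_ad_iter.
  assert (Ex : Tn x = q1 (Tn (q1 x))).
  { rewrite <- (Hcq1 Tn HTn), Hq1q1. assert (E0 : Tn (q x) = vzero X).
    { unfold Tn. replace n with ((n - N0) + N0)%nat by lia. rewrite Nat.iter_add.
      assert (Hz : forall m T, (forall x, T (q x) = vzero X) -> forall x, Nat.iter m (ad a) T (q x) = vzero X).
      { induction m; intros T HT y; [apply HT|]. change (a (Nat.iter m (ad a) T (q y)) -v Nat.iter m (ad a) T (a (q y)) = vzero X).
        rewrite (Hqc a Ha), !IHm by assumption. rewrite (lin_0 La). vec. }
      apply Hz. intro y. now apply HN0. }
    unfold q1, opsub, opid. rewrite (lin_sub _ _ (L_lin HTn)), E0. vec. }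
  rewrite Ex.
  pose proof (@compress_bound X a q1 v (D * d) k (opnorm v) La Lq1 (L_lin Hv) ltac:(apply Rmult_le_pos; lra) Hs ltac:(lra)
    (Hcq1 a Ha) Hcut1 (fun y => opnorm_spec y (L_lb Hv)) n 0%nat 0%nat x) as H.
  simpl in H. fold Tn in H. eapply Rle_trans; [exact H|].
  replace (k ^ 0) with 1 by reflexivity. fold E. rewrite Rmult_1_r.
  apply Rmult_le_compat_r; [apply nm_ge0|]. replace (2 * k) with (eps * / 2) by (unfold k; field). rewrite Rpow_mult_distr.
  replace (E * opnorm v * (eps ^ n * (/ 2) ^ n)) with (eps ^ n * opnorm v * (E * (/ 2) ^ n)) by ring.
  rewrite <- (Rmult_1_r (eps ^ n * opnorm v)) at 2. apply Rmult_le_compat_l; [apply Rmult_le_pos; lra|lra].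
Qed.

(** All elements of [L] are Engel, so [J = L] serves for every [I], provided the estimate survives
    the passage to the quotient norm. *)
Theorem engel_part : E_solvable L.
Proof.
  intros I HI HIc [A0 [HA0 HA0I]]. exists L. pose proof L_sub as Ls.
  split; [split; [auto|split; [assumption|intros; now apply L_bracket]]|].
  split; [intros u A _ HA _; exact HA|]. destruct HI as [HIL [HIs HIb]].
  split; [assumption|split; [now exists A0|]].
  intros a Ha eps He. destruct (all_engel Ha He) as [N HN]. exists N. intros n Hn v Hv.
  assert (Hen : 0 < eps ^ n) by now apply pow_lt.
  assert (Hq : forall T, L T -> (forall r, (exists B, I B /\ r = opnorm (opsub T B)) -> qnorm I T <= r) /\
     (forall m, (forall r, (exists B, I B /\ r = opnorm (opsub T B)) -> m <= r) -> m <= qnorm I T)).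
  { intros T HT. apply inf_of_spec.
    - exists (opnorm (opsub T opzero)), opzero. split; [apply HIs|reflexivity].
    - intros r [B [HB ->]]. apply opnorm_ge0, lb_opsub; apply L_lb; auto. }
  (* The quotient norm of [v] is the infimum over [v - B] with [B] in [I]; as [(ad a)^n B] stays in
     [I], the norm of [(ad a)^n (v - B)] bounds the quotient norm of [(ad a)^n v]. *)
  destruct (Hq v Hv) as [_ H2]. destruct (Hq _ (L_ad_iter n Ha Hv)) as [H3 _].
  apply Rmult_le_reg_l with (/ eps ^ n); [now apply Rinv_0_lt_compat|]. rewrite <- Rmult_assoc, Rinv_l, Rmult_1_l by lra.
  apply H2. intros r [B [HB ->]]. apply Rmult_le_reg_l with (eps ^ n); [assumption|]. rewrite <- Rmult_assoc, Rinv_r, Rmult_1_l by lra.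
  pose proof (HIL B HB) as HBL.
  assert (HvB : L (opsub v B)).
  { replace (opsub v B) with (opadd v (opscal (Copp Cone) B)) by (apply functional_extensionality; intro; unfold opsub, opadd, opscal; now rewrite <- vopp_scal).
    apply Ls; [assumption|]. now apply Ls. }
  eapply Rle_trans; [|apply (HN n Hn _ HvB)]. apply H3. exists (Nat.iter n (ad a) B). split.
  - clear - HIb HB Ha. induction n; [assumption|]. now apply HIb.
  - f_equal. clear - Hv HBL Ha Lcomp Lsg. induction n; [reflexivity|]. simpl. rewrite IHn. pose proof (L_lin Ha) as La.
    apply functional_extensionality; intro x. unfold ad, bracket, opsub, opcomp. rewrite (lin_sub _ _ La). vec.
Qed.
End EngelPart.

Theorem mainTheorem14 (X : CBanach) (G : AbGroup)
    (L : op X -> Prop) (Lg : G -> op X -> Prop) :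
  (forall A, L A -> compact_op A) ->
  subgraded L Lg ->
  locally_finitely_subgraded Lg ->
  ((forall g A, Lg g A -> engel L A) -> E_solvable L) /\
  ((forall g A, Lg g A -> volterra A) -> forall A, L A -> volterra A).
Proof.
  intros Lcomp Lsg Llf. split.
  - intro Leng. now apply engel_part with (Lg := Lg).
  - intros Hvol. now apply volterra_part with (Lg := Lg).
Qed.
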